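(* Let $\sigma$ be a finite positive measure supported on an interval $[a(0),b]$, $0\le a(0)<b$, with density $\sigma'$ with respect to Lebesgue measure, such that $x\mapsto\sqrt{(x-a(0))(b-x)}\,\sigma'(x)$ (extended to the endpoints by its limits) vanishes at $x=a(0)$ and is strictly increasing in $[a(0),b]$. For $0<t<\|\sigma\|$ let $S(t)=[a(t),b]$, where $a(t)$ is the unique solution of $$t=\int_{a(0)}^{a(t)}\sqrt{\frac{b-x}{a(t)-x}}\,d\sigma(x).$$ (a) There exists a universal real constant $C_{BW}$ (independent of all the data) such that the following holds. Let $A$ be a symmetric positive definite matrix with spectrum $0<\lambda_1<\lambda_2<\dots\le b$ and let $N$ be a positive integer. If the integers $n\ge2$ with $n/N<\|\sigma\|$ and $d\in\{0,1,\dots,n-2\}$ are such that $$\sigma((-\infty,\lambda_j])\ge j/N\quad\text{for } j=1,\dots,d,$$ $$\lambda_d<a(n/N)\le\lambda_{d+1}\quad(\text{or } a(n/N)\le\lambda_1 \text{ in case } d=0),$$ then $$E_n(\Lambda(A))\le E_n([\lambda_{d+1},b])\le\exp\Bigl(C_{BW}-N\int_0^{n/N}g_{S(t)}(0,\infty)\,dt\Bigr).$$ (b) Suppose $\|\sigma\|=1$. For each $N$ let $A_N$ be the diagonal matrix with eigenvalues $\lambda_{1,N}<\dots<\lambda_{N,N}$ satisfying $\sigma((-\infty,\lambda_{j,N}])=j/N$ for $j=1,\dots,N$, and let $d_{n,N}$ be the index $d$ with $\lambda_{d,N}<a(n/N)\le\lambda_{d+1,N}$ (with $d=0$ if $a(n/N)\le\lambda_{1,N}$).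 Then for every $t\in(0,\|\sigma\|)$ $$\lim_{\substack{n,N\to\infty\\ n/N\to t}}E_{n,N}([\lambda_{d_{n,N}+1,N},b])^{1/n}=\liminf_{\substack{n,N\to\infty,\ n/N\to t\\ 0\le d<n-1}}E_{n,N}([\lambda_{d+1,N},b])^{1/n}.$$
   Context: $\Pi_n$ is the set of polynomials of degree at most $n$; $\|q\|_S=\max_{x\in S}|q(x)|$; $\Lambda(A)$ is the spectrum of $A$; $\|\sigma\|$ is the total mass of $\sigma$. For a fixed matrix $A$, a compact set $S$ and $n$ sufficiently large, $$E_n(S):=\min\Bigl\{\frac{\|q\|_S}{|q(0)|}:\ q\in\Pi_n,\ q(0)\neq 0,\ q(\lambda)=0\ \text{for all }\lambda\in\Lambda(A)\setminus S\Bigr\}.$$ In (b), $E_{n,N}$ denotes $E_n$ formed with the spectrum of $A=A_N$, and in the $\liminf$ the integer $d$ may depend arbitrarily on $n,N$ subject to $0\le d<n-1$. $g_S(\cdot,\infty)$ is the Green function of $\overline{\mathbb C}\setminus S$ with pole at $\infty$ (zero on $S$ when $S$ is an interval). *)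

(* Defs.v *)
From HB Require Import structures.
From mathcomp Require Import all_boot all_order all_algebra.
From mathcomp Require Import all_classical all_reals all_analysis.

Set Implicit Arguments.
Unset Strict Implicit.
Unset Printing Implicit Defensive.

Import Order.TTheory GRing.Theory Num.Theory numFieldNormedType.Exports.

Local Open Scope classical_set_scope.
Local Open Scope ring_scope.

Section PolynomialExtremalProblem.
Variable R : realType.

Definition supnorm (q : {poly R}) (S : set R) : R :=
  sup [set `|q.[x]| | x in S].

Definition spectrum m (A : 'M[R]_m) : set R := [set x | eigenvalue A x].

Definition posdef m (A : 'M[R]_m) : Prop :=
  A^T = A /\ forall v : 'rV[R]_m, v != 0 -> 0 < (v *m A *m v^T) 0 0.

Definition admissible_poly m (A : 'M[R]_m) (S : set R) (n : nat)
    (q : {poly R}) : Prop :=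
  [/\ (size q <= n.+1)%N, q.[0] != 0 &
      forall x, spectrum A x -> ~ S x -> q.[x] = 0].

(* For compact S and n at least the number of eigenvalues outside S, the
   infimum is a minimum. *)
Definition En m (A : 'M[R]_m) (n : nat) (S : set R) : R :=
  inf [set supnorm q S / `|q.[0]| | q in admissible_poly A S n].

End PolynomialExtremalProblem.

(* The complex plane is identified with R * R, (x, y) standing for x + iy. *)
Section GreenFunction.
Variable R : realType.

Definition modulus (z : R * R) : R := Num.sqrt (z.1 ^+ 2 + z.2 ^+ 2).

Definition dx (u : R * R -> R) : R * R -> R := 'D_((1, 0) : R * R) u.
Definition dy (u : R * R -> R) : R * R -> R := 'D_((0, 1) : R * R) u.

Definition has_partials (u : R * R -> R) (z : R * R) : Prop :=
  derivable u z (1, 0) /\ derivable u z (0, 1).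

(* For open U: u is of class C^2 on U and its Laplacian vanishes there. *)
Definition harmonic_on (U : set (R * R)) (u : R * R -> R) : Prop :=
  forall z, U z ->
  [/\ has_partials u z /\ has_partials (dx u) z /\ has_partials (dy u) z,
      {for z, continuous (dx (dx u))} /\ {for z, continuous (dy (dx u))},
      {for z, continuous (dx (dy u))} /\ {for z, continuous (dy (dy u))} &
      dx (dx u) z + dy (dy u) z = 0].

(* S is a subset of the real axis, regular for the Dirichlet problem (e.g. a
   nondegenerate compact interval), so that the Green function with pole at
   infinity extends continuously by 0 to S.  Boundedness of g(z) - ln |z| near
   infinity is the logarithmic pole. *)
Definition is_green_infty (S : set R) (g : R * R -> R) : Prop :=
  [/\ harmonic_on [set z | ~ (S z.1 /\ z.2 = 0)] g,
      continuous g,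
      forall x, S x -> g (x, 0) = 0 &
      exists M r : R, forall z, r <= modulus z ->
        `|g z - ln (modulus z)| <= M].

Definition green_infty (S : set R) : R * R -> R :=
  xget (fun=> 0) [set g | is_green_infty S g].

End GreenFunction.

Section Constraint.
Variable R : realType.
Local Notation measR := {finite_measure set (measurableTypeR R) -> \bar R}.

Definition has_density (sigma : measR) (f : R -> R) : Prop :=
  [/\ forall x, 0 <= f x,
      measurable_fun setT (f : measurableTypeR R -> measurableTypeR R) &
      forall B : set (measurableTypeR R), measurable B ->
        sigma B = (\int[lebesgue_measure]_(x in B) (f x)%:E)%E].

(* The extension to the endpoints takes values in \bar R: the limit at b,
   which exists by monotonicity, may be +oo. *)
Definition increasing_weight (a0 b : R) (f : R -> R) : Prop :=
  exists h : R -> \bar R,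
  [/\ forall x, a0 < x < b -> h x = (Num.sqrt ((x - a0) * (b - x)) * f x)%:E,
      h x @[x --> a0^'+] --> h a0 /\ h x @[x --> b^'-] --> h b,
      h a0 = 0%E &
      {in `[a0, b] &, {homo h : x y / x < y >-> (x < y)%E}}].

Definition constraint_data (a0 b : R) (sigma : measR) (f : R -> R) : Prop :=
  [/\ 0 <= a0 < b,
      sigma (~` `[a0, b]) = 0%E,
      has_density sigma f &
      increasing_weight a0 b f].

(* The point x = a contributes the junk value 0, but it is sigma-null. *)
Definition left_endpoint (a0 b : R) (sigma : measR) (t : R) : R :=
  xget a0 [set a | a0 <= a <= b /\
    t%:E = (\int[sigma]_(x in `[a0, a]) (Num.sqrt ((b - x) / (a - x)))%:E)%E].

Definition St (a0 b : R) (sigma : measR) (t : R) : set R :=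
  `[left_endpoint a0 b sigma t, b].

End Constraint.

Section Indices.
Variable R : realType.

(* Eigenvalues are numbered from 1 as lam 1, ..., lam k; the value lam 0 is
   never used. *)
Definition enumerates_spectrum m (A : 'M[R]_m) (k : nat) (lam : nat -> R) :=
  (forall i j, (1 <= i < j)%N -> (j <= k)%N -> lam i < lam j) /\
  (forall x, spectrum A x <-> exists2 j, (1 <= j <= k)%N & x = lam j).

(* lam d < a <= lam (d + 1), the first inequality being void for d = 0. *)
Definition splitting_index (k : nat) (lam : nat -> R) (a : R) (d : nat) :=
  [/\ (d < k)%N, (0 < d)%N -> lam d < a & a <= lam d.+1].

Definition diag_of (N : nat) (lam : nat -> R) : 'M[R]_N :=
  diag_mx (\row_(j < N) lam j.+1).

End Indices.

Section Limits.
Variable R : realType.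

Definition ratio_box (t : R) (e : nat * R) : set (nat * nat) :=
  [set p | [/\ (e.1 <= p.1)%N, (e.1 <= p.2)%N &
               `|p.1%:R / p.2%:R - t| < e.2]].

(* (n, N) with n, N --> oo and n / N --> t *)
Definition ratio_filter (t : R) : set_system (nat * nat) :=
  filter_from [set e : nat * R | 0 < e.2] (ratio_box t).

(* ((n, N), d) with n, N --> oo, n / N --> t and d subject only to
   0 <= d < n - 1 *)
Definition ratio_index_filter (t : R) : set_system (nat * nat * nat) :=
  filter_from [set e : nat * R | 0 < e.2]
    (fun e => [set p | ratio_box t e p.1 /\ (p.2 < p.1.1.-1)%N]).

Lemma ratio_boxI (t : R) (e1 e2 : nat * R) :
  ratio_box t (maxn e1.1 e2.1, Num.min e1.2 e2.2)
    `<=` ratio_box t e1 `&` ratio_box t e2.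
Proof.
move=> p; rewrite /ratio_box /= !geq_max lt_min.
by move=> [/andP[? ?] /andP[? ?] /andP[? ?]].
Qed.

Global Instance ratio_filter_filter (t : R) : Filter (ratio_filter t).
Proof.
apply: filter_from_filter; first by exists (0%N, 1) => /=.
move=> e1 e2 /= e10 e20; exists (maxn e1.1 e2.1, Num.min e1.2 e2.2).
  by rewrite /= lt_min e10.
exact: ratio_boxI.
Qed.

Global Instance ratio_index_filter_filter (t : R) :
  Filter (ratio_index_filter t).
Proof.
apply: filter_from_filter; first by exists (0%N, 1) => /=.
move=> e1 e2 /= e10 e20; exists (maxn e1.1 e2.1, Num.min e1.2 e2.2).
  by rewrite /= lt_min e10.
by move=> p /= [/ratio_boxI[? ?] ?].
Qed.

End Limits.

(* Main.v *)
Require Import Defs.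
From HB Require Import structures.
From mathcomp Require Import all_boot all_order all_algebra.
From mathcomp Require Import all_classical all_reals all_analysis.
From mathcomp Require Import ring lra zify measurable_realfun complex.
Set Implicit Arguments.
Unset Strict Implicit.
Unset Printing Implicit Defensive.
Import Order.TTheory GRing.Theory Num.Theory numFieldNormedType.Exports.
Local Open Scope classical_set_scope.
Local Open Scope ring_scope.

(** Let tau(c) be the integral over [a(0), c] of sqrt((b - x) / (c - x)) against sigma, so that tau(a(t)) = t.
    By Tonelli's theorem, t times the mean over s in [0, t] of the equilibrium measures of [a(s), b] dominates
    sigma to the left of a(t).

    For the upper bound, take finitely many intervals [a(s_i), b], merge the zeros of their Chebyshev polynomials
    of a high degree into one increasing list and cut it into n blocks of equal length.  Each block is replaced by
    a single zero: by its mean, or, to the left of a(t), by its right end, which may moreover be moved further to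
    the right to the prescribed zero lambda_j.  Since |1 - x / z| decreases in z < x, the latter costs nothing on
    [a(t), b]; the error made by the means is bounded because the arcsine distribution functions are regular of
    order 1/2.  The Chebyshev polynomials have an exact size at 0 in terms of the Green functions of [a(s_i), b].

    For the lower bound, dividing a polynomial transplanted to the unit circle by the Blaschke factors of its zeros
    gives |q(0)| <= (2n + 1) max |q| exp(n g(0) - sum_j g(0, lambda_j)), where g is the Green function of
    [lambda_(d+1), b]; the same Tonelli identity turns the exponent into a Riemann sum of g_S(s)(0).

    The Green function of [a, b] is compared with arccosh((|z - a| + |z - b|) / (b - a)) by the maximum principle;
    only this upper bound is needed, and it holds trivially for the junk value 0. *)

(** * The arcsine distribution *)

(** Chebyshev polynomials stand in for logarithmic potentials: their sizes on an ellipse and at 0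
    are explicit, so no potential is ever integrated. Near [x] the logarithms of the distances to
    their zeros are not bounded below; the distances are therefore truncated at a length [e], and
    measuring on an ellipse of parameter [exp (1 / n)] instead of the interval pays for this with a
    bounded factor. The degree of the Chebyshev polynomials is free while [n] is fixed. Letting it
    grow absorbs all counting errors, provided that the counting inequality at the prescribed zeros
    is strict. Regularity of order 1/2 makes the distances from [x] to the two ends of a block, [i]
    blocks away, differ by a factor [1 + O(1 / i)]. Taking the mean then costs [O(1 / i^2)], a
    convergent series with a universal sum, and this is why the constant depends on nothing. In the
    lower bound the obstacle is that Green functions with pole [y] blow up as [y] tends to 0, and
    [a(0)] may be 0; the mass below the first eigenvalue is therefore estimated separately. In (b)
    both bounds meet at [exp (- m)], [m] being the mean over [0, t] of the Green functions of
    [a(s), b] at 0. *)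

Section Sine.
Variable R : realType.
Implicit Types x y z s u v : R.

Lemma sin_concave x y s : 0 <= x -> x <= y -> y <= pi -> 0 <= s <= 1 ->
  (1 - s) * sin x + s * sin y <= sin ((1 - s) * x + s * y).
Proof.
move=> x0 xy ypi /andP[s0 s1].
set z := (1 - s) * x + s * y.
have xz : x <= z by rewrite /z; nra.
have zy : z <= y by rewrite /z; nra.
have cs : {within `[x, z], continuous (@sin R)}.
  by apply: continuous_subspaceT; exact: continuous_sin.
have cs2 : {within `[z, y], continuous (@sin R)}.
  by apply: continuous_subspaceT; exact: continuous_sin.
have [t1 t1I E1] := MVT_segment xz (fun t _ => is_derive_sin t) cs.
have [t2 t2I E2] := MVT_segment zy (fun t _ => is_derive_sin t) cs2.
move: t1I t2I; rewrite !in_itv /= => /andP[a1 a2] /andP[b1 b2].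
have C : cos t2 <= cos t1.
  rewrite leNgt; apply/negP => lt.
  have := @ltr_cos R t2 t1; rewrite !in_itv /= => h.
  have h1 : 0 <= t1 <= pi by apply/andP; split; lra.
  have h2 : 0 <= t2 <= pi by apply/andP; split; lra.
  by move: (h h2 h1); rewrite lt => /esym; lra.
have Ez1 : z - x = s * (y - x) by rewrite /z; ring.
have Ez2 : y - z = (1 - s) * (y - x) by rewrite /z; ring.
rewrite Ez1 in E1; rewrite Ez2 in E2.
have : (1 - s) * (sin z - sin x) - s * (sin y - sin z) = (1-s) * s * (y-x) * (cos t1 - cos t2).
  by rewrite E1 E2; ring.
have : 0 <= (1-s) * s * (y-x) * (cos t1 - cos t2).
  by apply: mulr_ge0; [apply: mulr_ge0; [apply: mulr_ge0|]|]; lra.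
by move=> h1 h2; nra.
Qed.

Lemma sin_sqrB x y : sin x ^+ 2 - sin y ^+ 2 = sin (x - y) * sin (x + y).
Proof.
rewrite sinB sinD.
have h1 := cos2Dsin2 x; have h2 := cos2Dsin2 y.
transitivity (sin x ^+ 2 * (cos y ^+ 2 + sin y ^+ 2) - (cos x ^+ 2 + sin x ^+ 2) * sin y ^+ 2).
  by rewrite h1 h2; ring.
ring.
Qed.

Lemma sin_scale u s : 0 <= u <= pi -> 0 <= s <= 1 -> s * sin u <= sin (s * u).
Proof.
move=> /andP[u0 u1] s01.
by have := sin_concave (lexx 0) u0 u1 s01; rewrite sin0 !mulr0 !add0r.
Qed.

Lemma sin_le_id x : 0 <= x -> sin x <= x.
Proof.
move=> x0.
have cs : {within `[0, x], continuous (@sin R)}.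
  by apply: continuous_subspaceT; exact: continuous_sin.
have [t _] := MVT_segment x0 (fun t _ => is_derive_sin t) cs.
rewrite sin0 !subr0 => ->.
by rewrite ler_piMl// cos_le1.
Qed.

Lemma sin_chord x : 0 <= x <= pi / 2 -> x <= 2 * sin x.
Proof.
move=> /andP[x0 x1].
have p0 := @pi_gt0 R; have p4 := @pihalf_lt2 R.
have := @sin_scale (pi / 2) (x / (pi / 2)).
rewrite sin_pihalf mulr1 divfK; last by lra.
move=> h; have {}h : x / (pi / 2) <= sin x.
  apply: h; first by apply/andP; split; lra.
  apply/andP; split; first by apply: divr_ge0; lra.
  by rewrite ler_pdivrMr; lra.
apply: le_trans (ler_wpM2l _ h); last by [].
rewrite mulrA ler_pdivlMr; last by lra.
nra.
Qed.

(** By [sin_sqrB] both differences are products [sin (u - a) * sin (u + a)]. If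
    [g = a + s * (b - a)], concavity of the sine on [0, pi] makes each factor at [g] at least [s]
    times the factor at [b]; hence [s ^+ 2 <= th]. In the variable [sin ^+ 2] this is regularity of
    order 1/2. *)
Lemma arc_ratio (a g b th : R) : 0 <= a -> a <= g -> g <= b -> b <= pi / 2 -> 0 <= th ->
  sin g ^+ 2 - sin a ^+ 2 <= th * (sin b ^+ 2 - sin a ^+ 2) ->
  g - a <= Num.sqrt th * (b - a).
Proof.
move=> a0 ag gb b2 th0.
have p0 := @pi_gt0 R.
have [ab|ab] := ltP a b; last first.
  have -> : g = a by lra.
  have -> : b = a by lra.
  by rewrite [a - a]subrr mulr0.
rewrite !sin_sqrB.
set s := (g - a) / (b - a).
have s01 : 0 <= s <= 1.
  rewrite /s divr_ge0 ?subr_ge0 //=; last by lra.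
  by rewrite ler_pdivrMr ?mul1r; lra.
have Eg : g - a = s * (b - a) by rewrite /s divfK//; lra.
have h1 : s * sin (b - a) <= sin (g - a).
  by rewrite Eg; apply: sin_scale => //; apply/andP; split; lra.
have h2 : s * sin (b + a) <= sin (g + a).
  have -> : g + a = (1 - s) * (a + a) + s * (b + a) by rewrite -[g](subrK a) Eg; ring.
  have l1 : a + a <= b + a by lra.
  have l2 : 0 <= a + a by lra.
  have l3 : b + a <= pi by lra.
  apply: le_trans (sin_concave l2 l1 l3 s01).
  rewrite lerDr mulr_ge0//; first by lra.
  by apply: sin_ge0_pi; apply/andP; split; lra.
have D1 : 0 < sin (b - a) by apply: sin_gt0_pi; apply/andP; split; lra.
have D2 : 0 < sin (b + a) by apply: sin_gt0_pi; apply/andP; split; lra.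
move/andP: (s01) => [s0 s1] H.
have ss : s ^+ 2 <= th.
  have D3 : 0 < sin (b - a) * sin (b + a) by apply: mulr_gt0.
  rewrite -(ler_pM2r D3); apply: le_trans H.
  apply: le_trans (ler_pM _ _ h1 h2).
  - by rewrite le_eqVlt; apply/orP; left; apply/eqP; ring.
  - by apply: mulr_ge0 => //; lra.
  - by apply: mulr_ge0 => //; lra.
rewrite Eg ler_pM2r; last by lra.
by rewrite -[leLHS]ger0_norm// -sqrtr_sqr ler_wsqrtr.
Qed.

(** A doubling property. If it failed with [d = b - a > 0], the angle [a - 8 * d] would still be
    positive, and the increment of [sin ^+ 2] from there to [a] would be at least 32 / 17 times the
    one from [a] to [b]. *)
Lemma arc_left_right (g a b : R) : 0 <= g -> g <= a -> a <= b -> b <= pi / 2 ->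
  sin a ^+ 2 - sin g ^+ 2 <= sin b ^+ 2 - sin a ^+ 2 ->
  a - g <= 8 * (b - a).
Proof.
move=> g0 ga ab b2 H.
have p0 := @pi_gt0 R; have p4 := @pihalf_lt2 R.
rewrite leNgt; apply/negP => lt.
set d := b - a in lt.
have d0 : 0 <= d by rewrite /d; lra.
have ad : 8 * d < a by lra.
have [dz|dz] := eqVneq d 0.
  have Eb : b = a by move: dz; rewrite /d; lra.
  have ag : g < a by lra.
  have : sin g < sin a.
    by rewrite ltr_sin//; rewrite in_itv /=; apply/andP; split; lra.
  have sg0 : 0 <= sin g by apply: sin_ge0_pi; apply/andP; split; lra.
  by move: H; rewrite Eb subrr subr_le0 => H1 H2; nra.
have dp : 0 < d by rewrite lt_def dz.
have H1 : sin (a - 8 * d) ^+ 2 >= sin g ^+ 2.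
  have sg0 : 0 <= sin g by apply: sin_ge0_pi; apply/andP; split; lra.
  have sg1 : sin g <= sin (a - 8 * d).
    rewrite leNgt; apply/negP.
    by rewrite ltr_sin; [|rewrite in_itv /=; apply/andP; split; lra..]; lra.
  by nra.
have : sin a ^+ 2 - sin (a - 8 * d) ^+ 2 <= sin b ^+ 2 - sin a ^+ 2 by lra.
rewrite !sin_sqrB.
have -> : a - (a - 8 * d) = 8 * d by ring.
have -> : a + (a - 8 * d) = 2 * a - 8 * d by ring.
have -> : b + a = 2 * a + d by rewrite /d; ring.
rewrite -/d.
have bE : b = a + d by rewrite /d; ring.
have k1 : 4 * sin d <= sin (8 * d).
  have h1 : 8 * d <= 2 * sin (8 * d) by apply: sin_chord; apply/andP; split; lra.
  have h2 := sin_le_id d0.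
  by lra.
(* The quotient [(2 * a - 8 * d) / (2 * a + d)] increases with [a] and equals 8 / 17 at
   [a = 8 * d]. *)
have k2 : (8 / 17) * sin (2 * a + d) <= sin (2 * a - 8 * d).
  set s := (2 * a - 8 * d) / (2 * a + d).
  have e : 2 * a - 8 * d = s * (2 * a + d) by rewrite /s divfK//; lra.
  have ls : 8 / 17 <= s.
    by rewrite /s ler_pdivlMr; lra.
  have ls1 : s <= 1 by rewrite /s ler_pdivrMr; lra.
  have sp : 0 <= sin (2 * a + d) by apply: sin_ge0_pi; apply/andP; split; lra.
  rewrite e; apply: (@le_trans _ _ (s * sin (2 * a + d))).
    by rewrite ler_wpM2r.
  by apply: sin_scale; apply/andP; split; lra.
have d1 : 0 < sin d by apply: sin_gt0_pi; apply/andP; split; lra.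
have d2 : 0 < sin (2 * a + d) by apply: sin_gt0_pi; apply/andP; split; lra.
have k3 : (4 * sin d) * ((8 / 17) * sin (2 * a + d)) <= sin (8 * d) * sin (2 * a - 8 * d).
  apply: ler_pM => //; first by lra.
  by apply: mulr_ge0; lra.
move=> k4.
have : 0 < sin d * sin (2 * a + d) by apply: mulr_gt0.
by move: k3 k4; set w := sin (8 * d) * _; move=> k3 k4 k5; nra.
Qed.

End Sine.

(** * Arcsine distribution functions in the angle coordinate *)

Section Angle.
Variable R : realType.
Variables (b c : R).
Hypothesis cb : c < b.
Implicit Types y t : R.

(** The substitution that turns the arcsine law of [c, b] into the uniform law of the angle on
    [0, pi / 2]. *)
Definition arcpt (b c t : R) := c + (b - c) * sin t ^+ 2.
(* [arcang b c y / (pi / 2)] is the mass that the equilibrium measure of [c, b] gives to ]-oo, y]. *)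
Definition arcang (b c y : R) := asin (Num.sqrt (Num.max 0 (Num.min 1 ((y - c) / (b - c))))).

Local Notation clip y := (Num.max 0 (Num.min 1 ((y - c) / (b - c)))).

Let clip01 y : 0 <= clip y <= 1.
Proof. by rewrite le_max lexx /= ge_max ler01 /= ge_min lexx. Qed.

Let sq01 y : Num.sqrt (clip y) \in `[(-1), 1].
Proof.
have cb' := cb.
rewrite in_itv /=; have /andP[h1 h2] := clip01 y.
rewrite (le_trans _ (sqrtr_ge0 _)) ?lerN10//=.
by rewrite -[leRHS]sqrtr1 ler_wsqrtr.
Qed.

Lemma arcang_itv y : 0 <= arcang b c y <= pi / 2.
Proof.
have cb' := cb.
have h := sq01 y; rewrite in_itv /= in h.
apply/andP; split; last exact: asin_lepi2.
have p0 := @pi_gt0 R.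
have h1 := asin_geNpi2 h; have h2 := asin_lepi2 h.
rewrite leNgt; apply/negP => lt.
have : sin (arcang b c y) < 0.
  rewrite -sin0 ltr_sin//; rewrite in_itv /=; apply/andP; split; rewrite /arcang //; lra.
by rewrite /arcang asinK// ltNge sqrtr_ge0.
Qed.

Lemma sin_arcang y : sin (arcang b c y) ^+ 2 = clip y.
Proof. by rewrite /arcang asinK// sqr_sqrtr//; case/andP: (clip01 y). Qed.

Lemma arcang_sin t : 0 <= t <= pi / 2 -> asin (Num.sqrt (sin t ^+ 2)) = t.
Proof.
have cb' := cb.
move=> /andP[t0 t1].
have p0 := @pi_gt0 R.
rewrite sqrtr_sqr ger0_norm; last by apply: sin_ge0_pi; apply/andP; split; lra.
by rewrite sinK// in_itv /=; apply/andP; split; lra.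
Qed.

Lemma arcpt_ang y : c <= y <= b -> arcpt b c (arcang b c y) = y.
Proof.
have cb' := cb.
move=> /andP[cy yb]; rewrite /arcpt sin_arcang.
have h1 : (y - c) / (b - c) <= 1 by rewrite ler_pdivrMr; lra.
have h0 : 0 <= (y - c) / (b - c) by apply: divr_ge0; lra.
by rewrite (min_idPr h1) (max_idPr h0); by field; rewrite subr_eq0 gt_eqF.
Qed.

Lemma arcang_sin2 y : c <= y <= b -> (b - c) * sin (arcang b c y) ^+ 2 = y - c.
Proof. by move=> /arcpt_ang h; rewrite -[in RHS]h /arcpt; ring. Qed.

Lemma arcang_lo y : y <= c -> arcang b c y = 0.
Proof.
have cb' := cb.
move=> yc; rewrite -[RHS]arcang_sin; last by have := @pi_gt0 R; move=> ?; apply/andP; split; lra.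
rewrite /arcang sin0 expr0n /=; congr (asin (Num.sqrt _)).
have h0 : (y - c) / (b - c) <= 0.
  by rewrite ler_pdivrMr; lra.
have h1 : (y - c) / (b - c) <= 1 by lra.
by rewrite (min_idPr h1) (max_idPl h0).
Qed.

Lemma arcang_hi y : b <= y -> arcang b c y = pi / 2.
Proof.
have cb' := cb.
move=> yc; rewrite -[RHS]arcang_sin; last by have := @pi_gt0 R; move=> ?; apply/andP; split; lra.
rewrite /arcang sin_pihalf expr1n /=; congr (asin (Num.sqrt _)).
have h1 : 1 <= (y - c) / (b - c) by rewrite ler_pdivlMr; lra.
by rewrite (min_idPl h1) (max_idPr ler01).
Qed.

Lemma sin2_le t u : 0 <= t <= pi / 2 -> 0 <= u <= pi / 2 ->
  (sin t ^+ 2 <= sin u ^+ 2) = (t <= u).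
Proof.
have cb' := cb.
move=> /andP[t0 t1] /andP[u0 u1].
have p0 := @pi_gt0 R.
have s1 : 0 <= sin t by apply: sin_ge0_pi; apply/andP; split; lra.
have s2 : 0 <= sin u by apply: sin_ge0_pi; apply/andP; split; lra.
rewrite ler_sqr ?nnegrE// leNgt ltr_sin -?leNgt// in_itv /=; apply/andP; split; lra.
Qed.

Lemma arcpt_le t u : 0 <= t <= pi / 2 -> 0 <= u <= pi / 2 ->
  (arcpt b c t <= arcpt b c u) = (t <= u).
Proof. by move=> h1 h2; rewrite /arcpt lerD2l ler_pM2l ?subr_gt0// sin2_le. Qed.

Lemma arcang_le y y' : y <= y' -> arcang b c y <= arcang b c y'.
Proof.
have cb' := cb.
move=> yy; rewrite -sin2_le ?arcang_itv// !sin_arcang.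
have h : (y - c) / (b - c) <= (y' - c) / (b - c) by rewrite ler_pM2r ?invr_gt0; lra.
move: h; set w := _ / _; set w' := _ / _; rewrite /Num.max /Num.min.
by repeat case: ifP; lra.
Qed.

Lemma arcpt_itv t : c <= arcpt b c t <= b.
Proof.
have cb' := cb.
have h1 : sin t ^+ 2 <= 1 by rewrite sin2cos2 lerBlDr lerDl sqr_ge0.
have h0 := sqr_ge0 (sin t).
by rewrite /arcpt; apply/andP; split; nra.
Qed.

(** This adjunction turns counting nodes below [y] into counting equally spaced angles. Positivity
    of [t] makes it hold to the left of [c], where [arcang] is constantly 0. *)
Lemma arcpt_le_ang t y : 0 < t -> t <= pi / 2 -> (arcpt b c t <= y) = (t <= arcang b c y).
Proof.
have cb' := cb.
move=> t0 t1.
have ht : 0 <= t <= pi / 2 by apply/andP; split; lra.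
have [yc|cy] := leP y c.
  rewrite (arcang_lo yc) [RHS]leNgt t0 /=; apply/negbTE; rewrite -ltNge.
  apply: le_lt_trans yc _.
  rewrite /arcpt ltrDl mulr_gt0 ?subr_gt0// exprn_gt0//.
  by apply: sin_gt0_pi; have := @pi_gt0 R; move=> ?; apply/andP; split; lra.
have [yb|yb] := leP b y.
  by rewrite (arcang_hi yb) t1 (le_trans _ yb)//; case/andP: (arcpt_itv t).
rewrite -[in LHS](@arcpt_ang y); last by apply/andP; split; lra.
by rewrite arcpt_le ?arcang_itv.
Qed.

(** Reflection of [c, b] exchanges the squares of sine and cosine, hence complementary angles. The
    left-hand regularity estimates follow from the right-hand ones in this way. *)
Lemma arcang_mirror y : arcang b c (b + c - y) = pi / 2 - arcang b c y.
Proof.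
have cb' := cb.
have /andP[h1 h2] := arcang_itv y.
have h3 : 0 <= pi / 2 - arcang b c y <= pi / 2 by apply/andP; split; lra.
rewrite -[RHS]arcang_sin// /arcang; congr (asin (Num.sqrt _)); rewrite -/(arcang b c y).
have -> : sin (pi / 2 - arcang b c y) = cos (arcang b c y).
  by rewrite sinB sin_pihalf cos_pihalf; ring.
rewrite cos2sin2 sin_arcang.
have -> : (b + c - y - c) / (b - c) = 1 - (y - c) / (b - c) by field; rewrite subr_eq0 gt_eqF.
set w := (y - c) / (b - c).
rewrite /Num.max /Num.min.
by repeat case: ifP; lra.
Qed.

Lemma arcang_ratio (x y th : R) : c <= x -> x <= y -> y <= b -> 0 <= th <= 1 ->
  arcang b c (x + th * (y - x)) - arcang b c x <=
    Num.sqrt th * (arcang b c y - arcang b c x).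
Proof.
have cb' := cb.
move=> cx xy yb /andP[th0 th1].
set z := x + th * (y - x).
have xz : x <= z by rewrite /z; nra.
have zy : z <= y by rewrite /z; nra.
have /andP[ax0 _] := arcang_itv x.
have /andP[_ ay1] := arcang_itv y.
apply: arc_ratio => //; try exact: arcang_le.
have bc : 0 < b - c by lra.
rewrite -(ler_pM2l bc) mulrCA !mulrBr !arcang_sin2 ?/z; [|apply/andP; split; rewrite -?/z; lra..].
by rewrite le_eqVlt; apply/orP; left; apply/eqP; ring.
Qed.

Lemma arcang_lr (x r : R) : 0 <= r -> x + r <= b ->
  arcang b c x - arcang b c (x - r) <= 8 * (arcang b c (x + r) - arcang b c x).
Proof.
have cb' := cb.
move=> r0 xrb.
have [xc|cx] := leP x c.
  rewrite [arcang b c x]arcang_lo// [arcang _ _ (x - _)]arcang_lo; last by lra.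
  rewrite subrr subr0 mulr_ge0//.
  by case/andP: (arcang_itv (x + r)).
(* Beyond [r = x - c] the left side no longer changes, while the right side still grows. *)
wlog : r r0 xrb / r <= x - c => [hw|].
  have [rx|rx] := leP r (x - c); first exact: hw.
  have := hw (x - c); rewrite subr_ge0 (ltW cx) lexx => /(_ isT) h.
  have {}h : x + (x - c) <= b -> arcang b c x - arcang b c (x - (x - c)) <= 8 * (arcang b c (x + (x - c)) - arcang b c x) by move=> ?; exact: h.
  have {}h := h (ltac:(lra)).
  rewrite [arcang _ _ (x - r)]arcang_lo; last by lra.
  rewrite [arcang _ _ (x - (x - c))]arcang_lo in h; last by lra.
  apply: le_trans h _; rewrite ler_pM2l// lerD2r; apply: arcang_le; lra.
move=> rx.
have /andP[ax0 _] := arcang_itv (x - r).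
have /andP[_ ay1] := arcang_itv (x + r).
apply: arc_left_right => //; try (apply: arcang_le; lra).
have bc : 0 < b - c by lra.
rewrite -(ler_pM2l bc) !mulrBr !arcang_sin2; [|apply/andP; split; lra..].
by rewrite le_eqVlt; apply/orP; left; apply/eqP; ring.
Qed.

(** The 9 is 1 for the right half of the window, from [arcang_ratio], plus 8 for the left half,
    which [arcang_lr] compares with the right one. *)
Lemma arcang_spread (x y th : R) : c <= x -> x <= y -> y <= b -> 0 <= th <= 1 ->
  arcang b c (x + th * (y - x)) - arcang b c (x - th * (y - x)) <=
    9 * Num.sqrt th * (arcang b c y - arcang b c x).
Proof.
have cb' := cb.
move=> cx xy yb th01; have /andP[th0 th1] := th01.
have h1 := arcang_ratio cx xy yb th01.
have h2 : arcang b c x - arcang b c (x - th * (y - x)) <= 8 * (arcang b c (x + th * (y - x)) - arcang b c x).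
  by apply: arcang_lr; nra.
by lra.
Qed.

Lemma arcang_ratio_left (x y th : R) : c <= y -> y <= x -> x <= b -> 0 <= th <= 1 ->
  arcang b c x - arcang b c (x - th * (x - y)) <=
    Num.sqrt th * (arcang b c x - arcang b c y).
Proof.
have cb' := cb.
move=> cy yx xb th01.
have := @arcang_ratio (b + c - x) (b + c - y) th (ltac:(lra)) (ltac:(lra)) (ltac:(lra)) th01.
have -> : b + c - x + th * (b + c - y - (b + c - x)) = b + c - (x - th * (x - y)) by ring.
by rewrite !arcang_mirror; move=> h; apply: le_trans (le_trans h _); rewrite le_eqVlt; apply/orP; left; apply/eqP; ring.
Qed.

Lemma arcang_spread_left (x y th : R) : c <= y -> y <= x -> x <= b -> 0 <= th <= 1 ->
  arcang b c (x + th * (x - y)) - arcang b c (x - th * (x - y)) <=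
    9 * Num.sqrt th * (arcang b c x - arcang b c y).
Proof.
have cb' := cb.
move=> cy yx xb th01.
have := @arcang_spread (b + c - x) (b + c - y) th (ltac:(lra)) (ltac:(lra)) (ltac:(lra)) th01.
have -> : b + c - x + th * (b + c - y - (b + c - x)) = b + c - (x - th * (x - y)) by ring.
have -> : b + c - x - th * (b + c - y - (b + c - x)) = b + c - (x + th * (x - y)) by ring.
by rewrite !arcang_mirror; move=> h; apply: le_trans (le_trans h _); rewrite le_eqVlt; apply/orP; left; apply/eqP; ring.
Qed.

End Angle.

(** * Chebyshev nodes *)

Section Chebyshev.
Variable R : realType.
Implicit Types x y t : R.

Fixpoint cheb_pair n : {poly R} * {poly R} :=
  if n is m.+1 then let p := cheb_pair m in (p.2, 2%:P * 'X * p.2 - p.1)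
  else (1, 'X).
Definition cheb n := (cheb_pair n).1.

Lemma chebSS n : cheb n.+2 = 2%:P * 'X * cheb n.+1 - cheb n.
Proof. by []. Qed.

Lemma cheb_cos n t : (cheb n).[cos t] = cos (n%:R * t).
Proof.
suff [] : (cheb n).[cos t] = cos (n%:R * t) /\ (cheb n.+1).[cos t] = cos (n.+1%:R * t) by [].
elim: n => [|n [IH1 IH2]].
  by rewrite /cheb /= hornerX mul0r cos0 mul1r hornerC.
split=> //; rewrite chebSS !hornerE IH1 IH2.
have -> : n.+2%:R * t = n.+1%:R * t + t by rewrite -[n.+2]addn1 natrD; ring.
have -> : n%:R * t = n.+1%:R * t - t by rewrite -[n.+1]addn1 natrD; ring.
by rewrite [cos (_ - t)]cosB [cos (_ + t)]cosD; ring.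
Qed.

Lemma size_cheb n : size (cheb n.+1) = n.+2 /\ lead_coef (cheb n.+1) = 2 ^+ n.
Proof.
suff [] : [/\ size (cheb n.+1) = n.+2, lead_coef (cheb n.+1) = 2 ^+ n & (size (cheb n) <= n.+1)%N] by [].
elim: n => [|n [IH1 IH2 IH3]].
  by rewrite /cheb /= size_polyX lead_coefX expr0 size_poly1.
have two : (2 : R) != 0 by rewrite pnatr_eq0.
have h1 : 2%:P * 'X * cheb n.+1 = 2 *: ('X * cheb n.+1) by rewrite -mulrA mul_polyC.
have nz : cheb n.+1 != 0 by rewrite -size_poly_eq0 IH1.
have s1 : size (2 *: ('X * cheb n.+1)) = n.+3.
  by rewrite size_scale// mulrC size_mulX// IH1.
have lt : (size (- cheb n) < size (2 *: ('X * cheb n.+1)))%N.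
  by rewrite s1 size_polyN (leq_ltn_trans IH3).
split; last by rewrite IH1.
- by rewrite chebSS h1 size_polyDl.
- by rewrite chebSS h1 lead_coefDl// lead_coefZ ['X * _]mulrC lead_coefMX IH2 -exprS.
Qed.

Definition chebnode K (k : nat) : R := pi * (2 * k + 1)%:R / (2 * K)%:R.

Lemma chebnode_itv K k : (k < K)%N -> 0 < chebnode K k < pi.
Proof.
move=> kK; have p0 := @pi_gt0 R; rewrite /chebnode; apply/andP; split.
  by rewrite !mulr_gt0 ?invr_gt0 ?ltr0n//; lia.
rewrite ltr_pdivrMr ?ltr0n; last by lia.
by rewrite ltr_pM2l// ltr_nat; lia.
Qed.

Lemma chebnode_inj K k l : (0 < K)%N -> chebnode K k = chebnode K l -> k = l.
Proof.
move=> K0; rewrite /chebnode => h.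
have : (2 * k + 1)%:R = (2 * l + 1)%:R :> R.
  apply: (@mulfI _ pi); first by rewrite gt_eqF// pi_gt0.
  by apply: (@mulIf _ (2 * K)%:R^-1) => //; rewrite invr_eq0 pnatr_eq0; lia.
by move/eqP; rewrite eqr_nat => /eqP; lia.
Qed.

Lemma cos_pihalf_odd (k : nat) : cos (pi / 2 * (2 * k + 1)%:R) = 0 :> R.
Proof.
elim: k => [|k IH]; first by rewrite muln0 mulr1 cos_pihalf.
have -> : pi / 2 * (2 * k.+1 + 1)%:R = pi / 2 * (2 * k + 1)%:R + pi :> R.
  by rewrite mulnS -addnA natrD; field.
by rewrite cosDpi IH oppr0.
Qed.

Lemma cheb_prod K : (0 < K)%N ->
  cheb K = 2 ^+ K.-1 *: \prod_(0 <= k < K) ('X - (cos (chebnode K k))%:P).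
Proof.
case: K => // K _.
have [h1 h2] := size_cheb K.
rewrite /= -h2 -(big_map (fun k => cos (chebnode K.+1 k)) xpredT (fun z => 'X - z%:P)).
apply: all_roots_prod_XsubC.
- by rewrite size_map size_iota subn0.
- apply/allP => z /mapP[k]; rewrite mem_index_iota /= => kK ->.
  rewrite /root cheb_cos.
  have -> : K.+1%:R * chebnode K.+1 k = pi / 2 * (2 * k + 1)%:R.
    by rewrite /chebnode natrM; field; rewrite nat1r pnatr_eq0.
  by rewrite cos_pihalf_odd.
- rewrite uniq_rootsE map_inj_in_uniq ?iota_uniq// => k l; rewrite !mem_index_iota /= => hk hl.
  have /andP[k1 k2] := chebnode_itv hk; have /andP[l1 l2] := chebnode_itv hl.
  move=> /cos_inj; rewrite !in_itv /= !ltW// => h; apply: (@chebnode_inj K.+1) => //.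
  exact: h.
Qed.

(** The field is arbitrary because the identity is used twice: over the complex numbers to bound the
    product on an ellipse, and over [R] to evaluate it at 0. *)
Lemma cheb_joukowski (F : fieldType) (f : {rmorphism R -> F}) (w : F) n :
  w != 0 -> (2 : F) != 0 ->
  2 * (map_poly f (cheb n)).[(w + w^-1) / 2] = w ^+ n + w^-1 ^+ n.
Proof.
move=> w0 t0; set z := _ / 2.
suff [] : 2 * (map_poly f (cheb n)).[z] = w ^+ n + w^-1 ^+ n /\
  2 * (map_poly f (cheb n.+1)).[z] = w ^+ n.+1 + w^-1 ^+ n.+1 by [].
elim: n => [|n [IH1 IH2]].
  rewrite /cheb /= map_polyX hornerX rmorph1 hornerC !expr0 !expr1 mulr1; split=> //.
  by rewrite /z mulrC divfK.
split=> //; rewrite chebSS rmorphB /= !rmorphM /= map_polyX map_polyC /= rmorph_nat.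
rewrite hornerD hornerN !hornerM !hornerC hornerX.
have -> : 2 * (2 * z * (map_poly f (cheb n.+1)).[z] - (map_poly f (cheb n)).[z]) =
  (2 * z) * (2 * (map_poly f (cheb n.+1)).[z]) - 2 * (map_poly f (cheb n)).[z] by ring.
rewrite IH1 IH2.
have -> : 2 * z = w + w^-1 by rewrite /z mulrC divfK.
by rewrite !exprS; field.
Qed.

Lemma joukowski_prod (F : fieldType) (f : {rmorphism R -> F}) (w : F) K :
  (0 < K)%N -> w != 0 -> (2 : F) != 0 ->
  \prod_(0 <= k < K) (w + w^-1 - 2 * f (cos (chebnode K k))) = w ^+ K + w^-1 ^+ K.
Proof.
move=> K0 w0 t0; rewrite -(cheb_joukowski f)// cheb_prod//.
rewrite map_polyZ hornerZ rmorph_prod horner_prod rmorphXn /= rmorph_nat mulrA.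
rewrite -exprS prednK//.
have -> : (2 : F) ^+ K = \prod_(0 <= k < K) 2 by rewrite prodr_const_nat subn0.
rewrite -big_split /=; apply: eq_bigr => k _.
rewrite rmorphB /= map_polyX map_polyC /= !hornerE mulrBr; congr (_ - _).
by rewrite mulrC divfK.
Qed.

(** The point with abscissa [x] and height [(r - r^-1) / 2 * sin t] is [(w + w^-1) / 2] for a [w] of
    modulus [r] and argument [t]. It lies on an ellipse with foci -1 and 1, and the product is the
    modulus of [w ^+ K + w^-1 ^+ K]. *)
Lemma joukowski_norm_prod (x r t : R) K : (0 < K)%N -> 1 <= r ->
  x = (r + r^-1) / 2 * cos t ->
  \prod_(0 <= k < K) (2 * Num.sqrt ((x - cos (chebnode K k)) ^+ 2 + ((r - r^-1) / 2 * sin t) ^+ 2))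
    <= 2 * r ^+ K.
Proof.
move=> K0 r1 xE.
have r0 : r != 0 by rewrite gt_eqF//; lra.
pose w : R[i] := Complex (r * cos t) (r * sin t).
have nw : Normc.normc w = r.
  rewrite /w /= !exprMn -mulrDr cos2Dsin2 mulr1 sqrtr_sqr ger0_norm//; lra.
have w0 : w != 0.
  by apply/eqP => e; move: nw; rewrite e Normc.normc0 => /eqP; rewrite eq_sym (negbTE r0).
have wV : w^-1 = Complex (r^-1 * cos t) (- (r^-1 * sin t)).
  apply: (mulfI w0); rewrite divff//; apply/eqP; rewrite eq_complex /w /=.
  have h := cos2Dsin2 t.
  apply/andP; split; apply/eqP.
    transitivity ((cos t ^+ 2 + sin t ^+ 2) * (r / r)); last by ring.
    by rewrite h divff// mul1r.
  by ring.
have t0 : (2 : R[i]) != 0 by rewrite pnatr_eq0.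
have := joukowski_prod (real_complex R) K0 w0 t0.
move/(congr1 (@Normc.normc R)).
have -> : Normc.normc (\prod_(0 <= k < K) (w + w^-1 - 2 * (cos (chebnode K k))%:C%C)) =
  \prod_(0 <= k < K) Normc.normc (w + w^-1 - 2 * (cos (chebnode K k))%:C%C).
  by apply: (big_morph _ (@Normc.normcM R) (@Normc.normc1 R)).
have nX (z : R[i]) k : Normc.normc (z ^+ k) = Normc.normc z ^+ k.
  by elim: k => [|k IH]; rewrite ?expr0 ?Normc.normc1// !exprS Normc.normcM IH.
move=> E.
apply: (@le_trans _ _ (Normc.normc (w ^+ K + w^-1 ^+ K))).
  rewrite -E le_eqVlt; apply/orP; left; apply/eqP; apply: eq_bigr => k _.
  have -> : w + w^-1 - 2 * (cos (chebnode K k))%:C%C =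
    Complex (2 * (x - cos (chebnode K k))) (2 * ((r - r^-1) / 2 * sin t)).
    rewrite wV /w xE; apply/eqP; rewrite eq_complex /= -mulr_natl.
    by apply/andP; split; apply/eqP; simpc; rewrite /=; field.
  rewrite /= !exprMn -mulrDr sqrtrM ?sqr_ge0// sqrtr_sqr ger0_norm//.
apply: le_trans (le_normcD _ _) _.
rewrite !nX Normc.normcV nw.
have : r^-1 ^+ K <= r ^+ K.
  apply: (@le_trans _ _ 1).
    by rewrite exprn_ile1// ?invr_ge0 ?invf_le1//; lra.
  by rewrite exprn_ege1.
by lra.
Qed.

(** The zeros of the Chebyshev polynomial of degree [K] of [c, b], increasing in [k]: the quantiles
    of order [(k + 1 / 2) / K] of the equilibrium measure. *)
Definition arcnode (b c : R) K k := arcpt b c (chebnode K k / 2).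

Lemma arcnodeE b c K k : arcnode b c K k = (b + c) / 2 - (b - c) / 2 * cos (chebnode K k).
Proof.
rewrite /arcnode /arcpt; set t := chebnode K k.
have -> : cos t = 1 - 2 * sin (t / 2) ^+ 2.
  have e : t = (t / 2) *+ 2 by rewrite -mulr_natr divfK// pnatr_eq0.
  by rewrite [in LHS]e cos_mulr2n cos2sin2 -mulr_natr; ring.
by field.
Qed.

(** Lifting [x] vertically to the ellipse of parameter [expR d] only increases its distances to the
    nodes. In the coordinate [X] of [-1, 1], with half-axes [A] and [e], [cos t = X / A] gives
    [sin t >= e / A], so the height is at least [e ^+ 2 / A]: the truncation comes for a factor
    [expR d] per node. *)
Lemma arcnode_prod_max (d : R) : 0 < d ->
  exists2 e0, 0 < e0 & forall b c x K, c < b -> c <= x <= b -> (0 < K)%N ->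
    \prod_(0 <= k < K) Num.max `|x - arcnode b c K k| (e0 * (b - c)) <=
    2 * ((b - c) / 4) ^+ K * expR d ^+ K.
Proof.
move=> d0.
set r := expR d; have r1 : 1 < r by rewrite expR_gt1.
have rV : r^-1 < 1 by rewrite invf_lt1//; lra.
have rV0 : 0 < r^-1 by rewrite invr_gt0; lra.
set A := (r + r^-1) / 2; set e := (r - r^-1) / 2.
have Ae : A ^+ 2 - e ^+ 2 = 1.
  by rewrite /A /e; field; rewrite gt_eqF//; lra.
have e0 : 0 < e by rewrite /e; lra.
have A0 : 0 < A by rewrite /A; lra.
have A1 : 1 < A by rewrite ltNge; apply/negP => h; nra.
(* The last 1/2 is the scale factor [(b - c) / 2] from [-1, 1] to [c, b]. *)
exists (e ^+ 2 / A / 2); first by rewrite !divr_gt0// ?exprn_gt0//; lra.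
move=> b c x K cb /andP[cx xb] K0.
set X := (b + c - 2 * x) / (b - c).
have bc : 0 < b - c by lra.
have bcn : b - c != 0 by rewrite gt_eqF.
have xE : x = (b + c) / 2 - (b - c) / 2 * X by rewrite /X; field.
have X1 : -1 <= X <= 1.
  by rewrite /X; apply/andP; split; rewrite ?ler_pdivlMr ?ler_pdivrMr//; lra.
have XA : -1 <= X / A <= 1.
  move/andP: X1 => [? ?]; apply/andP; split; [rewrite ler_pdivlMr//|rewrite ler_pdivrMr//]; lra.
set t := acos (X / A).
have XE : X = (r + r^-1) / 2 * cos t.
  rewrite /t acosK; last by rewrite in_itv.
  by rewrite -/A mulrC divfK// gt_eqF//; lra.
have st : e / A <= sin t.
  rewrite /t sin_acos// -[leLHS]ger0_norm; last by rewrite divr_ge0; lra.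
  rewrite -sqrtr_sqr ler_wsqrtr// (expr_div_n e A) (expr_div_n X A).
  have -> : e ^+ 2 = A ^+ 2 - 1 by lra.
  rewrite mulrBl divff; last by rewrite expf_neq0// gt_eqF//; lra.
  rewrite lerD2l lerN2 ler_pM2r ?invr_gt0 ?exprn_gt0//.
  by move/andP: X1 => [? ?]; nra.
have := @joukowski_norm_prod X r t K K0 (ltW r1) XE.
have b4 : 0 <= (b - c) / 4 by lra.
move/(ler_wpM2l (exprn_ge0 K b4)); rewrite mulrCA mulrA; apply: le_trans.
have {1}-> : ((b - c) / 4) ^+ K = \prod_(0 <= k < K) ((b - c) / 4) by rewrite prodr_const_nat subn0.
rewrite -big_split /= big_seq [leRHS]big_seq; apply: ler_prod => k _.
rewrite le_max normr_ge0 /= arcnodeE [in x - _]xE.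
set ck := cos _.
have -> : (b + c) / 2 - (b - c) / 2 * X - ((b + c) / 2 - (b - c) / 2 * ck) = (b - c) / 2 * (ck - X) by ring.
have -> : (b - c) / 4 * (2 * Num.sqrt ((X - ck) ^+ 2 + ((r - r^-1) / 2 * sin t) ^+ 2)) =
  (b - c) / 2 * (Num.sqrt ((X - ck) ^+ 2 + (e * sin t) ^+ 2)) by rewrite -/e; field.
have -> : e ^+ 2 / A / 2 * (b - c) = (b - c) / 2 * (e ^+ 2 / A) by field; rewrite gt_eqF//; lra.
rewrite normrM ger0_norm; last by lra.
rewrite ge_max !ler_pM2l ?divr_gt0//; apply/andP; split.
  by rewrite -sqrtr_sqr ler_wsqrtr// -[(X - ck) ^+ 2]sqrrN opprB lerDl sqr_ge0.
have h : 0 <= e ^+ 2 / A by rewrite divr_ge0 ?sqr_ge0//; lra.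
rewrite -[leLHS]ger0_norm// -sqrtr_sqr ler_wsqrtr//.
apply: (@le_trans _ _ ((e * sin t) ^+ 2)); last by rewrite lerDr sqr_ge0.
rewrite ler_sqr ?nnegrE//; last first.
  by rewrite mulr_ge0 ?(ltW e0)//; apply: le_trans st; rewrite divr_ge0; lra.
by rewrite expr2 -mulrA ler_pM2l.
Qed.

(* The Green function of the complement of [a, b] with pole at infinity, at the point 0. *)
Definition gam (b a : R) := ln ((Num.sqrt b + Num.sqrt a) / (Num.sqrt b - Num.sqrt a)).

Lemma gam_arg_ge1 (b a : R) : 0 <= a < b ->
  1 <= (Num.sqrt b + Num.sqrt a) / (Num.sqrt b - Num.sqrt a).
Proof.
move=> /andP[a0 ab].
have h : Num.sqrt a < Num.sqrt b by rewrite ltr_sqrt//; lra.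
have h0 := sqrtr_ge0 a.
by rewrite ler_pdivlMr; lra.
Qed.

(** The number [w = expR (gam b c)] satisfies [w + w^-1 = 2 * (b + c) / (b - c)], so it corresponds
    to the point 0 under the Joukowski map of [c, b]. The term [w^-1 ^+ K] is dropped; [(b - c) / 4]
    is the capacity of the interval. *)
Lemma arcnode_prod0 (b c : R) K : 0 <= c < b -> (0 < K)%N ->
  ((b - c) / 4) ^+ K * expR (gam b c) ^+ K <= \prod_(0 <= k < K) arcnode b c K k.
Proof.
move=> cb K0; have /andP[c0 clb] := cb.
have h : Num.sqrt c < Num.sqrt b by rewrite ltr_sqrt//; lra.
have h0 := sqrtr_ge0 c.
have w1 := gam_arg_ge1 cb.
rewrite /gam lnK ?posrE; last by lra.
set w := (_ / _) in w1 *.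
have w0 : w != 0 by rewrite gt_eqF//; lra.
have := @joukowski_prod _ idfun w K K0 w0.
rewrite pnatr_eq0 => /(_ isT) E.
apply: (@le_trans _ _ (((b - c) / 4) ^+ K * (w ^+ K + w^-1 ^+ K))).
  rewrite ler_wpM2l ?exprn_ge0//; first by lra.
  by rewrite lerDl exprn_ge0// invr_ge0; lra.
rewrite -E.
have -> : ((b - c) / 4) ^+ K = \prod_(0 <= k < K) ((b - c) / 4) by rewrite prodr_const_nat subn0.
rewrite -big_split /= le_eqVlt; apply/orP; left; apply/eqP; apply: eq_bigr => k _.
rewrite arcnodeE.
suff -> : w + w^-1 = 2 * (b + c) / (b - c) by field; rewrite subr_eq0 gt_eqF.
have eb : b = Num.sqrt b ^+ 2 by rewrite sqr_sqrtr//; lra.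
have ec : c = Num.sqrt c ^+ 2 by rewrite sqr_sqrtr.
rewrite /w [in RHS]eb [in RHS]ec.
field.
by rewrite subr_sqr mulf_eq0 !negb_or -!andbA; apply/and3P; split; rewrite gt_eqF//; lra.
Qed.

Lemma arcnode_gt0 (b c : R) K k : 0 <= c < b -> (k < K)%N -> 0 < arcnode b c K k.
Proof.
move=> /andP[c0 cb] kK; rewrite /arcnode /arcpt ltr_wpDl// mulr_gt0 ?subr_gt0//.
rewrite exprn_gt0// sin_gt0_pihalf//.
by have /andP[h1 h2] := chebnode_itv kK; apply/andP; split; lra.
Qed.

Lemma arcnode_itv (b c : R) K k : c < b -> c <= arcnode b c K k <= b.
Proof. by move=> cb; exact: arcpt_itv. Qed.

(** The angles of the nodes are the midpoints [(k + 1 / 2) * pi / (2 * K)], so the count is the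
    number [X] rounded to a nearest integer. *)
Lemma arcnode_count (b c y : R) K : c < b -> (0 < K)%N ->
  `| (\sum_(0 <= k < K) nat_of_bool (arcnode b c K k <= y)%R)%N%:R - K%:R * (arcang b c y / (pi / 2)) | <= 1.
Proof.
move=> cb K0.
have p0 := @pi_gt0 R.
have Kp : 0 < K%:R :> R by rewrite ltr0n.
set X := K%:R * _.
have /andP[a0 a1] := arcang_itv cb y.
have X0 : 0 <= X by rewrite /X mulr_ge0 ?divr_ge0//; lra.
have XK : X <= K%:R.
  by rewrite /X -[leRHS]mulr1 ler_pM2l// ler_pdivrMr//; lra.
have hX : 0 <= X + 2^-1 by lra.
set m := Num.truncn (X + 2^-1).
have /andP[m1 m2] := truncn_itv hX.
have mK : (m <= K)%N.
  rewrite -ltnS -(ltr_nat R); apply: le_lt_trans m1 _.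
  by rewrite -[K.+1]addn1 natrD; lra.
have -> : (\sum_(0 <= k < K) nat_of_bool (arcnode b c K k <= y)%R)%N = m.
  rewrite (eq_big_nat _ _ (F2 := fun k => nat_of_bool (k < m)%N)); last first.
    move=> k /andP[_ kK]; congr nat_of_bool.
    have /andP[k1 k2] := chebnode_itv kK.
    rewrite /arcnode arcpt_le_ang//; [|lra..].
    rewrite /m truncn_ge_nat// -[k.+1]addn1 natrD.
    have -> : chebnode K k / 2 = (k%:R + 2^-1) / K%:R * (pi / 2).
      by rewrite /chebnode natrD !natrM; field; rewrite gt_eqF.
    rewrite -ler_pdivlMr; last by lra.
    rewrite ler_pdivrMr// [_ * K%:R]mulrC -/X.
    by apply/idP/idP => ?; lra.
  have s1 : (\sum_(0 <= k < m) (k < m) = m)%N.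
    rewrite (eq_big_nat _ _ (F2 := fun _ => 1%N)); last by move=> k /andP[_ ->].
    by rewrite sum_nat_const_nat muln1 subn0.
  have s2 : (\sum_(m <= k < K) (k < m) = 0)%N.
    by rewrite big_nat big1// => k /andP[h _]; rewrite ltnNge h.
  by rewrite (big_cat_nat _ (n := m))//= s1 s2 addn0.
rewrite ler_norml; apply/andP; split; lra.
Qed.

Lemma arcnode_lt (b c : R) K k l : c < b -> (k < l < K)%N -> arcnode b c K k < arcnode b c K l.
Proof.
move=> cb /andP[kl lK]; rewrite ltNge; apply/negP.
have /andP[l1 l2] := chebnode_itv lK.
have kK : (k < K)%N by lia.
have /andP[k1 k2] := chebnode_itv kK.
rewrite /arcnode arcpt_le//; [|apply/andP; split; lra..].
rewrite ler_pM2r// /chebnode ler_pM2r ?invr_gt0 ?ltr0n; last by lia.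
by rewrite ler_pM2l ?pi_gt0// ler_nat; lia.
Qed.

(** The nodes are distinct, so at most one of them equals [y]. The induction carries along that an
    excess of one is witnessed by such a node. *)
Lemma arcnode_count_lt (b c y : R) K : c < b -> (0 < K)%N ->
  (\sum_(0 <= k < K) nat_of_bool (arcnode b c K k <= y)%R <=
   (\sum_(0 <= k < K) nat_of_bool (arcnode b c K k < y)%R).+1)%N.
Proof.
move=> cb K0.
suff H j : (j <= K)%N ->
  (\sum_(0 <= k < j) nat_of_bool (arcnode b c K k <= y)%R <=
   (\sum_(0 <= k < j) nat_of_bool (arcnode b c K k < y)%R).+1)%N /\
  ((\sum_(0 <= k < j) nat_of_bool (arcnode b c K k <= y)%R =
   (\sum_(0 <= k < j) nat_of_bool (arcnode b c K k < y)%R).+1)%N -> exists2 k, (k < j)%N & arcnode b c K k = y).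
  by have [] := H K (leqnn K).
elim: j => [_|j IHj jK]; first by rewrite !big_geq.
have [h1 h2] := IHj (ltnW jK).
rewrite !big_nat_recr//=.
have [lt|gt|e] := ltgtP (arcnode b c K j) y.
- split; first by lia.
  move=> h; have [|k kj hk] := h2; first by lia.
  by exists k => //; lia.
- split; first by lia.
  move=> h; have [|k kj hk] := h2; first by lia.
  by exists k => //; lia.
- split; last by exists j.
  rewrite addn1 addn0 ltnS leqNgt; apply/negP => h.
  have [|k kj hk] := h2; first by lia.
  have := @arcnode_lt b c K k j cb; rewrite kj jK => /(_ isT).
  by rewrite hk e ltxx.
Qed.

End Chebyshev.

(** * Discretization of a logarithmic potential *)

Lemma near_block_start_le j kx u0 P : (u0 < kx.+1 * P -> kx <= j + 2 -> u0 <= j * P + 0 + 3 * P)%N.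
Proof. nia. Qed.

Lemma near_block_end_le j kx u0 P :
  (kx * P <= u0 -> j <= kx + 2 -> 0 < P -> j * P + P.-1 <= u0 + 3 * P)%N.
Proof. nia. Qed.

Section Blocks.
Variable R : realType.
Implicit Types (x y z : R) (zs : seq R).

(** A Kantorovich type inequality: [ln m - ln D <= m / D - 1], and on [A, B] the convex function
    [1 / D] lies below its chord [(A + B - D) / (A * B)]. Summation leaves
    [m * (A + B - m) / (A * B) - 1], which is largest at [m = (A + B) / 2]. *)
Lemma ln_mean_le (P : nat) (D : nat -> R) (A B : R) : (0 < P)%N -> 0 < A ->
  (forall p, (p < P)%N -> A <= D p <= B) ->
  P%:R * ln ((\sum_(0 <= p < P) D p) / P%:R) - \sum_(0 <= p < P) ln (D p) <=
    P%:R * ((B - A) ^+ 2 / (4 * A * B)).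
Proof.
move=> P0 A0 hD.
have Pp : 0 < P%:R :> R by rewrite ltr0n.
set m := _ / P%:R.
have AB : A <= B by have /andP[h1 h2] := hD 0%N P0; lra.
have sA : P%:R * A <= \sum_(0 <= p < P) D p.
  rewrite mulr_natl -[X in A *+ X]subn0 -sumr_const_nat !big_nat; apply: ler_sum => p /andP[_ pP].
  by case/andP: (hD p pP).
have mA : A <= m by rewrite /m ler_pdivlMr// mulrC.
have -> : P%:R * ln m - \sum_(0 <= p < P) ln (D p) = \sum_(0 <= p < P) (ln m - ln (D p)).
  by rewrite sumrB sumr_const_nat subn0 mulr_natl.
apply: (@le_trans _ _ (\sum_(0 <= p < P) (m * ((A + B - D p) / (A * B)) - 1))).
  rewrite !big_nat; apply: ler_sum => p /andP[_ pP].
  have /andP[h1 h2] := hD p pP.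
  have D0 : 0 < D p by lra.
  rewrite -ln_div ?posrE//; last by lra.
  have q0 : 0 < m / D p by rewrite divr_gt0//; lra.
  have := @le_ln1Dx R (m / D p - 1); rewrite (addrC 1) subrK => h.
  apply: le_trans (h _) _; first by lra.
  rewrite lerD2r ler_pM2l; last by lra.
  rewrite -[(D p)^-1]mul1r ler_pdivrMr// mulrAC ler_pdivlMr; last by rewrite mulr_gt0//; lra.
  by nra.
rewrite sumrB -mulr_sumr sumr_const_nat subn0 -mulr_suml.
rewrite sumrB sumr_const_nat subn0.
have mE : \sum_(0 <= i < P) D i = m * P%:R by rewrite /m divfK// gt_eqF.
rewrite mE.
have AB0 : 0 < A * B by rewrite mulr_gt0//; lra.
have -> : m * (((A + B) *+ P - m * P%:R) / (A * B)) - 1 *+ P =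
  P%:R * (m * (A + B - m) / (A * B) - 1) by rewrite -[(A + B) *+ P]mulr_natl; ring.
rewrite ler_pM2l//.
have -> : (B - A) ^+ 2 / (4 * A * B) = ((A + B) ^+ 2 / 4) / (A * B) - 1.
  by field; apply/andP; split; rewrite gt_eqF//; lra.
rewrite lerD2r ler_pM2r ?invr_gt0//.
have := sqr_ge0 (m - (A + B) / 2); lra.
Qed.

Lemma count_add_le (p q r : pred R) zs : (forall z, (p z + q z <= r z)%N) ->
  (count p zs + count q zs <= count r zs)%N.
Proof. by move=> h; elim: zs => //= z zs IH; have := h z; lia. Qed.

Lemma sum_block_le (f : nat -> nat) (n P j : nat) : (j < n)%N ->
  (\sum_(0 <= p < P) f (j * P + p) <= \sum_(0 <= l < n * P) f l)%N.
Proof.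
move=> jn.
have h : (j * P + P <= n * P)%N by rewrite -mulSnr leq_mul2r jn orbT.
have h1 : (j * P <= n * P)%N by lia.
have h2 : (j * P <= j * P + P)%N by lia.
rewrite (big_cat_nat (leq0n _) h1) /= (big_cat_nat h2 h) /=.
have -> : (\sum_(j * P <= l < j * P + P) f l = \sum_(0 <= p < P) f (j * P + p))%N.
  rewrite -{1}[(j * P)%N]add0n big_addn addKn.
  by apply: eq_bigr => p _; rewrite addnC.
lia.
Qed.

Lemma count_nth_sum (c : pred R) zs :
  count c zs = (\sum_(0 <= l < size zs) c (nth 0%R zs l))%N.
Proof. by rewrite -sum1_count big_mkcond (big_nth 0). Qed.

Lemma sum_blocks (f : nat -> R) (n P : nat) :
  \sum_(0 <= j < n) \sum_(0 <= p < P) f (j * P + p)%N = \sum_(0 <= l < n * P) f l.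
Proof.
elim: n => [|n IH]; first by rewrite mul0n !big_geq.
rewrite big_nat_recr//= IH mulSnr [RHS](big_cat_nat _ (n := (n * P)%N))//=; last by lia.
congr (_ + _); rewrite -{2}[(n * P)%N]add0n big_addn addKn.
by apply: eq_bigr => p _; rewrite addnC.
Qed.

Lemma ln4_le2 : ln 4 <= 2 :> R.
Proof.
have h : ln 2 <= 1 :> R.
  have := @le_ln1Dx R 1; rewrite -[1 + 1]/(2%:R) => -> //; lra.
have -> : (4 : R) = 2 * 2 by lra.
by rewrite lnM ?posrE//; lra.
Qed.

(** A layer-cake bound: each power of 4 between [D] and [B] accounts for at most [ln 4 <= 2]. The
    truncation at [e] bounds the number of layers by an [m] that does not depend on [D], so that a
    sum over many [D] can be exchanged with the sum over layers. *)
Lemma ln_ratio_count (B D e : R) (m : nat) : 0 < D -> e <= D -> 0 < B -> B <= 4 ^+ m * e ->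
  ln B - ln D <= 2 * (\sum_(0 <= i < m) nat_of_bool (D * 4 ^+ i < B)%R)%N%:R.
Proof.
move=> D0 eD B0 Bm.
have {Bm e eD} : B <= 4 ^+ m * D.
  by apply: le_trans Bm _; rewrite ler_wpM2l// exprn_ge0.
elim: m => [|m IH] Bm.
  rewrite expr0 mul1r in Bm.
  by rewrite big_geq// mulr0 subr_le0 ler_ln ?posrE.
rewrite big_nat_recr//= natrD mulrDr.
have [lt|ge] := ltP (D * 4 ^+ m) B; last first.
  by rewrite mulr0 addr0; apply: IH; rewrite mulrC.
rewrite mulr1.
have hs : (\sum_(0 <= i < m) nat_of_bool (D * 4 ^+ i < B)%R = m)%N.
  rewrite (eq_big_nat _ _ (F2 := fun _ => 1%N)); last first.
    move=> i /andP[_ im]; apply/eqP; rewrite eqb1; apply: le_lt_trans lt.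
    by rewrite ler_pM2l// ler_weXn2l ?ler1n// ltnW.
  by rewrite sum_nat_const_nat muln1 subn0.
rewrite hs.
have : ln B <= ln (4 ^+ m.+1 * D) by rewrite ler_ln ?posrE// mulr_gt0 ?exprn_gt0.
have e1 : m.+1%:R = m%:R + 1 :> R by rewrite -natr1.
rewrite lnM ?posrE ?exprn_gt0// lnXn// -[ln 4 *+ _]mulr_natl e1.
have h4 := ln4_le2; have m0 : 0 <= m%:R :> R by [].
by nra.
Qed.

Section Discretization.
Variables (M : R -> R) (zs : seq R) (n P : nat) (kk a b e x : R) (mm : nat).

(* [M] is the counting function of the sorted list [zs] up to an error [kk]; [x] is the point of evaluation. *)
Record block_data : Prop := BlockData {
  bd_sorted : sorted <=%R zs;
  bd_size : size zs = (n * P)%N;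
  bd_P : (0 < P)%N;
  bd_lo : forall y, M y - kk <= (count (fun z => z < y) zs)%:R;
  bd_hi : forall y, (count (fun z => z <= y) zs)%:R <= M y + kk;
  bd_mono : forall y y', y <= y' -> M y <= M y';
  bd_kk : 0 <= kk;
  bd_kP : 2 * kk * 4 <= P%:R;
  bd_km : 2 * kk * mm%:R <= P%:R;
  bd_x : a <= x <= b;
  bd_b : all (fun z => z <= b) zs;
  bd_e : 0 < e;
  bd_mm : b - a <= 4 ^+ mm * e;
  bd_r : forall y th, x <= y -> y <= b -> 0 <= th <= 1 ->
    M (x + th * (y - x)) - M x <= Num.sqrt th * (M y - M x);
  bd_r' : forall y th, a <= y -> y <= x -> 0 <= th <= 1 ->
    M x - M (x - th * (x - y)) <= Num.sqrt th * (M x - M y);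
  bd_s : forall y th, x <= y -> y <= b -> 0 <= th <= 1 ->
    M (x + th * (y - x)) - M (x - th * (y - x)) <= 9 * Num.sqrt th * (M y - M x);
  bd_s' : forall y th, a <= y -> y <= x -> 0 <= th <= 1 ->
    M (x + th * (x - y)) - M (x - th * (x - y)) <= 9 * Num.sqrt th * (M x - M y) }.

Hypothesis H : block_data.

Let Z j p := nth 0 zs (j * P + p).

(* Blocks starting to the left of [a] are moved to their right ends; the others are replaced by their means. *)
Definition block_zero j := if Z j 0 < a then Z j P.-1
  else (\sum_(0 <= p < P) Z j p) / P%:R.

(** The cost at [x] of replacing the block [j] by one zero of multiplicity [P]. Truncating the old
    distances at [e] keeps this cost bounded above. *)
Let phi j := P%:R * ln `|x - block_zero j| -
  \sum_(0 <= p < P) ln (Num.max `|x - Z j p| e).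

Let u0 := count (fun z => z <= x) zs.
(** The block in which the sorted list passes [x]; the blocks at index distance at most 2 from it
    are the near ones. *)
Let kx := (u0 %/ P)%N.

Let Pp : 0 < P%:R :> R. Proof. by rewrite ltr0n (bd_P H). Qed.

Lemma nth_le_count l y : (l < size zs)%N ->
  (nth 0 zs l <= y) = (l < count (fun z => z <= y)%R zs)%N.
Proof.
move=> lz; have := bd_sorted H; elim: (zs) l lz => // z s IH l /=.
rewrite (path_sortedE le_trans) => /[swap] /andP[/allP zl ss].
case: l => [_|l] /=.
  have [zy|yz] := leP z y; first by rewrite add1n ltnS leq0n.
  rewrite add0n; apply/esym/negbTE; rewrite -leqNgt leqn0 -leqn0 leqNgt -has_count.
  by apply/hasPn => w /zl zw; rewrite -ltNge (lt_le_trans yz).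
rewrite ltnS => ls; rewrite IH//.
have [zy|yz] := leP z y; first by rewrite add1n ltnS.
rewrite add0n; apply/idP/idP; last by apply: ltn_trans.
have -> : count (fun z => z <= y)%R s = 0%N; last by rewrite ltn0.
apply/eqP; rewrite -leqn0 leqNgt -has_count; apply/hasPn => w /zl zw.
by rewrite -ltNge (lt_le_trans yz).
Qed.

Lemma zs_le l l' : (l <= l')%N -> (l' < size zs)%N -> nth 0 zs l <= nth 0 zs l'.
Proof.
move=> ll lz; apply: (sorted_leq_nth le_trans lexx) => //.
- exact: (bd_sorted H).
- by rewrite inE (leq_ltn_trans ll).
Qed.

Lemma M_nth_hi l : (l < size zs)%N -> M (nth 0 zs l) <= l%:R + kk.
Proof.
move=> lz; have := bd_lo H (nth 0 zs l).
have : (count (fun z => (z < nth 0 zs l)%R) zs <= l)%N.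
  have {2}-> : zs = take l zs ++ drop l zs by rewrite cat_take_drop.
  rewrite count_cat.
  have : (count (fun z => (z < nth 0 zs l)%R) (take l zs) <= l)%N.
    by apply: leq_trans (count_size _ _) _; rewrite size_take lz.
  suff -> : count (fun z => (z < nth 0 zs l)%R) (drop l zs) = 0%N by rewrite addn0.
  apply/eqP; rewrite -leqn0 leqNgt -has_count; apply/hasPn => w /(nthP 0)[p].
  rewrite size_drop => pl; rewrite nth_drop => <-; rewrite -leNgt; apply: zs_le; [exact: leq_addr|by rewrite -ltn_subRL].
by rewrite -(ler_nat R) => h1 h2; lra.
Qed.

Lemma M_nth_lo l : (l < size zs)%N -> l%:R + 1 - kk <= M (nth 0 zs l).
Proof.
move=> lz; have := bd_hi H (nth 0 zs l).
have : (l < count (fun z => (z <= nth 0 zs l)%R) zs)%N by rewrite -nth_le_count.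
by rewrite -(ler_nat R) -natr1 => h1 h2; lra.
Qed.

Lemma M_x_hi : M x <= u0%:R + kk.
Proof.
have := bd_lo H x.
have : (count (fun z => (z < x)%R) zs <= u0)%N.
  by apply: sub_count => z /= /ltW.
by rewrite -(ler_nat R) => h1 h2; lra.
Qed.

Lemma M_x_lo : u0%:R - kk <= M x.
Proof. by have := bd_hi H x; rewrite -/u0; lra. Qed.

Lemma u0_kx : ((kx * P)%N <= u0 < kx.+1 * P)%N.
Proof. by rewrite leq_divM /= ltn_ceil// (bd_P H). Qed.

Lemma block_idx j p : (j < n)%N -> (p < P)%N -> (j * P + p < size zs)%N.
Proof. by move=> jn pP; rewrite (bd_size H); nia. Qed.

Lemma Z_le j p q : (j < n)%N -> (p <= q)%N -> (q < P)%N -> Z j p <= Z j q.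
Proof. by move=> jn pq qP; apply: zs_le; rewrite ?leq_add2l//; apply: block_idx. Qed.

Lemma Z_ends j p : (j < n)%N -> (p < P)%N -> Z j 0 <= Z j p <= Z j P.-1.
Proof.
by move=> jn pP; rewrite !Z_le//; have := bd_P H; lia.
Qed.

Lemma block_zero_itv j : (j < n)%N -> Z j 0 <= block_zero j <= Z j P.-1.
Proof.
move=> jn; rewrite /block_zero; case: ifP => _.
  by rewrite lexx andbT Z_le//; have := bd_P H; lia.
rewrite ler_pdivlMr// ler_pdivrMr// ![_ * P%:R]mulr_natr -[X in _ *+ X <= _]subn0.
rewrite -[X in _ && (_ <= _ *+ X)]subn0 -!sumr_const_nat; apply/andP; split.
  by rewrite !big_nat; apply: ler_sum => p /andP[_ pP]; case/andP: (Z_ends jn pP).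
by rewrite !big_nat; apply: ler_sum => p /andP[_ pP]; case/andP: (Z_ends jn pP).
Qed.

(** The zeros of such a block move to the right but stay on the left of [x], so every distance to
    [x] shrinks. *)
Lemma phi_left j : (j < n)%N -> Z j 0 < a -> block_zero j < x -> phi j <= 0.
Proof.
move=> jn ja wx; rewrite /phi subr_le0 -[P%:R]/(1 *+ P) -[in 1 *+ P](subn0 P) mulrnAl mul1r -sumr_const_nat.
rewrite !big_nat; apply: ler_sum => p /andP[_ pP].
have e0 := bd_e H.
have /andP[_ h] := Z_ends jn pP.
have h2 : Z j p <= block_zero j by rewrite /block_zero ja.
rewrite ler_ln ?posrE ?normr_gt0 ?subr_eq0 ?gt_eqF ?lt_max ?e0 ?orbT//.
by rewrite le_max !ger0_norm; [rewrite lerD2l lerN2 h2|lra|lra].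
Qed.

(** At most [9 * 2^-1 ^+ i * c1 + 2 * kk] zeros lie within [4^-1 ^+ i * B] of [x], by the regularity
    of [M], and the first term is at most [36 * P * 2^-1 ^+ i]. With [ln_ratio_count] the layers sum
    up to at most [2 * (72 * P + 2 * kk * mm)], which is at most [146 * P]. *)
Lemma near_sum (B c1 : R) j : (j < n)%N -> 0 < B -> B <= b - a -> 0 <= c1 -> c1 <= 4 * P%:R ->
  (forall th, 0 <= th <= 1 -> M (x + th * B) - M (x - th * B) <= 9 * Num.sqrt th * c1) ->
  P%:R * ln B - \sum_(0 <= p < P) ln (Num.max `|x - Z j p| e) <= P%:R * 146.
Proof.
move=> jn B0 Bba c10 c1P hM.
have e0 := bd_e H.
rewrite -[in P%:R * ln B](subn0 P) mulr_natl -sumr_const_nat -sumrB.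
apply: (@le_trans _ _ (\sum_(0 <= p < P) 2 * (\sum_(0 <= i < mm) nat_of_bool (Num.max `|x - Z j p| e * 4 ^+ i < B)%R)%N%:R)).
  rewrite !big_nat; apply: ler_sum => p /andP[_ pP].
  apply: (@ln_ratio_count _ _ e) => //.
  - by rewrite lt_max e0 orbT.
  - by rewrite le_max lexx orbT.
  - exact: le_trans Bba (bd_mm H).
rewrite -mulr_sumr -natr_sum exchange_big /= natr_sum.
apply: (@le_trans _ _ (2 * \sum_(0 <= i < mm) (36 * P%:R * 2^-1 ^+ i + 2 * kk))).
  rewrite ler_pM2l// !big_nat; apply: ler_sum => i /andP[_ im].
  set th := (4^-1 : R) ^+ i.
  have th0 : 0 < th by rewrite exprn_gt0// invr_gt0.
  have th1 : th <= 1 by rewrite exprn_ile1//; lra.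
  have sth : Num.sqrt th = 2^-1 ^+ i.
    have -> : th = (2^-1 ^+ i) ^+ 2 by rewrite -exprM mulnC exprM /th; congr (_ ^+ _); field.
    by rewrite sqrtr_sqr ger0_norm// exprn_ge0// invr_ge0.
  have hc : (\sum_(0 <= p < P) nat_of_bool (Num.max `|x - Z j p| e * 4 ^+ i < B)%R <=
      count (fun z => (x - th * B < z <= x + th * B)%R) zs)%N.
    rewrite count_nth_sum (bd_size H).
    apply: leq_trans (sum_block_le (fun l => nat_of_bool (x - th * B < nth 0 zs l <= x + th * B)%R) P jn).
    apply: leq_sum => p _; rewrite -/(Z j p).
    have [h|//] := ltP; rewrite lt0b.
    have {}h : `|x - Z j p| < th * B.
      rewrite /th exprVn mulrC ltr_pdivlMr ?exprn_gt0//; apply: le_lt_trans h.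
      by rewrite ler_pM2r ?exprn_gt0// le_max lexx.
    by move: h; rewrite ltr_norml => /andP[h1 h2]; apply/andP; split; lra.
  have hc2 : (count (fun z => (x - th * B < z <= x + th * B)%R) zs + count (fun z => (z < x - th * B)%R) zs
      <= count (fun z => (z <= x + th * B)%R) zs)%N.
    apply: count_add_le => z.
    have tB : 0 <= th * B by rewrite mulr_ge0//; lra.
    have [h1|h1] := leP z (x + th * B); last first.
      have -> : (z < x - th * B)%R = false by apply/negbTE; rewrite -leNgt; lra.
      by rewrite andbF.
    by rewrite andbT; case: ltgtP.
  have h1 := bd_lo H (x - th * B).
  have h2 := bd_hi H (x + th * B).
  have := hM th; rewrite (ltW th0) th1 sth => /(_ isT) h3.
  have q0 : 0 <= (2^-1 : R) ^+ i by rewrite exprn_ge0// invr_ge0.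
  have h4 : 9 * 2^-1 ^+ i * c1 <= 36 * P%:R * 2^-1 ^+ i by nra.
  move: hc hc2; rewrite -(ler_nat R) => hc; rewrite -(ler_nat R) natrD => hc2.
  by lra.
rewrite big_split /= -mulr_sumr sumr_const_nat subn0.
have hs : \sum_(0 <= i < mm) (2^-1 : R) ^+ i <= 2.
  suff -> : \sum_(0 <= i < mm) (2^-1 : R) ^+ i = 2 - 2 * 2^-1 ^+ mm.
    by rewrite gerBl mulr_ge0// exprn_ge0// invr_ge0.
  elim: (mm) => [|m IH]; first by rewrite big_geq// expr0; lra.
  by rewrite big_nat_recr//= IH exprS; field.
have h5 : kk *+ 2 *+ mm = 2 * kk * mm%:R by rewrite -mulr_natl -mulr_natr; ring.
have := bd_km H; rewrite -[2 * kk *+ mm]mulr_natr => h6.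
have : 36 * P%:R * (\sum_(0 <= i < mm) (2^-1 : R) ^+ i) <= 36 * P%:R * 2.
  by rewrite ler_pM2l// mulr_gt0.
lra.
Qed.

Let dst j : nat := (j - kx + (kx - j))%N.

Lemma phi_near j : (j < n)%N -> (j <= kx + 2)%N -> (kx <= j + 2)%N -> x != block_zero j ->
  phi j <= P%:R * 146.
Proof.
move=> jn j1 j2 nx.
have /andP[xa xb] := bd_x H.
have P0 := bd_P H; have kP := bd_kP H; have k0 := bd_kk H; have P0' := Pp.
have /andP[w1 w2] := block_zero_itv jn.
have /andP[v1 v2] := u0_kx.
have i0 := block_idx jn P0.
have i1 : (j * P + P.-1 < size zs)%N by apply: block_idx => //; lia.
have zb : Z j P.-1 <= b by apply: (allP (bd_b H)); apply: mem_nth.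
have [wx|xw|wE] := ltgtP (block_zero j) x; last by rewrite wE eqxx in nx.
- have [za|az] := ltP (Z j 0) a.
    by apply: le_trans (phi_left jn za wx) _; rewrite mulr_ge0.
  rewrite /phi ger0_norm; last by lra.
  apply: (@near_sum _ (M x - M (block_zero j))) => //; try lra.
  - by rewrite subr_ge0; apply: (bd_mono H); exact: ltW.
  - have h1 := M_x_hi; have h2 := M_nth_lo i0.
    have h3 := bd_mono H w1.
    (* At most [3 * P] zeros lie between the start of the block and [x]; the counting errors fit
       into a fourth [P]. *)
    have := near_block_start_le v2 j2.
    rewrite -(ler_nat R) natrD natrM => h4.
    by rewrite /Z in h3; lra.
  - by move=> th th01; apply: (bd_s' H) => //; lra.
- rewrite /phi ltr0_norm; last by lra.
  rewrite opprB; apply: (@near_sum _ (M (block_zero j) - M x)) => //; try lra.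
  - by rewrite subr_ge0; apply: (bd_mono H); exact: ltW.
  - have h1 := M_x_lo; have h2 := M_nth_hi i1.
    have h3 := bd_mono H w2.
    have := near_block_end_le v1 j1 P0.
    rewrite -(ler_nat R) [(u0 + _)%:R]natrD natrM => h4.
    by rewrite /Z in h3; lra.
  - by move=> th th01; apply: (bd_s H) => //; lra.
Qed.

(** With [s = Num.sqrt (A / B)] the left side is the square of [(1 - s ^+ 2) / (2 * s)], and the
    hypothesis reads [(1 - s) * (i - 5 / 4) <= 5 / 2 * s]; the result is of order [1 / i ^+ 2], put
    in telescoping form. The offset 5 / 4 is one block for rounding to blocks and a quarter of a
    block for the counting error. *)
Lemma far_num (A B i : R) : 0 < A -> A <= B -> 3 <= i ->
  i - 5 / 4 <= Num.sqrt (A / B) * (i + 5 / 4) ->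
  (B - A) ^+ 2 / (4 * A * B) <= 1800 * ((i + 1)^-1 - (i + 2)^-1).
Proof.
move=> A0 AB i3.
have B0 : 0 < B by lra.
set s := Num.sqrt (A / B) => hs.
have s0 : 0 < s by rewrite sqrtr_gt0 divr_gt0.
have sE : A = s ^+ 2 * B by rewrite sqr_sqrtr ?divfK ?gt_eqF// divr_ge0//; lra.
have s1 : s <= 1 by rewrite -[leRHS]sqrtr1 ler_wsqrtr// ler_pdivrMr//; lra.
have -> : (B - A) ^+ 2 / (4 * A * B) = ((1 - s ^+ 2) / (2 * s)) ^+ 2.
  by rewrite sE; field; apply/andP; split; rewrite gt_eqF//; lra.
have h1 : (1 - s ^+ 2) / (2 * s) <= (5 / 2) / (i - 5 / 4).
  rewrite ler_pdivrMr; last by lra.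
  rewrite mulrAC ler_pdivlMr; last by lra.
  have : (1 - s) * (i - 5/4) <= (5 / 2) * s by nra.
  by nra.
have h0 : 0 <= (1 - s ^+ 2) / (2 * s) by rewrite divr_ge0//; nra.
apply: (@le_trans _ _ (((5 / 2) / (i - 5 / 4)) ^+ 2)).
  by rewrite ler_sqr ?nnegrE// divr_ge0; lra.
have -> : (i + 1)^-1 - (i + 2)^-1 = ((i + 1) * (i + 2))^-1.
  by field; apply/andP; split; rewrite gt_eqF//; lra.
rewrite expr_div_n ler_pdivrMr; last by rewrite exprn_gt0//; lra.
rewrite mulrAC ler_pdivlMr; last by rewrite mulr_gt0; lra.
by nra.
Qed.

(** Let [A] and [B] be the distances from [x] to the ends of the block. Regularity with [th = A / B]
    bounds the mass up to the start by [Num.sqrt (A / B)] times the mass up to the end; both masses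
    are those of [j - kx] blocks up to 5 / 4 of a block. Hence [A / B] is close to 1 and
    [ln_mean_le] is efficient. *)
Lemma phi_far_right j : (j < n)%N -> (kx + 3 <= j)%N ->
  phi j <= P%:R * (1800 * ((j%:R - kx%:R + 1)^-1 - (j%:R - kx%:R + 2)^-1)).
Proof.
move=> jn j1.
have /andP[xa xb] := bd_x H.
have P0 := bd_P H; have kP := bd_kP H; have k0 := bd_kk H; have P0' := Pp.
have /andP[v1 v2] := u0_kx.
have i0 := block_idx jn P0.
have i1 : (j * P + P.-1 < size zs)%N by apply: block_idx => //; lia.
have zb : Z j P.-1 <= b by apply: (allP (bd_b H)); apply: mem_nth.
have zx : x < Z j 0.
  by rewrite ltNge /Z nth_le_count// -leqNgt -/u0; nia.
have reg : (Z j 0 < a) = false by apply/negbTE; rewrite -leNgt; lra.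
have hD p : (p < P)%N -> Z j 0 - x <= Z j p - x <= Z j P.-1 - x.
  by move=> pP; rewrite !lerD2r; exact: Z_ends.
rewrite /phi /block_zero reg -normrN opprB.
have -> : (\sum_(0 <= p < P) Z j p) / P%:R - x = (\sum_(0 <= p < P) (Z j p - x)) / P%:R.
  by rewrite sumrB sumr_const_nat subn0 -[x *+ P]mulr_natr mulrBl mulfK// gt_eqF.
have sA : P%:R * (Z j 0 - x) <= \sum_(0 <= p < P) (Z j p - x).
  rewrite mulr_natl -[X in _ *+ X]subn0 -sumr_const_nat !big_nat; apply: ler_sum => p /andP[_ pP].
  by case/andP: (hD p pP).
have zx' : 0 < Z j 0 - x by lra.
rewrite ger0_norm; last first.
  by rewrite divr_ge0//; apply: le_trans sA; rewrite mulr_ge0//; lra.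
apply: le_trans (_ : _ <= P%:R * ln ((\sum_(0 <= p < P) (Z j p - x)) / P%:R) - \sum_(0 <= p < P) ln (Z j p - x)) _.
  rewrite lerD2l lerN2 !big_nat; apply: ler_sum => p /andP[_ pP].
  have /andP[h1 h2] := hD p pP.
  rewrite ler_ln ?posrE ?lt_max ?(bd_e H) ?orbT//; last by lra.
  by rewrite le_max -normrN opprB ler_norm.
apply: le_trans (ln_mean_le P0 zx' hD) _.
rewrite ler_pM2l//; apply: far_num => //.
- by rewrite lerD2r; case/andP: (Z_ends jn P0).
- by rewrite lerBrDr -natrD ler_nat addnC.
set A := Z j 0 - x in zx' *; set B := Z j P.-1 - x.
have AB : A <= B by rewrite lerD2r; case/andP: (Z_ends jn P0).
have th01 : 0 <= A / B <= 1.
  by rewrite divr_ge0 ?ler_pdivrMr ?mul1r//=; lra.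
have := @bd_r H (Z j P.-1) (A / B); rewrite -/B.
rewrite divfK; last by rewrite gt_eqF//; lra.
have -> : x + A = Z j 0 by rewrite /A; ring.
have xZ : x <= Z j P.-1 by rewrite /A /B in AB zx'; lra.
move=> /(_ xZ zb th01) h.
have s0 := sqrtr_ge0 (A / B).
have h1 := M_x_hi; have h2 := M_nth_lo i0.
have h3 := M_x_lo; have h4 := M_nth_hi i1.
rewrite -/(Z j 0) -/(Z j P.-1) in h2 h4.
have e1 : (j * P + 0)%:R - u0%:R >= (j%:R - kx%:R - 1) * P%:R :> R.
  move: v2; rewrite -(ler_nat R) -natr1 mulSn natrD natrM => v2.
  by rewrite addn0 natrM; lra.
have e2 : (j * P + P.-1)%:R - u0%:R <= (j%:R - kx%:R + 1) * P%:R :> R.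
  have : P.-1%:R <= P%:R :> R by rewrite ler_nat leq_pred.
  move: v1; rewrite -(ler_nat R) natrM => v1.
  by rewrite natrD natrM; lra.
set s := Num.sqrt _ in s0 h *.
set i := j%:R - kx%:R in e1 e2 *.
rewrite -(ler_pM2r P0').
have k1 : (i - 5 / 4) * P%:R <= M (Z j 0) - M x by lra.
have k2 : M (Z j P.-1) - M x <= (i + 5 / 4) * P%:R by lra.
apply: le_trans k1 _; apply: le_trans h _.
by rewrite -mulrA ler_wpM2l.
Qed.

Lemma phi_far_left j : (j < n)%N -> (j + 3 <= kx)%N -> x != block_zero j ->
  phi j <= P%:R * (1800 * ((kx%:R - j%:R + 1)^-1 - (kx%:R - j%:R + 2)^-1)).
Proof.
move=> jn j1 nx.
have /andP[xa xb] := bd_x H.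
have P0 := bd_P H; have kP := bd_kP H; have k0 := bd_kk H; have P0' := Pp.
have /andP[v1 v2] := u0_kx.
have i0 := block_idx jn P0.
have i1 : (j * P + P.-1 < size zs)%N by apply: block_idx => //; lia.
have i3 : 3 <= kx%:R - j%:R :> R by rewrite lerBrDr -natrD ler_nat addnC.
have zxl : Z j P.-1 <= x.
  by rewrite /Z nth_le_count// -/u0; nia.
have h1 := M_x_hi; have h2 := M_nth_lo i0.
have h3 := M_x_lo; have h4 := M_nth_hi i1.
rewrite -/(Z j 0) -/(Z j P.-1) in h2 h4.
have e1 : u0%:R - (j * P + P.-1)%:R >= (kx%:R - j%:R - 1) * P%:R :> R.
  have : P.-1%:R <= P%:R :> R by rewrite ler_nat leq_pred.
  move: v1; rewrite -(ler_nat R) natrM => v1.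
  by rewrite natrD natrM; lra.
have e2 : u0%:R - (j * P + 0)%:R <= (kx%:R - j%:R + 1) * P%:R :> R.
  move: v2; rewrite -(ler_nat R) -natr1 mulSn natrD natrM => v2.
  by rewrite addn0 natrM; lra.
set i := kx%:R - j%:R in i3 e1 e2 *.
have k1 : (i - 5 / 4) * P%:R <= M x - M (Z j P.-1) by lra.
have k2 : M x - M (Z j 0) <= (i + 5 / 4) * P%:R by lra.
have zx : Z j P.-1 < x.
  rewrite lt_neqAle zxl andbT; apply/eqP => zE.
  by move: k1; rewrite zE subrr => k1; nra.
have [za|az] := ltP (Z j 0) a.
  apply: (@le_trans _ _ 0).
    apply: phi_left => //; have /andP[_ w2] := block_zero_itv jn; exact: le_lt_trans zx.
  have ige0 : 0 <= i by apply: le_trans i3.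
  have p1 : 0 < i + 1 by apply: ltr_wpDl.
  have p2 : 0 < i + 2 by apply: ltr_wpDl.
  apply: mulr_ge0; first exact: ltW.
  apply: mulr_ge0; first exact: ler0n.
  by rewrite subr_ge0 lef_pV2 ?posrE// lerD2l ler1n.
have reg : (Z j 0 < a) = false by apply/negbTE; rewrite -leNgt.
have hD p : (p < P)%N -> x - Z j P.-1 <= x - Z j p <= x - Z j 0.
  by move=> pP; have /andP[? ?] := Z_ends jn pP; apply/andP; split; lra.
rewrite /phi /block_zero reg.
have -> : x - (\sum_(0 <= p < P) Z j p) / P%:R = (\sum_(0 <= p < P) (x - Z j p)) / P%:R.
  by rewrite sumrB sumr_const_nat subn0 -[x *+ P]mulr_natr mulrBl mulfK// gt_eqF.
have sA : P%:R * (x - Z j P.-1) <= \sum_(0 <= p < P) (x - Z j p).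
  rewrite mulr_natl -[X in _ *+ X]subn0 -sumr_const_nat !big_nat; apply: ler_sum => p /andP[_ pP].
  by case/andP: (hD p pP).
have zx' : 0 < x - Z j P.-1 by lra.
rewrite ger0_norm; last first.
  by rewrite divr_ge0//; apply: le_trans sA; rewrite mulr_ge0//; lra.
apply: le_trans (_ : _ <= P%:R * ln ((\sum_(0 <= p < P) (x - Z j p)) / P%:R) - \sum_(0 <= p < P) ln (x - Z j p)) _.
  rewrite lerD2l lerN2 !big_nat; apply: ler_sum => p /andP[_ pP].
  have /andP[g1 g2] := hD p pP.
  rewrite ler_ln ?posrE ?lt_max ?(bd_e H) ?orbT//; last by lra.
  by rewrite le_max ler_norm.
apply: le_trans (ln_mean_le P0 zx' hD) _.
have Zz : Z j 0 <= Z j P.-1 by case/andP: (Z_ends jn P0).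
rewrite ler_pM2l//; apply: far_num => //; first by lra.
set A := x - Z j P.-1 in zx' *; set B := x - Z j 0.
have AB : A <= B by rewrite /A /B; lra.
have th01 : 0 <= A / B <= 1.
  by rewrite divr_ge0 ?ler_pdivrMr ?mul1r//=; lra.
have := @bd_r' H (Z j 0) (A / B); rewrite -/B.
rewrite divfK; last by rewrite gt_eqF//; lra.
have -> : x - A = Z j P.-1 by rewrite /A; ring.
have xZ : Z j 0 <= x by lra.
move=> /(_ az xZ th01) h.
have s0 := sqrtr_ge0 (A / B).
set s := Num.sqrt _ in s0 h *.
rewrite -(ler_pM2r P0').
apply: le_trans k1 _; apply: le_trans h _.
by rewrite -mulrA ler_wpM2l.
Qed.

(** The costs are dominated by a telescoping series in the index distance to [kx], with sum at most
    1 on either side. The factor 1800 is [12 * 150]: for [q <= 2] the difference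
    [1 / ((q + 1) * (q + 2))] is at least 1 / 12, so that the near blocks with their 146 fit in. *)
Lemma phi_sum : (forall j, (j < n)%N -> x != block_zero j) ->
  \sum_(0 <= j < n) phi j <= P%:R * 3600.
Proof.
move=> nx; have P0' := Pp.
pose T (i : nat) : R := (i%:R + 1)^-1.
have hT (i : nat) : T i - T i.+1 = (i%:R + 1)^-1 - (i%:R + 2)^-1.
  by rewrite /T -natr1; congr (_ - _^-1); ring.
have T0 (i : nat) : 0 < T i by rewrite invr_gt0 addrC nat1r.
have hphi j : (j < n)%N -> phi j <= P%:R * 1800 * (T (dst j) - T (dst j).+1).
  move=> jn; rewrite hT -mulrA.
  have [h1|h1] := leqP (kx + 3) j.
    have -> : dst j = (j - kx)%N by rewrite /dst; lia.
    rewrite natrB; last by lia.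
    exact: phi_far_right.
  have [h2|h2] := leqP (j + 3) kx.
    have -> : dst j = (kx - j)%N by rewrite /dst; lia.
    rewrite natrB; last by lia.
    by apply: phi_far_left => //; exact: nx.
  apply: le_trans (phi_near jn _ _ (nx j jn)) _; [lia|lia|].
  rewrite ler_pM2l//.
  have d2 : (dst j <= 2)%N by rewrite /dst; lia.
  set q : R := (dst j)%:R.
  have q0 : 0 <= q by [].
  have q2 : q <= 2 by rewrite ler_nat.
  have -> : (q + 1)^-1 - (q + 2)^-1 = ((q + 1) * (q + 2))^-1.
    by field; apply/andP; split; rewrite gt_eqF//; lra.
  by rewrite ler_pdivlMr; [nra|rewrite mulr_gt0; lra].
apply: (@le_trans _ _ (\sum_(0 <= j < n) P%:R * 1800 * (T (dst j) - T (dst j).+1))).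
  by rewrite !big_nat; apply: ler_sum => j /andP[_ jn]; exact: hphi.
rewrite -mulr_sumr -mulrA ler_pM2l//.
have tel (m1 m2 : nat) : (m1 <= m2)%N -> \sum_(m1 <= i < m2) (T i - T i.+1) = T m1 - T m2.
  move=> h; rewrite -opprB -(telescope_sumr T h) -sumrN; apply: eq_bigr => i _.
  by rewrite opprB.
suff : \sum_(0 <= j < n) (T (dst j) - T (dst j).+1) <= 2 by lra.
have pos i : 0 <= T i - T i.+1.
  by rewrite hT subr_ge0 lef_pV2 ?posrE ?ltr_wpDl//; lra.
have up m : \sum_(0 <= j < m) (T (dst (kx + j)) - T (dst (kx + j)).+1) <= 1.
  rewrite (eq_bigr (fun i => T i - T i.+1)); last first.
    by move=> i _; have -> : dst (kx + i) = i by rewrite /dst; lia.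
  rewrite tel//; have := T0 m; rewrite {2}/T add0r invr1; lra.
have tl q m : \sum_(0 <= i < m) (T (q + i)%N - T (q + i.+1)%N) = T q - T (q + m)%N.
  elim: m => [|m IH]; first by rewrite big_geq// addn0 subrr.
  by rewrite big_nat_recr//= IH; ring.
have down m : (m <= kx)%N -> \sum_(0 <= j < m) (T (dst j) - T (dst j).+1) <= 1.
  move=> mk; rewrite big_nat_rev /= (eq_big_nat _ _ (F2 := fun i => T (kx - m + i.+1)%N - T (kx - m + i.+1).+1)); last first.
    by move=> i /andP[_ im]; have -> : dst (0 + m - i.+1) = (kx - m + i.+1)%N by rewrite /dst; lia.
  rewrite (eq_bigr (fun i => T ((kx - m).+1 + i)%N - T ((kx - m).+1 + i.+1)%N)); last first.
    by move=> i _; rewrite addnS addSn !addnS.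
  rewrite tl.
  have := T0 ((kx - m).+1 + m)%N; have : T (kx - m).+1 <= 1.
    by rewrite /T invf_le1 ?ltr_wpDl// lerDr.
  by lra.
have [nk|kn] := leqP n kx; first by have := down n nk; lra.
rewrite (big_cat_nat (leq0n _) (ltnW kn)) /=.
have := down kx (leqnn _); have := up (n - kx)%N.
have -> : \sum_(kx <= i < n) (T (dst i) - T (dst i).+1) =
    \sum_(0 <= j < n - kx) (T (dst (kx + j)) - T (dst (kx + j)).+1).
  by rewrite -{1}[kx]add0n big_addn; apply: eq_bigr => i _; rewrite addnC.
lra.
Qed.

End Discretization.

End Blocks.

(** * Polynomials with prescribed zeros *)

Section CoreUpper.
Variable R : realType.

Lemma ln_mean_ge (P : nat) (D : nat -> R) : (0 < P)%N ->
  (forall p, (p < P)%N -> 0 < D p) ->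
  \sum_(0 <= p < P) ln (D p) <= P%:R * ln ((\sum_(0 <= p < P) D p) / P%:R).
Proof.
move=> P0 hD.
have Pp : 0 < P%:R :> R by rewrite ltr0n.
have S0 : 0 < \sum_(0 <= p < P) D p.
  rewrite big_ltn//; apply: ltr_wpDr; last exact: hD.
  by rewrite big_nat; apply: sumr_ge0 => p /andP[_ pP]; apply/ltW/hD.
set m := _ / P%:R.
have m0 : 0 < m by rewrite divr_gt0.
have -> : P%:R * ln m = \sum_(0 <= p < P) ln m by rewrite sumr_const_nat subn0 mulr_natl.
rewrite -subr_le0 -sumrB.
apply: (@le_trans _ _ (\sum_(0 <= p < P) (D p / m - 1))).
  rewrite !big_nat; apply: ler_sum => p /andP[_ pP].
  have D0 := hD p pP.
  rewrite -ln_div ?posrE//.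
  have q0 : 0 < D p / m by rewrite divr_gt0.
  have := @le_ln1Dx R (D p / m - 1); rewrite (addrC 1) subrK; apply.
  by rewrite ltrBrDr addNr.
rewrite sumrB sumr_const_nat subn0 -mulr_suml /m invf_div mulrCA mulfV ?gt_eqF// mulr1.
by rewrite subrr.
Qed.

(** Finitely many strict inequalities, scaled by a large degree, absorb a fixed counting error. *)
Lemma uniform_gap (d : nat) (g : nat -> R) (kk : R) :
  (forall j, (j < d)%N -> 0 < g j) ->
  exists K0 : nat, forall K j, (K0 <= K)%N -> (j < d)%N -> kk <= K%:R * g j.
Proof.
elim: d => [|d IH] hg; first by exists 0%N.
have [|K0 h0] := IH; first by move=> j jd; apply: hg; exact: ltnW.
have gd := hg d (ltnSn d).
exists (maxn K0 (Num.truncn (`|kk| / g d)).+1) => K j; rewrite geq_max => /andP[k1 k2].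
rewrite ltnS leq_eqVlt => /orP[/eqP ->|jd]; last exact: h0.
apply: le_trans (ler_norm _) _; rewrite -ler_pdivrMr//.
apply: le_trans (ltW (truncnS_gt _)) _.
by rewrite ler_nat.
Qed.

Lemma pow4_unbounded (y : R) : exists m : nat, y <= 4 ^+ m.
Proof.
exists (Num.truncn y).+1; apply: le_trans (ltW (truncnS_gt _)) _.
elim: (Num.truncn y).+1 => [|m IH]; first by rewrite expr0.
rewrite exprS -natr1.
have : 1 <= (4 : R) ^+ m by rewrite exprn_ege1// ler1n.
lra.
Qed.

(** * The merged Chebyshev zeros of finitely many intervals *)

Section Components.
Variables (b a : R) (k n Kp : nat) (c : nat -> R).
Hypotheses (k0 : (0 < k)%N) (n0 : (0 < n)%N) (Kp0 : (0 < Kp)%N) (ab : a < b)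
  (hc : forall i, (i < k)%N -> 0 <= c i <= a).

(** Each of the [k] intervals contributes [n * Kp] zeros and a block has [k * Kp], so there are
    exactly [n] blocks whatever [Kp] is. *)
Let K := (n * Kp)%N.
Let P := (k * Kp)%N.
Let K0 : (0 < K)%N. Proof. by rewrite muln_gt0 n0. Qed.

Definition atoms := sort <=%R [seq arcnode b (c i) K l | i <- iota 0 k, l <- iota 0 K].

Definition massfun y := \sum_(0 <= i < k) K%:R * (arcang b (c i) y / (pi / 2)).

Lemma sum_atoms (h : R -> R) :
  \sum_(z <- atoms) h z = \sum_(0 <= i < k) \sum_(0 <= l < K) h (arcnode b (c i) K l).
Proof.
rewrite (perm_big [seq arcnode b (c i) K l | i <- iota 0 k, l <- iota 0 K]) /=; last first.
  by rewrite perm_sort.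
by rewrite big_allpairs_dep /index_iota !subn0.
Qed.

Lemma size_atoms : size atoms = (n * P)%N.
Proof. by rewrite size_sort size_allpairs !size_iota /K /P; lia. Qed.

Lemma count_atoms (p : pred R) :
  count p atoms = (\sum_(0 <= i < k) \sum_(0 <= l < K) nat_of_bool (p (arcnode b (c i) K l)))%N.
Proof.
rewrite -sum1_count big_mkcond (perm_big [seq arcnode b (c i) K l | i <- iota 0 k, l <- iota 0 K]) /=; last first.
  by rewrite perm_sort.
by rewrite big_allpairs_dep /index_iota !subn0.
Qed.

Let cb i : (i < k)%N -> c i < b.
Proof. by move=> /hc /andP[_ ?]; apply: le_lt_trans ab. Qed.

Lemma count_atoms_hi y : (count (fun z => z <= y) atoms)%:R <= massfun y + k%:R.
Proof.
rewrite count_atoms natr_sum /massfun -[k%:R]/(1 *+ k) -[in 1 *+ k](subn0 k) -sumr_const_nat -big_split /=.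
rewrite !big_nat; apply: ler_sum => i /andP[_ ik].
have := @arcnode_count R b (c i) y K (cb ik) K0.
by rewrite ler_norml => /andP[_]; lra.
Qed.

Lemma count_atoms_lo y : massfun y - 2 * k%:R <= (count (fun z => z < y) atoms)%:R.
Proof.
rewrite count_atoms natr_sum /massfun [2 * _]mulr_natr -[in 2 *+ k](subn0 k) -sumr_const_nat -sumrB /=.
rewrite !big_nat; apply: ler_sum => i /andP[_ ik].
have := @arcnode_count R b (c i) y K (cb ik) K0.
have := @arcnode_count_lt R b (c i) y K (cb ik) K0.
rewrite ler_norml -(ler_nat R) -natr1 => h1 /andP[h2 _].
lra.
Qed.

Lemma massfun_le y y' : y <= y' -> massfun y <= massfun y'.
Proof.
move=> yy; rewrite /massfun !big_nat; apply: ler_sum => i /andP[_ ik].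
rewrite ler_wpM2l// ler_pM2r ?invr_gt0 ?divr_gt0 ?pi_gt0//.
by apply: arcang_le => //; exact: cb.
Qed.

Lemma massfun_comb (y1 y2 y3 y4 s : R) :
  (forall i, (i < k)%N -> arcang b (c i) y1 - arcang b (c i) y2 <=
     s * (arcang b (c i) y3 - arcang b (c i) y4)) ->
  massfun y1 - massfun y2 <= s * (massfun y3 - massfun y4).
Proof.
move=> h; rewrite /massfun -!sumrB mulr_sumr !big_nat; apply: ler_sum => i /andP[_ ik].
have p0 : 0 <= K%:R / (pi / 2) :> R by rewrite divr_ge0// divr_ge0// pi_ge0.
have := ler_wpM2l p0 (h i ik); set u := K%:R / _; rewrite -/u.
by move=> h1; rewrite /u in h1 *; lra.
Qed.

Lemma atoms_mem z : z \in atoms -> exists2 i, (i < k)%N & exists2 l, (l < K)%N & z = arcnode b (c i) K l.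
Proof.
rewrite mem_sort => /allpairsP[[i l] /= []]; rewrite !mem_iota /= !add0n => ik lK ->.
by exists i => //; exists l.
Qed.

Lemma atoms_gt0 z : z \in atoms -> 0 < z.
Proof.
move=> /atoms_mem[i ik [l lK ->]]; apply: arcnode_gt0 => //.
by rewrite cb// andbT; case/andP: (hc ik).
Qed.

Lemma atoms_block (x e : R) (mm : nat) : a <= x <= b -> 0 < e -> b - a <= 4 ^+ mm * e ->
  (16 <= Kp)%N -> (4 * mm <= Kp)%N ->
  block_data massfun atoms n P (2 * k%:R) a b e x mm.
Proof.
move=> xab e0 mme K16 Kmm; have /andP[xa xb] := xab.
have kp : 0 < k%:R :> R by rewrite ltr0n.
have PE : P%:R = k%:R * Kp%:R :> R by rewrite natrM.
split=> //.
- exact: (sort_sorted (@le_total _ R)).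
- exact: size_atoms.
- by rewrite muln_gt0 k0.
- exact: count_atoms_lo.
- by move=> y; apply: le_trans (count_atoms_hi y) _; rewrite lerD2l; lra.
- exact: massfun_le.
- have : 16 <= Kp%:R :> R by rewrite ler_nat.
  by rewrite PE; nra.
- have : 4 * mm%:R <= Kp%:R :> R by rewrite -natrM ler_nat.
  by rewrite PE; nra.
- apply/allP => z /atoms_mem[i ik [l lK ->]].
  by case/andP: (@arcnode_itv R b (c i) K l (cb ik)).
- move=> y th xy yb th01; apply: massfun_comb => i ik; apply: arcang_ratio => //; first exact: cb.
  by case/andP: (hc ik) => _ h; apply: le_trans xa.
- move=> y th xy yb th01; apply: massfun_comb => i ik; apply: arcang_ratio_left => //; first exact: cb.
  by case/andP: (hc ik) => _ h; apply: le_trans xy.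
- move=> y th xy yb th01; apply: massfun_comb => i ik; apply: arcang_spread => //; first exact: cb.
  by case/andP: (hc ik) => _ h; apply: le_trans xa.
- move=> y th xy yb th01; apply: massfun_comb => i ik; apply: arcang_spread_left => //; first exact: cb.
  by case/andP: (hc ik) => _ h; apply: le_trans xy.
Qed.

Lemma sum_ln_atoms : \sum_(0 <= i < k) (K%:R * ln ((b - c i) / 4) + K%:R * gam b (c i)) <=
  \sum_(z <- atoms) ln z.
Proof.
rewrite sum_atoms !big_nat; apply: ler_sum => i /andP[_ ik].
have ci : 0 <= c i < b by rewrite cb// andbT; case/andP: (hc ik).
have bc : 0 < (b - c i) / 4 by have := cb ik; lra.
have -> : \sum_(0 <= l < K) ln (arcnode b (c i) K l) = ln (\prod_(0 <= l < K) arcnode b (c i) K l).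
  rewrite big_seq [in RHS]big_seq.
  suff [] : \sum_(l <- index_iota 0 K | l \in index_iota 0 K) ln (arcnode b (c i) K l) =
    ln (\prod_(l <- index_iota 0 K | l \in index_iota 0 K) arcnode b (c i) K l) /\
    0 < (\prod_(l <- index_iota 0 K | l \in index_iota 0 K) arcnode b (c i) K l) by [].
  elim/big_rec2: _ => [|l y1 y2]; first by rewrite ln1.
  rewrite mem_index_iota /= => lK [-> y20].
  have h := arcnode_gt0 ci lK.
  by rewrite lnM ?posrE// mulr_gt0.
have h := arcnode_prod0 ci K0.
have p1 : 0 < ((b - c i) / 4) ^+ K * expR (gam b (c i)) ^+ K.
  by rewrite mulr_gt0// exprn_gt0// expR_gt0.
apply: le_trans (_ : _ <= ln (((b - c i) / 4) ^+ K * expR (gam b (c i)) ^+ K)) _; last first.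
  by rewrite ler_ln// posrE// (lt_le_trans p1).
rewrite [ln (_ ^+ K * _)]lnM ?posrE ?exprn_gt0 ?expR_gt0// !lnXn ?expR_gt0// expRK.
by rewrite -[ln _ *+ K]mulr_natl -[gam _ _ *+ K]mulr_natl.
Qed.

Lemma sum_ln_max_atoms (x d e : R) : a <= x <= b -> 0 < e ->
  (forall b c x K, c < b -> c <= x <= b -> (0 < K)%N ->
    \prod_(0 <= k < K) Num.max `|x - arcnode b c K k| (e * (b - c)) <=
    2 * ((b - c) / 4) ^+ K * expR d ^+ K) ->
  \sum_(z <- atoms) ln (Num.max `|x - z| (e * (b - a))) <=
  \sum_(0 <= i < k) (1 + K%:R * ln ((b - c i) / 4) + K%:R * d).
Proof.
move=> /andP[ax xb] e0 H.
rewrite sum_atoms !big_nat; apply: ler_sum => i /andP[_ ik].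
have /andP[c0 ca] := hc ik.
have bc : 0 < (b - c i) / 4 by have := cb ik; lra.
have eb : 0 < e * (b - a) by rewrite mulr_gt0// subr_gt0.
have ebc : 0 < e * (b - c i) by rewrite mulr_gt0// subr_gt0 cb.
(* One truncation length serves all components because [b - a] is at most every [b - c i]. *)
apply: (@le_trans _ _ (\sum_(0 <= l < K) ln (Num.max `|x - arcnode b (c i) K l| (e * (b - c i))))).
  apply: ler_sum => l _; rewrite ler_ln ?posrE ?lt_max ?eb ?ebc ?orbT//.
  rewrite ge_max !le_max lexx /= ler_pM2l// lerD2l lerN2 ca orbT //.
have -> : \sum_(0 <= l < K) ln (Num.max `|x - arcnode b (c i) K l| (e * (b - c i))) =
   ln (\prod_(0 <= l < K) (Num.max `|x - arcnode b (c i) K l| (e * (b - c i)))).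
  suff [] : \sum_(0 <= l < K) ln (Num.max `|x - arcnode b (c i) K l| (e * (b - c i))) =
    ln (\prod_(0 <= l < K) (Num.max `|x - arcnode b (c i) K l| (e * (b - c i)))) /\
    0 < (\prod_(0 <= l < K) (Num.max `|x - arcnode b (c i) K l| (e * (b - c i)))) by [].
  elim/big_rec2: _ => [|l y1 y2 _]; first by rewrite ln1.
  move=> [-> y20].
  have h : 0 < Num.max `|x - arcnode b (c i) K l| (e * (b - c i)) by rewrite lt_max ebc orbT.
  by rewrite lnM ?posrE// mulr_gt0.
have xci : c i <= x <= b by rewrite xb andbT; apply: le_trans ax.
have := H b (c i) x K (cb ik) xci K0.
set p := \prod_(0 <= l < K) _ => hp.
have p0 : 0 < p by apply: prodr_gt0 => l _; rewrite lt_max ebc orbT.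
apply: le_trans (_ : _ <= ln (2 * ((b - c i) / 4) ^+ K * expR d ^+ K)) _.
  by rewrite ler_ln// posrE// (lt_le_trans p0).
rewrite [ln (_ * expR d ^+ K)]lnM ?posrE ?mulr_gt0 ?exprn_gt0 ?expR_gt0//.
rewrite [ln (2 * _)]lnM ?posrE ?mulr_gt0 ?exprn_gt0 ?expR_gt0// !lnXn ?expR_gt0// expRK.
rewrite -[ln (_ / 4) *+ K]mulr_natl -[d *+ K]mulr_natl !lerD2r.
by have := @le_ln1Dx R 1; rewrite -[1 + 1]/(2%:R) => -> //; lra.
Qed.

End Components.

Lemma horner_zero_prod (n : nat) (w : nat -> R) (x : R) :
  (\prod_(0 <= j < n) (1 - (w j)^-1 *: 'X)).[x] = \prod_(0 <= j < n) (1 - x / w j).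
Proof.
rewrite horner_prod; apply: eq_bigr => j _.
by rewrite hornerD hornerN hornerZ hornerX hornerC mulrC.
Qed.

Lemma size_zero_prod (n : nat) (w : nat -> R) :
  (size (\prod_(0 <= j < n) (1 - (w j)^-1 *: 'X) : {poly R})%R <= n.+1)%N.
Proof.
elim: n => [|n IH]; first by rewrite big_geq// size_poly1.
rewrite big_nat_recr//=; apply: leq_trans (size_polyMleq _ _) _.
have : (size (1 - (w n)^-1 *: 'X : {poly R})%R <= 2)%N.
  apply: leq_trans (size_polyD _ _) _; rewrite geq_max size_poly1 size_polyN.
  by apply: leq_trans (size_scale_leq _ _) _; rewrite size_polyX.
by move=> h; move: IH h; set u := size _; set v := size _; lia.
Qed.

(** The strict counting condition puts the right end of the block [j] to the left of [lam j], for
    [j < d]. The constant is [3600 + 1 + 1]: the block costs, the factor 2 of each Chebyshev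
    polynomial (in all at most [k <= P]), and the ellipses of parameter [expR n^-1] ([Kp] per
    interval, [P] in all), each divided by [P]. *)
Theorem constrained_poly_exists : exists C : R,
  forall (b a : R) (k n d : nat) (c lam : nat -> R),
  (0 < k)%N -> (0 < n)%N -> a < b -> (d <= n)%N ->
  (forall i, (i < k)%N -> 0 <= c i <= a) ->
  (forall j, (j < d)%N -> lam j < a /\
     j.+1%:R < n%:R / k%:R * \sum_(0 <= i < k) (arcang b (c i) (lam j) / (pi / 2))) ->
  exists q : {poly R},
    [/\ (size q <= n.+1)%N, q.[0] = 1, forall j, (j < d)%N -> 0 < lam j /\ q.[lam j] = 0 &
      forall x, a <= x <= b ->
        `|q.[x]| <= expR (C - n%:R / k%:R * \sum_(0 <= i < k) gam b (c i))].
Proof.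
exists 3602 => b a k n d c lam k0 n0 ab dn hc hlam.
have np : 0 < n%:R :> R by rewrite ltr0n.
have kp : 0 < k%:R :> R by rewrite ltr0n.
have dl : 0 < n%:R^-1 :> R by rewrite invr_gt0.
have [e0 e0p he0] := @arcnode_prod_max R n%:R^-1 dl.
set e := e0 * (b - a).
have ep : 0 < e by rewrite mulr_gt0// subr_gt0.
have [mm hmm] := pow4_unbounded ((b - a) / e).
have {}hmm : b - a <= 4 ^+ mm * e by rewrite -ler_pdivrMr.
(* The slack of the counting condition, multiplied by [k]; times [Kp] it has to exceed the counting
   error [2 * k]. *)
pose g j := n%:R * (\sum_(0 <= i < k) (arcang b (c i) (lam j) / (pi / 2))) - j.+1%:R * k%:R.
have [|Kp1 hKp1] := @uniform_gap d g (2 * k%:R).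
  move=> j jd; have [_] := hlam j jd.
  by rewrite mulrAC ltr_pdivlMr// /g subr_gt0.
set Kp := maxn Kp1 (maxn 16 (4 * mm)).
have Kp16 : (16 <= Kp)%N by rewrite /Kp !leq_max leqnn orbT.
have Kpmm : (4 * mm <= Kp)%N by rewrite /Kp !leq_max leqnn !orbT.
have Kp0 : (0 < Kp)%N by apply: leq_trans Kp16.
have Kpp : 0 < Kp%:R :> R by rewrite ltr0n.
pose zs := atoms b k n Kp c.
pose P := (k * Kp)%N.
pose M := massfun b k n Kp c.
have PE : P%:R = k%:R * Kp%:R :> R by rewrite natrM.
have P0 : (0 < P)%N by rewrite muln_gt0 k0.
have Pp : 0 < P%:R :> R by rewrite ltr0n.
have BD x (hx : a <= x <= b) := @atoms_block b a k n Kp c k0 n0 Kp0 ab hc x e mm hx ep hmm Kp16 Kpmm.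
have aab : a <= a <= b by rewrite lexx ltW.
have BDa := BD a aab.
pose w j := block_zero zs P a j.
pose Z j p := nth 0 zs (j * P + p).
have zpos j p : (j < n)%N -> (p < P)%N -> 0 < Z j p.
  move=> jn pP; apply: (@atoms_gt0 b a k n Kp c) => //.
  by apply: mem_nth; apply: (block_idx BDa).
have wlam j : (j < d)%N -> Z j 0 < a /\ w j <= lam j.
  move=> jd; have jn : (j < n)%N by apply: leq_trans dn.
  have [la hl] := hlam j jd.
  have i1 : (j * P + P.-1 < size zs)%N by apply: (block_idx BDa) => //; rewrite prednK.
  have zl : Z j P.-1 <= lam j.
    rewrite /Z (nth_le_count BDa)// -(ltr_nat R).
    have h1 := bd_lo BDa (lam j).
    have h2 : (count (fun z => (z < lam j)%R) zs <= count (fun z => (z <= lam j)%R) zs)%N.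
      by apply: sub_count => z /= /ltW.
    rewrite -(ler_nat R) in h2.
    have h3 := hKp1 Kp j (leq_maxl _ _) jd.
    have h4 : M (lam j) = n%:R * Kp%:R * \sum_(0 <= i < k) (arcang b (c i) (lam j) / (pi / 2)).
      by rewrite /M /massfun natrM mulr_sumr.
    (* The last zero of the block [j] has index [j.+1 * P - 1], whence [j.+1] in the counting
       condition. *)
    have h5 : (j * P + P.-1)%:R + 1 = j.+1%:R * k%:R * Kp%:R :> R.
      by rewrite natr1 -addnS prednK// -mulrA -PE -mulSnr natrM.
    rewrite /g in h3.
    have h6 : Kp%:R * (n%:R * \sum_(0 <= i < k) (arcang b (c i) (lam j) / (pi / 2)) - j.+1%:R * k%:R) =
      M (lam j) - ((j * P + P.-1)%:R + 1) by rewrite h4 h5; ring.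
    rewrite h6 in h3; rewrite -/M in h1.
    lra.
  have za : Z j 0 < a.
    apply: le_lt_trans la; apply: le_trans zl.
    by case/andP: (Z_ends BDa jn P0).
  by split=> //; rewrite /w /block_zero -/(Z j 0) za.
have wpos j : (j < n)%N -> 0 < w j.
  move=> jn; have /andP[h _] := block_zero_itv BDa jn.
  by apply: lt_le_trans h; apply: zpos.
have lampos j : (j < d)%N -> 0 < lam j.
  move=> jd; have [_ h] := wlam j jd; apply: lt_le_trans h; apply: wpos.
  exact: leq_trans dn.
pose w' j := if (j < d)%N then lam j else w j.
have w'pos j : (j < n)%N -> 0 < w' j.
  by rewrite /w'; case: ifP => [/lampos//|_]; exact: wpos.
(* At 0 nothing is lost: a right end is the largest zero of its block, and for a mean the logarithm
   is concave. *)
have lnw j : (j < n)%N -> \sum_(0 <= p < P) ln (Z j p) <= P%:R * ln (w j).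
  move=> jn; rewrite /w /block_zero -/(Z j 0); case: ifP => _.
    rewrite -/(Z j P.-1); have -> : P%:R * ln (Z j P.-1) = \sum_(0 <= p < P) ln (Z j P.-1).
      by rewrite sumr_const_nat subn0 mulr_natl.
    rewrite !big_nat; apply: ler_sum => p /andP[_ pP].
    have /andP[_ h] := Z_ends BDa jn pP.
    by rewrite ler_ln ?posrE ?zpos// prednK.
  by apply: ln_mean_ge => // p pP; apply: zpos.
exists (\prod_(0 <= j < n) (1 - (w' j)^-1 *: 'X)); split.
- exact: size_zero_prod.
- by rewrite horner_zero_prod big1// => j _; rewrite mul0r subr0.
- move=> j jd; split; first exact: lampos.
  rewrite horner_zero_prod (bigD1_seq j) ?iota_uniq//=; last first.
    by rewrite mem_index_iota /=; apply: leq_trans dn.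
  by rewrite /w' jd divff ?gt_eqF ?lampos// subrr mul0r.
move=> x xab; have /andP[ax xb] := xab.
have bd := BD x xab.
rewrite horner_zero_prod.
have [->|q0] := eqVneq (\prod_(0 <= j < n) (1 - x / w' j)) 0.
  by rewrite normr0 expR_ge0.
have f0 j : (j < n)%N -> 1 - x / w' j != 0.
  move=> jn; apply: contra q0 => /eqP e1.
  by rewrite (bigD1_seq j) ?iota_uniq ?mem_index_iota//= e1 mul0r.
have nx j : (j < n)%N -> x != w j.
  move=> jn; have [jd|dj] := ltnP j d.
    have [za h] := wlam j jd; have [la _] := hlam j jd.
    by rewrite gt_eqF//; lra.
  have := f0 j jn; rewrite /w' ltnNge dj /=; apply: contra => /eqP ->.
  by rewrite divff ?subrr// gt_eqF// wpos.
rewrite normr_prod.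
have np0 : 0 < \prod_(0 <= j < n) `|1 - x / w' j|.
  by rewrite -normr_prod normr_gt0.
rewrite -[leLHS]lnK ?posrE// ler_expR.
have -> : ln (\prod_(0 <= j < n) `|1 - x / w' j|) = \sum_(0 <= j < n) ln `|1 - x / w' j|.
  rewrite big_seq [in RHS]big_seq.
  suff [] : ln (\prod_(j <- index_iota 0 n | j \in index_iota 0 n) `|1 - x / w' j|) =
     \sum_(j <- index_iota 0 n | j \in index_iota 0 n) ln `|1 - x / w' j| /\
     0 < \prod_(j <- index_iota 0 n | j \in index_iota 0 n) `|1 - x / w' j| by [].
  elim/big_rec2: _ => [|j y1 y2]; first by rewrite ln1.
  rewrite mem_index_iota /= => jn [<- y20].
  have h : 0 < `|1 - x / w' j| by rewrite normr_gt0 f0.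
  by rewrite lnM ?posrE// mulr_gt0.
have h1 : \sum_(0 <= j < n) ln `|1 - x / w' j| <= \sum_(0 <= j < n) (ln `|x - w j| - ln (w j)).
  rewrite !big_nat; apply: ler_sum => j /andP[_ jn].
  have wj := wpos j jn.
  have xw : 0 < `|x - w j| by rewrite normr_gt0 subr_eq0 nx.
  rewrite -ln_div ?posrE//.
  have wE : `|1 - x / w j| = `|x - w j| / w j.
    have -> : 1 - x / w j = - ((x - w j) / w j) by field; rewrite gt_eqF.
    by rewrite normrN normf_div [`|w j|]gtr0_norm.
  have g0 : 0 < `|1 - x / w j| by rewrite wE divr_gt0.
  rewrite -wE.
  rewrite ler_ln ?posrE ?normr_gt0 ?f0//; last first.
    by rewrite -normr_gt0.
  rewrite /w'; case: ifP => // jd.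
  have [za wl] := wlam j jd; have [la _] := hlam j jd; have lp := lampos j jd.
  have x1 : 1 <= x / lam j by rewrite ler_pdivlMr// mul1r; lra.
  have x2 : x / lam j <= x / w j.
    by rewrite ler_pM2l ?lef_pV2 ?posrE//; lra.
  by clear -x1 x2; rewrite !ler0_norm; lra.
apply: le_trans h1 _.
have h2 : P%:R * \sum_(0 <= j < n) (ln `|x - w j| - ln (w j)) <=
  P%:R * 3600 + \sum_(z <- zs) ln (Num.max `|x - z| e) - \sum_(z <- zs) ln z.
  have hs := phi_sum bd nx; rewrite sumrB in hs.
  have e1 : \sum_(z <- zs) ln (Num.max `|x - z| e) =
    \sum_(0 <= j < n) \sum_(0 <= p < P) ln (Num.max `|x - Z j p| e).
    by rewrite (sum_blocks (fun l => ln (Num.max `|x - nth 0 zs l| e))) (big_nth 0) (bd_size bd).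
  have e2 : \sum_(z <- zs) ln z = \sum_(0 <= j < n) \sum_(0 <= p < P) ln (Z j p).
    by rewrite (sum_blocks (fun l => ln (nth 0 zs l))) (big_nth 0) (bd_size bd).
  have h3 : \sum_(0 <= j < n) \sum_(0 <= p < P) ln (Z j p) <= P%:R * \sum_(0 <= j < n) ln (w j).
    by rewrite mulr_sumr !big_nat; apply: ler_sum => j /andP[_ jn]; apply: lnw.
  rewrite -e1 in hs; rewrite -e2 in h3.
  rewrite sumrB mulrBr [P%:R * \sum_(0 <= j < n) ln `|_|]mulr_sumr.
  by move: hs h3; rewrite -/w; lra.
have h4 := @sum_ln_max_atoms b a k n Kp c n0 Kp0 ab hc x _ e0 xab e0p he0.
have h5 := @sum_ln_atoms b a k n Kp c n0 Kp0 ab hc.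
rewrite -(ler_pM2l Pp); apply: le_trans h2 _.
have e3 : \sum_(0 <= i < k) (1 + (n * Kp)%:R * ln ((b - c i) / 4) + (n * Kp)%:R * n%:R^-1) =
  k%:R + (n * Kp)%:R * \sum_(0 <= i < k) ln ((b - c i) / 4) + k%:R * Kp%:R.
  rewrite !big_split /= -mulr_sumr !sumr_const_nat subn0; congr (_ + _ + _).
  by rewrite -mulr_natl natrM; field; rewrite gt_eqF.
have e4 : \sum_(0 <= i < k) ((n * Kp)%:R * ln ((b - c i) / 4) + (n * Kp)%:R * gam b (c i)) =
  (n * Kp)%:R * \sum_(0 <= i < k) ln ((b - c i) / 4) + (n * Kp)%:R * \sum_(0 <= i < k) gam b (c i).
  by rewrite big_split /= -!mulr_sumr.
rewrite e3 in h4; rewrite e4 in h5.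
have -> : P%:R * (3602 - n%:R / k%:R * \sum_(0 <= i < k) gam b (c i)) =
  P%:R * 3602 - (n * Kp)%:R * \sum_(0 <= i < k) gam b (c i).
  by rewrite mulrBr PE natrM; congr (_ - _); field; rewrite gt_eqF.
have kP : k%:R <= P%:R :> R by rewrite ler_nat leq_pmulr.
rewrite -PE in h4.
rewrite -/zs -/e in h4 h5.
lra.
Qed.

End CoreUpper.

(** * Integrals over open intervals *)

Section RealMeasurability.
Variable R : realType.

Lemma measurable_invr : measurable_fun [set: R] (fun x : R => x^-1).
Proof.
rewrite (_ : (fun x => x^-1) = (fun x : R => if 0 < x then x `^ (-1) else 0 - ((- x) `^ (-1)))).
  apply: measurable_fun_ifT.
  - by apply: measurable_fun_ltr => //; exact: measurable_id.
  - exact: measurable_powR.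
  - apply: measurable_funB; first exact: measurable_cst.
    have h := measurableT_comp (@measurable_powR R (-1)) (@oppr_measurable R setT).
    exact: h.
apply/funext => x; case: ltP => h; first by rewrite powR_inv1// ltW.
by rewrite powR_inv1 ?oppr_ge0// invrN opprK add0r.
Qed.

Lemma measurable_sqrtr : measurable_fun [set: R] (@Num.sqrt R).
Proof. by apply: continuous_measurable_fun; exact: sqrt_continuous. Qed.

Lemma measurable_fun_invr d (T : measurableType d) (D : set T) (f : T -> R) :
  measurable_fun D f -> measurable_fun D (fun x => (f x)^-1).
Proof. by move=> mf; apply: (measurableT_comp measurable_invr). Qed.

Lemma measurable_fun_sqrtr d (T : measurableType d) (D : set T) (f : T -> R) :
  measurable_fun D f -> measurable_fun D (fun x => Num.sqrt (f x)).
Proof. by move=> mf; apply: (measurableT_comp measurable_sqrtr). Qed.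

Local Notation mu := (@lebesgue_measure R).

(** The integrands to come are singular at the endpoints. The theorem for compact intervals is
    applied to [[u + d n, v - d n]] and monotone convergence gives the limit, so finiteness of the
    integral is part of the conclusion. *)
Lemma FTC_oo (f F : R -> R) (u v : R) : u < v ->
  {within `[u, v], continuous F} ->
  (forall x, x \in `]u, v[ -> is_derive x 1 F (f x)) ->
  {in `]u, v[, continuous f} -> (forall x, x \in `]u, v[ -> 0 <= f x) ->
  (\int[mu]_(x in `]u, v[) (f x)%:E = (F v - F u)%:E)%E.
Proof.
move=> uv cF dF cf f0.
pose d (n : nat) : R := (v - u) / 2 / n.+2%:R.
have d0 n : 0 < d n by rewrite !divr_gt0 ?subr_gt0 ?ltr0n.
have dlt n : d n < (v - u) / 2.
  by rewrite ltr_pdivrMr ?ltr0n// ltr_pMr ?ltr1n// divr_gt0// subr_gt0.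
have dec n m : (n <= m)%N -> d m <= d n.
  move=> nm; rewrite ler_pM2l ?divr_gt0 ?subr_gt0//.
  by rewrite lef_pV2 ?posrE ?ltr0n// ler_nat !ltnS.
pose S n : set R := `[u + d n, v - d n]%classic.
have SE : \bigcup_n S n = `]u, v[%classic.
  apply/seteqP; split => x.
    move=> [n _]; rewrite /S /= !in_itv /= => /andP[h1 h2].
    by have := d0 n; move=> ?; apply/andP; split; lra.
  rewrite /= in_itv /= => /andP[ux xv].
  pose e := Num.min (x - u) (v - x).
  have e0 : 0 < e by rewrite lt_min !subr_gt0 ux.
  exists (Num.truncn ((v - u) / 2 / e)) => //.
  have : d (Num.truncn ((v - u) / 2 / e)) <= e.
    rewrite /d ler_pdivrMr ?ltr0n// [e * _]mulrC -ler_pdivrMr//.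
    apply: le_trans (ltW (truncnS_gt _)) _; by rewrite ler_nat.
  rewrite /S /= in_itv /= /e le_min => /andP[h1 h2].
  by apply/andP; split; lra.
have mS n : measurable (S n) by exact: measurable_itv.
have Ssub n x : S n x -> u < x < v.
  rewrite /S /= in_itv /= => /andP[h1 h2]; have := d0 n => ?.
  by apply/andP; split; lra.
have mf n : measurable_fun (S n) (fun x => (f x)%:E).
  apply/measurable_EFinP; apply: (@measurable_funS _ _ _ _ `]u, v[%classic) => //.
    by move=> x /Ssub; rewrite /= in_itv.
  apply: open_continuous_measurable_fun => //.
  by move=> x; rewrite inE => /cf.
have ndS : nondecreasing_seq S.
  move=> n m nm; apply/subsetPset => x; rewrite /S /= !in_itv /= => /andP[h1 h2].
  by have := dec _ _ nm => ?; apply/andP; split; lra.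
have f0' n x : S n x -> (0 <= (f x)%:E)%E.
  by move=> /Ssub h; rewrite lee_fin f0// in_itv.
have := @ge0_nondecreasing_set_cvg_integral _ (measurableTypeR R) R S (fun x => (f x)%:E) (@lebesgue_measure R) ndS mS mf f0'.
rewrite SE.
have -> : (fun n => (\int[mu]_(x in S n) (f x)%:E)%E) = (fun n => (F (v - d n) - F (u + d n))%:E).
  apply/funext => n; have dn := d0 n; have dl := dlt n.
  have lt : u + d n < v - d n by lra.
  have sub x : x \in `[u + d n, v - d n] -> x \in `]u, v[.
    by rewrite !in_itv /= => /andP[h1 h2]; apply/andP; split; lra.
  have cFx x : x \in `[u + d n, v - d n] -> {for x, continuous F}.
    move=> /sub /dF h; apply: differentiable_continuous; apply/derivable1_diffP.
    exact: (@ex_derive _ _ _ _ _ _ _ h).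
  rewrite (@continuous_FTC2 _ f F)//.
  - apply: continuous_in_subspaceT => x; rewrite inE => /sub; exact: cf.
  - split.
    + move=> x h; have /dF : x \in `]u, v[ by apply: sub; move: h; apply: subset_itv_oo_cc.
      by move=> h'; exact: (@ex_derive _ _ _ _ _ _ _ h').
    + by apply: cvg_at_right_filter; apply: cFx; rewrite in_itv /= lexx ltW.
    + by apply: cvg_at_left_filter; apply: cFx; rewrite in_itv /= lexx ltW.
  - move=> x h; have /dF h' : x \in `]u, v[ by apply: sub; move: h; apply: subset_itv_oo_cc.
    by rewrite derive1E; exact: (@derive_val _ _ _ _ _ _ _ h').
move=> h1.
have d_cvg : d @ \oo --> (0 : R).
  rewrite -[X in _ --> X](mulr0 ((v - u) / 2)); apply: cvgMr.
  have := @cvg_harmonic R; rewrite -(@cvg_shiftS _ (@harmonic R)); exact.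
have [cFo cFu cFv] := (continuous_within_itvP F uv).1 cF.
have h2 : (F (v - d n) - F (u + d n)) @[n --> \oo] --> F v - F u.
  apply: cvgB.
  - apply: (cvg_at_leftP F v (F v)).1 => //; split=> //.
      by move=> n; rewrite ltrBlDr ltrDl.
    by rewrite -[X in _ --> X]subr0; apply: cvgB => //; exact: cvg_cst.
  - apply: (cvg_at_rightP F u (F u)).1 => //; split=> //.
      by move=> n; rewrite ltrDl.
    by rewrite -[X in _ --> X]addr0; apply: cvgD => //; exact: cvg_cst.
have h3 : (F (v - d n) - F (u + d n))%:E @[n --> \oo] --> (F v - F u)%:E.
  by apply: cvg_EFin => //; exact: nearW.
exact: (cvg_unique (@ereal_hausdorff R) h1 h3).
Qed.

End RealMeasurability.

(** * Densities, dilations and comparison of integrals *)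

Section Measure.
Variable R : realType.
Local Notation mu := (@lebesgue_measure R).
Local Notation measR := {finite_measure set (measurableTypeR R) -> \bar R}.

(** The density and the Radon-Nikodym derivative have the same integral over every measurable set,
    hence agree almost everywhere. *)
Lemma density_integral (sigma : measR) (f : R -> R) (D : set (measurableTypeR R)) (g : R -> R) :
  has_density sigma f -> measurable D -> measurable_fun setT g -> (forall x, 0 <= g x) ->
  (\int[sigma]_(x in D) (g x)%:E = \int[mu]_(x in D) (g x * f x)%:E)%E.
Proof.
move=> [f0 mf sE] mD mg g0.
have numu : sigma `<< mu.
  apply/null_content_dominatesP => A mA A0.
  by rewrite sE// null_set_integral//; apply/measurable_EFinP; exact: measurable_funTS.
rewrite -(@Radon_Nikodym_SigmaFinite.change_of_variables _ _ _ sigma mu numu (EFin \o g) D)//=; last first.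
  by apply/measurable_EFinP; apply: measurable_funTS.
set rn := Radon_Nikodym_SigmaFinite.f _ _.
have mrn : measurable_fun setT rn by exact: measurable_int (Radon_Nikodym_SigmaFinite.f_integrable numu).
have mEf : measurable_fun setT (EFin \o f) by apply/measurable_EFinP.
have ae : ae_eq mu setT rn (EFin \o f).
  apply: integral_ae_eq => //.
    exact: (Radon_Nikodym_SigmaFinite.f_integrable numu).
  by move=> E _ mE; rewrite -sE// (Radon_Nikodym_SigmaFinite.f_integral numu mE).
apply: ae_eq_integral => //.
- apply: emeasurable_funM; last exact: measurable_funTS.
  by apply/measurable_EFinP; apply: measurable_funTS.
- by apply/measurable_EFinP; apply: measurable_funTS; exact: measurable_funM.
- apply: filterS ae => x h _ ; rewrite EFinM; congr (_ * _)%E; exact: h.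
Qed.

(** The push-forward of Lebesgue measure under the dilation about [a], multiplied by [r], agrees
    with Lebesgue measure on half-open intervals; uniqueness does the rest. *)
Lemma lebesgue_scale (a r : R) (D : set (measurableTypeR R)) (g : R -> R) : 0 < r ->
  measurable D -> measurable_fun setT g -> (forall x, 0 <= g x) ->
  (\int[mu]_(x in D) (g x)%:E =
   r%:E * \int[mu]_(x in (fun x : R => a + r * (x - a))%R @^-1` D) (g (a + r * (x - a))%R)%:E)%E.
Proof.
move=> r0 mD mg g0.
pose phi : measurableTypeR R -> measurableTypeR R := fun x => a + r * (x - a).
have mphi : measurable_fun setT phi.
  apply: measurable_funD; first exact: measurable_cst.
  apply: measurable_funM; first exact: measurable_cst.
  by apply: measurable_funB => //; exact: measurable_id.
pose pm := measure_function_pushforward__canonical__measure_function_Measure mu mphi.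
pose m := mscale (NngNum (ltW r0)) pm.
have mE A : measurable A -> mu A = m A.
  move=> mA; apply: lebesgue_measure_unique => //= _ [[x y]] _ <-.
  rewrite /m /mscale /= /pushforward.
  have -> : phi @^-1` [set` `]x, y]] = [set` `]a + (x - a) / r, a + (y - a) / r]].
    apply/seteqP; split => z; rewrite /phi /= !in_itv /= => /andP[h1 h2]; apply/andP; split.
    - by rewrite -ltrBrDl ltr_pdivrMr// mulrC ltrBlDl.
    - by rewrite -lerBlDl ler_pdivlMr// mulrC lerBrDl.
    - by rewrite -ltrBlDl mulrC -ltr_pdivrMr// ltrBrDl.
    - by rewrite -lerBrDl mulrC -ler_pdivlMr// lerBlDl.
  rewrite !lebesgue_measure_itv /= !lte_fin ltrD2l ltr_pM2r ?invr_gt0// ltrD2r.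
  by case: ifP => _; rewrite ?mule0// -EFinM; congr EFin; field; rewrite gt_eqF.
transitivity (\int[m]_(x in D) (g x)%:E)%E.
  by apply: eq_measure_integral => A mA _; exact: mE.
rewrite /m ge0_integral_mscale//; last 2 first.
- by apply/measurable_EFinP; apply: measurable_funTS.
- by move=> x _; rewrite lee_fin.
congr (_ * _)%E; rewrite ge0_integral_pushforward//.
- by apply/measurable_EFinP; apply: measurable_funTS.
- by move=> x _; rewrite lee_fin.
Qed.

(** Here [f] will be a family of Green functions picked by [xget], about whose measurability in the
    parameter nothing is known. Its integral is at most that of its positive part, which is a
    supremum over the simple functions below it and therefore monotone. *)
Lemma Rintegral_le (D : set (measurableTypeR R)) (f g : R -> R) :
  (forall x, D x -> f x <= g x) -> (forall x, D x -> 0 <= g x) ->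
  (\int[mu]_(x in D) (g x)%:E < +oo)%E ->
  \int[mu]_(x in D) f x <= \int[mu]_(x in D) g x.
Proof.
move=> fg g0 gy.
rewrite /Rintegral.
have h0 : (0 <= \int[mu]_(x in D) (g x)%:E)%E by apply: integral_ge0 => x Dx; rewrite lee_fin g0.
have hle : (\int[mu]_(x in D) (f x)%:E <= \int[mu]_(x in D) (g x)%:E)%E.
  rewrite integralE.
  apply: (@le_trans _ _ (\int[mu]_(x in D) ((EFin \o f)^\+ x)))%E.
    rewrite geeDl// oppe_le0; apply: integral_ge0 => x Dx; exact: funeneg_ge0.
  rewrite integral_mkcond [leRHS]integral_mkcond.
  rewrite !ge0_integralTE; last 2 first.
  - by move=> x; rewrite patchE; case: ifPn => // /set_mem Dx; rewrite lee_fin g0.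
  - by move=> x; rewrite patchE; case: ifPn => // _; exact: funepos_ge0.
  apply: ereal_sup_le => _ [h hf <-]; exists h => //.
  move=> x /=; apply: le_trans (hf x) _; rewrite !patchE; case: ifPn => // /set_mem Dx.
  by rewrite funeposE /= ge_max lee_fin fg//= lee_fin g0.
(* If the integral of [f] is minus infinity, its [fine] value is 0, which the nonnegative right side
   still dominates. *)
move: hle h0 gy; case: (\int[mu]_(x in D) (f x)%:E)%E => [u| |]; case: (\int[mu]_(x in D) (g x)%:E)%E => [v| |] //=.
Qed.

End Measure.

(** * Arcsine integrals *)

Section ArcsineIntegral.
Variable R : realType.
Local Notation mu := (@lebesgue_measure R).

Lemma asin_within : {within `[-1, 1], continuous (@asin R)}.
Proof.
have := @segment_can_le_continuous R (- (pi / 2)) (pi / 2) sin asin.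
rewrite sinN sin_pihalf; apply.
- by have := @pi_gt0 R; lra.
- by apply: continuous_subspaceT; exact: continuous_sin.
- exact: sinK.
Qed.

(* The clamp makes the function continuous on the whole line. *)
Definition asq (x : R) : R := asin (Num.max (-1) (Num.min 1 (Num.sqrt x))).

Lemma continuous_asq : continuous asq.
Proof.
move=> x; pose h (y : R) : R := Num.max (-1) (Num.min 1 (Num.sqrt y)).
have hI y : h y \in `[-1, 1] by rewrite in_itv /= /h le_max lexx /= ge_max ge_min lexx /= andbT; lra.
have ch : {for x, continuous h}.
  apply: continuous_max; first exact: cvg_cst.
  apply: continuous_min; first exact: cvg_cst.
  exact: sqrt_continuous.
have /subspace_continuousP/(_ (h x) (hI x)) ca := asin_within.
apply: (@cvg_comp _ _ _ h asin (nbhs x) (within `[-1, 1]%classic (nbhs (h x)))) => //.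
move=> A wA.
have : nbhs x (h @^-1` [set y | `[-1, 1]%classic y -> A y]) by exact: (ch _ wA).
by apply: filterS => y /= /(_ (hI y)).
Qed.

Lemma asq0 : asq 0 = 0.
Proof.
rewrite /asq sqrtr0 min_r// max_r ?lerN10//.
rewrite -[X in asin X]sin0 sinK// in_itv /=.
by have := @pi_gt0 R => ?; apply/andP; split; lra.
Qed.

Lemma asq1 : asq 1 = pi / 2.
Proof.
rewrite /asq sqrtr1 minxx max_r; last by lra.
rewrite -[X in asin X]sin_pihalf sinK// in_itv /=.
by have := @pi_gt0 R => ?; apply/andP; split; lra.
Qed.

Lemma derive_asq (x : R) : 0 < x < 1 ->
  is_derive x 1 asq (2 * Num.sqrt (x * (1 - x)))^-1.
Proof.
move=> /andP[x0 x1].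
have s0 : 0 < Num.sqrt x by rewrite sqrtr_gt0.
have s1 : Num.sqrt x < 1 by rewrite -[ltRHS]sqrtr1 ltr_sqrt// ltr01.
have d1 := @is_derive1_sqrt R x x0.
have s11 : -1 < Num.sqrt x < 1 by apply/andP; split=> //; lra.
have d2 := @is_derive1_asin R _ s11.
have := @is_derive1_comp R asin (@Num.sqrt R) x _ _ d2 d1.
have -> : (2 * Num.sqrt (x * (1 - x)))^-1 = (Num.sqrt (1 - Num.sqrt x ^+ 2))^-1 * (2 * Num.sqrt x)^-1.
  rewrite sqr_sqrtr ?ltW// sqrtrM ?ltW// -invfM; congr _^-1; ring.
move=> d3; apply: near_eq_is_derive d3.
near=> y.
have y0 : 0 < y by near: y; exact: lt_nbhsr.
have y1 : y < 1 by near: y; exact: lt_nbhsl.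
have sy : Num.sqrt y < 1 by rewrite -[ltRHS]sqrtr1 ltr_sqrt// ltr01.
rewrite /asq /= min_r ?ltW// max_r//.
by apply: le_trans (sqrtr_ge0 y); lra.
Unshelve. all: by end_near.
Qed.

(** The common form of the arcsine integrals below: a fractional linear [u] maps the interval into
    [0, 1], and the integrand is the derivative of [asin (Num.sqrt u)]. *)
Lemma asin_sqrt_integral (u v : R -> R) (p q : R) : p < q ->
  {within `[p, q], continuous u} ->
  (forall x, x \in `]p, q[ -> is_derive x 1 u (v x)) ->
  (forall x, x \in `]p, q[ -> 0 < u x < 1 /\ 0 <= v x) ->
  {in `]p, q[, continuous v} ->
  (\int[mu]_(x in `]p, q[) (v x / (2 * Num.sqrt (u x * (1 - u x))))%:E = (asq (u q) - asq (u p))%:E)%E.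
Proof.
move=> pq cu du u01 cv.
apply: (@FTC_oo _ _ (asq \o u)) => //.
- have /subspace_continuousP cu' := cu.
  apply/subspace_continuousP => x xI; apply: (@cvg_comp _ _ _ u asq _ (nbhs (u x))); first exact: cu'.
  exact: continuous_asq.
- move=> x xI; have [ux _] := u01 x xI.
  rewrite mulrC; exact: is_derive1_comp (derive_asq ux) (du x xI).
- move=> x xI; have [/andP[ux0 ux1] _] := u01 x xI.
  have cux : {for x, continuous u}.
    apply: differentiable_continuous; apply/derivable1_diffP.
    exact: (@ex_derive _ _ _ _ _ _ _ (du x xI)).
  have s0 : 0 < Num.sqrt (u x * (1 - u x)) by rewrite sqrtr_gt0 mulr_gt0// subr_gt0.
  apply: cvgM; first exact: cv.
  apply: cvgV; first by rewrite mulf_neq0// ?pnatr_eq0// gt_eqF.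
  apply: cvgM; first exact: cvg_cst.
  apply: (@cvg_comp _ _ _ (fun y => u y * (1 - u y)) Num.sqrt); last exact: sqrt_continuous.
  by apply: cvgM => //; apply: cvgB => //; exact: cvg_cst.
- move=> x xI; have [_ vx] := u01 x xI.
  by rewrite divr_ge0// mulr_ge0// sqrtr_ge0.
Qed.

Lemma arcsine_integral (a c : R) : a < c ->
  (\int[mu]_(x in `]a, c[) (Num.sqrt ((x - a) * (c - x)))^-1%:E = pi%:E)%E.
Proof.
move=> ac.
have ca0 : 0 < c - a by rewrite subr_gt0.
have e1 : (\int[mu]_(x in `]a, c[) (Num.sqrt ((x - a) * (c - x)))^-1%:E =
   2%:E * \int[mu]_(x in `]a, c[) ((c - a)^-1 / (2 * Num.sqrt ((x - a) / (c - a) * (1 - (x - a) / (c - a)))))%:E)%E.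
  rewrite -ge0_integralZl//; last 2 first.
  - apply/measurable_EFinP; apply: measurable_funM; first exact: measurable_cst.
    apply: measurable_fun_invr; apply: measurable_funM; first exact: measurable_cst.
    apply: measurable_fun_sqrtr; apply: measurable_funM.
      by apply: measurable_funM => //; apply: measurable_funB => //; exact: measurable_id.
    apply: measurable_funB => //.
    by apply: measurable_funM => //; apply: measurable_funB => //; exact: measurable_id.
  - by move=> x _; rewrite lee_fin; apply: divr_ge0; [by rewrite invr_ge0 ltW|by apply: mulr_ge0].
  apply: eq_integral => x; rewrite inE /= in_itv /= => /andP[h1 h2].
  rewrite -EFinM; congr EFin.
  have -> : (x - a) / (c - a) * (1 - (x - a) / (c - a)) = ((x - a) * (c - x)) * ((c - a)^-1 ^+ 2).
    by field; rewrite gt_eqF.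
  rewrite [in RHS]sqrtrM; last by rewrite mulr_ge0// subr_ge0 ltW.
  rewrite sqrtr_sqr ger0_norm ?invr_ge0 ?ltW//.
  have s0 : Num.sqrt ((x - a) * (c - x)) != 0 by rewrite gt_eqF// sqrtr_gt0 mulr_gt0// subr_gt0.
  by field; rewrite gt_eqF//= s0.
rewrite e1 (_ : (\int[mu]_(x in `]a, c[) _)%E = (pi / 2)%:E).
  by rewrite -EFinM; congr EFin; field.
have -> : pi / 2 = asq ((c - a) / (c - a)) - asq ((a - a) / (c - a)) :> R.
  by rewrite divff ?gt_eqF// subrr mul0r asq0 asq1 subr0.
apply: (@asin_sqrt_integral (fun x => (x - a) / (c - a)) (fun=> (c - a)^-1) a c) => //.
- apply: continuous_subspaceT => x; apply: cvgM; last exact: cvg_cst.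
  by apply: cvgB => //; exact: cvg_cst.
- move=> x _.
  have : is_derive x 1 (fun x => x - a) 1.
    by rewrite -[X in is_derive _ _ _ X]subr0; apply: is_deriveB.
  move=> h; rewrite -[X in is_derive _ _ _ X]mul1r.
  have := @is_deriveM R R (fun x => x - a) (fun=> (c - a)^-1) x 1 _ _ h (is_derive_cst _ _ _).
  by rewrite scaler0 add0r /GRing.scale /= mulr1 mul1r.
- move=> x; rewrite in_itv /= => /andP[h1 h2]; split; last by rewrite invr_ge0 ltW.
  apply/andP; split; first by rewrite divr_gt0// subr_gt0.
  by rewrite ltr_pdivrMr// mul1r ltrD2r.
- by move=> x _; exact: cvg_cst.
Qed.

End ArcsineIntegral.

(** * The constraint integral *)

Section Tau.
Variable R : realType.
Local Notation mu := (@lebesgue_measure R).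
Local Notation measR := {finite_measure set (measurableTypeR R) -> \bar R}.
Variables (a0 b : R) (sigma : measR) (f : R -> R).
Hypothesis cd : constraint_data a0 b sigma f.

Definition wt (x : R) : R := Num.sqrt ((x - a0) * (b - x)) * f x.

Definition tau (c : R) : \bar R :=
  (\int[sigma]_(x in `[a0, c]) (Num.sqrt ((b - x) / (c - x)))%:E)%E.

Lemma tau_left : tau a0 = (\int[sigma]_(x in [set a0]) (Num.sqrt ((b - x) / (a0 - x)))%:E)%E.
Proof. by rewrite /tau set_itv1. Qed.

Lemma cd_bounds : 0 <= a0 < b. Proof. by case: cd. Qed.

Lemma density_ge0 x : 0 <= f x. Proof. by case: cd => _ _ []. Qed.

Lemma density_measurable : measurable_fun setT (f : measurableTypeR R -> measurableTypeR R).
Proof. by case: cd => _ _ []. Qed.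

Lemma wt_ge0 x : 0 <= wt x.
Proof. by rewrite mulr_ge0// density_ge0. Qed.

Lemma wt_le x y : a0 < x -> x <= y -> y < b -> wt x <= wt y.
Proof.
case: cd => _ _ _ [h [hE _ _ hm]] ax; rewrite le_eqVlt => /predU1P[->//|xy] yb.
have xI : x \in `[a0, b] by rewrite in_itv /= !ltW// (lt_trans xy).
have yI : y \in `[a0, b] by rewrite in_itv /= !ltW// (lt_trans ax).
have := hm x y xI yI xy; rewrite !hE ?lte_fin; first exact: ltW.
- by rewrite yb (lt_trans ax).
- by rewrite ax (lt_trans xy).
Qed.

Lemma wt_small e : 0 < e -> exists2 d : R, 0 < d & forall x, a0 < x -> x < a0 + d -> x < b -> wt x < e.
Proof.
move=> e0; case: cd => _ _ _ [h [hE [ha _] h0 _]]; rewrite h0 in ha.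
have U : nbhs (0%E : \bar R) [set u | (u < e%:E)%E].
  by apply: open_nbhs_nbhs; split; [exact: open_ereal_lt_ereal|rewrite /= lte_fin].
have := ha _ U; rewrite /at_right => /nbhs_ballP[d /= d0 H]; exists d => // x x1 x2 xb.
have := H x; rewrite /= /ball /= hE ?x1// lte_fin; apply=> //.
by rewrite ltr0_norm ?subr_lt0//; lra.
Qed.

Lemma measurable_wt : measurable_fun setT wt.
Proof.
apply: measurable_funM; last exact: density_measurable.
apply: measurable_fun_sqrtr; apply: measurable_funM; apply: measurable_funB => //.
Qed.

Lemma measurable_arcker c : measurable_fun setT (fun x : R => (Num.sqrt ((x - a0) * (c - x)))^-1).
Proof.
apply: measurable_fun_invr; apply: measurable_fun_sqrtr.
by apply: measurable_funM; apply: measurable_funB.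
Qed.

(** This is [pi] times the mean of [wt] under the arcsine law of [a0, c]. In this form the
    monotonicity of [wt] passes to [tau]. *)
Lemma tauE c : a0 < c -> c <= b ->
  (tau c = \int[mu]_(x in `]a0, c[) (wt x * (Num.sqrt ((x - a0) * (c - x)))^-1)%:E)%E.
Proof.
move=> ac cb; case: cd => _ _ hd _.
rewrite /tau (density_integral hd)//; last first.
  apply: measurable_fun_sqrtr; apply: measurable_funM; first exact: measurable_funB.
  by apply: measurable_fun_invr; exact: measurable_funB.
rewrite -[LHS]integral_itv_obnd_cbnd; last first.
  apply/measurable_EFinP; apply: measurable_funTS; apply: measurable_funM; last exact: density_measurable.
  apply: measurable_fun_sqrtr; apply: measurable_funM; first exact: measurable_funB.
  by apply: measurable_fun_invr; exact: measurable_funB.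
rewrite -[LHS]integral_itv_bndo_bndc; last first.
  apply/measurable_EFinP; apply: measurable_funTS; apply: measurable_funM; last exact: density_measurable.
  apply: measurable_fun_sqrtr; apply: measurable_funM; first exact: measurable_funB.
  by apply: measurable_fun_invr; exact: measurable_funB.
apply: eq_integral => x; rewrite inE /= in_itv /= => /andP[h1 h2]; congr EFin.
have x1 : 0 <= x - a0 by rewrite subr_ge0 ltW.
have x2 : 0 <= b - x by rewrite subr_ge0 ltW// (lt_le_trans h2).
rewrite /wt !sqrtrM// invfM sqrtrV; last by rewrite subr_ge0 ltW.
have : Num.sqrt (x - a0) != 0 by rewrite gt_eqF// sqrtr_gt0 subr_gt0.
move=> s1; rewrite -[LHS]mul1r -(mulfV s1); ring.
Qed.

(** The dilation about [a0] that takes [a0, c] to [a0, c'] carries one arcsine law to the other and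
    moves every point to the right, where [wt] is larger. *)
Lemma tau_le c c' : a0 < c -> c <= c' -> c' <= b -> (tau c <= tau c')%E.
Proof.
move=> ac; rewrite le_eqVlt => /predU1P[->//|cc'] c'b.
have ac' := lt_trans ac cc'.
rewrite !tauE//; last exact: le_trans (ltW cc') c'b.
have d0 : 0 < c - a0 by rewrite subr_gt0.
pose r := (c' - a0) / (c - a0).
have r1 : 1 < r by rewrite /r ltr_pdivlMr// mul1r ltrD2r.
have r0 : 0 < r by apply: lt_trans r1.
rewrite [leRHS](@lebesgue_scale _ a0 r _ (fun x => wt x * (Num.sqrt ((x - a0) * (c' - x)))^-1))//; last 2 first.
- by apply: measurable_funM; [exact: measurable_wt|exact: measurable_arcker].
- by move=> x; rewrite mulr_ge0 ?wt_ge0// invr_ge0.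
have -> : (fun x : R => (a0 + r * (x - a0))%R) @^-1` `]a0, c'[ = `]a0, c[%classic.
  have ec : c' = a0 + r * (c - a0) by rewrite /r divfK ?gt_eqF// addrC subrK.
  apply/seteqP; split => x /=; rewrite !in_itv /= ltrDl pmulr_rgt0// subr_gt0 {1}ec ltrD2l ltr_pM2l// ltrD2r //.
have mg : measurable_fun setT (fun x : R => wt (a0 + r * (x - a0)) * (Num.sqrt ((a0 + r * (x - a0) - a0) * (c' - (a0 + r * (x - a0)))))^-1).
  have mphi : measurable_fun setT (fun x : R => a0 + r * (x - a0)).
    by apply: measurable_funD => //; apply: measurable_funM => //; exact: measurable_funB.
  apply: measurable_funM; first exact: (measurableT_comp measurable_wt mphi).
  exact: (measurableT_comp (measurable_arcker c') mphi).
rewrite -ge0_integralZl//; last 3 first.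
- by apply/measurable_EFinP; exact: measurable_funTS.
- by move=> x _; rewrite lee_fin mulr_ge0 ?wt_ge0// invr_ge0.
- by rewrite lee_fin ltW.
apply: ge0_le_integral => //.
- by move=> x _; rewrite lee_fin mulr_ge0 ?wt_ge0// invr_ge0.
- apply/measurable_EFinP; apply: measurable_funTS.
  by apply: measurable_funM; [exact: measurable_wt|exact: measurable_arcker].
- by apply: emeasurable_funM => //; apply/measurable_EFinP; exact: measurable_funTS.
move=> x; rewrite /= in_itv /= => /andP[h1 h2]; rewrite -EFinM lee_fin.
have ec : c' = a0 + r * (c - a0) by rewrite /r divfK ?gt_eqF// addrC subrK.
have -> : (a0 + r * (x - a0) - a0) * (c' - (a0 + r * (x - a0))) = r ^+ 2 * ((x - a0) * (c - x)) by rewrite ec; ring.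
rewrite [in leRHS]sqrtrM ?sqr_ge0// sqrtr_sqr gtr0_norm//.
have xr : x <= a0 + r * (x - a0).
  have : x - a0 <= r * (x - a0) by rewrite ler_peMl ?subr_ge0// ltW.
  by lra.
rewrite invfM [leRHS]mulrCA [r * (_ * _)]mulrA mulfV ?gt_eqF// mul1r.
apply: ler_wpM2r; first by rewrite invr_ge0.
apply: wt_le => //; apply: lt_le_trans c'b; rewrite ec ltrD2l ltr_pM2l// ltrD2r //.
Qed.

(** On ]a0, c[ the weight is at most [wt c], and [arcsine_integral] gives the factor [pi]. Since
    [wt] vanishes at [a0], this makes [tau] small near [a0]. *)
Lemma tau_le_wt c : a0 < c -> c < b -> (tau c <= (pi * wt c)%:E)%E.
Proof.
move=> ac cb; rewrite tauE ?(ltW cb)// mulrC EFinM -(arcsine_integral ac) -ge0_integralZl//; last 2 first.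
- by apply/measurable_EFinP; apply: measurable_funTS; exact: measurable_arcker.
- by rewrite lee_fin wt_ge0.
apply: ge0_le_integral => //.
- by move=> x _; rewrite lee_fin mulr_ge0 ?wt_ge0// invr_ge0.
- apply/measurable_EFinP; apply: measurable_funTS.
  by apply: measurable_funM; [exact: measurable_wt|exact: measurable_arcker].
- by apply: emeasurable_funM => //; apply/measurable_EFinP; apply: measurable_funTS; exact: measurable_arcker.
move=> x; rewrite /= in_itv /= => /andP[h1 h2]; rewrite -EFinM lee_fin ler_wpM2r ?invr_ge0//.
by apply: wt_le => //; exact: ltW.
Qed.

Lemma inv_sqrt_integral (c c' : R) : c < c' ->
  (\int[mu]_(x in `]c, c'[) (Num.sqrt (c' - x))^-1%:E = (2 * Num.sqrt (c' - c))%:E)%E.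
Proof.
move=> cc.
pose F (x : R) : R := - 2 * Num.sqrt (c' - x).
have -> : 2 * Num.sqrt (c' - c) = F c' - F c by rewrite /F subrr sqrtr0; ring.
have cs x : {for x, continuous (fun x => Num.sqrt (c' - x))}.
  apply: (@cvg_comp _ _ _ (fun y => c' - y) Num.sqrt); last exact: sqrt_continuous.
  by apply: cvgB => //; exact: cvg_cst.
apply: (@FTC_oo _ (fun x : R => (Num.sqrt (c' - x))^-1) F); first exact: cc.
- apply: continuous_subspaceT => x; apply: cvgM; [exact: cvg_cst|exact: cs].
- move=> x; rewrite in_itv /= => /andP[h1 h2].
  have x0 : 0 < c' - x by rewrite subr_gt0.
  have d1 := @is_derive1_sqrt R _ x0.
  have d2 : is_derive x 1 (fun y => c' - y) (-1).
    by rewrite -[X in is_derive _ _ _ X]sub0r; apply: is_deriveB.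
  have d3 := @is_derive1_comp R Num.sqrt (fun y => c' - y) x _ _ d1 d2.
  rewrite (_ : (Num.sqrt (c' - x))^-1 = -2 *: ((2 * Num.sqrt (c' - x))^-1 * -1)); first exact: is_deriveZ.
  by rewrite /GRing.scale /= ; field; rewrite gt_eqF// sqrtr_gt0.
- move=> x; rewrite in_itv /= => /andP[h1 h2].
  by apply: cvgV; [rewrite gt_eqF// sqrtr_gt0 subr_gt0|exact: cs].
- by move=> x _; rewrite invr_ge0.
Qed.

(** On ]a0, c[ the kernel decreases when [c] is replaced by [c']. On [c, c'[ one has [wt x <= wt c']
    and [x - a0 >= c - a0], which leaves the integral of the inverse square root of [c' - x]. *)
Lemma tau_step c c' : a0 < c -> c <= c' -> c' < b ->
  (tau c' <= tau c + (2 * wt c' * Num.sqrt ((c' - c) / (c - a0)))%:E)%E.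
Proof.
move=> ac; rewrite le_eqVlt => /predU1P[->|cc'] c'b.
  by rewrite subrr mul0r sqrtr0 mulr0 adde0.
have ac' := lt_trans ac cc'; have cb := lt_trans cc' c'b.
have m1 e : measurable_fun setT (fun x => wt x * (Num.sqrt ((x - a0) * (e - x)))^-1).
  by apply: measurable_funM; [exact: measurable_wt|exact: measurable_arcker].
have p1 e x : 0 <= wt x * (Num.sqrt ((x - a0) * (e - x)))^-1.
  by rewrite mulr_ge0 ?wt_ge0// invr_ge0.
rewrite !tauE ?(ltW cb) ?(ltW c'b)//.
have -> : `]a0, c'[%classic = `]a0, c[%classic `|` `[c, c'[%classic.
  by rewrite -itv_bndbnd_setU// bnd_simp ltW.
rewrite ge0_integral_setU//; last 3 first.
- by apply/measurable_EFinP; apply: measurable_funTS; exact: m1.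
- by move=> x _; rewrite lee_fin.
- apply/disj_setPLR => x /=; rewrite !in_itv /= => /andP[_ h1]; apply/negP; rewrite negb_and -ltNge h1 //.
apply: leeD.
  apply: ge0_le_integral => //.
  - by move=> x _; rewrite lee_fin.
  - by apply/measurable_EFinP; apply: measurable_funTS; exact: m1.
  - by apply/measurable_EFinP; apply: measurable_funTS; exact: m1.
  move=> x; rewrite /= in_itv /= => /andP[h1 h2]; rewrite lee_fin ler_wpM2l ?wt_ge0//.
  rewrite lef_pV2 ?posrE ?sqrtr_gt0 ?mulr_gt0 ?subr_gt0//; last exact: lt_trans cc'.
  by rewrite ler_wsqrtr// ler_wpM2l ?subr_ge0 ?ltW// ltrD2r.
rewrite -integral_itv_obnd_cbnd; last first.
  by apply/measurable_EFinP; apply: measurable_funTS; exact: m1.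
have -> : (2 * wt c' * Num.sqrt ((c' - c) / (c - a0)))%:E =
   ((wt c' / Num.sqrt (c - a0))%:E * (2 * Num.sqrt (c' - c))%:E)%E.
  rewrite -EFinM sqrtrM ?subr_ge0 ?ltW// sqrtrV ?subr_ge0 ?ltW//; congr EFin; ring.
rewrite -inv_sqrt_integral// -ge0_integralZl//; last 2 first.
- apply/measurable_EFinP; apply: measurable_funTS; apply: measurable_fun_invr; apply: measurable_fun_sqrtr.
  exact: measurable_funB.
- by rewrite lee_fin divr_ge0 ?wt_ge0.
apply: ge0_le_integral => //.
- by move=> x _; rewrite lee_fin.
- by apply/measurable_EFinP; apply: measurable_funTS; exact: m1.
- apply: emeasurable_funM => //; apply/measurable_EFinP; apply: measurable_funTS; apply: measurable_fun_invr; apply: measurable_fun_sqrtr.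
  exact: measurable_funB.
move=> x; rewrite /= in_itv /= => /andP[h1 h2]; rewrite -EFinM lee_fin.
have x0 : 0 < x - a0 by rewrite subr_gt0 (lt_trans ac).
rewrite sqrtrM ?(ltW x0)// invfM mulrA ler_wpM2r ?invr_ge0//.
apply: ler_pM; rewrite ?wt_ge0 ?invr_ge0//.
  by apply: wt_le => //; [exact: lt_trans h1|exact: ltW].
by rewrite lef_pV2 ?posrE ?sqrtr_gt0 ?subr_gt0// ?ler_wsqrtr ?lerD2r ?ltW// -subr_gt0.
Qed.

End Tau.

(** * Existence of the left endpoint a(t) *)

Section LeftEndpoint.
Variable R : realType.
Local Notation mu := (@lebesgue_measure R).
Local Notation measR := {finite_measure set (measurableTypeR R) -> \bar R}.
Variables (a0 b : R) (sigma : measR) (f : R -> R).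
Hypothesis cd : constraint_data a0 b sigma f.
Local Notation tau := (tau a0 b sigma).

Lemma sigma_set1 x : sigma [set x] = 0%E.
Proof.
case: cd => _ _ [_ mf sE] _; rewrite sE; last exact: measurable_set1.
by apply: (@integral_Sset1 _ _ _ x).
Qed.

Lemma sigma_halfline x : x <= b -> (sigma [set` `]-oo, x]] = sigma [set` `[a0, x[])%E.
Proof.
move=> xb; case: cd => _ s0 _ _.
have -> : [set` `]-oo, x]] = ([set` `]-oo, x[] `&` ~` `[a0, b] `|` `[a0, x[) `|` [set x].
  apply/seteqP; split => y /=.
    rewrite !in_itv /= le_eqVlt => /predU1P[->|yx]; first by right.
    left; case: (leP a0 y) => h; [right|left].
      by rewrite yx.
    by split.
  by rewrite !in_itv /= => -[[[/ltW//]|/andP[_ /ltW]//]|->].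
have mA : measurable ([set` `]-oo, x[] `&` ~` `[a0, b] : set (measurableTypeR R)).
  by apply: measurableI => //; exact: measurableC.
rewrite measureU0//; last 2 first.
- by apply: measurableU.
- exact: sigma_set1.
rewrite setUC measureU0//.
apply/eqP; rewrite eq_le measure_ge0 andbT -s0 le_measure ?inE//.
by apply: measurableC.
Qed.

Lemma sigma_halfline_b : sigma [set` `]-oo, b]] = sigma setT.
Proof.
case: cd => _ s0 _ _.
have -> : setT = [set` `]-oo, b]] `|` (~` `[a0, b] `&` [set` `]b, +oo[]).
  apply/seteqP; split => y //= _.
  case: (leP y b) => h; [left|right]; first by rewrite in_itv.
  by split; rewrite /= in_itv /= ?h// (leNgt y b) h andbF.
rewrite [RHS]measureU0//; first by apply: measurableI => //; exact: measurableC.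
apply/eqP; rewrite eq_le measure_ge0 andbT -s0 le_measure ?inE//.
- by apply: measurableI => //; exact: measurableC.
- by apply: measurableC.
Qed.

Lemma measurable_kern e : measurable_fun setT (fun x : R => Num.sqrt ((b - x) / (e - x))).
Proof.
apply: measurable_fun_sqrtr; apply: measurable_funM; first exact: measurable_funB.
by apply: measurable_fun_invr; exact: measurable_funB.
Qed.

Lemma mass_le_tau K c : 0 <= K -> a0 < c -> c <= b ->
  (forall x, a0 <= x < c -> K <= Num.sqrt ((b - x) / (c - x))) ->
  (K%:E * sigma [set` `]-oo, c]] <= tau c)%E.
Proof.
move=> K0 ac cb H; rewrite sigma_halfline//.
rewrite -integral_cst//.
apply: (@le_trans _ _ (\int[sigma]_(x in `[a0, c[) (Num.sqrt ((b - x) / (c - x)))%:E)%E).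
  apply: ge0_le_integral => //.
  - by apply/measurable_EFinP; apply: measurable_funTS; exact: measurable_kern.
apply: ge0_subset_integral => //.
- by apply/measurable_EFinP; apply: measurable_funTS; exact: measurable_kern.
- by move=> x; rewrite /= !in_itv /= => /andP[-> /ltW ->].
Qed.

Lemma mass_le_tau1 c : a0 < c -> c <= b -> (sigma [set` `]-oo, c]] <= tau c)%E.
Proof.
move=> ac cb; rewrite -[leLHS]mul1e; apply: mass_le_tau => // x /andP[h1 h2].
rewrite -[leLHS]sqrtr1 ler_wsqrtr// ler_pdivlMr ?subr_gt0// mul1r lerD2r //.
Qed.

(** The quotient [(b - x) / (c - x)] increases with [x], so the kernel is at least its value at
    [a0]. The gain over [mass_le_tau1] keeps the first eigenvalue away from [a0] and the index [d]
    away from [n]. *)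
Lemma mass_le_sqrt_tau c : a0 < c -> c < b ->
  (sigma [set` `]-oo, c]] <= (Num.sqrt ((c - a0) / (b - a0)))%:E * tau c)%E.
Proof.
move=> ac cb.
have d1 : 0 < c - a0 by rewrite subr_gt0.
have d2 : 0 < b - a0 by rewrite subr_gt0 (lt_trans ac).
have H := @mass_le_tau (Num.sqrt ((b - a0) / (c - a0))) c (sqrtr_ge0 _) ac (ltW cb).
have s0 : 0 < Num.sqrt ((c - a0) / (b - a0)) by rewrite sqrtr_gt0 divr_gt0.
rewrite -[leLHS]mul1e -(_ : (Num.sqrt ((c - a0) / (b - a0)))%:E * (Num.sqrt ((b - a0) / (c - a0)))%:E = 1)%E; last first.
  rewrite -EFinM -sqrtrM ?divr_ge0 ?ltW//; rewrite (_ : _ * _ = 1) ?sqrtr1//.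
  by field; rewrite !gt_eqF.
rewrite -muleA lee_pmul2l//; apply: H => x /andP[h1 h2].
apply: ler_wsqrtr; rewrite ler_pdivrMr// mulrAC ler_pdivlMr ?subr_gt0//.
nra.
Qed.

Lemma tau_fin c : a0 < c -> c < b -> tau c \is a fin_num.
Proof.
move=> ac cb; apply/fin_numPlt/andP; split.
  by apply: lt_le_trans (integral_ge0 _ _) => // x _; rewrite lee_fin.
by apply: le_lt_trans (tau_le_wt cd ac cb) _; rewrite ltry.
Qed.

Lemma tau_ge0 c : (0 <= tau c)%E.
Proof. by apply: integral_ge0 => x _; rewrite lee_fin. Qed.

Lemma mass_large t : (t%:E < sigma setT)%E ->
  exists c, [/\ a0 < c, c < b & (t%:E <= sigma [set` `]-oo, c]])%E].
Proof.
move=> ts; apply: contrapT => H.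
have ab : a0 < b by case/andP: (cd_bounds cd).
have d0 : 0 < b - a0 by rewrite subr_gt0.
pose c (n : nat) : R := b - (b - a0) / n.+2%:R.
have cI n : a0 < c n < b.
  have n0 : (0 : R) < n.+2%:R by rewrite ltr0n.
  have n1 : (1 : R) < n.+2%:R by rewrite ltr1n.
  rewrite /c; apply/andP; split; last by rewrite gtrBl divr_gt0.
  have : (b - a0) / n.+2%:R < b - a0 by rewrite ltr_pdivrMr// ltr_pMr.
  by move: ((b - a0) / n.+2%:R) => z; lra.
have small n : (sigma [set` `]-oo, c n]] <= t%:E)%E.
  have /andP[h1 h2] := cI n.
  rewrite leNgt; apply/negP => h.
  by apply: H; exists (c n); split=> //; exact: ltW.
have := @nondecreasing_cvg_mu _ _ _ sigma (fun n => [set` `]-oo, c n]]) (fun n => measurable_itv _).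
have -> : \bigcup_n [set` `]-oo, c n]] = `]-oo, b[%classic.
  apply/seteqP; split => x.
    move=> [n _]; rewrite /= !in_itv /= => h; apply: le_lt_trans h _.
    by have /andP[] := cI n.
  rewrite /= in_itv /= => xb.
  have e0 : 0 < b - x by rewrite subr_gt0.
  exists (Num.truncn ((b - a0) / (b - x))) => //=.
  rewrite in_itv /= /c lerBrDl -lerBrDr ler_pdivrMr ?ltr0n// [_ * _%:R]mulrC -ler_pdivrMr//.
  apply: le_trans (ltW (truncnS_gt _)) _; by rewrite ler_nat.
move=> /(_ (measurable_itv _)) h.
have mono : {homo (fun n => `]-oo, c n]%classic : set R) : n m / (n <= m)%N >-> (n <= m)%O}.
  move=> n m nm; apply/subsetPset => x; rewrite /= !in_itv /= => h1; apply: le_trans h1 _.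
  rewrite /c lerD2l lerN2 ler_pM2l// lef_pV2 ?posrE ?ltr0n// ler_nat !ltnS //.
have h3 := h mono.
have : (sigma `]-oo, b[%classic <= t%:E)%E.
  by apply: (@cvge_le _ _ _ R (sigma \o (fun n => `]-oo, c n]%classic)) _ _ _ h3); apply: nearW => n; exact: small.
apply/negP; rewrite -ltNge (lt_le_trans ts)// -sigma_halfline_b sigma_halfline// le_measure ?inE//.
by move=> x /=; rewrite !in_itv /= => /andP[].
Qed.

Lemma tau_large t : (t%:E < sigma setT)%E -> exists c, [/\ a0 < c, c < b & (t%:E <= tau c)%E].
Proof.
move=> /mass_large[c [c1 c2 c3]]; exists c; split=> //.
exact: le_trans c3 (mass_le_tau1 c1 (ltW c2)).
Qed.

(** By monotonicity it suffices to look at [tau b], whose kernel is 1 except at the point [b], where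
    it has the value 0. *)
Lemma tau_le_mass c : a0 < c -> c <= b -> (tau c <= sigma setT)%E.
Proof.
move=> ac cb; apply: le_trans (tau_le cd ac cb (lexx b)) _.
rewrite -[leRHS]mul1e -integral_cst//.
apply: le_trans (_ : _ <= \int[sigma]_(x in `[a0, b]) cst 1 x)%E _.
  apply: ge0_le_integral => //.
  - by apply/measurable_EFinP; apply: measurable_funTS; exact: measurable_kern.
  - move=> x _; rewrite lee_fin; have [->|xb] := eqVneq x b; first by rewrite subrr mul0r sqrtr0.
    by rewrite divff ?sqrtr1// subr_eq0 eq_sym.
by apply: ge0_subset_integral.
Qed.

Lemma mass_gt0 y : a0 < y -> y < b -> (0 < sigma [set` `]-oo, y]])%E.
Proof.
move=> ay yb; pose m := (a0 + y) / 2.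
have am : a0 < m by rewrite /m; lra.
have my : m < y by rewrite /m; lra.
have mb := lt_trans my yb.
have wm : 0 < wt a0 b f m.
  case: cd => _ _ _ [h [hE _ h0 hm]].
  have := hm a0 m; rewrite h0 (hE m) ?am ?mb// lte_fin; apply=> //.
    by rewrite in_itv /= lexx ltW// (lt_trans ay).
  by rewrite in_itv /= !ltW.
have d0 : 0 < b - a0 by rewrite subr_gt0 (lt_trans ay).
have k0 : 0 < wt a0 b f m / (b - a0) by rewrite divr_gt0.
apply: (@lt_le_trans _ _ ((wt a0 b f m / (b - a0))%:E * mu `[m, y])%E).
  rewrite lebesgue_measure_itv /= lte_fin my -EFinB -EFinM lte_fin mulr_gt0// subr_gt0 //.
rewrite -integral_cst//.
case: (cd) => _ _ [_ mf sE] _.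
apply: (@le_trans _ _ (sigma [set` `[m, y]])); last first.
  by apply: le_measure; rewrite ?inE// => x; rewrite /= !in_itv /= => /andP[].
rewrite sE//; apply: ge0_le_integral => //.
- by move=> x _; rewrite lee_fin ltW.
- by apply/measurable_EFinP; exact: measurable_funTS.
move=> x; rewrite /= in_itv /= => /andP[mx xy]; rewrite lee_fin.
have xb := le_lt_trans xy yb.
have ax := lt_le_trans am mx.
rewrite ler_pdivrMr//; apply: le_trans (wt_le cd am mx xb) _.
rewrite /wt mulrC ler_wpM2l ?(density_ge0 cd)//.
rewrite -[leRHS]ger0_norm ?(ltW d0)// -sqrtr_sqr ler_wsqrtr//.
have g1 : 0 <= x - a0 by rewrite subr_ge0 ltW.
have g2 : 0 <= b - x by rewrite subr_ge0 ltW.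
nra.
Qed.

Lemma tau_modulus p q e : a0 < p -> q < b -> 0 < e ->
  exists2 d : R, 0 < d & forall c c', p <= c -> c <= c' -> c' <= q -> c' - c <= d ->
    (tau c' <= tau c + e%:E)%E.
Proof.
move=> ap qb e0; pose W := 2 * wt a0 b f q + 1.
have W0 : 0 < W by have := wt_ge0 cd q => ?; rewrite /W; lra.
exists ((p - a0) * (e / W) ^+ 2).
  by rewrite mulr_gt0 ?subr_gt0// exprn_gt0// divr_gt0.
move=> c c' pc cc c'q cd'.
have ac : a0 < c by exact: lt_le_trans pc.
have ac' : a0 < c' by exact: lt_le_trans cc.
apply: le_trans (tau_step cd ac cc (le_lt_trans c'q qb)) _.
rewrite leeD2l// lee_fin.
have h1 : 2 * wt a0 b f c' <= W.
  by have := wt_le cd ac' c'q qb; rewrite /W => ?; lra.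
have h2 : Num.sqrt ((c' - c) / (c - a0)) <= e / W.
  rewrite -[leRHS]ger0_norm; last by rewrite divr_ge0 ?ltW.
  rewrite -sqrtr_sqr ler_wsqrtr// ler_pdivrMr ?subr_gt0//.
  by apply: le_trans cd' _; rewrite mulrC ler_wpM2l ?sqr_ge0// lerD2r.
apply: le_trans (ler_pM _ _ h1 h2) _ => //; first by rewrite mulr_ge0// (wt_ge0 cd).
by rewrite mulrC divfK// gt_eqF.
Qed.

(** An intermediate value argument by hand, since [tau] has extended real values and its continuity
    is available only as [tau_modulus]: the supremum of the points of ]a0, c1] with [tau c <= t] is
    a solution when [tau c1 >= t]. *)
Lemma tau_surj t : 0 < t -> (t%:E < sigma setT)%E -> exists c, [/\ a0 < c, c < b & tau c = t%:E].
Proof.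
move=> t0 ts.
have p0 := @pi_gt0 R.
have [c1 [ac1 c1b tc1]] := tau_large ts.
pose E := [set c | a0 < c <= c1 /\ (tau c <= t%:E)%E].
have [d dp Hd] := wt_small cd (divr_gt0 t0 p0).
have d10 : 0 < c1 - a0 by rewrite subr_gt0.
(* Close enough to [a0] for [pi * wt c0 <= t], so that [E] is not empty. *)
pose c0 := a0 + Num.min (d / 2) ((c1 - a0) / 2).
have m0 : 0 < Num.min (d / 2) ((c1 - a0) / 2) by rewrite lt_min !divr_gt0.
have ac0 : a0 < c0 by rewrite /c0 ltrDl.
have c0d : c0 < a0 + d by rewrite /c0 ltrD2l gt_min; apply/orP; left; lra.
have c01 : c0 <= c1.
  have : Num.min (d / 2) ((c1 - a0) / 2) <= (c1 - a0) / 2 by rewrite ge_min lexx orbT.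
  by rewrite /c0; lra.
have c0b := le_lt_trans c01 c1b.
have E0 : E c0.
  split; first by rewrite ac0.
  apply: le_trans (tau_le_wt cd ac0 c0b) _; rewrite lee_fin.
  by rewrite mulrC -ler_pdivlMr// ltW// Hd.
have Eub : ubound E c1 by move=> c [/andP[]].
have Es : has_sup E by split; [exists c0|exists c1].
pose s := sup E.
have c0s : c0 <= s by apply: ub_le_sup => //; exists c1.
have as_ : a0 < s by exact: lt_le_trans c0s.
have sc1 : s <= c1 by apply: ge_sup => //; exists c0.
have sb := le_lt_trans sc1 c1b.
exists s; split=> //; apply/eqP; rewrite eq_le; apply/andP; split.
  apply/lee_addgt0Pr => e e0.
  have as2 : a0 < (a0 + s) / 2 by lra.
  have [dd dd0 H] := tau_modulus as2 c1b e0.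
  have m1 : 0 < Num.min dd ((s - a0) / 2) by rewrite lt_min dd0 divr_gt0// subr_gt0.
  have [c [/andP[Ec1 Ec2] Ec3] Ec4] := sup_adherent m1 Es.
  have cs : c <= s by apply: ub_le_sup; [exists c1|split=> //; apply/andP].
  apply: (@le_trans _ _ (tau c + e%:E)%E); last by rewrite leeD2r.
  have g1 : Num.min dd ((s - a0) / 2) <= dd by rewrite ge_min lexx.
  have g2 : Num.min dd ((s - a0) / 2) <= (s - a0) / 2 by rewrite ge_min lexx orbT.
  by rewrite -/s in Ec4; apply: H => //; lra.
move: sc1; rewrite le_eqVlt => /predU1P[->//|sc1].
apply/lee_addgt0Pr => e e0.
have [dd dd0 H] := tau_modulus as_ c1b e0.
pose c := Num.min (s + dd) c1.
have sc : s < c by rewrite lt_min ltrDl dd0.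
have cc1 : c <= c1 by rewrite ge_min lexx orbT.
apply: (@le_trans _ _ (tau c)); last first.
  by apply: H => //; rewrite ?(ltW sc)// lerBlDl ge_min lexx.
rewrite leNgt; apply/negP => h.
have : c <= s.
  apply: ub_le_sup; first by exists c1.
  by split; [rewrite cc1 (lt_trans as_)|exact: ltW].
by rewrite leNgt sc.
Qed.

(** For [t = 0] the point [a0] is a solution, the integral over a single point being 0. The value
    [b] is excluded because [tau b] is at least the total mass. *)
Lemma left_endpointP t : 0 <= t -> (t%:E < sigma setT)%E ->
  let a := left_endpoint a0 b sigma t in [/\ a0 <= a, a < b & tau a = t%:E].
Proof.
move=> t0 ts a.
have /andP[_ ab] := cd_bounds cd.
have [/andP[h1 h2] h3] : [set a | a0 <= a <= b /\ t%:E = tau a] a.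
  apply: (@xgetPex _ a0 [set a | a0 <= a <= b /\ t%:E = tau a]).
  move: t0; rewrite le_eqVlt => /predU1P[<-|t0].
    exists a0; split; first by rewrite lexx ltW.
    rewrite tau_left; apply/esym; apply: null_set_integral => //.
    - by apply/measurable_EFinP; apply: measurable_funTS; exact: measurable_kern.
    - exact: (sigma_set1 a0).
  have [c [c1 c2 c3]] := tau_surj t0 ts; exists c; split => //.
  by rewrite !ltW.
split=> //; rewrite lt_neqAle h2 andbT; apply/eqP => e.
move: ts; rewrite h3 e; apply/negP; rewrite -leNgt -sigma_halfline_b.
exact: mass_le_tau1.
Qed.

End LeftEndpoint.

(** * Tonelli identities *)

Section Tonelli.
Variable R : realType.
Local Notation mu := (@lebesgue_measure R).
Local Notation measR := {finite_measure set (measurableTypeR R) -> \bar R}.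
Variables (a0 b : R) (sigma : measR) (f : R -> R).
Hypothesis cd : constraint_data a0 b sigma f.
Local Notation tau := (tau a0 b sigma).

(* Measurability is superfluous: the integral of a nonnegative function is a supremum over the simple functions
   below it. *)
Lemma ge0_le_integral_nomeasurable d (T : measurableType d) (m : {measure set T -> \bar R})
    (D : set T) (g h : T -> \bar R) :
  (forall x, D x -> (0 <= g x)%E) -> (forall x, D x -> (g x <= h x)%E) ->
  (\int[m]_(x in D) g x <= \int[m]_(x in D) h x)%E.
Proof.
move=> g0 gh; rewrite integral_mkcond [leRHS]integral_mkcond.
rewrite !ge0_integralTE; last 2 first.
- by move=> x; rewrite patchE; case: ifPn => // /set_mem Dx; exact: le_trans (g0 _ Dx) (gh _ Dx).
- by move=> x; rewrite patchE; case: ifPn => // /set_mem; exact: g0.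
apply: ereal_sup_le => _ [u hu <-]; exists u => //.
move=> x; apply: le_trans (hu x) _; rewrite !patchE; case: ifPn => // /set_mem; exact: gh.
Qed.

Definition joint_kernel (k : R -> R) (X : R) (p : measurableTypeR R * measurableTypeR R) : R :=
  if [&& a0 <= p.1, p.1 < p.2, a0 < p.2 & p.2 < X] then Num.sqrt ((b - p.1) / (p.2 - p.1)) * k p.2 else 0.

Definition inner_kernel (k : R -> R) (X y : R) : \bar R :=
  (\int[mu]_(e in `]y, X[) (Num.sqrt ((b - y) / (e - y)) * k e)%:E)%E.

Lemma measurable_joint_kernel k X : measurable_fun setT k -> measurable_fun setT (joint_kernel k X).
Proof.
move=> mk.
have mf : measurable_fun setT (@fst (measurableTypeR R) (measurableTypeR R)) by exact: measurable_fst.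
have ms : measurable_fun setT (@snd (measurableTypeR R) (measurableTypeR R)) by exact: measurable_snd.
apply: measurable_fun_ifT; last exact: measurable_cst.
- apply: measurable_and; first by apply: measurable_fun_ler.
  apply: measurable_and; first by apply: measurable_fun_ltr.
  by apply: measurable_and; apply: measurable_fun_ltr.
- apply: measurable_funM; last exact: (measurableT_comp mk ms).
  apply: measurable_fun_sqrtr; apply: measurable_funM; first exact: measurable_funB.
  by apply: measurable_fun_invr; exact: measurable_funB.
Qed.

Lemma inner_kernelE k X y : a0 <= y < X ->
  inner_kernel k X y = (\int[mu]_e (joint_kernel k X (y, e))%:E)%E.
Proof.
move=> /andP[h1 h2]; rewrite /inner_kernel integral_mkcond.
apply: eq_integral => e _; rewrite patchE /joint_kernel /= h1 /=.
case: ifPn => [/set_mem|/negP h].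
  by rewrite /= in_itv /= => /andP[h3 h4]; rewrite h3 h4 (le_lt_trans h1 h3).
case: ifP => // /and3P[h3 h4 h5]; case: h; apply/mem_set.
by rewrite /= in_itv /= h3.
Qed.

Lemma measurable_inner_kernel (k : R -> R) (X : R) : measurable_fun setT k -> (forall e, 0 <= k e) ->
  measurable_fun `[a0, X[%classic (inner_kernel k X : measurableTypeR R -> \bar R).
Proof.
move=> mk k0.
have m := @measurable_fun_fubini_tonelli_F _ _ _ _ _ mu (EFin \o joint_kernel k X).
apply: (@eq_measurable_fun _ _ _ _ _ (fun y => \int[mu]_e (joint_kernel k X (y, e))%:E)%E).
  by move=> y; rewrite inE /= in_itv /= => h; rewrite inner_kernelE.
apply: measurable_funTS; apply: m.
  by apply/measurable_EFinP; exact: measurable_joint_kernel.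
by move=> p; rewrite /= lee_fin /joint_kernel; case: ifP => // _; rewrite mulr_ge0.
Qed.

(** Tonelli on the triangle [a0 <= y < e < X]. Used with [arcdens b X] and [gamdens b], it turns
    averages over the endpoints a(s), encoded in [tau], into integrals against [sigma]. *)
Lemma tau_kernel_integral (k : R -> R) (X : R) :
  measurable_fun setT k -> (forall e, 0 <= k e) ->
  (\int[sigma]_(y in `[a0, X[) inner_kernel k X y =
   \int[mu]_(e in `]a0, X[) (tau e * (k e)%:E))%E.
Proof.
move=> mk k0.
have G0 p : 0 <= joint_kernel k X p by rewrite /joint_kernel; case: ifP => // _; rewrite mulr_ge0.
have mG := measurable_joint_kernel X mk.
have := @fubini_tonelli _ _ _ _ R sigma mu (EFin \o joint_kernel k X).
move=> /(_ _ _)/esym T.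
rewrite [LHS]integral_mkcond [RHS]integral_mkcond.
transitivity (\int[sigma]_x \int[mu]_y (EFin \o joint_kernel k X) (x, y))%E.
  apply: eq_integral => y _; rewrite patchE; case: ifPn => [/set_mem|/negP nh].
    by rewrite /= in_itv /= => h; rewrite inner_kernelE.
  apply/esym/integral0_eq => e _; rewrite /= /joint_kernel /=; case: ifP => // /and4P[h1 h2 h3 h4].
  by case: nh; apply/mem_set; rewrite /= in_itv /= h1 (lt_trans h2).
rewrite -T; last 2 first.
- by apply/measurable_EFinP.
- by move=> p; rewrite /= lee_fin.
apply: eq_integral => e _; rewrite patchE; case: ifPn => [/set_mem|/negP nh].
  rewrite /= in_itv /= => /andP[h1 h2].
  rewrite muleC -ge0_integralZl//; last 2 first.
  - by apply/measurable_EFinP; apply: measurable_funTS; exact: measurable_kern.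
  - by rewrite lee_fin.
  rewrite [RHS]integral_mkcond; apply: eq_integral => y _; rewrite patchE /joint_kernel /= h1 h2 !andbT.
  case: ifPn => [/andP[h3 h4]|h].
    rewrite mem_set /=; last by rewrite in_itv /= h3 ltW.
    by rewrite -EFinM mulrC.
  case: ifPn => // /set_mem; rewrite /= in_itv /= => /andP[h3].
  rewrite le_eqVlt => /predU1P[->|h4]; last by rewrite h3 h4 in h.
  (* On the diagonal the kernel of [tau e] has the default value 0, in agreement with
     [joint_kernel]. *)
  by rewrite subrr invr0 mulr0 sqrtr0 mule0.
apply: integral0_eq => y _; rewrite /= /joint_kernel /=; case: ifP => // /and4P[h1 h2 h3 h4].
by case: nh; apply/mem_set; rewrite /= in_itv /= h3.
Qed.

(** A staircase with jumps [t] at the points [e i] takes the place of [tau]; for [tau] itself this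
    amounts to replacing the mean over all endpoints a(s) by a mean over finitely many. *)
Lemma step_kernel_integral (k : R -> R) (X : R) (m : nat) (e K : nat -> R) (t : R) : 0 <= t ->
  measurable_fun setT k -> (forall e, 0 <= k e) ->
  (forall i, (i < m)%N -> a0 <= e i) ->
  (forall i, (i < m)%N -> (\int[mu]_(x in `]e i, X[) (k x)%:E = (K i)%:E)%E) ->
  (\int[mu]_(x in `]a0, X[) ((\sum_(0 <= i < m) t * (e i < x)%R%:R) * k x)%:E =
    (t * \sum_(0 <= i < m) K i)%:E)%E.
Proof.
move=> t0 mk k0 ae HK.
have mi i : measurable_fun setT (fun x : R => (e i < x)%R%:R * k x).
  apply: measurable_funM => //.
  rewrite (_ : (fun x : R => (e i < x)%R%:R) = (fun x : R => if e i < x then 1 else 0 : R)).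
    by apply: measurable_fun_ifT => //; apply: measurable_fun_ltr.
  by apply/funext => x; case: ifP.
have me i : measurable_fun `]a0, X[%classic (fun x : measurableTypeR R => ((e i < x)%R%:R * k x)%:E).
  by apply/measurable_EFinP; apply: measurable_funTS; exact: mi.
under eq_integral => x _.
  rewrite -mulr_sumr -mulrA big_distrl /= EFinM.
  rewrite -sumEFin.
  over.
rewrite ge0_integralZl//; last 2 first.
- by apply: emeasurable_sum => i _; exact: me.
- by move=> x _; apply: sume_ge0 => i _; rewrite lee_fin mulr_ge0.
rewrite EFinM; congr (_ * _)%E.
rewrite ge0_integral_sum//; last first.
  by move=> i x _; rewrite lee_fin mulr_ge0.
rewrite -sumEFin; apply: eq_big_nat => i /andP[_ im].
rewrite -HK// [LHS]integral_mkcond [RHS]integral_mkcond; apply: eq_integral => x _.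
rewrite !patchE !mem_setE /= !in_itv /=.
have ei := ae _ im.
case: (ltP (e i) x) => h; rewrite /= ?mul1r ?mul0r; last by case: ifP.
by rewrite (le_lt_trans ei h).
Qed.

Lemma tau_kernel_le (k : R -> R) (X : R) (m : nat) (e K : nat -> R) (t : R) : 0 <= t ->
  measurable_fun setT k -> (forall e, 0 <= k e) ->
  (forall i, (i < m)%N -> a0 <= e i) ->
  (forall i, (i < m)%N -> (\int[mu]_(x in `]e i, X[) (k x)%:E = (K i)%:E)%E) ->
  (forall x, a0 < x < X -> (tau x <= (\sum_(0 <= i < m) t * (e i < x)%R%:R)%:E)%E) ->
  (\int[mu]_(e in `]a0, X[) (tau e * (k e)%:E) <= (t * \sum_(0 <= i < m) K i)%:E)%E.
Proof.
move=> t0 mk k0 ae HK H; rewrite -(@step_kernel_integral k X m e K t)//.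
apply: ge0_le_integral_nomeasurable => x.
  by move=> _; rewrite mule_ge0 ?lee_fin ?tau_ge0.
by rewrite /= in_itv /= => /H h; rewrite EFinM lee_wpmul2r ?lee_fin.
Qed.

Lemma tau_kernel_ge (k : R -> R) (X : R) (m : nat) (e K : nat -> R) (t : R) : 0 <= t ->
  measurable_fun setT k -> (forall e, 0 <= k e) ->
  (forall i, (i < m)%N -> a0 <= e i) ->
  (forall i, (i < m)%N -> (\int[mu]_(x in `]e i, X[) (k x)%:E = (K i)%:E)%E) ->
  (forall x, a0 < x < X -> ((\sum_(0 <= i < m) t * (e i < x)%R%:R)%:E <= tau x)%E) ->
  ((t * \sum_(0 <= i < m) K i)%:E <= \int[mu]_(e in `]a0, X[) (tau e * (k e)%:E))%E.
Proof.
move=> t0 mk k0 ae HK H; rewrite -(@step_kernel_integral k X m e K t)//.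
apply: ge0_le_integral_nomeasurable => x.
  by move=> _; rewrite lee_fin mulr_ge0// sumr_ge0// => i _; rewrite mulr_ge0.
by rewrite /= in_itv /= => /H h; rewrite EFinM lee_wpmul2r ?lee_fin.
Qed.

End Tonelli.

(** * Explicit integrals of the two kernels *)

Section Kernels.
Variable R : realType.
Local Notation mu := (@lebesgue_measure R).
Implicit Types b X e y c : R.

(* [arcdens b X] is minus the derivative of [e |-> arcang b e X / (pi / 2)], [gamdens b] that of [gam b]; the
   absolute values only make them nonnegative everywhere. *)
Definition arcdens b X e : R := pi^-1 * (Num.sqrt (b - X) / (`|b - e| * Num.sqrt (X - e))).
Definition gamdens b e : R := Num.sqrt b / (Num.sqrt e * `|b - e|).

Lemma arcdens_ge0 b X e : 0 <= arcdens b X e.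
Proof. by rewrite mulr_ge0 ?invr_ge0 ?pi_ge0// divr_ge0// mulr_ge0. Qed.

Lemma gamdens_ge0 b e : 0 <= gamdens b e.
Proof. by rewrite divr_ge0// mulr_ge0. Qed.

Lemma measurable_arcdens b X : measurable_fun setT (arcdens b X).
Proof.
apply: measurable_funM => //; apply: measurable_funM => //; apply: measurable_fun_invr.
apply: measurable_funM; last by apply: measurable_fun_sqrtr; exact: measurable_funB.
by apply: measurableT_comp; [exact: normr_measurable|exact: measurable_funB].
Qed.

Lemma measurable_gamdens b : measurable_fun setT (gamdens b).
Proof.
apply: measurable_funM => //; apply: measurable_fun_invr.
apply: measurable_funM; first exact: measurable_fun_sqrtr.
by apply: measurableT_comp; [exact: normr_measurable|exact: measurable_funB].
Qed.

Lemma is_derive_ratio (p q r s x : R) : r + s * x != 0 ->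
  is_derive x 1 (fun x => (p + q * x) / (r + s * x)) ((q * r - p * s) / (r + s * x) ^+ 2).
Proof.
move=> h.
have d1 (u v : R) : is_derive x 1 (fun x => u + v * x) v.
  rewrite -[X in is_derive _ _ _ X]add0r; apply: is_deriveD.
  rewrite -[X in is_derive _ _ _ X]mulr1; exact: is_deriveZ.
have dV := @is_deriveV R (fun x => r + s * x) x _ _ h (d1 r s).
have := @is_deriveM R _ (fun x => p + q * x) (fun x => (r + s * x)^-1) x _ _ _ (d1 p q) dV.
by move=> d; apply: (is_derive_eq d); rewrite /GRing.scale /=; field.
Qed.

Lemma continuous_ratio (p q r s x : R) : r + s * x != 0 ->
  {for x, continuous (fun x => (p + q * x) / (r + s * x))}.
Proof.
move=> h; have := is_derive_ratio p q h => d.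
apply: differentiable_continuous; apply/derivable1_diffP.
exact: (@ex_derive _ _ _ _ _ _ _ d).
Qed.

Lemma asqE (x : R) : 0 <= x <= 1 -> asq x = asin (Num.sqrt x).
Proof.
move=> /andP[x0 x1]; rewrite /asq min_r; last by rewrite -[leRHS]sqrtr1 ler_wsqrtr.
by rewrite max_r// (le_trans _ (sqrtr_ge0 x)).
Qed.

Lemma asq_compl (x : R) : 0 <= x <= 1 -> pi / 2 - asq x = asq (1 - x).
Proof.
move=> /andP[x0 x1].
have p0 := @pi_gt0 R.
have y0 : 0 <= 1 - x by rewrite subr_ge0.
have y1 : 1 - x <= 1 by lra.
rewrite !asqE ?x0 ?y0//.
have s1 : Num.sqrt x <= 1 by rewrite -[leRHS]sqrtr1 ler_wsqrtr.
have s0 := sqrtr_ge0 x.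
have sI : -1 <= Num.sqrt x <= 1 by rewrite s1 andbT; lra.
have A1 := asin_lepi2 sI.
have A0 : 0 <= asin (Num.sqrt x).
  rewrite leNgt; apply/negP => h.
  have : sin (asin (Num.sqrt x)) < 0.
    rewrite -oppr_gt0 -sinN; apply: sin_gt0_pi; have := asin_geNpi2 sI => ?; apply/andP; split; lra.
  by rewrite asinK ?in_itv//= ltNge s0.
rewrite -[LHS]sinK; last by rewrite in_itv /=; apply/andP; split; lra.
congr asin; rewrite sinB sin_pihalf cos_pihalf mul0r subr0 mul1r cos_asin//.
by rewrite sqr_sqrtr.
Qed.

Lemma arcang_asq b e X : e < b -> e <= X <= b -> arcang b e X = asq ((X - e) / (b - e)).
Proof.
move=> eb /andP[eX Xb].
have h : 0 <= (X - e) / (b - e) by rewrite divr_ge0// subr_ge0// ltW.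
have h1 : (X - e) / (b - e) <= 1 by rewrite ler_pdivrMr ?subr_gt0// mul1r lerD2r.
by rewrite asqE ?h// /arcang min_r// max_r.
Qed.

Lemma arcdens_integral b X e : e < b -> X < b ->
  (\int[mu]_(x in `]e, X[) (arcdens b X x)%:E = (arcang b e X / (pi / 2))%:E)%E.
Proof.
move=> eb Xb.
have p0 := @pi_gt0 R.
have [eX|Xe] := ltP e X; last first.
  rewrite set_itv_ge ?integral_set0 ?bnd_simp -?leNgt//.
  by rewrite arcang_lo// mul0r.
rewrite arcang_asq ?(ltW eX) ?(ltW Xb)//.
pose u x := (b - X) / (b - x).
have u01 : 0 <= u e <= 1.
  rewrite /u divr_ge0 ?subr_ge0 ?(ltW eb) ?(ltW Xb)//= ler_pdivrMr ?subr_gt0// mul1r lerD2l lerN2 ltW//.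
have -> : (X - e) / (b - e) = 1 - u e by rewrite /u; field; rewrite gt_eqF// subr_gt0.
rewrite -asq_compl//.
have u1 : u X = 1 by rewrite /u divff// gt_eqF// subr_gt0.
pose v x := (b - X) / (b - x) ^+ 2.
have ue : u = (fun x => ((b - X) + 0 * x) / (b + (-1) * x)) by apply/funext => x; rewrite /u; congr (_ / _); ring.
have nz x : x < b -> b + (-1) * x != 0 by move=> h; rewrite gt_eqF//; lra.
have H : (\int[mu]_(x in `]e, X[) (v x / (2 * Num.sqrt (u x * (1 - u x))))%:E = (pi / 2 - asq (u e))%:E)%E.
  rewrite -asq1 -[X in asq X - _]u1; apply: (@asin_sqrt_integral R u v e X eX).
  - apply: continuous_in_subspaceT => x; rewrite inE /= in_itv /= => /andP[_ h].
    by rewrite ue; apply: continuous_ratio; apply: nz; exact: le_lt_trans Xb.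
  - move=> x; rewrite in_itv /= => /andP[_ h]; rewrite ue.
    have h' := nz x (lt_trans h Xb).
    apply: (is_derive_eq (is_derive_ratio (b - X) 0 h')); rewrite /v.
    have bx : b - x != 0 by rewrite gt_eqF// subr_gt0 (lt_trans h).
    by congr (_ / _ ^+ 2); ring.
  - move=> x; rewrite in_itv /= => /andP[h1 h2].
    have bX : 0 < b - X by lra.
    have bx : 0 < b - x by lra.
    rewrite /u /v divr_gt0//= ltr_pdivrMr// divr_ge0 ?sqr_ge0 ?(ltW bX)//; split=> //; lra.
  - move=> x; rewrite in_itv /= => /andP[h1 h2]; rewrite /v.
    apply: cvgM; first exact: cvg_cst.
    apply: cvgV; first by rewrite gt_eqF// exprn_gt0// subr_gt0 (lt_trans h2).
    by apply: cvgM; apply: cvgB => //; exact: cvg_cst.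
rewrite mulrC EFinM -H.
rewrite -ge0_integralZl//.
- apply: eq_integral => x; rewrite inE /= in_itv /= => /andP[h1 h2].
  rewrite -EFinM; congr EFin; rewrite /arcdens.
  have bx : 0 < b - x by lra.
  have bX : 0 < b - X by lra.
  have Xx : 0 < X - x by lra.
  have -> : u x * (1 - u x) = (b - X) * (X - x) * (b - x)^-1 ^+ 2.
    by rewrite /u; field; rewrite gt_eqF.
  rewrite (gtr0_norm bx) [in RHS]sqrtrM ?mulr_ge0 ?(ltW bX) ?(ltW Xx)//.
  rewrite sqrtr_sqr gtr0_norm ?invr_gt0// sqrtrM ?(ltW bX)//.
  have e1 : b - X = Num.sqrt (b - X) ^+ 2 by rewrite sqr_sqrtr// ltW.
  have s1 : Num.sqrt (b - X) != 0 by rewrite gt_eqF// sqrtr_gt0.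
  rewrite /v; set s := Num.sqrt (b - X) in e1 s1 *; rewrite e1.
  have s2 : Num.sqrt (X - x) != 0 by rewrite gt_eqF// sqrtr_gt0.
  have := p0; generalize (pi : R) => P P0.
  by field; rewrite s1 s2 !gt_eqF.
- apply/measurable_EFinP; apply: measurable_funM.
    apply: measurable_funM => //; apply: measurable_fun_invr.
    by apply: measurable_funX; exact: measurable_funB.
  have mu_ : measurable_fun `]e, X[%classic u.
    by apply: measurable_funM => //; apply: measurable_fun_invr; exact: measurable_funB.
  apply: measurable_fun_invr; apply: measurable_funM => //; apply: measurable_fun_sqrtr.
  by apply: measurable_funM => //; exact: measurable_funB.
- move=> x; rewrite /= in_itv /= => /andP[h1 h2]; rewrite lee_fin; apply: divr_ge0; last exact: mulr_ge0.
  by rewrite /v divr_ge0 ?sqr_ge0// subr_ge0 ltW.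
- by rewrite lee_fin invr_ge0 divr_ge0// ltW.
Qed.

(** The substitution [u] is the fractional linear map taking [y], [X], [b] to 0, 1, infinity. Since
    the value does not depend on [y], [arcdens] inverts the kernel of [tau], as in Abel's equation:
    integrated against [sigma], the identity returns the mass to the left of [X]. *)
Lemma arcdens_kernel_integral b X y : y < X -> X < b ->
  (\int[mu]_(e in `]y, X[) (Num.sqrt ((b - y) / (e - y)) * arcdens b X e)%:E = 1)%E.
Proof.
move=> yX Xb.
have p0 := @pi_gt0 R.
have yb := lt_trans yX Xb.
have Xy0 : 0 < X - y by rewrite subr_gt0.
pose D e := (b - e) * (X - y).
pose u e := (e - y) * (b - X) / D e.
pose v e := (b - X) * (b - y) / ((X - y) * (b - e) ^+ 2).
have ue : u = (fun x => ((- y * (b - X)) + (b - X) * x) / (b * (X - y) + (- (X - y)) * x)).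
  by apply/funext => x; rewrite /u /D; congr (_ / _); ring.
have nz x : x < b -> b * (X - y) + (- (X - y)) * x != 0.
  by move=> h; rewrite (_ : _ + _ = (X - y) * (b - x)) ?mulf_neq0 ?gt_eqF ?subr_gt0//; ring.
have H : (\int[mu]_(x in `]y, X[) (v x / (2 * Num.sqrt (u x * (1 - u x))))%:E = (pi / 2)%:E)%E.
  have -> : pi / 2 = asq (u X) - asq (u y).
    have -> : u y = 0 by rewrite /u subrr !mul0r.
    have -> : u X = 1 by rewrite /u /D [X in _ / X]mulrC divff// mulf_neq0// gt_eqF// subr_gt0.
    by rewrite asq0 asq1 subr0.
  apply: (@asin_sqrt_integral R u v y X yX).
  - apply: continuous_in_subspaceT => x; rewrite inE /= in_itv /= => /andP[_ h].
    by rewrite ue; apply: continuous_ratio; apply: nz; exact: le_lt_trans Xb.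
  - move=> x; rewrite in_itv /= => /andP[_ h]; rewrite ue.
    have bx : b - x != 0 by rewrite gt_eqF// subr_gt0 (lt_trans h).
    have h' := nz x (lt_trans h Xb).
    apply: (is_derive_eq (is_derive_ratio _ _ h')); rewrite /v.
    rewrite (_ : b * (X - y) + (- (X - y)) * x = (X - y) * (b - x)); last by ring.
    by field; rewrite bx gt_eqF.
  - move=> x; rewrite in_itv /= => /andP[h1 h2].
    have bX : 0 < b - X by rewrite subr_gt0.
    have bx : 0 < b - x by rewrite subr_gt0 (lt_trans h2).
    have by_ : 0 < b - y by rewrite subr_gt0.
    have xy : 0 < x - y by rewrite subr_gt0.
    have Xx : 0 < X - x by rewrite subr_gt0.
    split; last by rewrite divr_ge0 ?mulr_ge0 ?sqr_ge0// ltW.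
    rewrite divr_gt0 ?mulr_gt0//= ltr_pdivrMr ?mulr_gt0// mul1r -subr_gt0.
    rewrite (_ : _ - _ = (b - y) * (X - x)) ?mulr_gt0// /D; ring.
  - move=> x; rewrite in_itv /= => /andP[h1 h2]; rewrite /v.
    apply: cvgM; first exact: cvg_cst.
    apply: cvgV; first by rewrite mulf_neq0 ?gt_eqF// exprn_gt0// subr_gt0 (lt_trans h2).
    apply: cvgM; first exact: cvg_cst.
    by apply: cvgM; apply: cvgB => //; exact: cvg_cst.
have -> : (1%E : \bar R) = ((pi / 2)^-1%:E * (pi / 2)%:E)%E.
  by rewrite -EFinM mulVf// gt_eqF// divr_gt0.
rewrite -H -ge0_integralZl//.
- apply: eq_integral => x; rewrite inE /= in_itv /= => /andP[h1 h2].
  rewrite -EFinM; congr EFin; rewrite /arcdens.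
  have bX : 0 < b - X by rewrite subr_gt0.
  have bx : 0 < b - x by rewrite subr_gt0 (lt_trans h2).
  have by_ : 0 < b - y by rewrite subr_gt0.
  have xy : 0 < x - y by rewrite subr_gt0.
  have Xx : 0 < X - x by rewrite subr_gt0.
  have -> : u x * (1 - u x) = (x - y) * (b - X) * (b - y) * (X - x) * (D x)^-1 ^+ 2.
    by rewrite /u /D; field; rewrite !gt_eqF.
  have D0 : 0 < D x by rewrite mulr_gt0.
  rewrite (gtr0_norm bx) [in RHS]sqrtrM ?mulr_ge0 ?ltW//.
  rewrite sqrtr_sqr gtr0_norm ?invr_gt0//.
  rewrite [in RHS]sqrtrM ?mulr_ge0 ?ltW// [in RHS]sqrtrM ?mulr_ge0 ?ltW// [in RHS]sqrtrM ?ltW//.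
  rewrite [in LHS]sqrtrM ?ltW// sqrtrV ?ltW//.
  have e1 : b - X = Num.sqrt (b - X) ^+ 2 by rewrite sqr_sqrtr// ltW.
  have e2 : b - y = Num.sqrt (b - y) ^+ 2 by rewrite sqr_sqrtr// ltW.
  have s1 : Num.sqrt (b - X) != 0 by rewrite gt_eqF// sqrtr_gt0.
  have s2 : Num.sqrt (X - x) != 0 by rewrite gt_eqF// sqrtr_gt0.
  have s3 : Num.sqrt (b - y) != 0 by rewrite gt_eqF// sqrtr_gt0.
  rewrite /v /D; set s := Num.sqrt (b - X) in e1 s1 *; set s' := Num.sqrt (b - y) in e2 s3 *.
  rewrite e1 e2.
  have s4 : Num.sqrt (x - y) != 0 by rewrite gt_eqF// sqrtr_gt0.
  have := p0; generalize (pi : R) => P P0.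
  by field; rewrite s1 s2 s3 s4 !gt_eqF.
- apply/measurable_EFinP; apply: measurable_funM.
    apply: measurable_funM => //; apply: measurable_fun_invr.
    by apply: measurable_funM => //; apply: measurable_funX; exact: measurable_funB.
  have mu_ : measurable_fun `]y, X[%classic u.
    apply: measurable_funM => //.
      by apply: measurable_funM => //; exact: measurable_funB.
    by apply: measurable_fun_invr; apply: measurable_funM => //; exact: measurable_funB.
  apply: measurable_fun_invr; apply: measurable_funM => //; apply: measurable_fun_sqrtr.
  by apply: measurable_funM => //; exact: measurable_funB.
- move=> x; rewrite /= in_itv /= => /andP[h1 h2]; rewrite lee_fin; apply: divr_ge0; last exact: mulr_ge0.
  have [xb Xb' yb'] : [/\ 0 <= X - y, 0 <= b - X & 0 <= b - y] by rewrite !subr_ge0 !ltW.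
  by apply: divr_ge0; apply: mulr_ge0 => //; exact: sqr_ge0.
- by rewrite lee_fin invr_ge0 divr_ge0// ltW.
Qed.

(** Twice the inverse hyperbolic tangent of the square root of [r]; the Green functions with pole at
    infinity and at a finite point both take this form. *)
Definition lrat (r : R) : R := ln ((1 + Num.sqrt r) / (1 - Num.sqrt r)).

Lemma sqrt_lt1 (r : R) : r < 1 -> Num.sqrt r < 1.
Proof. by move=> h; rewrite -[ltRHS]sqrtr1 ltr_sqrt// ltr01. Qed.

Lemma continuous_lrat (r : R) : r < 1 -> {for r, continuous lrat}.
Proof.
move=> /sqrt_lt1 r1; have r0 := sqrtr_ge0 r.
have h : {for r, continuous (fun x => 1 - Num.sqrt x)}.
  by apply: cvgB; [exact: cvg_cst|exact: sqrt_continuous].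
apply: (@cvg_comp _ _ _ (fun x => (1 + Num.sqrt x) / (1 - Num.sqrt x)) (@ln R)).
  apply: cvgM.
    by apply: cvgD; [exact: cvg_cst|exact: sqrt_continuous].
  by apply: cvgV; last exact: h; rewrite gt_eqF// subr_gt0.
by apply: continuous_ln; rewrite divr_gt0//; lra.
Qed.

Lemma derive_lrat (r : R) : 0 < r < 1 -> is_derive r 1 lrat (Num.sqrt r * (1 - r))^-1.
Proof.
move=> /andP[r0 r1].
have s1 := sqrt_lt1 r1; have s0 : 0 < Num.sqrt r by rewrite sqrtr_gt0.
have nz : 1 + (-1) * Num.sqrt r != 0 by rewrite gt_eqF//; lra.
have d1 := is_derive1_comp (is_derive_ratio 1 1 nz) (is_derive1_sqrt r0).
have pos : 0 < (1 + 1 * Num.sqrt r) / (1 + (-1) * Num.sqrt r) by rewrite divr_gt0//; lra.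
have d2 := @is_derive1_comp R (@ln R) ((fun x : R => (1 + 1 * x) / (1 + -1 * x)) \o Num.sqrt) r _ _ (is_derive1_ln pos) d1.
rewrite (_ : lrat = (@ln R \o ((fun x : R => (1 + 1 * x) / (1 + -1 * x)) \o Num.sqrt))); last first.
  by apply/funext => x; rewrite /lrat /=; congr (ln (_ / _)); ring.
apply: (is_derive_eq d2).
have e : r = Num.sqrt r ^+ 2 by rewrite sqr_sqrtr// ltW.
rewrite [in RHS]e sqrtr_sqr (gtr0_norm s0).
set s := Num.sqrt r in s0 s1 nz pos *.
field; rewrite !gt_eqF ?andbT//; try lra.
by rewrite subr_gt0 expr_lt1// ltW.
Qed.

Lemma lrat_integral (u v : R -> R) (p q : R) : p < q ->
  (forall x, p <= x <= q -> {for x, continuous u} /\ u x < 1) ->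
  (forall x, p < x < q -> [/\ is_derive x 1 u (v x), {for x, continuous v}, 0 < u x & 0 <= v x]) ->
  (\int[mu]_(x in `]p, q[) (v x / (Num.sqrt (u x) * (1 - u x)))%:E = (lrat (u q) - lrat (u p))%:E)%E.
Proof.
move=> pq cu H.
apply: (@FTC_oo R (fun x => v x / (Num.sqrt (u x) * (1 - u x))) (lrat \o u)) => //.
- apply: continuous_in_subspaceT => x; rewrite inE /= in_itv /= => /cu[c1 c2].
  by apply: (@cvg_comp _ _ _ u lrat); [exact: c1|exact: continuous_lrat].
- move=> x; rewrite in_itv /= => h; have [d1 _ u0 _] := H x h.
  have /andP[h1 h2] := h.
  have [_ u1] : {for x, continuous u} /\ u x < 1 by apply: cu; rewrite !ltW.
  have u01 : 0 < u x < 1 by rewrite u0.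
  by apply: (is_derive_eq (@is_derive1_comp R lrat u x _ _ (derive_lrat u01) d1)); rewrite mulrC.
- move=> x; rewrite in_itv /= => h; have [d1 cv u0 v0] := H x h.
  have /andP[h1 h2] := h.
  have [c1 u1] : {for x, continuous u} /\ u x < 1 by apply: cu; rewrite !ltW.
  apply: cvgM; first exact: cv.
  apply: cvgV; first by rewrite mulf_neq0 ?gt_eqF ?sqrtr_gt0 ?subr_gt0.
  apply: cvgM.
    by apply: (@cvg_comp _ _ _ u Num.sqrt); [exact: c1|exact: sqrt_continuous].
  by apply: cvgB; [exact: cvg_cst|exact: c1].
- move=> x; rewrite in_itv /= => h; have [d1 cv u0 v0] := H x h.
  have /andP[h1 h2] := h.
  have [c1 u1] : {for x, continuous u} /\ u x < 1 by apply: cu; rewrite !ltW.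
  by rewrite divr_ge0// mulr_ge0// subr_ge0 ltW.
Qed.

Lemma gam_lrat b x : 0 <= x -> x < b -> gam b x = lrat (x / b).
Proof.
move=> x0 xb; have b0 : 0 < b by exact: le_lt_trans xb.
rewrite /gam /lrat sqrtrM// sqrtrV ?ltW//.
have s0 : 0 < Num.sqrt b by rewrite sqrtr_gt0.
have s1 : 0 < Num.sqrt b - Num.sqrt x by rewrite subr_gt0 ltr_sqrt.
by congr ln; field; rewrite !gt_eqF.
Qed.

Lemma is_derive_divr (b x : R) : is_derive x 1 (fun x => x / b) b^-1.
Proof.
have := @is_deriveM R R id (fun=> b^-1) x 1 _ _ (is_derive_id _ _) (is_derive_cst _ _ _).
by move=> d; apply: (is_derive_eq d); rewrite /GRing.scale /=; ring.
Qed.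

Lemma gamdens_integral b e c : 0 <= e -> e <= c -> c < b ->
  (\int[mu]_(x in `]e, c[) (gamdens b x)%:E = (gam b c - gam b e)%:E)%E.
Proof.
move=> e0; rewrite le_eqVlt => /predU1P[->|ec] cb.
  by rewrite set_itv_ge ?integral_set0 ?subrr// bnd_simp ltxx.
have b0 : 0 < b by rewrite (le_lt_trans e0)// (lt_trans ec).
rewrite !gam_lrat ?(ltW (le_lt_trans e0 ec)) ?(lt_trans ec)//.
rewrite -(@lrat_integral (fun x => x / b) (fun=> b^-1) e c ec).
- apply: eq_integral => x; rewrite inE /= in_itv /= => /andP[h1 h2]; congr EFin.
  have x0 : 0 < x by exact: le_lt_trans h1.
  have bx : 0 < b - x by rewrite subr_gt0 (lt_trans h2).
  rewrite /gamdens (gtr0_norm bx) sqrtrM ?ltW// sqrtrV ?ltW//.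
  have s1 : Num.sqrt x != 0 by rewrite gt_eqF// sqrtr_gt0.
  have s2 : Num.sqrt b != 0 by rewrite gt_eqF// sqrtr_gt0.
  have -> : 1 - x / b = (b - x) / b by field; rewrite gt_eqF.
  by field; rewrite s1 s2 !gt_eqF.
- move=> x /andP[h1 h2]; split.
    by apply: cvgM; [exact: cvg_id|exact: cvg_cst].
  by rewrite ltr_pdivrMr// mul1r (le_lt_trans h2).
- move=> x /andP[h1 h2]; split; first exact: is_derive_divr.
  + exact: cvg_cst.
  + by rewrite divr_gt0// (le_lt_trans e0).
  + by rewrite invr_ge0 ltW.
Qed.

(* The Green function of the complement of [c, b] with pole at [y], at the point 0. *)
Definition gamker b c y : R := lrat (b * (c - y) / ((b - y) * c)).

(** The substitution [u] is the fractional linear map taking [y], [b], 0 to 0, 1, infinity; it stays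
    below 1 up to [c < b]. *)
Lemma gamdens_kernel_integral b y c : 0 < y -> y < c -> c < b ->
  (\int[mu]_(e in `]y, c[) (Num.sqrt ((b - y) / (e - y)) * gamdens b e)%:E = (gamker b c y)%:E)%E.
Proof.
move=> y0 yc cb.
have b0 : 0 < b by rewrite (lt_trans y0)// (lt_trans yc).
have by0 : 0 < b - y by rewrite subr_gt0 (lt_trans yc).
pose u e := b * (e - y) / ((b - y) * e).
pose v e := b * y / ((b - y) * e ^+ 2).
have ue : u = (fun x => (- (b * y) + b * x) / (0 + (b - y) * x)).
  by apply/funext => x; rewrite /u; congr (_ / _); ring.
have lt1 x : y <= x -> x < b -> u x < 1.
  move=> yx xb; have x0 : 0 < x by exact: lt_le_trans yx.
  rewrite /u ltr_pdivrMr ?mulr_gt0// mul1r -subr_gt0.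
  by rewrite (_ : _ - _ = y * (b - x)) ?mulr_gt0 ?subr_gt0//; ring.
have d (x : R) : 0 < x -> is_derive x 1 u (v x).
  move=> x0; rewrite ue.
  have nz : 0 + (b - y) * x != 0 by rewrite add0r gt_eqF// mulr_gt0.
  apply: (is_derive_eq (is_derive_ratio _ _ nz)); rewrite /v.
  by rewrite add0r; field; rewrite !gt_eqF.
have := @lrat_integral u v y c yc.
have -> : u y = 0 by rewrite /u subrr mulr0 mul0r.
have -> : lrat 0 = 0 by rewrite /lrat sqrtr0 addr0 subr0 divr1 ln1.
rewrite subr0 -/(gamker b c y) => <-.
- apply: eq_integral => x; rewrite inE /= in_itv /= => /andP[h1 h2]; congr EFin.
  have x0 : 0 < x by exact: lt_trans h1.
  have bx : 0 < b - x by rewrite subr_gt0 (lt_trans h2).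
  have xy : 0 < x - y by rewrite subr_gt0.
  have -> : 1 - u x = y * (b - x) / ((b - y) * x) by rewrite /u; field; rewrite !gt_eqF.
  rewrite /gamdens (gtr0_norm bx) /u /v.
  rewrite [in RHS]sqrtrM ?mulr_ge0 ?ltW// sqrtrV ?mulr_ge0 ?ltW// ![in RHS]sqrtrM ?ltW//.
  rewrite sqrtrM ?ltW// sqrtrV ?ltW//.
  have eb : b = Num.sqrt b ^+ 2 by rewrite sqr_sqrtr// ltW.
  have ex : x = Num.sqrt x ^+ 2 by rewrite sqr_sqrtr// ltW.
  have ey : b - y = Num.sqrt (b - y) ^+ 2 by rewrite sqr_sqrtr// ltW.
  have s1 : Num.sqrt x != 0 by rewrite gt_eqF// sqrtr_gt0.
  have s2 : Num.sqrt b != 0 by rewrite gt_eqF// sqrtr_gt0.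
  have s3 : Num.sqrt (x - y) != 0 by rewrite gt_eqF// sqrtr_gt0.
  have s4 : Num.sqrt (b - y) != 0 by rewrite gt_eqF// sqrtr_gt0.
  have -> : b * y / ((b - y) * x ^+ 2) / (Num.sqrt b * Num.sqrt (x - y) / (Num.sqrt (b - y) * Num.sqrt x) * (y * (b - x) / ((b - y) * x)))
     = b * Num.sqrt (b - y) * Num.sqrt x / (x * (b - x) * Num.sqrt b * Num.sqrt (x - y)).
    by field; rewrite s1 s2 s3 s4 !gt_eqF.
  rewrite (_ : b * Num.sqrt (b - y) * Num.sqrt x = Num.sqrt b ^+ 2 * Num.sqrt (b - y) * Num.sqrt x); last by rewrite -eb.
  rewrite (_ : x * (b - x) = Num.sqrt x ^+ 2 * (b - x)); last by rewrite -ex.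
  by field; rewrite s1 s2 s3 !gt_eqF.
- move=> x /andP[h1 h2]; have x0 : 0 < x by exact: lt_le_trans h1.
  split; last by apply: lt1 => //; exact: le_lt_trans cb.
  apply: differentiable_continuous; apply/derivable1_diffP.
  exact: (@ex_derive _ _ _ _ _ _ _ (d x x0)).
- move=> x /andP[h1 h2]; have x0 : 0 < x by exact: lt_trans h1.
  split.
  + exact: d.
  + apply: cvgM; first exact: cvg_cst.
    apply: cvgV; first by rewrite gt_eqF// mulr_gt0// exprn_gt0.
    by apply: cvgM; [exact: cvg_cst|apply: cvgM; exact: cvg_id].
  + by rewrite /u divr_gt0 ?mulr_gt0// subr_gt0.
  + by rewrite divr_ge0 ?mulr_ge0 ?sqr_ge0 ?ltW.
Qed.

End Kernels.

(** * Riemann sums of Green functions *)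

Section EndpointSums.
Variable R : realType.
Local Notation mu := (@lebesgue_measure R).
Local Notation measR := {finite_measure set (measurableTypeR R) -> \bar R}.

Lemma arcang_anti (b c c' y : R) : c <= c' -> c' < b -> arcang b c' y <= arcang b c y.
Proof.
rewrite le_eqVlt => /predU1P[->//|cc] cb'.
have cb := lt_trans cc cb'.
have [yc|yc] := leP y c'.
  by rewrite (arcang_lo cb')//; case/andP: (arcang_itv cb y).
have [yb|yb] := leP b y; first by rewrite !arcang_hi.
have h0 : 0 <= (y - c') / (b - c') by rewrite divr_ge0// subr_ge0 ltW.
have h1 : (y - c) / (b - c) <= 1 by rewrite ler_pdivrMr ?subr_gt0// mul1r lerD2r ltW.
have le : (y - c') / (b - c') <= (y - c) / (b - c).
  rewrite ler_pdivrMr ?subr_gt0// mulrAC ler_pdivlMr ?subr_gt0//; nra.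
rewrite -(sin2_le cb (arcang_itv cb' y) (arcang_itv cb y)) !sin_arcang//.
rewrite [in leRHS]min_r// [in leRHS]max_r; last exact: le_trans le.
by rewrite [in leLHS]min_r ?max_r//; exact: le_trans h1.
Qed.

Lemma arcang_anti_lt (b c c' y : R) : c < c' -> c' < b -> c < y -> y < b -> arcang b c' y < arcang b c y.
Proof.
move=> cc cb' cy yb; have cb := lt_trans cc cb'.
rewrite lt_neqAle arcang_anti ?andbT//; last exact: ltW.
apply/eqP => e.
have := sin_arcang cb y; rewrite -e sin_arcang//.
have h1 : (y - c) / (b - c) < 1 by rewrite ltr_pdivrMr ?subr_gt0// mul1r ltrD2r.
have h0 : 0 < (y - c) / (b - c) by rewrite divr_gt0 ?subr_gt0.
have h2 : (y - c') / (b - c') < (y - c) / (b - c).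
  rewrite ltr_pdivrMr ?subr_gt0// mulrAC ltr_pdivlMr ?subr_gt0//; nra.
rewrite (@min_r _ _ 1 ((y - c) / _)) ?(ltW h1)// (@max_r _ _ 0 ((y - c) / _)) ?(ltW h0)//.
rewrite min_r; last by rewrite ltW// (lt_trans h2).
by case: leP => ? ?; lra.
Qed.

Lemma gam_le (b x y : R) : 0 <= x -> x <= y -> y < b -> gam b x <= gam b y.
Proof.
move=> x0 xy yb.
have bx : x < b by exact: le_lt_trans yb.
have := @gamdens_integral R b x y x0 xy yb => h.
have : (0 <= (gam b y - gam b x)%:E)%E.
  by rewrite -h; apply: integral_ge0 => z _; rewrite lee_fin gamdens_ge0.
by rewrite lee_fin subr_ge0.
Qed.

Lemma gam_ge0 (b x : R) : 0 <= x -> x < b -> 0 <= gam b x.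
Proof.
move=> x0 xb; apply: ln_ge0; exact: (gam_arg_ge1 (introT andP (conj x0 xb))).
Qed.

(** Staircases of step [d] below [z] here and above [z] in [step_count_ge]; they differ by the shift
    from [i.+1] to [i]. *)
Lemma step_count_le (d z : R) k : 0 < d -> 0 <= z ->
  \sum_(0 <= i < k) d * (i.+1%:R * d <= z)%R%:R <= z.
Proof.
move=> d0 z0; elim: k => [|k IH]; first by rewrite big_geq.
case h : (k.+1%:R * d <= z); last first.
  by rewrite big_nat_recr//= h mulr0 addr0.
apply: le_trans h; apply: (@le_trans _ _ (\sum_(0 <= i < k.+1) d)).
  by apply: ler_sum => i _; case: (_ <= z); rewrite ?mulr1// mulr0 ltW.
by rewrite sumr_const_nat subn0 -[d *+ _]mulr_natl.
Qed.

Lemma step_count_ge (d z : R) k : 0 < d -> z <= k%:R * d ->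
  z <= \sum_(0 <= i < k) d * (i%:R * d < z)%R%:R.
Proof.
move=> d0; elim: k => [|k IH]; first by rewrite big_geq// mul0r.
have [h _|h h'] := leP z (k%:R * d).
  by rewrite big_nat_recr//= (le_trans (IH h))// lerDl mulr_ge0// ltW.
apply: le_trans h' _.
rewrite (eq_big_nat _ _ (F2 := fun=> d)); first by rewrite sumr_const_nat subn0 -[d *+ _]mulr_natl.
move=> i /andP[_ ik]; rewrite (le_lt_trans _ h) ?mulr1//.
by rewrite ler_pM2r// ler_nat -ltnS.
Qed.

Variables (a0 b : R) (sigma : measR) (f : R -> R).
Hypothesis cd : constraint_data a0 b sigma f.
Local Notation tau := (tau a0 b sigma).
Local Notation a := (left_endpoint a0 b sigma).

Lemma tau_a0 : tau a0 = 0%E.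
Proof.
rewrite tau_left; apply: null_set_integral => //.
- by apply/measurable_EFinP; apply: measurable_funTS; exact: measurable_kern.
- exact: (sigma_set1 cd a0).
Qed.

Lemma tau_le_endpoint s x : 0 <= s -> (s%:E < sigma setT)%E -> a0 < x -> x <= a s -> (tau x <= s%:E)%E.
Proof.
move=> s0 sS ax xa; have [_ ab <-] := left_endpointP cd s0 sS.
by apply: (tau_le cd ax xa); exact: ltW.
Qed.

Lemma tau_ge_endpoint s x : 0 <= s -> (s%:E < sigma setT)%E -> a s < x -> x <= b -> (s%:E <= tau x)%E.
Proof.
move=> s0 sS ax xb; have [a1 ab e] := left_endpointP cd s0 sS.
move: a1; rewrite le_eqVlt => /predU1P[a1|a1].
  by rewrite -e -a1 tau_a0 tau_ge0.
by rewrite -e; apply: (tau_le cd a1) => //; exact: ltW.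
Qed.

Lemma endpoint_gt s : 0 < s -> (s%:E < sigma setT)%E -> a0 < a s.
Proof.
move=> s0 sS; have [a1 ab e] := left_endpointP cd (ltW s0) sS.
rewrite lt_neqAle a1 andbT; apply/eqP => e'.
by move: e; rewrite -e' tau_a0 => -[h]; rewrite h ltxx in s0.
Qed.

Lemma endpoint_le s s' : 0 <= s -> s <= s' -> (s'%:E < sigma setT)%E -> a s <= a s'.
Proof.
move=> s0; rewrite le_eqVlt => /predU1P[->//|ss] sS.
have s'0 := le_lt_trans s0 ss.
have sS' : (s%:E < sigma setT)%E by apply: lt_trans sS; rewrite lte_fin.
have [a1 ab e] := left_endpointP cd s0 sS'.
have [a1' ab' e'] := left_endpointP cd (ltW s'0) sS.
rewrite leNgt; apply/negP => h.
have := tau_le_endpoint s0 sS' (endpoint_gt s'0 sS) (ltW h).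
by rewrite e' lee_fin leNgt ss.
Qed.

(* Shifting the grid by two steps makes the counting inequality [mass_lt_arcang] strict. *)
Definition shifted_endpoint (t : R) (k i : nat) : R :=
  if (i <= 1)%N then a0 else a (i.-1%:R * (t / k%:R)).

(** Divided by [k], a right-endpoint Riemann sum for the mean over [0, t] of the Green functions of
    [a(s), b] at 0. *)
Definition gam_sum (t : R) (k : nat) : R :=
  \sum_(1 <= i < k.+1) gam b (a (i%:R * (t / k%:R))).

Lemma step_lt (t : R) k i : 0 < t -> (0 < k)%N -> (i <= k)%N ->
  0 <= i%:R * (t / k%:R) /\ i%:R * (t / k%:R) <= t.
Proof.
move=> t0 k0 ik; split; first by rewrite mulr_ge0// divr_ge0// ltW.
rewrite mulrCA -[leRHS]mulr1 ler_pM2l// ler_pdivrMr ?ltr0n// mul1r ler_nat//.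
Qed.

Lemma stepS t k i : 0 < t -> (t%:E < sigma setT)%E -> (0 < k)%N -> (i <= k)%N ->
  ((i%:R * (t / k%:R))%:E < sigma setT)%E.
Proof.
move=> t0 tS k0 ik; apply: le_lt_trans tS; rewrite lee_fin.
by have [] := step_lt t0 k0 ik.
Qed.

(** The mass equals the integral of [tau] against [arcdens b X], by [arcdens_kernel_integral]. Now
    [tau x > s] forces [a s < x], so [tau] lies below the staircase that jumps by [t / k] at the
    endpoints [a (i * t / k)]. *)
Lemma mass_le_arcang t k X : 0 < t -> (t%:E < sigma setT)%E -> (0 < k)%N ->
  a0 < X -> X < a t ->
  (sigma [set` `]-oo, X]] <= (t / k%:R * \sum_(0 <= i < k)
     (arcang b (if i == 0%N then a0 else a (i%:R * (t / k%:R))) X / (pi / 2)))%:E)%E.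
Proof.
move=> t0 tS k0 aX Xa.
have [_ ab _] := left_endpointP cd (ltW t0) tS.
have Xb := lt_trans Xa ab.
have d0 : 0 < t / k%:R by rewrite divr_gt0// ltr0n.
have /andP[_ a0b] := cd_bounds cd.
set e := fun i : nat => if i == 0%N then a0 else a (i%:R * (t / k%:R)).
have eb i : (i < k)%N -> a0 <= e i < b.
  move=> ik; rewrite /e; case: eqP => [_|_]; first by rewrite lexx.
  have [h1 _] := step_lt t0 k0 (ltnW ik).
  by have [-> ->] := left_endpointP cd h1 (stepS t0 tS k0 (ltnW ik)).
rewrite (sigma_halfline cd (ltW Xb)).
have -> : sigma [set` `[a0, X[] = (\int[mu]_(e in `]a0, X[) (tau e * (arcdens b X e)%:E))%E.
  rewrite -(tau_kernel_integral a0 b sigma X (measurable_arcdens b X) (arcdens_ge0 b X)).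
  rewrite -[LHS]mul1e -integral_cst//; apply: eq_integral => y; rewrite inE /= in_itv /= => /andP[_ yX].
  by rewrite /inner_kernel arcdens_kernel_integral.
apply: (tau_kernel_le (e := e)).
- exact: ltW.
- exact: measurable_arcdens.
- exact: arcdens_ge0.
- by move=> i /eb/andP[].
- by move=> i /eb/andP[_ h]; exact: arcdens_integral.
move=> x /andP[h1 h2].
have xb := lt_trans h2 Xb.
have fx := tau_fin cd h1 xb.
have txt : (tau x <= t%:E)%E by apply: tau_le_endpoint; rewrite ?ltW// (lt_trans h2).
rewrite -(fineK fx) lee_fin.
apply: le_trans (@step_count_ge (t / k%:R) (fine (tau x)) k d0 _) _.
  rewrite mulrC divfK ?pnatr_eq0 ?gtn_eqF//.
  by rewrite -lee_fin fineK.
apply: ler_sum_nat => i /andP[_ ik]; rewrite ler_pM2l//.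
case h : (i%:R * (t / k%:R) < fine (tau x)) => //.
rewrite (_ : e i < x) // /e; case: eqP => // _.
have [g1 _] := step_lt t0 k0 (ltnW ik).
rewrite ltNge; apply/negP => g.
have := tau_le_endpoint g1 (stepS t0 tS k0 (ltnW ik)) h1 g.
by rewrite -(fineK fx) lee_fin leNgt h.
Qed.

(** The strict inequality comes from the term [i = 1], in which [a (t / k) > a0] is replaced by
    [a0]; all later endpoints move weakly to the left. *)
Lemma mass_lt_arcang t k X : 0 < t -> (t%:E < sigma setT)%E -> (1 < k)%N ->
  a0 < X -> X < a t ->
  (sigma [set` `]-oo, X]] < (t / k%:R * \sum_(0 <= i < k)
     (arcang b (shifted_endpoint t k i) X / (pi / 2)))%:E)%E.
Proof.
move=> t0 tS k1 aX Xa.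
have k0 : (0 < k)%N by exact: ltnW.
have [_ ab _] := left_endpointP cd (ltW t0) tS.
have Xb := lt_trans Xa ab.
apply: le_lt_trans (mass_le_arcang t0 tS k0 aX Xa) _.
rewrite lte_fin ltr_pM2l ?divr_gt0 ?ltr0n//.
have p2 : 0 < (pi / 2 : R) by rewrite divr_gt0// pi_gt0.
case: k k1 k0 => [//|[//|k]] _ k0.
rewrite !big_nat_recl//= !addrA; apply: ltr_leD.
  rewrite ltrD2l ltr_pM2r ?invr_gt0//.
  apply: arcang_anti_lt => //.
    apply: endpoint_gt; first by rewrite mul1r divr_gt0// ltr0n.
    exact: stepS.
  have [h1 _] := step_lt t0 k0 (isT : (1 <= k.+2)%N).
  by have [] := left_endpointP cd h1 (stepS t0 tS k0 (isT : (1 <= k.+2)%N)).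
apply: ler_sum_nat => i /andP[_ ik].
rewrite ler_pM2r ?invr_gt0//.
have ik2 : (i.+2 <= k.+2)%N by rewrite !ltnS ltnW.
have [h1 _] := step_lt t0 k0 ik2.
apply: arcang_anti.
  rewrite /shifted_endpoint /=; apply: endpoint_le => //.
  - by rewrite mulr_ge0// divr_ge0// ltW.
  - by rewrite ler_wpM2r ?divr_ge0 ?(ltW t0)// ler_nat.
  - exact: stepS.
by have [] := left_endpointP cd h1 (stepS t0 tS k0 ik2).
Qed.

Lemma shifted_endpoint_itv t k i : 0 < t -> (t%:E < sigma setT)%E -> (i < k)%N ->
  0 <= shifted_endpoint t k i <= a t.
Proof.
move=> t0 tS ik; have k0 : (0 < k)%N by exact: leq_ltn_trans ik.
have /andP[a00 _] := cd_bounds cd.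
rewrite /shifted_endpoint; case: ifP => _.
  by rewrite a00 ltW// endpoint_gt.
have ik' : (i.-1 <= k)%N by rewrite (leq_trans (leq_pred _))// ltnW.
have [h1 h2] := step_lt t0 k0 ik'.
have [h3 _ _] := left_endpointP cd h1 (stepS t0 tS k0 ik').
by rewrite (le_trans a00 h3) endpoint_le.
Qed.

(** The shifted sum lacks the last two terms of [gam_sum], each at most [gam b (a t)], and has two
    nonnegative terms at [a0] instead. *)
Lemma gam_sum_shifted t k : 0 < t -> (t%:E < sigma setT)%E -> (1 < k)%N ->
  gam_sum t k - 2 * gam b (a t) <= \sum_(0 <= i < k) gam b (shifted_endpoint t k i).
Proof.
move=> t0 tS k1.
have k0 : (0 < k)%N by exact: ltnW.
have [_ ab _] := left_endpointP cd (ltW t0) tS.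
have /andP[a00 a0b] := cd_bounds cd.
case: k k1 k0 => [//|[//|k]] _ k0.
have g0 := gam_ge0 a00 a0b.
have gle i : (i <= k.+2)%N -> gam b (a (i%:R * (t / k.+2%:R))) <= gam b (a t).
  move=> ik; have [h1 h2] := step_lt t0 k0 ik.
  have [h3 _ _] := left_endpointP cd h1 (stepS t0 tS k0 ik).
  by apply: gam_le => //; [exact: le_trans h3|exact: endpoint_le].
rewrite /gam_sum big_add1 /= [leRHS]big_nat_recl// [X in _ <= _ + X]big_nat_recl//= big_nat_recr//= big_nat_recr//=.
rewrite /shifted_endpoint /=.
have := gle k.+1 (leqnSn _); have := gle k.+2 (leqnn _).
by set S := \sum_(0 <= i < k) _; lra.
Qed.

(** A staircase below [tau] jumps at the endpoints [a (i.+1 * t / k)], and each jump contributes an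
    increment of [gam b] up to [c]. Endpoints beyond [c] are cut down to [c]; they contribute 0,
    whereas on the left side they count as negative. *)
Lemma gam_sum_le_integral t k c : 0 < t -> (t%:E < sigma setT)%E -> (0 < k)%N ->
  a0 < c -> c < b ->
  ((t * gam b c - t / k%:R * gam_sum t k)%:E <= \int[mu]_(e in `]a0, c[) (tau e * (gamdens b e)%:E))%E.
Proof.
move=> t0 tS k0 ac cb.
have /andP[a00 a0b] := cd_bounds cd.
have d0 : 0 < t / k%:R by rewrite divr_gt0// ltr0n.
pose e i := Num.min (a (i.+1%:R * (t / k%:R))) c.
have eb i : (i < k)%N -> a0 <= a (i.+1%:R * (t / k%:R)) /\ a (i.+1%:R * (t / k%:R)) < b.
  move=> ik; have [h1 h2] := step_lt t0 k0 ik.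
  by have [? ?] := left_endpointP cd h1 (stepS t0 tS k0 ik).
apply: (@le_trans _ _ (t / k%:R * \sum_(0 <= i < k) (gam b c - gam b (e i)))%:E).
  rewrite lee_fin /gam_sum big_add1 /= sumrB sumr_const_nat subn0 mulrBr.
  rewrite -[gam b c *+ k]mulr_natl mulrA divfK ?pnatr_eq0 ?gtn_eqF// lerD2l lerN2.
  rewrite ler_pM2l//; apply: ler_sum_nat => i /andP[_ ik].
  have [h1 h2] := eb _ ik; have h0 := le_trans a00 h1.
  by apply: gam_le => //; rewrite ?ge_min ?lexx// le_min h0 (le_trans a00 (ltW ac)).
apply: (tau_kernel_ge (e := e)).
- exact: ltW.
- exact: measurable_gamdens.
- exact: gamdens_ge0.
- by move=> i ik; rewrite le_min (ltW ac) andbT; have [] := eb _ ik.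
- move=> i ik; have [h1 h2] := eb _ ik.
  apply: gamdens_integral => //; last by rewrite ge_min lexx orbT.
  by rewrite le_min (le_trans a00 h1) (le_trans a00 (ltW ac)).
move=> x /andP[h1 h2].
have xb := lt_trans h2 cb.
have fx := tau_fin cd h1 xb.
rewrite -(fineK fx) lee_fin.
apply: le_trans (@step_count_le (t / k%:R) (fine (tau x)) k d0 _); last exact: fine_ge0 (tau_ge0 _ _ _ _).
apply: ler_sum_nat => i /andP[_ ik]; rewrite ler_pM2l//.
case h : (e i < x) => //.
rewrite (_ : _ <= fine _)// -lee_fin fineK//.
have [g1 _] := step_lt t0 k0 ik.
apply: tau_ge_endpoint => //; [exact: stepS| |exact: ltW].
by move: h; rewrite /e gt_min => /orP[//|h]; move: (lt_trans h h2); rewrite ltxx.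
Qed.

End EndpointSums.

(** * The Green function at the origin *)

Section GreenBound.
Variable R : realType.

(** At a maximum [g' c = 0]; with [l > 0] the derivative would be positive just to the right of [c],
    and the mean value theorem would give a larger value there. *)
Lemma second_derivative_at_max (g g' : R -> R) (c e l : R) : 0 < e ->
  (forall x, `|x - c| < e -> is_derive x 1 g (g' x)) -> is_derive c 1 g' l ->
  (forall x, `|x - c| < e -> g x <= g c) -> l <= 0.
Proof.
move=> e0 dg dg' gc; rewrite leNgt; apply/negP => l0.
have inI x : x \in `]c - e, c + e[ -> `|x - c| < e.
  by rewrite in_itv /= ltr_norml => /andP[h1 h2]; apply/andP; split; lra.
have g'c : g' c = 0.
  have cI : c \in `]c - e, c + e[ by rewrite in_itv /=; apply/andP; split; lra.
  have h : is_derive c 1 g 0.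
    apply: (@derive1_at_max _ g (c - e) (c + e)) => //; first by lra.
      by move=> t /inI /dg d; exact: (@ex_derive _ _ _ _ _ _ _ d).
    by move=> t /inI; exact: gc.
  by rewrite -(@derive_val _ _ _ _ _ _ _ (dg c (inI c cI))) (@derive_val _ _ _ _ _ _ _ h).
have [d d0 Hd] : exists2 d : R, 0 < d & forall h, 0 < h -> h < d -> 0 < g' (c + h).
  have dv := @ex_derive _ _ _ _ _ _ _ dg'; have := @derive_val _ _ _ _ _ _ _ dg'.
  rewrite /derive => lE.
  have cv : h^-1 *: ((g' \o shift c) (h *: 1) - g' c) @[h --> (0:R)^'] --> l by rewrite -lE.
  have := @cvgr_gt _ _ _ _ _ _ cv _ l0.
  move=> /(_ _); rewrite /dnbhs => /nbhs_ballP[d /= d0 H]; exists d => // h h0 hd.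
  have := H h; rewrite /ball /= sub0r normrN gtr0_norm// => /(_ hd).
  rewrite gt_eqF// => /(_ isT); rewrite g'c subr0 /= /GRing.scale /= mulr1 addrC.
  by rewrite pmulr_rgt0// invr_gt0.
pose h := Num.min (d / 2) (e / 2).
have h0 : 0 < h by rewrite lt_min !divr_gt0.
have hd : h < d by rewrite gt_min; apply/orP; left; lra.
have he : h < e by rewrite gt_min; apply/orP; right; lra.
have ch : c < c + h by rewrite ltrDl.
have near x : c <= x <= c + h -> `|x - c| < e.
  by move=> /andP[h1 h2]; rewrite ger0_norm ?subr_ge0//; lra.
have cg : {within `[c, c + h], continuous g}.
  apply: derivable_within_continuous => x; rewrite in_itv /= => /near/dg dx.
  exact: (@ex_derive _ _ _ _ _ _ _ dx).
have dg2 x : x \in `]c, c + h[ -> is_derive x 1 g (g' x).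
  by rewrite in_itv /= => /andP[h1 h2]; apply: dg; apply: near; rewrite !ltW.
have [x] := MVT ch dg2 cg.
rewrite in_itv /= => /andP[h1 h2] E.
have x0 : 0 < g' x.
  by rewrite -(subrK c x) addrC; apply: Hd; rewrite ?subr_gt0//; lra.
have := gc (c + h) (near (c + h) _).
rewrite lexx ltW// => /(_ isT); rewrite -subr_le0 E leNgt => /negP; apply.
by rewrite [c + h]addrC addrK mulr_gt0.
Qed.

Lemma is_derive_dx (u : R * R -> R) (x y : R) : derivable u (x, y) (1, 0) ->
  is_derive x 1 (fun s => u (s, y)) (dx u (x, y)).
Proof.
have E : (fun h : R => h^-1 *: (((fun s => u (s, y)) \o shift x) (h *: 1) - u (x, y))) =
   (fun h : R => h^-1 *: ((u \o shift (x, y)) (h *: ((1, 0) : R * R)) - u (x, y))).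
  apply/funext => h; rewrite /= /shift /=; congr (_ *: (u _ - _)).
  by apply/pair_equal_spec; split => /=; rewrite ?scaler0 ?add0r.
rewrite /derivable => d; split; first by rewrite /derivable E.
by rewrite /dx /derive E.
Qed.

Lemma is_derive_dy (u : R * R -> R) (x y : R) : derivable u (x, y) (0, 1) ->
  is_derive y 1 (fun s => u (x, s)) (dy u (x, y)).
Proof.
have E : (fun h : R => h^-1 *: (((fun s => u (x, s)) \o shift y) (h *: 1) - u (x, y))) =
   (fun h : R => h^-1 *: ((u \o shift (x, y)) (h *: ((0, 1) : R * R)) - u (x, y))).
  apply/funext => h; rewrite /= /shift /=; congr (_ *: (u _ - _)).
  by apply/pair_equal_spec; split => /=; rewrite ?scaler0 ?add0r.
rewrite /derivable => d; split; first by rewrite /derivable E.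
by rewrite /dy /derive E.
Qed.

Definition dist (c k s : R) : R := Num.sqrt ((s - c) ^+ 2 + k ^+ 2).

Lemma is_derive_dist c k s : 0 < dist c k s -> is_derive s 1 (dist c k) ((s - c) / dist c k s).
Proof.
rewrite sqrtr_gt0 => h.
have d1 : is_derive s 1 (fun s => s - c) 1.
  by rewrite -[X in is_derive _ _ _ X]subr0; apply: is_deriveB.
have d2 : is_derive s 1 (fun s => (s - c) ^+ 2 + k ^+ 2) (2 * (s - c)).
  have := @is_deriveX R R (fun s => s - c) 2 s _ _ d1 => d.
  have := @is_deriveD _ _ _ _ _ _ _ _ _ d (is_derive_cst (k ^+ 2) s 1) => d'.
  by apply: (is_derive_eq d'); rewrite /GRing.scale /= addr0 expr1 mulr1.
have := @is_derive1_comp R Num.sqrt _ s _ _ (is_derive1_sqrt h) d2 => d.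
apply: (is_derive_eq d); rewrite /dist.
by field; rewrite gt_eqF// sqrtr_gt0.
Qed.

Lemma is_derive_dist2 c k s : 0 < dist c k s ->
  is_derive s 1 (fun s => (s - c) / dist c k s) (k ^+ 2 / dist c k s ^+ 3).
Proof.
move=> h.
have d1 : is_derive s 1 (fun s => s - c) 1.
  by rewrite -[X in is_derive _ _ _ X]subr0; apply: is_deriveB.
have nz : dist c k s != 0 by rewrite gt_eqF.
have dV := @is_deriveV R (dist c k) s _ _ nz (is_derive_dist h).
have d := @is_deriveM R R (fun s => s - c) (fun s => (dist c k s)^-1) s 1 _ _ d1 dV.
apply: (is_derive_eq d); rewrite /GRing.scale /=.
have e : dist c k s ^+ 2 = (s - c) ^+ 2 + k ^+ 2 by rewrite sqr_sqrtr// addr_ge0// sqr_ge0.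
have -> : k ^+ 2 = dist c k s ^+ 2 - (s - c) ^+ 2 by rewrite e; ring.
by field.
Qed.

Section Line.
Variables (c1 k1 c2 k2 L : R).
Let r1 := dist c1 k1.
Let r2 := dist c2 k2.
Let p s := r1 s + r2 s.
Let p' s := (s - c1) / r1 s + (s - c2) / r2 s.
Let W s := Num.sqrt (p s ^+ 2 - L ^+ 2).
(** The restriction of [ellipse_green], up to a constant, to a line: [c1], [c2] are the positions of
    the foci along the line and [k1], [k2] their offsets from it. Horizontal and vertical lines are
    two instances, so one computation yields both second derivatives. *)
Definition line_green (s : R) := ln (p s + W s).
Definition line_green' (s : R) := p' s / W s.

Let is_derive_p s : 0 < r1 s -> 0 < r2 s -> is_derive s 1 p (p' s).
Proof. by move=> h1 h2; apply: is_deriveD; exact: is_derive_dist. Qed.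

Let is_derive_W s : 0 < r1 s -> 0 < r2 s -> 0 < p s ^+ 2 - L ^+ 2 -> is_derive s 1 W (p s * p' s / W s).
Proof.
move=> h1 h2 h3.
have d0 := is_derive_p h1 h2.
have d2 : is_derive s 1 (fun s => p s ^+ 2 - L ^+ 2) (2 * p s * p' s).
  have := @is_deriveX R R p 2 s _ _ d0 => d.
  have := @is_deriveB _ _ _ _ _ _ _ _ _ d (is_derive_cst (L ^+ 2) s 1) => d'.
  by apply: (is_derive_eq d'); rewrite /GRing.scale /= subr0 expr1.
have := @is_derive1_comp R Num.sqrt _ s _ _ (is_derive1_sqrt h3) d2 => d.
apply: (is_derive_eq d); rewrite /W.
by field; rewrite gt_eqF// sqrtr_gt0.
Qed.

Lemma is_derive_line_green s : 0 < r1 s -> 0 < r2 s -> 0 < p s ^+ 2 - L ^+ 2 ->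
  is_derive s 1 line_green (line_green' s).
Proof.
move=> h1 h2 h3.
have W0 : 0 < W s by rewrite sqrtr_gt0.
have p0 : 0 < p s by rewrite addr_gt0.
have pW : 0 < p s + W s by rewrite addr_gt0.
have d := @is_deriveD _ _ _ _ _ _ _ _ _ (is_derive_p h1 h2) (is_derive_W h1 h2 h3).
have d' := @is_derive1_comp R (@ln R) _ s _ _ (is_derive1_ln pW) d.
apply: (is_derive_eq d'); rewrite /line_green'.
by field; rewrite !gt_eqF.
Qed.

Lemma is_derive_line_green' s : 0 < r1 s -> 0 < r2 s -> 0 < p s ^+ 2 - L ^+ 2 ->
  is_derive s 1 line_green'
    ((k1 ^+ 2 / r1 s ^+ 3 + k2 ^+ 2 / r2 s ^+ 3) / W s - p s * p' s ^+ 2 / W s ^+ 3).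
Proof.
move=> h1 h2 h3.
have W0 : 0 < W s by rewrite sqrtr_gt0.
have dp' : is_derive s 1 p' (k1 ^+ 2 / r1 s ^+ 3 + k2 ^+ 2 / r2 s ^+ 3).
  by apply: is_deriveD; exact: is_derive_dist2.
have nz : W s != 0 by rewrite gt_eqF.
have dV := @is_deriveV R W s _ _ nz (is_derive_W h1 h2 h3).
have d := @is_deriveM R R p' (fun s => (W s)^-1) s 1 _ _ dp' dV.
apply: (is_derive_eq d); rewrite /GRing.scale /=.
move: (_ + _ / r2 s ^+ 3) => P2.
by field.
Qed.

End Line.

Variables (a b : R).
Hypothesis ab : a < b.

(* arccosh ((|z - a| + |z - b|) / (b - a)) *)
Definition ellipse_green (z : R * R) : R :=
  line_green a z.2 b z.2 (b - a) z.1 - ln (b - a).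

Local Notation r1 z := (dist a z.2 z.1).
Local Notation r2 z := (dist b z.2 z.1).

Let foci_sqr (x y : R) : (r1 (x, y) + r2 (x, y)) ^+ 2 - (b - a) ^+ 2 =
  2 * ((x - a) * (x - b) + y ^+ 2 + r1 (x, y) * r2 (x, y)).
Proof.
have e1 : r1 (x, y) ^+ 2 = (x - a) ^+ 2 + y ^+ 2 by rewrite sqr_sqrtr// addr_ge0// sqr_ge0.
have e2 : r2 (x, y) ^+ 2 = (x - b) ^+ 2 + y ^+ 2 by rewrite sqr_sqrtr// addr_ge0// sqr_ge0.
by rewrite sqrrD e1 e2; ring.
Qed.

Let foci_prod (x y : R) :
  (r1 (x, y) * r2 (x, y)) ^+ 2 - ((x - a) * (x - b) + y ^+ 2) ^+ 2 = (y * (b - a)) ^+ 2.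
Proof.
have e1 : r1 (x, y) ^+ 2 = (x - a) ^+ 2 + y ^+ 2 by rewrite sqr_sqrtr// addr_ge0// sqr_ge0.
have e2 : r2 (x, y) ^+ 2 = (x - b) ^+ 2 + y ^+ 2 by rewrite sqr_sqrtr// addr_ge0// sqr_ge0.
by rewrite exprMn e1 e2; ring.
Qed.

Let dist_ge (c k s : R) : `|s - c| <= dist c k s.
Proof. by rewrite -sqrtr_sqr ler_wsqrtr// lerDl sqr_ge0. Qed.

Lemma foci_ge z : b - a <= r1 z + r2 z.
Proof.
apply: le_trans (lerD (dist_ge a z.2 z.1) (dist_ge b z.2 z.1)).
have := ler_norm (z.1 - a); have := ler_norm (b - z.1).
by rewrite distrC => ? ?; lra.
Qed.

Lemma ellipse_green_ge0 z : 0 <= ellipse_green z.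
Proof.
have d0 : 0 < b - a by rewrite subr_gt0.
rewrite /ellipse_green subr_ge0 /line_green ler_ln ?posrE//; last first.
  by apply: lt_le_trans d0 _; rewrite (le_trans (foci_ge z))// lerDl.
by rewrite (le_trans (foci_ge z))// lerDl.
Qed.

Lemma continuous_ellipse_green : continuous ellipse_green.
Proof.
move=> z; have d0 : 0 < b - a by rewrite subr_gt0.
have cr c : {for z, continuous (fun z : R * R => dist c z.2 z.1)}.
  apply: (@cvg_comp _ _ _ (fun z : R * R => (z.1 - c) ^+ 2 + z.2 ^+ 2) Num.sqrt); last exact: sqrt_continuous.
  apply: cvgD.
    apply: (@cvg_comp _ _ _ (fun z : R * R => z.1 - c) (fun x => x ^+ 2) (nbhs z) (nbhs (z.1 - c))); last exact: exprn_continuous.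
    by apply: cvgB; [exact: cvg_fst|exact: cvg_cst].
  apply: (@cvg_comp _ _ _ (fun z : R * R => z.2) (fun x => x ^+ 2) (nbhs z) (nbhs z.2)); last exact: exprn_continuous.
  exact: cvg_snd.
have cp : {for z, continuous (fun z : R * R => r1 z + r2 z)} by apply: cvgD; exact: cr.
have c2 : {for z, continuous (fun z : R * R => (r1 z + r2 z) ^+ 2 - (b - a) ^+ 2)}.
  apply: cvgB; last exact: cvg_cst.
  apply: (@cvg_comp _ _ _ (fun z : R * R => r1 z + r2 z) (fun x => x ^+ 2) (nbhs z) (nbhs (r1 z + r2 z))); last exact: exprn_continuous.
  exact: cp.
have c3 : {for z, continuous (fun z : R * R => Num.sqrt ((r1 z + r2 z) ^+ 2 - (b - a) ^+ 2))}.
  apply: (@cvg_comp _ _ _ (fun z : R * R => (r1 z + r2 z) ^+ 2 - (b - a) ^+ 2) Num.sqrt); last exact: sqrt_continuous.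
  exact: c2.
apply: cvgB; last exact: cvg_cst.
apply: (@cvg_comp _ _ _ (fun z : R * R => (r1 z + r2 z) + Num.sqrt ((r1 z + r2 z) ^+ 2 - (b - a) ^+ 2)) (@ln R)).
  by apply: cvgD; [exact: cp|exact: c3].
apply: continuous_ln; apply: lt_le_trans d0 _.
by rewrite (le_trans (foci_ge z))// lerDl.
Qed.

Lemma off_segment (x y : R) : ~ (a <= x <= b /\ y = 0) ->
  [/\ 0 < r1 (x, y), 0 < r2 (x, y) & 0 < (r1 (x, y) + r2 (x, y)) ^+ 2 - (b - a) ^+ 2].
Proof.
move=> H; rewrite foci_sqr /=.
have d0 : 0 < b - a by rewrite subr_gt0.
have [y0|y0] := eqVneq y 0; last first.
  have y2 : 0 < y ^+ 2 by rewrite exprn_even_gt0.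
  split; rewrite ?sqrtr_gt0 ?ltr_wpDl ?sqr_ge0//.
  rewrite mulr_gt0//.
  have := foci_prod x y; rewrite /=.
  set P := dist _ _ _ * _; set c := ((x - a) * (x - b) + _) => E.
  have P0 : 0 <= P by rewrite mulr_ge0// sqrtr_ge0.
  have : 0 < (y * (b - a)) ^+ 2 by rewrite exprn_even_gt0//= mulf_neq0// gt_eqF.
  rewrite -E => h; rewrite ltNge; apply/negP => h'.
  have g1 : 0 <= - c - P by lra.
  have g2 : 0 <= - c + P by lra.
  by have := mulr_ge0 g1 g2; nra.
have xab : x < a \/ b < x.
  apply: contrapT => h; apply: H; split=> //; apply/andP; split; rewrite leNgt; apply/negP => h'; apply: h; by [left|right].
subst y; rewrite /dist expr0n /= !addr0 !sqrtr_sqr !normr_gt0 !subr_eq0.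
have pp : 0 < (x - a) * (x - b) by case: xab => ?; nra.
by split; [case: xab => ?; apply/eqP => ?; lra|case: xab => ?; apply/eqP => ?; lra|rewrite mulr_gt0// ltr_wpDr// mulr_ge0].
Qed.

(** The two summands are the second derivatives of [is_derive_line_green'] along a horizontal and a
    vertical line. Over a common denominator the numerator vanishes by [foci_sqr]. *)
Lemma ellipse_green_laplacian (x y : R) : ~ (a <= x <= b /\ y = 0) ->
  let p := r1 (x, y) + r2 (x, y) in let W := Num.sqrt (p ^+ 2 - (b - a) ^+ 2) in
  ((y ^+ 2 / r1 (x, y) ^+ 3 + y ^+ 2 / r2 (x, y) ^+ 3) / W
     - p * ((x - a) / r1 (x, y) + (x - b) / r2 (x, y)) ^+ 2 / W ^+ 3) +
  (((x - a) ^+ 2 / r1 (x, y) ^+ 3 + (x - b) ^+ 2 / r2 (x, y) ^+ 3) / W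
     - p * ((y - 0) / r1 (x, y) + (y - 0) / r2 (x, y)) ^+ 2 / W ^+ 3) = 0.
Proof.
move=> /off_segment[h1 h2 h3] p W.
have W0 : 0 < W by rewrite sqrtr_gt0.
have W2 : W ^+ 2 = p ^+ 2 - (b - a) ^+ 2 by rewrite sqr_sqrtr// ltW.
have e1 : r1 (x, y) ^+ 2 = (x - a) ^+ 2 + y ^+ 2 by rewrite sqr_sqrtr// addr_ge0// sqr_ge0.
have e2 : r2 (x, y) ^+ 2 = (x - b) ^+ 2 + y ^+ 2 by rewrite sqr_sqrtr// addr_ge0// sqr_ge0.
have W2' := foci_sqr x y; rewrite -/p -W2 in W2'.
move: h1 h2 e1 e2 W2'; rewrite /p /=.
move: (dist a y x) (dist b y x) (W) W0 => s1 s2 w w0 h1 h2 e1 e2 W2'.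
have q1 : (x - a) ^+ 2 = s1 ^+ 2 - y ^+ 2 by rewrite e1; ring.
have q2 : (x - b) ^+ 2 = s2 ^+ 2 - y ^+ 2 by rewrite e2; ring.
rewrite q1 q2 subr0.
rewrite (_ : _ + _ = (w ^+ 2 * (s1 + s2) * (s1 * s2) - (s1 + s2) * ((s2 ^+ 2 * ((x - a) ^+ 2 + y ^+ 2) + s1 ^+ 2 * ((x - b) ^+ 2 + y ^+ 2)) + 2 * s1 * s2 * ((x - a) * (x - b) + y ^+ 2))) / (w ^+ 3 * s1 ^+ 2 * s2 ^+ 2)); last by field; rewrite !gt_eqF.
rewrite -e1 -e2 W2'; rewrite (_ : _ - _ = 0) ?mul0r//; ring.
Qed.

Lemma gam_ellipse_green : 0 <= a -> ellipse_green (0, 0) = gam b a.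
Proof.
move=> a0; have b0 : 0 < b by exact: le_lt_trans ab.
have d0 : 0 < b - a by rewrite subr_gt0.
rewrite /ellipse_green /line_green /dist /= expr0n /= !addr0 !sqrtr_sqr !sub0r !normrN.
rewrite (ger0_norm a0) (gtr0_norm b0).
have ea : a = Num.sqrt a ^+ 2 by rewrite sqr_sqrtr.
have eb : b = Num.sqrt b ^+ 2 by rewrite sqr_sqrtr// ltW.
have sab : Num.sqrt a < Num.sqrt b by rewrite ltr_sqrt.
have sa0 := sqrtr_ge0 a; have sb0 : 0 < Num.sqrt b by rewrite sqrtr_gt0.
rewrite /gam; move: (Num.sqrt a) (Num.sqrt b) ea eb sab sa0 sb0 => s t -> -> sab sa0 sb0.
have -> : Num.sqrt ((s ^+ 2 + t ^+ 2) ^+ 2 - (t ^+ 2 - s ^+ 2) ^+ 2) = 2 * s * t.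
  rewrite (_ : _ - _ = (2 * s * t) ^+ 2); last by ring.
  by rewrite sqrtr_sqr ger0_norm// !mulr_ge0// ltW.
rewrite -ln_div ?posrE; last 2 first.
- by rewrite (_ : _ + _ = (t + s) ^+ 2) ?exprn_gt0//; [lra|ring].
- by rewrite (_ : _ - _ = (t - s) * (t + s)) ?mulr_gt0//; [lra|lra|ring].
have h1 : 0 < t - s by lra.
have h2 : 0 < t + s by lra.
rewrite (_ : t ^+ 2 - s ^+ 2 = (t - s) * (t + s)); last by ring.
rewrite (_ : _ + _ = (t + s) * (t + s)); last by ring.
by congr ln; field; rewrite !gt_eqF.
Qed.

Lemma green_near_x (x0 y0 ep : R) : ~ (a <= x0 <= b /\ y0 = 0) -> 0 < ep ->
  exists2 e : R, 0 < e <= ep & forall s, `|s - x0| < e -> ~ (a <= s <= b /\ y0 = 0).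
Proof.
move=> H ep0; have [y00|y00] := eqVneq y0 0; last first.
  by exists ep; [rewrite ep0 /=|move=> s _ [_]; apply/eqP].
have xab : x0 < a \/ b < x0.
  apply: contrapT => h; apply: H; split=> //; apply/andP; split; rewrite leNgt; apply/negP => h'; apply: h; by [left|right].
case: xab => h.
  exists (Num.min ep (a - x0)); first by rewrite lt_min ep0 subr_gt0 h ge_min lexx.
  move=> s; rewrite lt_min => /andP[_]; rewrite ltr_norml => /andP[h1 h2] [/andP[h3 h4] _]; lra.
exists (Num.min ep (x0 - b)); first by rewrite lt_min ep0 subr_gt0 h ge_min lexx.
move=> s; rewrite lt_min => /andP[_]; rewrite ltr_norml => /andP[h1 h2] [/andP[h3 h4] _]; lra.
Qed.

Lemma green_near_y (x0 y0 ep : R) : ~ (a <= x0 <= b /\ y0 = 0) -> 0 < ep ->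
  exists2 e : R, 0 < e <= ep & forall s, `|s - y0| < e -> ~ (a <= x0 <= b /\ s = 0).
Proof.
move=> H ep0; have [y00|y00] := eqVneq y0 0; last first.
  exists (Num.min ep `|y0|); first by rewrite lt_min ep0 normr_gt0 y00 ge_min lexx.
  by move=> s; rewrite lt_min => /andP[_ h] [_ s0]; move: h; rewrite s0 sub0r normrN ltxx.
by exists ep; [rewrite ep0 /=|move=> s _ [h _]; apply: H].
Qed.

(** If [g (0, 0) > gam b a], the function [h] is maximized on a large square. At infinity [g] is
    known only up to a bounded error, so [ellipse_green] gets the factor [1 + ep] to win on the
    boundary; the term [dl * z.1 ^+ 2] makes the Laplacian of [h] equal to [2 * dl > 0], which
    excludes a maximum in the interior off the segment. *)
Lemma green_le (g : R * R -> R) : 0 < a -> is_green_infty `[a, b]%classic g -> g (0, 0) <= gam b a.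
Proof.
move=> a0 [hg cg gS [M [r gM]]].
have d0 : 0 < b - a by rewrite subr_gt0.
have b0 : 0 < b by exact: lt_trans ab.
rewrite leNgt; apply/negP => Hlt.
pose gm := gam b a.
have gm0 : 0 <= gm by rewrite /gm -gam_ellipse_green ?ellipse_green_ge0// ltW.
pose eta0 := g (0, 0) - gm.
have eta00 : 0 < eta0 by rewrite subr_gt0.
pose ep := eta0 / (2 * (gm + 1)).
have ep0 : 0 < ep by rewrite divr_gt0// mulr_gt0// ltr_wpDl.
pose eta := g (0, 0) - (1 + ep) * gm.
have eta_gt0 : 0 < eta.
  have : ep * gm <= eta0 / 2.
    rewrite /ep mulrAC ler_pdivrMr ?mulr_gt0 ?ltr_wpDl//.
    rewrite (_ : _ / 2 * _ = eta0 * (gm + 1)); last by field.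
    by rewrite ler_pM2l// lerDl.
  rewrite /eta; have : g (0, 0) = eta0 + gm by rewrite subrK.
  by move=> ->; lra.
(* On the boundary of the square [ep * ln rho] has to outweigh the bounded terms [ln 2 + M] and
   [(1 + ep) * ln (b - a)]. *)
pose T := ((ln 2 + M) + (1 + ep) * ln (b - a)) / ep.
pose rho := Num.max (Num.max r 1) (Num.max (2 * b) (expR T)).
have [rr r1_] : r <= rho /\ 1 <= rho by split; rewrite !le_max lexx ?orbT.
have [rb rT] : 2 * b <= rho /\ expR T <= rho by split; rewrite !le_max lexx ?orbT.
have rho0 : 0 < rho by lra.
(* The added term is then at most [eta / 2] on the square, half of [h (0, 0) = eta]; so the maximum
   cannot be attained on the segment, where [g] vanishes. *)
pose dl := eta / (2 * rho ^+ 2).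
have dl0 : 0 < dl by rewrite divr_gt0// mulr_gt0// exprn_gt0.
have dlr : dl * rho ^+ 2 = eta / 2 by rewrite /dl; field; rewrite gt_eqF.
pose h (z : R * R) := g z - (1 + ep) * ellipse_green z + dl * z.1 ^+ 2.
have ch : continuous h.
  move=> z; apply: cvgD.
    apply: cvgB; first exact: cg.
    by apply: cvgM; [exact: cvg_cst|exact: continuous_ellipse_green].
  apply: cvgM; first exact: cvg_cst.
  apply: (@cvg_comp _ _ _ (fun z : R * R => z.1) (fun x => x ^+ 2) (nbhs z) (nbhs z.1)); last exact: exprn_continuous.
  exact: cvg_fst.
pose I : set R := `[- rho, rho]%classic.
have I0 : I 0 by rewrite /I /= in_itv /=; apply/andP; split; lra.
have cB : compact (I `*` I) by apply: compact_setX; exact: segment_compact.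
have [[x0 y0] /set_mem[/= xI yI] hmax] : exists2 c : R * R, c \in I `*` I & forall t, t \in I `*` I -> h t <= h c.
  by apply: compact_EVT_max => //; [exists (0, 0)|exact: continuous_subspaceT].
have hge : eta <= h (x0, y0).
  have := hmax (0, 0) (mem_set (conj I0 I0)); rewrite {1}/h /= (gam_ellipse_green (ltW a0)).
  by rewrite expr0n /= mulr0 addr0.
move: xI yI; rewrite /I /= !in_itv /= => /andP[x1 x2] /andP[y1 y2].
have dx2 : dl * x0 ^+ 2 <= eta / 2.
  rewrite -dlr ler_pM2l// -[x0 ^+ 2]real_normK ?num_real// ler_sqr ?nnegrE//; last exact: ltW.
  by rewrite ler_norml x1.
have nS : ~ (a <= x0 <= b /\ y0 = 0).
  move=> [xab y00]; move: hge; rewrite /h y00 gS; last by rewrite /= in_itv.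
  have := ellipse_green_ge0 (x0, 0) => G0 /=; rewrite sub0r => hge.
  have : 0 <= (1 + ep) * ellipse_green (x0, 0) by rewrite mulr_ge0//; lra.
  by move=> ?; lra.
have bd : `|x0| < rho /\ `|y0| < rho.
  apply: contrapT => nb.
  have mx : rho <= Num.max `|x0| `|y0|.
    rewrite leNgt; apply/negP; rewrite gt_max => /andP[? ?]; exact: nb.
  have sqx := sqr_ge0 x0; have sqy := sqr_ge0 y0.
  have mod1 : rho <= modulus (x0, y0).
    apply: le_trans mx _; rewrite /modulus /= ge_max -!sqrtr_sqr !ler_wsqrtr ?lerDl ?lerDr//.
  have mod2 : modulus (x0, y0) <= 2 * rho.
    rewrite /modulus /= -[leRHS]ger0_norm; last by lra.
    rewrite -sqrtr_sqr ler_wsqrtr//; nra.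
  have ge : ln rho - ln (b - a) <= ellipse_green (x0, y0).
    rewrite /ellipse_green lerD2r /line_green ler_ln ?posrE//; last first.
      by apply: lt_le_trans d0 _; rewrite (le_trans (foci_ge (x0, y0)))// lerDl.
    apply: (@le_trans _ _ (dist a y0 x0 + dist b y0 x0)); last by rewrite lerDl.
    have q c : 0 < c -> c <= b -> rho / 2 <= dist c y0 x0.
      move=> c0 cb; move: mx; rewrite le_max => /orP[hx|hy].
        apply: le_trans (dist_ge c y0 x0).
        by have := ler_dist_dist x0 c; have := ler_norm (`|x0| - `|c|); rewrite (gtr0_norm c0) => ? ?; lra.
      apply: (@le_trans _ _ `|y0|); first by lra.
      by rewrite /dist -sqrtr_sqr ler_wsqrtr// lerDr sqr_ge0.
    have := q a a0 (ltW ab); have := q b b0 (lexx _); move=> ? ?; lra.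
  have gle : g (x0, y0) <= ln 2 + ln rho + M.
    have := gM (x0, y0) (le_trans rr mod1); rewrite ler_norml => /andP[_ h1].
    have m0 : 0 < modulus (x0, y0) by exact: lt_le_trans mod1.
    have : ln (modulus (x0, y0)) <= ln 2 + ln rho.
      by rewrite -lnM ?posrE// ler_ln ?posrE// mulr_gt0.
    by lra.
  have lT : T <= ln rho by rewrite -ler_expR lnK// posrE.
  have epT : ep * T = (ln 2 + M) + (1 + ep) * ln (b - a) by rewrite /T; field; rewrite gt_eqF.
  have : ep * T <= ep * ln rho by rewrite ler_pM2l.
  have : (1 + ep) * (ln rho - ln (b - a)) <= (1 + ep) * ellipse_green (x0, y0) by rewrite ler_pM2l//; lra.
  move: hge; rewrite /h /= epT; nra.
have [bx by_] := bd.
have rx0 : 0 < rho - `|x0| by rewrite subr_gt0.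
have ry0 : 0 < rho - `|y0| by rewrite subr_gt0.
have [ex /andP[ex0 exr] Hex] := green_near_x nS rx0.
have [ey /andP[ey0 eyr] Hey] := green_near_y nS ry0.
have dgx s : `|s - x0| < ex -> is_derive s 1 (fun s => h (s, y0))
    (dx g (s, y0) - (1 + ep) * line_green' a y0 b y0 (b - a) s + dl * (2 * s)).
  move=> sx; have nSs := Hex s sx.
  have [h1 h2 h3] := off_segment nSs.
  have [[[dg1 _] _] _ _ _] := hg (s, y0) nSs.
  have D1 := is_derive_dx dg1.
  have D2 := @is_derive_line_green a y0 b y0 (b - a) s h1 h2 h3.
  have D2' := @is_deriveB _ _ _ _ _ _ _ _ _ D2 (is_derive_cst (ln (b - a)) s 1).
  have D3 := is_deriveZ (1 + ep) D2'.
  have D4 := is_deriveZ dl (@is_deriveX R R id 2 s 1 _ (is_derive_id s 1)).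
  have D5 := @is_deriveD _ _ _ _ _ _ _ _ _ (@is_deriveB _ _ _ _ _ _ _ _ _ D1 D3) D4.
  by apply: (is_derive_eq D5); rewrite /GRing.scale /= subr0 expr1 mulr1.
have dgy s : `|s - y0| < ey -> is_derive s 1 (fun s => h (x0, s))
    (dy g (x0, s) - (1 + ep) * line_green' 0 (x0 - a) 0 (x0 - b) (b - a) s).
  move=> sy; have nSs := Hey s sy.
  have [h1 h2 h3] := off_segment nSs.
  have ed c : dist 0 (x0 - c) s = dist c s x0 by rewrite /dist subr0 addrC.
  have [[[_ dg1] _] _ _ _] := hg (x0, s) nSs.
  have D1 := is_derive_dy dg1.
  have D2 := @is_derive_line_green 0 (x0 - a) 0 (x0 - b) (b - a) s.
  rewrite !ed in D2; have {}D2 := D2 h1 h2 h3.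
  have D2' := @is_deriveB _ _ _ _ _ _ _ _ _ D2 (is_derive_cst (ln (b - a)) s 1).
  have D3 := is_deriveZ (1 + ep) D2'.
  have D5 := @is_deriveD _ _ _ _ _ _ _ _ _ (@is_deriveB _ _ _ _ _ _ _ _ _ D1 D3) (is_derive_cst (dl * x0 ^+ 2) s 1).
  have E : (fun s => h (x0, s)) =
      (fun s => g (x0, s) - (1 + ep) * (line_green 0 (x0 - a) 0 (x0 - b) (b - a) s - ln (b - a)) + dl * x0 ^+ 2).
    apply/funext => s'; rewrite /h /ellipse_green /line_green /=.
    by rewrite /dist !subr0 ![(x0 - _) ^+ 2 + _]addrC.
  by rewrite E; apply: (is_derive_eq D5); rewrite /GRing.scale /= subr0 addr0.
have nx : `|x0 - x0| < ex by rewrite subrr normr0.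
have ny : `|y0 - y0| < ey by rewrite subrr normr0.
have [h1 h2 h3] := off_segment nS.
have [[_ [[dxx _] [_ dyy]]] _ _ lap] := hg (x0, y0) nS.
have lx : dx (dx g) (x0, y0) - (1 + ep) * ((y0 ^+ 2 / dist a y0 x0 ^+ 3 + y0 ^+ 2 / dist b y0 x0 ^+ 3) /
     Num.sqrt ((dist a y0 x0 + dist b y0 x0) ^+ 2 - (b - a) ^+ 2)
     - (dist a y0 x0 + dist b y0 x0) * ((x0 - a) / dist a y0 x0 + (x0 - b) / dist b y0 x0) ^+ 2 /
     Num.sqrt ((dist a y0 x0 + dist b y0 x0) ^+ 2 - (b - a) ^+ 2) ^+ 3) + dl * 2 <= 0.
  apply: (second_derivative_at_max ex0 dgx).
    have D1 := is_derive_dx dxx.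
    have D2 := @is_derive_line_green' a y0 b y0 (b - a) x0 h1 h2 h3.
    have D3 := is_deriveZ (1 + ep) D2.
    have D4 := is_deriveZ dl (is_deriveZ 2 (is_derive_id x0 1)).
    have D5 := @is_deriveD _ _ _ _ _ _ _ _ _ (@is_deriveB _ _ _ _ _ _ _ _ _ D1 D3) D4.
    by apply: (is_derive_eq D5); rewrite /GRing.scale /= mulr1.
  move=> s sx; apply: hmax; apply/mem_set; split; rewrite /I /= in_itv /= ?y1 ?y2//.
  by rewrite -ler_norml -(subrK x0 s) (le_trans (ler_normD _ _))//; clear -sx exr; lra.
have ly : dy (dy g) (x0, y0) - (1 + ep) * (((x0 - a) ^+ 2 / dist a y0 x0 ^+ 3 + (x0 - b) ^+ 2 / dist b y0 x0 ^+ 3) /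
     Num.sqrt ((dist a y0 x0 + dist b y0 x0) ^+ 2 - (b - a) ^+ 2)
     - (dist a y0 x0 + dist b y0 x0) * ((y0 - 0) / dist a y0 x0 + (y0 - 0) / dist b y0 x0) ^+ 2 /
     Num.sqrt ((dist a y0 x0 + dist b y0 x0) ^+ 2 - (b - a) ^+ 2) ^+ 3) <= 0.
  apply: (second_derivative_at_max ey0 dgy).
    have D1 := is_derive_dy dyy.
    have ed c : dist 0 (x0 - c) y0 = dist c y0 x0 by rewrite /dist subr0 addrC.
    have D2 := @is_derive_line_green' 0 (x0 - a) 0 (x0 - b) (b - a) y0.
    rewrite !ed in D2; have {}D2 := D2 h1 h2 h3.
    have D3 := is_deriveZ (1 + ep) D2.
    have D5 := @is_deriveB _ _ _ _ _ _ _ _ _ D1 D3.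
    exact: (is_derive_eq D5).
  move=> s sx; apply: hmax; apply/mem_set; split; rewrite /I /= in_itv /= ?x1 ?x2//.
  by rewrite -ler_norml -(subrK y0 s) (le_trans (ler_normD _ _))//; clear -sx eyr; lra.
have /= := ellipse_green_laplacian nS.
move: lx ly.
set A := (X in _ - (1 + ep) * X + _ <= 0); set B := (X in _ - (1 + ep) * X <= 0) => lx ly AB.
have e0 : (1 + ep) * A + (1 + ep) * B = 0 by rewrite -mulrDr AB mulr0.
by clear -lx ly lap dl0 e0; lra.
Qed.

(** For [a = 0] the origin belongs to the interval, where a Green function vanishes by definition;
    [green_le] covers the origin outside of it. *)
Lemma green_infty_le : 0 <= a -> green_infty `[a, b]%classic (0, 0) <= gam b a.
Proof.
move=> a0; rewrite /green_infty.
have gm0 : 0 <= gam b a by rewrite -gam_ellipse_green// ellipse_green_ge0.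
case: xgetP => [g -> hg|//].
move: a0; rewrite le_eqVlt => /predU1P[a0|a0]; last exact: green_le.
have [_ _ -> //] := hg.
by rewrite /= in_itv /= -a0 lexx a0 ltW.
Qed.

End GreenBound.

(** * The upper bound *)

Section SupNorm.
Variable R : realType.

Lemma supnorm_ge0 (q : {poly R}) (S : set R) : 0 <= supnorm q S.
Proof.
have [h|h] := pselect (has_sup [set `|q.[x]| | x in S]); last by rewrite /supnorm sup_out.
have [[_ [x Sx _]] ub] := h.
by apply: le_trans (normr_ge0 q.[x]) _; apply: ub_le_sup => //; exists x.
Qed.

Lemma supnorm_le (q : {poly R}) (S : set R) (M : R) : S !=set0 ->
  (forall x, S x -> `|q.[x]| <= M) -> supnorm q S <= M.
Proof.
move=> [x0 S0] H; apply: ge_sup; first by exists `|q.[x0]|, x0.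
by move=> _ [x Sx <-]; exact: H.
Qed.

Lemma le_supnorm (q : {poly R}) (u v x : R) : u <= x <= v -> `|q.[x]| <= supnorm q `[u, v]%classic.
Proof.
move=> /andP[ux xv]; have uv := le_trans ux xv.
have cq : {within `[u, v], continuous (fun x => `|q.[x]|)}.
  apply: continuous_subspaceT => y; apply: (@cvg_comp _ _ _ (horner q) (@Num.norm R R)); first exact: continuous_horner.
  exact: norm_continuous.
have [c _ Hc] := EVT_max uv cq.
apply: ub_le_sup; last by exists x => //; rewrite /= in_itv /= ux.
by exists `|q.[c]| => _ [y yI <-]; exact: Hc.
Qed.

Lemma En_le m (A : 'M[R]_m) (S : set R) n q : admissible_poly A S n q ->
  En A n S <= supnorm q S / `|q.[0]|.
Proof.
move=> h; apply: ge_inf; last by exists q.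
by exists 0 => _ [p _ <-]; rewrite divr_ge0 ?supnorm_ge0.
Qed.

Lemma En_ge m (A : 'M[R]_m) (S : set R) n M : (exists q, admissible_poly A S n q) ->
  (forall q, admissible_poly A S n q -> M <= supnorm q S / `|q.[0]|) -> M <= En A n S.
Proof.
move=> [q hq] H; apply: lb_le_inf; first by exists (supnorm q S / `|q.[0]|), q.
by move=> _ [p hp <-]; exact: H.
Qed.

(** A polynomial admissible for [u, v] vanishes at the eigenvalues outside, so its maximum over the
    spectrum is at most the one over [u, v]. *)
Lemma En_spectrum_le m (A : 'M[R]_m) (u v : R) n : spectrum A !=set0 -> u <= v ->
  (exists q, admissible_poly A `[u, v]%classic n q) ->
  En A n (spectrum A) <= En A n `[u, v]%classic.
Proof.
move=> S0 uv ex; apply: En_ge => // q [q1 q2 q3].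
have aq : admissible_poly A (spectrum A) n q by split.
apply: le_trans (En_le aq) _; rewrite ler_pM2r ?invr_gt0 ?normr_gt0//.
apply: supnorm_le => // x Sx; have [xI|xI] := pselect (`[u, v]%classic x).
  by apply: le_supnorm; move: xI; rewrite /= in_itv.
by rewrite q3// normr0 supnorm_ge0.
Qed.

End SupNorm.

(** * Riemann sums of monotone functions *)

Section StepIntegral.
Variable R : realType.
Local Notation mu := (@lebesgue_measure R).

Lemma grid_itv (t : R) k i : 0 < t -> (0 < k)%N -> (i <= k)%N -> 0 <= i%:R * (t / k%:R) <= t.
Proof. by move=> t0 k0 ik; have [-> ->] := step_lt t0 k0 ik. Qed.

(** With [c = false] the cells are closed: they cover [0, t] and serve for upper bounds. With
    [c = true] they are half-open, hence disjoint, and serve for lower bounds. *)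
Definition cell (t : R) (k : nat) (c : bool) (i : nat) : set (measurableTypeR R) :=
  [set` Interval (BLeft (i%:R * (t / k%:R))) (BSide c (i.+1%:R * (t / k%:R)))].

Definition stepf (t : R) (k : nat) (c : bool) (v : nat -> R) (s : R) : R :=
  \sum_(0 <= i < k) v i * \1_(cell t k c i) s.

Lemma stepf_integral (t : R) k (v : nat -> R) (c : bool) : 0 < t -> (0 < k)%N ->
  (forall i, 0 <= v i) ->
  (\int[mu]_(s in `[0%R, t]) (stepf t k c v s)%:E = (t / k%:R * \sum_(0 <= i < k) v i)%:E)%E.
Proof.
move=> t0 k0 v0.
have mI i : measurable (cell t k c i : set (measurableTypeR R)) by exact: measurable_itv.
have m1 i : measurable_fun `[0%R, t]%classic (fun s : measurableTypeR R => (v i * \1_(cell t k c i) s)%:E).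
  apply/measurable_EFinP; apply: measurable_funM; first exact: measurable_cst.
  by apply: measurable_indic; exact: mI.
have d0 : 0 < t / k%:R by rewrite divr_gt0// ltr0n.
under eq_integral => s _ do rewrite -sumEFin.
rewrite ge0_integral_sum//; last first.
  by move=> i s _; rewrite lee_fin mulr_ge0.
rewrite mulr_sumr -sumEFin; apply: eq_big_nat => i /andP[_ ik].
under eq_integral => s _ do rewrite EFinM.
rewrite ge0_integralZl//; last first.
  by rewrite lee_fin.
  by apply/measurable_EFinP; exact: measurable_indic.
rewrite integral_indic// setIidl; last first.
  move=> s; rewrite /cell /= !in_itv /= => /andP[h1 h2].
  have /andP[g1 _] := grid_itv t0 k0 (ltnW ik); have /andP[_ g2] := grid_itv t0 k0 ik.
  rewrite (le_trans g1 h1) /=; apply: le_trans g2.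
  by move: h2; case: (c) => //= /ltW.
rewrite mulrC EFinM; congr (_ * _)%E.
rewrite [LHS](lebesgue_measure_itv (Interval (BLeft (i%:R * (t / k%:R))) (BSide c (i.+1%:R * (t / k%:R))))) /= lte_fin ltr_pM2r// ltr_nat ltnSn.
by rewrite -EFinB; congr EFin; rewrite -mulrBl -natrB// subSnn mul1r.
Qed.

Lemma stepf_ge0 t k c v s : (forall i, 0 <= v i) -> 0 <= stepf t k c v s.
Proof. by move=> v0; apply: sumr_ge0 => i _; rewrite mulr_ge0. Qed.

Lemma stepf_ge t k c v s j : (forall i, 0 <= v i) -> (j < k)%N -> cell t k c j s -> v j <= stepf t k c v s.
Proof.
move=> v0 jk sj; rewrite /stepf (big_cat_nat _ (n := j)) ?(ltnW jk)//= (@big_ltn _ _ _ j)//.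
rewrite (_ : \1_(cell t k c j) s = 1); last by rewrite indicE mem_set.
have h1 : 0 <= \sum_(0 <= i < j) v i * \1_(cell t k c i) s by apply: sumr_ge0 => i _; rewrite mulr_ge0.
have h2 : 0 <= \sum_(j.+1 <= i < k) v i * \1_(cell t k c i) s by apply: sumr_ge0 => i _; rewrite mulr_ge0.
by rewrite mulr1; lra.
Qed.

Lemma cell_cover (t : R) k s : 0 < t -> (0 < k)%N -> 0 <= s <= t ->
  exists2 j, (j < k)%N & cell t k false j s.
Proof.
move=> t0 k0 /andP[s0 st].
have d0 : 0 < t / k%:R by rewrite divr_gt0// ltr0n.
have key m d : 0 < d -> s <= m.+1%:R * d -> exists2 j, (j < m.+1)%N & j%:R * d <= s <= j.+1%:R * d.
  move=> d_gt0; elim: m => [h|m IH h]; first by exists 0%N; rewrite // mul0r s0.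
  have [h1|h1] := leP s (m.+1%:R * d).
    by have [j jk] := IH h1; exists j => //; exact: ltnW.
  by exists m.+1 => //=; rewrite ltW.
case: k k0 d0 => // k _ d0; have [|j jk js] := key k _ d0.
  by rewrite mulrCA divff ?mulr1// pnatr_eq0.
by exists j => //; rewrite /cell /= in_itv.
Qed.

Lemma Rintegral_le_step (t : R) k (phi u : R -> R) : 0 < t -> (0 < k)%N ->
  (forall s, 0 <= s <= t -> 0 <= phi s) ->
  (forall s s', 0 <= s -> s <= s' -> s' <= t -> phi s <= phi s') ->
  (forall s, 0 <= s <= t -> u s <= phi s) ->
  \int[mu]_(s in `[0, t]) u s <= t / k%:R * \sum_(1 <= i < k.+1) phi (i%:R * (t / k%:R)).
Proof.
move=> t0 k0 p0 pm up.
(* The minimum keeps [v i] nonnegative for all [i], also beyond the last cell. *)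
pose v i := phi (Num.min (i.+1%:R * (t / k%:R)) t).
have v0 i : 0 <= v i.
  apply: p0; rewrite le_min ge_min lexx orbT andbT (ltW t0) andbT.
  by rewrite mulr_ge0// divr_ge0// ltW.
have vE i : (i < k)%N -> v i = phi (i.+1%:R * (t / k%:R)).
  by move=> ik; rewrite /v min_l//; have /andP[] := grid_itv t0 k0 ik.
have E := stepf_integral false t0 k0 v0.
have -> : t / k%:R * \sum_(1 <= i < k.+1) phi (i%:R * (t / k%:R)) = \int[mu]_(s in `[0, t]) stepf t k false v s.
  rewrite /Rintegral E big_add1 /=; congr (_ * _).
  by apply: eq_big_nat => i /andP[_ ik]; rewrite vE.
apply: Rintegral_le.
- move=> s; rewrite /= in_itv /= => h; have /andP[s0 st] := h.
  apply: le_trans (up s h) _.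
  have [j jk js] := cell_cover t0 k0 h.
  apply: le_trans (stepf_ge v0 jk js); rewrite vE//.
  move: js; rewrite /cell /= in_itv /= => /andP[_ js].
  by apply: pm => //; have /andP[] := grid_itv t0 k0 jk.
- by move=> s _; exact: stepf_ge0.
- by rewrite E ltry.
Qed.

Lemma step_le_Rintegral (t : R) k (phi : R -> R) : 0 < t -> (0 < k)%N ->
  (forall s, 0 <= s <= t -> 0 <= phi s) ->
  (forall s s', 0 <= s -> s <= s' -> s' <= t -> phi s <= phi s') ->
  t / k%:R * \sum_(0 <= i < k) phi (i%:R * (t / k%:R)) <= \int[mu]_(s in `[0, t]) phi s.
Proof.
move=> t0 k0 p0 pm.
have d0 : 0 < t / k%:R by rewrite divr_gt0// ltr0n.
pose v i := phi (Num.min (i%:R * (t / k%:R)) t).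
have v0 i : 0 <= v i.
  apply: p0; rewrite le_min ge_min lexx orbT andbT (ltW t0) andbT.
  by rewrite mulr_ge0// divr_ge0// ltW.
have vE i : (i < k)%N -> v i = phi (i%:R * (t / k%:R)).
  by move=> ik; rewrite /v min_l//; have /andP[] := grid_itv t0 k0 (ltnW ik).
have E := stepf_integral true t0 k0 v0.
have -> : t / k%:R * \sum_(0 <= i < k) phi (i%:R * (t / k%:R)) = \int[mu]_(s in `[0, t]) stepf t k true v s.
  rewrite /Rintegral E; congr (_ * _).
  by apply: eq_big_nat => i /andP[_ ik]; rewrite vE.
apply: Rintegral_le.
- move=> s; rewrite /= in_itv /= => h; have /andP[s0 st] := h.
  rewrite /stepf.
  (* The partial sum stays 0 as long as [s] is to the right of its cells, so at most one term is
     nonzero. *)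
  have H m : (m <= k)%N -> \sum_(0 <= i < m) v i * \1_(cell t k true i) s <= phi s /\
      (m%:R * (t / k%:R) <= s -> \sum_(0 <= i < m) v i * \1_(cell t k true i) s = 0).
    elim: m => [|m IH] mk; first by rewrite big_geq//; split => //; exact: p0.
    have [IH1 IH2] := IH (ltnW mk); rewrite big_nat_recr//=.
    rewrite indicE; case: (boolP (s \in _)) => [/set_mem|/negP sm].
      rewrite /cell /= in_itv /= => /andP[h1 h2]; rewrite IH2// add0r mulr1; split.
        by rewrite vE//; apply: pm => //; have /andP[] := grid_itv t0 k0 (ltnW mk).
      by rewrite leNgt h2.
    rewrite mulr0 addr0; split=> // hm; apply: IH2; apply: le_trans hm.
    by rewrite ler_pM2r// ler_nat.
  by have [] := H k (leqnn k).
- by move=> s; rewrite /= in_itv /=; exact: p0.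
- apply: (@le_lt_trans _ _ (\int[mu]_(s in `[0%R, t]) (phi t)%:E)%E).
    apply: ge0_le_integral_nomeasurable => s; rewrite /= in_itv /= => /andP[s0 st].
      by rewrite lee_fin p0// s0.
    by rewrite lee_fin pm.
  by rewrite integral_cst//= lebesgue_measure_itv /= lte_fin t0 -EFinB -EFinM ltry.
Qed.

End StepIntegral.

(** * The exponential upper bound with a universal constant *)

Section ExtremalConstant.
Variable R : realType.
Local Notation mu := (@lebesgue_measure R).
Local Notation measR := {finite_measure set (measurableTypeR R) -> \bar R}.

Lemma admissible_enum m (A : 'M[R]_m) k lam (n d : nat) b (q : {poly R}) : enumerates_spectrum A k lam ->
  (forall x, spectrum A x -> x <= b) -> (d < k)%N ->
  (size q <= n.+1)%N -> q.[0] != 0 -> (forall j, (j < d)%N -> q.[lam j.+1] = 0) ->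
  admissible_poly A `[lam d.+1, b]%classic n q.
Proof.
move=> [inc spE] sb dk q1 q2 q3; split=> // x Sx xI.
have [j /andP[j1 jk] xj] := (spE x).1 Sx.
have [jd|jd] := leqP j d; first by rewrite xj -(prednK j1) q3// prednK.
exfalso; apply: xI; rewrite /= in_itv /= sb// andbT xj.
by move: jd; rewrite leq_eqVlt => /predU1P[<-//|jd]; rewrite ltW// inc.
Qed.

Lemma green_integral_le a0 b (sigma : measR) f (t : R) k : constraint_data a0 b sigma f ->
  0 < t -> (t%:E < sigma setT)%E -> (0 < k)%N ->
  \int[mu]_(s in `[0, t]) green_infty (St a0 b sigma s) (0, 0) <= t / k%:R * gam_sum a0 b sigma t k.
Proof.
move=> cd t0 tS k0.
have /andP[a00 a0b] := cd_bounds cd.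
have sS s : s <= t -> (s%:E < sigma setT)%E by move=> st; apply: le_lt_trans tS; rewrite lee_fin.
rewrite /gam_sum; apply: (@Rintegral_le_step R t k (fun s => gam b (left_endpoint a0 b sigma s))) => //.
- move=> s /andP[s0 st]; have [h1 h2 _] := left_endpointP cd s0 (sS _ st).
  by apply: gam_ge0 => //; exact: le_trans h1.
- move=> s s' s0 ss st; have [h1 h2 _] := left_endpointP cd s0 (sS _ (le_trans ss st)).
  have [h3 h4 _] := left_endpointP cd (le_trans s0 ss) (sS _ st).
  by apply: gam_le => //; [exact: le_trans h1|apply: (endpoint_le cd) => //; exact: sS].
- move=> s /andP[s0 st]; have [h1 h2 _] := left_endpointP cd s0 (sS _ st).
  by apply: green_infty_le => //; exact: le_trans h1.
Qed.

(* Upper bound of the theorem in terms of a Riemann sum of [s |-> g_S(s)(0)]. *)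
Lemma constrained_poly_sigma : exists C : R,
  forall a0 b (sigma : measR) f, constraint_data a0 b sigma f ->
  forall (n d k : nat) (lam : nat -> R) (t : R), (0 < n)%N -> (1 < k)%N -> (d <= n)%N ->
  0 < t -> (t%:E < sigma setT)%E ->
  (forall j, (j < d)%N -> lam j < left_endpoint a0 b sigma t /\
     (((t * j.+1%:R / n%:R))%:E <= sigma [set` `]-oo, lam j]])%E) ->
  exists q : {poly R},
    [/\ (size q <= n.+1)%N, q.[0] = 1, forall j, (j < d)%N -> 0 < lam j /\ q.[lam j] = 0 &
      forall x, left_endpoint a0 b sigma t <= x <= b ->
        `|q.[x]| <= expR (C - n%:R / k%:R * (gam_sum a0 b sigma t k - 2 * gam b (left_endpoint a0 b sigma t)))].
Proof.
have [C HC] := @constrained_poly_exists R.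
exists C => a0 b sigma f cd n d k lam t n0 k1 dn t0 tS H.
have k0 : (0 < k)%N by exact: ltnW.
have [_ ab _] := left_endpointP cd (ltW t0) tS.
have [|j jd|q [q1 q2 q3 q4]] := HC b (left_endpoint a0 b sigma t) k n d (shifted_endpoint a0 b sigma t k) lam k0 n0 ab dn.
- by move=> i ik; apply: (shifted_endpoint_itv cd).
- have [h1 h2] := H j jd; split=> //.
  have aX : a0 < lam j.
    rewrite ltNge; apply/negP => la.
    have : (sigma [set` `]-oo, lam j]] <= 0)%E.
      have /andP[_ a0b] := cd_bounds cd.
      apply: (@le_trans _ _ (sigma [set` `]-oo, a0]])%E).
        apply: le_measure; rewrite ?inE//= => x /=; rewrite !in_itv /= => h; exact: le_trans la.
      by rewrite (sigma_halfline cd (ltW a0b)) set_itv_ge ?measure0// bnd_simp ltxx.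
    apply/negP; rewrite -ltNge; apply: lt_le_trans h2.
    by rewrite lte_fin divr_gt0 ?mulr_gt0 ?ltr0n.
  have := le_lt_trans h2 (mass_lt_arcang cd t0 tS k1 aX h1); rewrite lte_fin.
  set S := \sum_(0 <= i < k) _ => h3.
  rewrite -(ltr_pM2l (divr_gt0 t0 (_ : 0 < n%:R))) ?ltr0n//.
  rewrite (_ : t / n%:R * _ = t * j.+1%:R / n%:R); last by rewrite mulrAC.
  rewrite (_ : t / n%:R * _ = t / k%:R * S)//.
  by field; rewrite !pnatr_eq0 !gtn_eqF.
exists q; split=> // x xI; apply: le_trans (q4 x xI) _.
rewrite ler_expR lerD2l lerN2 ler_wpM2l ?divr_ge0//.
exact: (gam_sum_shifted cd).
Qed.

Lemma extremal_constant_le : exists C_BW : R,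
    forall (a0 b : R) (sigma : measR) (f : R -> R),
    constraint_data a0 b sigma f ->
    forall (m : nat) (A : 'M[R]_m) (k : nat) (lam : nat -> R),
    posdef A ->
    enumerates_spectrum A k lam ->
    (forall x, spectrum A x -> x <= b) ->
    forall N n d : nat,
    (0 < N)%N ->
    (2 <= n)%N ->
    ((n%:R / N%:R)%:E < sigma setT)%E ->
    (d <= n - 2)%N ->
    (forall j, (1 <= j <= d)%N ->
      ((j%:R / N%:R)%:E <= sigma [set` `]-oo, lam j]])%E) ->
    splitting_index k lam (left_endpoint a0 b sigma (n%:R / N%:R)) d ->
    En A n (spectrum A) <= En A n `[lam d.+1, b]%classic /\
    En A n `[lam d.+1, b]%classic <=
      expR (C_BW - N%:R *
        \int[lebesgue_measure]_(t in `[0, n%:R / N%:R])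
          green_infty (St a0 b sigma t) (0, 0)).
Proof.
have [C HC] := constrained_poly_sigma.
exists (C + 1) => a0 b sigma f cd m A k lam pA enum sb N n d N0 n2 tS dn mass [dk lamd lamd1].
set t := n%:R / N%:R in tS lamd lamd1 *.
have n0 : (0 < n)%N by exact: ltnW.
have t0 : 0 < t by rewrite divr_gt0// ltr0n.
have [inc spE] := enum.
have [ha0 ab _] := left_endpointP cd (ltW t0) tS.
set a := left_endpoint a0 b sigma t in lamd lamd1 ha0 ab *.
have /andP[a00 a0b] := cd_bounds cd.
have g0 : 0 <= gam b a by apply: gam_ge0 => //; exact: le_trans ha0.
(* The loss [n / K * (2 * gam b a)] from shifting the grid becomes at most 1, which is the 1 in
   [C + 1]; the successors provide [1 < K]. *)
pose K := (Num.truncn (2 * n%:R * gam b a)).+2.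
have Sp j : (1 <= j <= k)%N -> spectrum A (lam j) by move=> h; apply/spE; exists j.
have Hj j : (j < d)%N -> lam j.+1 < a /\ ((t * j.+1%:R / n%:R)%:E <= sigma [set` `]-oo, lam j.+1]])%E.
  move=> jd; split.
    have /lamd h : (0 < d)%N by exact: leq_ltn_trans jd.
    apply: le_lt_trans h; move: jd; rewrite leq_eqVlt => /predU1P[->//|jd].
    by rewrite ltW// inc// ltnW.
  rewrite (_ : t * _ / _ = j.+1%:R / N%:R); first by apply: mass; rewrite /= jd.
  by rewrite /t; field; rewrite !pnatr_eq0 !gtn_eqF.
have [|q [q1 q2 q3 q4]] := HC a0 b sigma f cd n d K (fun j => lam j.+1) t n0 isT _ t0 tS Hj.
  by apply: leq_trans dn _; exact: leq_subr.
have lb : lam d.+1 <= b by apply: sb; apply: Sp; rewrite /= dk.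
have aq : admissible_poly A `[lam d.+1, b]%classic n q.
  by apply: (admissible_enum enum) => //; [rewrite q2 oner_neq0|move=> j /q3[]].
split.
  by apply: En_spectrum_le => //; [exists (lam d.+1); apply: Sp; rewrite /= dk|exists q].
apply: le_trans (En_le aq) _; rewrite q2 normr1 divr1.
apply: (@le_trans _ _ (expR (C - n%:R / K%:R * (gam_sum a0 b sigma t K - 2 * gam b a)))).
  apply: supnorm_le; first by exists (lam d.+1); rewrite /= in_itv /= lexx.
  move=> x; rewrite /= in_itv /= => /andP[x1 x2]; apply: q4.
  by rewrite x2 andbT; exact: le_trans x1.
rewrite ler_expR.
have K0 : (0 : R) < K%:R by rewrite ltr0n.
have h1 : n%:R / K%:R * (2 * gam b a) <= 1.
  rewrite mulrAC ler_pdivrMr// mul1r mulrCA mulrA.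
  apply: le_trans (ltW (truncnS_gt _)) _; by rewrite ler_nat.
have := @green_integral_le a0 b sigma f t K cd t0 tS isT.
set I := \int[_]_(_ in _) _ => h2.
have : N%:R * I <= n%:R / K%:R * gam_sum a0 b sigma t K.
  apply: le_trans (ler_wpM2l (ler0n _ N) h2) _.
  by rewrite le_eqVlt; apply/orP; left; apply/eqP; rewrite /t; field; rewrite !pnatr_eq0 !gtn_eqF.
rewrite mulrBr; move: h1; set X := _ * (2 * _); set Y := _ * gam_sum _ _ _ _ _; lra.
Qed.

End ExtremalConstant.

(** * A Bernstein-Walsh inequality with zeros *)

Section CircleBound.
Variable R : realType.
Local Notation N := (@Normc.normc R).
Local Notation cpoly := (map_poly (real_complex R)).

Lemma normcX (z : R[i]) k : N (z ^+ k) = N z ^+ k.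
Proof. by elim: k => [|k IH]; rewrite ?expr0 ?Normc.normc1// !exprS Normc.normcM IH. Qed.

Lemma normc_real (x : R) : N (x%:C)%C = `|x|.
Proof. by rewrite /= expr0n /= addr0 sqrtr_sqr. Qed.

Lemma normc_sum K (F : nat -> R[i]) : N (\sum_(0 <= i < K) F i) <= \sum_(0 <= i < K) N (F i).
Proof.
elim: K => [|K IH]; first by rewrite !big_geq// Normc.normc0.
by rewrite !big_nat_recr//= (le_trans (le_normcD _ _))// lerD2r.
Qed.

Definition cis (t : R) : R[i] := Complex (cos t) (sin t).

Lemma cisX t k : cis t ^+ k = cis (k%:R * t).
Proof.
elim: k => [|k IH]; first by rewrite expr0 mul0r /cis cos0 sin0.
rewrite exprS IH /cis -natr1 mulrDl mul1r cosD sinD.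
by apply/eqP; rewrite eq_complex; simpc; rewrite /=; apply/andP; split; apply/eqP; ring.
Qed.

Lemma normc_cis t : N (cis t) = 1.
Proof. by rewrite /= cos2Dsin2 sqrtr1. Qed.

Lemma cis_root K : (0 < K)%N -> cis (2 * pi / K%:R) ^+ K = 1.
Proof.
move=> K0; rewrite cisX mulrC divfK ?pnatr_eq0 ?gtn_eqF//.
by rewrite /cis (_ : 2 * pi = pi *+ 2 :> R) ?cos2pi ?sin2pi// mulr_natl.
Qed.

Lemma cis_root_neq1 K m : (0 < m < K)%N -> cis (2 * pi / K%:R) ^+ m != 1.
Proof.
move=> /andP[m0 mK]; rewrite cisX; apply/eqP => /(congr1 (@complex.Re R)) /=.
have K0 : (0 : R) < K%:R by rewrite ltr0n (leq_trans _ mK).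
have p0 := @pi_gt0 R.
pose u : R := m%:R * pi / K%:R.
rewrite (_ : m%:R * _ = u *+ 2); last by rewrite /u -mulr_natl; field; rewrite gt_eqF.
rewrite cos_mulr2n cos2sin2.
have s0 : 0 < sin u.
  apply: sin_gt0_pi; apply/andP; split; first by rewrite divr_gt0// mulr_gt0// ltr0n.
  by rewrite ltr_pdivrMr// mulrC ltr_pM2l// ltr_nat.
have : 0 < sin u ^+ 2 by rewrite exprn_gt0.
by rewrite -mulr_natl => ? ?; lra.
Qed.

(** Discrete Fourier inversion over the [K]-th roots of unity, in which [w ^+ (l * (K - k))] is the
    power of [w] with exponent [- l * k]. *)
Lemma coef_le_circle (P : {poly R}) K M : (0 < K)%N -> (size P <= K)%N ->
  (forall z : R[i], N z = 1 -> N (cpoly P).[z] <= M) -> forall k, (k < K)%N -> `|P`_k| <= M.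
Proof.
move=> K0 sP HM k kK.
set w := cis (2 * pi / K%:R).
have nw j : N (w ^+ j) = 1 by rewrite normcX normc_cis expr1n.
have E : \sum_(0 <= l < K) (cpoly P).[w ^+ l] * w ^+ (l * (K - k)) = K%:R * (P`_k)%:C%C.
  transitivity (\sum_(0 <= l < K) \sum_(0 <= i < K) (P`_i)%:C%C * (w ^+ (i + (K - k))) ^+ l).
    apply: eq_bigr => l _; rewrite (@horner_coef_wide _ K); last by rewrite size_map_poly.
    rewrite -(big_mkord xpredT (fun i => (cpoly P)`_i * (w ^+ l) ^+ i)) mulr_suml.
    apply: eq_bigr => i _; rewrite coef_map -mulrA; congr (_ * _).
    by rewrite -!exprM -exprD -mulnDr mulnC.
  rewrite exchange_big_nat//=.
  under eq_bigr => i _ do rewrite -mulr_sumr.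
  rewrite (@big_cat_nat _ _ _ k)//=; last exact: ltnW.
  rewrite (@big_ltn _ _ _ k)//=.
  have Z i : (i < K)%N -> i != k -> (P`_i)%:C%C * \sum_(0 <= l < K) (w ^+ (i + (K - k))) ^+ l = 0.
    move=> iK ik; set v := w ^+ _.
    have v1 : v != 1.
      rewrite /v; case: (ltngtP i k) ik => // h _.
        by apply: cis_root_neq1; apply/andP; split; lia.
      rewrite (_ : (i + (K - k) = (i - k) + K)%N); last by lia.
      by rewrite exprD cis_root// mulr1; apply: cis_root_neq1; apply/andP; split; lia.
    rewrite big_mkord; have := subrX1 v K.
    rewrite /v -exprM mulnC exprM cis_root// expr1n subrr => /esym/eqP.
    by rewrite mulf_eq0 subr_eq0 (negbTE v1) /= => /eqP ->; rewrite mulr0.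
  rewrite big_nat big1 ?add0r; last by move=> i /andP[_ ik]; rewrite Z//; lia.
  rewrite [X in _ + X]big_nat [X in _ + X]big1 ?addr0; last by move=> i /andP[ik iK]; rewrite Z//; lia.
  rewrite subnKC; last exact: ltnW.
  rewrite cis_root//; under eq_bigr => l _ do rewrite expr1n.
  by rewrite sumr_const_nat subn0 mulrC.
have := normc_sum K (fun l => (cpoly P).[w ^+ l] * w ^+ (l * (K - k))).
rewrite E Normc.normcM normc_real.
have -> : N K%:R = K%:R.
  rewrite (_ : (K%:R : R[i]) = (K%:R)%:C%C); last by rewrite rmorph_nat.
  by rewrite normc_real normr_nat.
move=> h.
have : K%:R * `|P`_k| <= K%:R * M.
  apply: le_trans h _; rewrite mulr_natl.
  apply: (@le_trans _ _ (\sum_(0 <= l < K) M)); last by rewrite sumr_const_nat subn0.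
  by apply: ler_sum => l _; rewrite Normc.normcM nw mulr1; apply: HM.
by rewrite ler_pM2l// ltr0n.
Qed.

(** A weak maximum modulus principle, obtained from the coefficients; its factor [K] is harmless
    under [n]-th roots. *)
Lemma horner_le_circle (P : {poly R}) K M x : (0 < K)%N -> (size P <= K)%N -> `|x| <= 1 ->
  (forall z : R[i], N z = 1 -> N (cpoly P).[z] <= M) -> `|P.[x]| <= K%:R * M.
Proof.
move=> K0 sP x1 HM; rewrite (@horner_coef_wide _ K)//.
apply: le_trans (ler_norm_sum _ _ _) _.
rewrite mulr_natl -[K in leRHS]card_ord -sumr_const; apply: ler_sum => i _.
rewrite normrM normrX; apply: (@le_trans _ _ (`|P`_i| * 1)).
  by rewrite ler_wpM2l// exprn_ile1.
by rewrite mulr1 (coef_le_circle K0 sP HM).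
Qed.

(** On the unit circle the conjugate of [z] is its inverse, so a Blaschke factor with real zero has
    modulus 1 there. *)
Lemma normc_blaschke (z : R[i]) (t : R) : N z = 1 -> N (z - t%:C%C) = N (1 - t%:C%C * z).
Proof.
case: z => x y /= h.
have h2 : x ^+ 2 + y ^+ 2 = 1.
  by rewrite -[LHS]sqr_sqrtr ?h ?expr1n// addr_ge0// sqr_ge0.
simpc; rewrite /=; congr Num.sqrt.
have -> : (x - t) ^+ 2 + y ^+ 2 = x ^+ 2 + y ^+ 2 - 2 * x * t + t ^+ 2 by ring.
transitivity (1 - 2 * x * t + t ^+ 2 * (x ^+ 2 + y ^+ 2)); first by rewrite h2; ring.
by ring.
Qed.

End CircleBound.

(** * Transplantation to the unit circle *)

Section BernsteinWalsh.
Variable R : realType.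
Local Notation N := (@Normc.normc R).
Local Notation cpoly := (map_poly (real_complex R)).
Variables (b c : R).
Hypotheses (c0 : 0 < c) (cb : c < b).

Let b0 : 0 < b. Proof. exact: lt_trans cb. Qed.

(* The inverse Joukowski map of the complement of [c, b], restricted to x <= c. *)
Definition jinv (x : R) : R :=
  (Num.sqrt (b - x) - Num.sqrt (c - x)) / (Num.sqrt (b - x) + Num.sqrt (c - x)).

Definition jmap (v : R) : R := (b + c) / 2 - (b - c) / 4 * (v + v^-1).

Lemma jinv_itv x : x < c -> 0 < jinv x < 1.
Proof.
move=> xc; have s2 : 0 < Num.sqrt (c - x) by rewrite sqrtr_gt0 subr_gt0.
have s1 : Num.sqrt (c - x) < Num.sqrt (b - x) by rewrite ltr_sqrt ?ltrD2r// subr_gt0 (lt_trans xc).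
rewrite /jinv divr_gt0 ?subr_gt0 ?addr_gt0//=; last exact: lt_trans s1.
by rewrite ltr_pdivrMr ?mul1r; lra.
Qed.

Lemma jmapK x : x < c -> jmap (jinv x) = x.
Proof.
move=> xc; have s2 : 0 < Num.sqrt (c - x) by rewrite sqrtr_gt0 subr_gt0.
have s1 : Num.sqrt (c - x) < Num.sqrt (b - x) by rewrite ltr_sqrt ?ltrD2r// subr_gt0 (lt_trans xc).
have e1 : b = Num.sqrt (b - x) ^+ 2 + x by rewrite sqr_sqrtr ?subrK// subr_ge0 ltW// (lt_trans xc).
have e2 : c = Num.sqrt (c - x) ^+ 2 + x by rewrite sqr_sqrtr ?subrK// subr_ge0 ltW.
rewrite /jmap /jinv; move: (Num.sqrt (b - x)) (Num.sqrt (c - x)) s1 s2 e1 e2 => s t st t0 -> ->.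
have h1 : s - t != 0 by rewrite subr_eq0 gt_eqF.
have h2 : s + t != 0 by rewrite gt_eqF// addr_gt0// (lt_trans t0).
by field; rewrite h1 h2.
Qed.

(** The left side is the pseudo-hyperbolic distance between the images of 0 and [x] in the unit
    disc; minus its logarithm is the Green function with pole at [x]. *)
Lemma jinv_ratio x : 0 < x -> x < c ->
  `|jinv 0 - jinv x| / (1 - jinv x * jinv 0) = expR (- gamker b c x).
Proof.
move=> x0 xc; have s2 : 0 < Num.sqrt (c - x) by rewrite sqrtr_gt0 subr_gt0.
have xb := lt_trans xc cb.
have s1 : Num.sqrt (c - x) < Num.sqrt (b - x) by rewrite ltr_sqrt ?ltrD2r// subr_gt0.
have t0 : 0 < Num.sqrt c by rewrite sqrtr_gt0.
have st : Num.sqrt c < Num.sqrt b by rewrite ltr_sqrt.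
have ss : Num.sqrt b * Num.sqrt (c - x) < Num.sqrt (b - x) * Num.sqrt c.
  have xbc : 0 < x * (b - c) by rewrite mulr_gt0// subr_gt0.
  rewrite -sqrtrM ?(ltW b0)// -sqrtrM ?subr_ge0 ?(ltW xb)// ltr_sqrt; first by nra.
  by rewrite mulr_gt0// subr_gt0.
have r0 : 0 <= Num.sqrt (b * (c - x) / ((b - x) * c)) by [].
have rE : Num.sqrt (b * (c - x) / ((b - x) * c)) = Num.sqrt b * Num.sqrt (c - x) / (Num.sqrt (b - x) * Num.sqrt c).
  rewrite sqrtrM ?mulr_ge0 ?subr_ge0 ?(ltW b0) ?(ltW xc)//.
  rewrite sqrtrV ?mulr_ge0 ?subr_ge0 ?(ltW c0) ?(ltW xb)//.
  by rewrite !sqrtrM ?subr_ge0 ?(ltW b0) ?(ltW xb).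
rewrite /gamker /lrat rE /jinv !subr0.
move: (Num.sqrt (b - x)) (Num.sqrt (c - x)) (Num.sqrt b) (Num.sqrt c) s1 s2 t0 st ss => u v s t uv v0 t0 st ss.
have sv0 : 0 < s * v by rewrite mulr_gt0// (lt_trans t0).
have u0 := lt_trans v0 uv; have s0 := lt_trans t0 st.
have ut0 : 0 < u * t by rewrite mulr_gt0.
have nu : 0 < (1 + s * v / (u * t)) / (1 - s * v / (u * t)).
  have w1 : s * v / (u * t) < 1 by rewrite ltr_pdivrMr// mul1r.
  have w0 : 0 < s * v / (u * t) by rewrite divr_gt0.
  by rewrite divr_gt0//; lra.
rewrite expRN lnK ?posrE//.
have -> : (s - t) / (s + t) - (u - v) / (u + v) = - (2 * (u * t - s * v) / ((s + t) * (u + v))).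
  by field; rewrite !gt_eqF ?addr_gt0.
rewrite normrN ger0_norm; last first.
  by rewrite divr_ge0 ?mulr_ge0 ?subr_ge0 ?addr_ge0 ?ltW.
have w0 : 0 < u * t - s * v by rewrite subr_gt0.
have -> : 1 - (u - v) / (u + v) * ((s - t) / (s + t)) = 2 * (u * t + s * v) / ((s + t) * (u + v)).
  by field; rewrite !gt_eqF ?addr_gt0.
have g1 : 0 < u * t + s * v by rewrite addr_gt0.
have h1 : s + t != 0 by rewrite gt_eqF// addr_gt0.
have h2 : u + v != 0 by rewrite gt_eqF// addr_gt0.
move: (u * t) (s * v) ut0 w0 g1 => p r p0 w0 g1.
have -> : (1 + r / p) / (1 - r / p) = (p + r) / (p - r).
  have h3 : p - r != 0 by rewrite gt_eqF.
  have h4 : p != 0 by rewrite gt_eqF.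
  by field; rewrite h3 h4.
have h3 : p - r != 0 by rewrite gt_eqF.
have h4 : p + r != 0 by rewrite gt_eqF.
by field; rewrite h1 h2 h3 h4.
Qed.

Lemma jinv0_gam : (jinv 0)^-1 = expR (gam b c).
Proof.
have st : Num.sqrt c < Num.sqrt b by rewrite ltr_sqrt.
have t0 := sqrtr_ge0 c.
rewrite /jinv !subr0 invf_div /gam lnK// posrE divr_gt0 ?subr_gt0//; lra.
Qed.

(* [v ^+ n * q.[jmap v]] as a polynomial in [v]. *)
Definition jpoly (n : nat) (q : {poly R}) : {poly R} :=
  \sum_(0 <= i < n.+1) q`_i *: (((b + c) / 2) *: 'X - ((b - c) / 4) *: ('X^2 + 1)) ^+ i * 'X^(n - i).

Lemma size_jpoly n q : (size (jpoly n q) <= (2 * n).+1)%N.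
Proof.
rewrite /jpoly big_nat.
apply: (big_ind (fun p : {poly R} => (size p <= (2 * n).+1)%N)).
- by rewrite size_poly0.
- by move=> p1 p2 h1 h2; rewrite (leq_trans (size_polyD _ _))// geq_max h1.
move=> i; rewrite ltnS => /= ik.
set l := _ - _.
have sl : (size l <= 3)%N.
  rewrite (leq_trans (size_polyD _ _))// geq_max size_polyN.
  rewrite (leq_trans (size_scale_leq _ _)) ?size_polyX//=.
  rewrite (leq_trans (size_scale_leq _ _))// (leq_trans (size_polyD _ _))// geq_max size_polyXn size_poly1 //.
have sli : (size (l ^+ i) <= (2 * i).+1)%N.
  elim: (i) => [|j IH]; first by rewrite expr0 size_poly1.
  rewrite exprS (leq_trans (size_polyMleq _ _))//.
  by move: IH sl; move: (size (l ^+ j)) (size l) => u v; lia.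
rewrite (leq_trans (size_polyMleq _ _))// size_polyXn.
have := leq_trans (size_scale_leq q`_i (l ^+ i)) sli.
by move: (size _) ik => u; lia.
Qed.

(** The target field varies because the formula is needed at real points, to locate the zeros, and
    on the complex unit circle, to bound the modulus. *)
Lemma horner_jpoly (S : fieldType) (f : {rmorphism R -> S}) n (q : {poly R}) (v : S) : (size q <= n.+1)%N -> v != 0 ->
  (map_poly f (jpoly n q)).[v] = v ^+ n * (map_poly f q).[f ((b + c) / 2) - f ((b - c) / 4) * (v + v^-1)].
Proof.
move=> sq v0; rewrite [X in _ = _ * X](@horner_coef_wide _ n.+1); last by rewrite size_map_poly.
rewrite -(big_mkord xpredT (fun i => (map_poly f q)`_i * _ ^+ i)) mulr_sumr.
rewrite /jpoly rmorph_sum horner_sum; apply: eq_big_nat => i /andP[_ ik].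
rewrite /= [map_poly f (_ * _)]rmorphM hornerM /= map_polyZ hornerZ [map_poly f (_ ^+ _)]rmorphXn horner_exp /= coef_map.
rewrite [map_poly f (_ - _)]rmorphB /= !map_polyZ [map_poly f (_ + _)]rmorphD /= map_polyX !map_polyXn rmorph1 /= !hornerE.
rewrite -[LHS]mulrA -[RHS]mulrA [RHS]mulrCA; congr (_ * _).
move: (f ((b + c) / 2)) (f ((b - c) / 4)) => A B.
rewrite (_ : A * v - B * (v ^+ 2 + 1) = v * (A - B * (v + v^-1))); last by field.
by rewrite exprMn mulrAC -exprD subnKC.
Qed.

Lemma normc_half (z : R[i]) : N z = 1 -> exists2 x : R, -1 <= x <= 1 & z + z^-1 = (2 * x)%:C%C.
Proof.
case: z => x y /= h.
have h2 : x ^+ 2 + y ^+ 2 = 1.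
  by rewrite -[LHS]sqr_sqrtr ?h ?expr1n// addr_ge0// sqr_ge0.
exists x; first by rewrite -ler_norml -[leRHS]sqrtr1 -sqrtr_sqr ler_wsqrtr// -h2 lerDl sqr_ge0.
have nz : Complex x y != 0 by apply/eqP => -[x0 y0]; move: h2; rewrite x0 y0 !expr0n /= addr0 => /esym/eqP; rewrite oner_eq0.
have -> : (Complex x y)^-1 = Complex x (- y).
  apply: (mulfI nz); rewrite divff//; apply/eqP; rewrite eq_complex; simpc; rewrite /=.
  by apply/andP; split; apply/eqP; [rewrite -h2|]; ring.
by apply/eqP; rewrite eq_complex /=; apply/andP; split; apply/eqP; ring.
Qed.

(** The division is carried out on polynomials: [Q], a multiple [D] of the product of the [X - B j],
    is replaced by [P], the same multiple of the product of the [1 - B j * X]. Both have the same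
    modulus on the circle, which is mapped into [c, b]; at [jinv 0] the quotient of the two products
    is given by [jinv_ratio]. The factor [(2 * n).+1] bounds the size of [P]. *)
Theorem bernstein_walsh_zeros (n d : nat) (q : {poly R}) (lam : nat -> R) (M : R) :
  (size q <= n.+1)%N -> (forall x, c <= x <= b -> `|q.[x]| <= M) ->
  (forall j, (j < d)%N -> 0 < lam j < c /\ q.[lam j] = 0) ->
  (forall i j, (i < d)%N -> (j < d)%N -> lam i = lam j -> i = j) ->
  `|q.[0]| <= (2 * n).+1%:R * M * expR (n%:R * gam b c - \sum_(0 <= j < d) gamker b c (lam j)).
Proof.
move=> sq qM ql inj.
pose B j := jinv (lam j).
pose Q := jpoly n q.
have BI j : (j < d)%N -> 0 < B j < 1 by move=> /ql[/andP[_ h] _]; exact: jinv_itv.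
have hR v : v != 0 -> Q.[v] = v ^+ n * q.[jmap v].
  move=> v0; have := @horner_jpoly R idfun n q v sq v0.
  by rewrite !map_poly_id.
have QB j : (j < d)%N -> root Q (B j).
  move=> jd; have [/andP[l0 lc] qz] := ql j jd; have /andP[B0 _] := BI j jd.
  by apply/rootP; rewrite hR ?gt_eqF// jmapK// qz mulr0.
pose rs := mkseq B d.
have urs : uniq rs.
  rewrite /rs map_inj_in_uniq ?iota_uniq// => i j; rewrite !mem_iota /= => id_ jd e.
  have [/andP[_ li] _] := ql i id_; have [/andP[_ lj] _] := ql j jd.
  by apply: inj => //; rewrite -(jmapK li) -(jmapK lj); congr jmap.
have ars : all (root Q) rs by apply/allP => z /mapP[j + ->]; rewrite mem_iota /= => jd; exact: QB.
have /dvdpP[D DE] : \prod_(z <- rs) ('X - z%:P) %| Q by apply: uniq_roots_dvdp; rewrite ?uniq_rootsE.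
pose E := \prod_(z <- rs) (1 - z *: 'X : {poly R}).
have sE : (size E <= d.+1)%N.
  have -> : d = size rs by rewrite size_mkseq.
  rewrite /E; elim: (rs) => [|z l IH]; first by rewrite big_nil size_poly1.
  rewrite big_cons (leq_trans (size_polyMleq _ _))//.
  have : (size (1 - z *: 'X : {poly R})%R <= 2)%N.
    rewrite (leq_trans (size_polyD _ _))// geq_max size_poly1 size_polyN.
    by rewrite (leq_trans (size_scale_leq _ _))// size_polyX.
  by move: IH; rewrite /=; move: (size _) (size _) => u v; lia.
pose P := D * E.
have sP : (size P <= (2 * n).+1)%N.
  have [D0|D0] := eqVneq D 0; first by rewrite /P D0 mul0r size_poly0.
  have m1 : \prod_(z <- rs) ('X - z%:P) \is monic by apply: monic_prod_XsubC.
  have := size_jpoly n q; rewrite -/Q DE size_Mmonic// size_prod_XsubC size_mkseq.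
  apply: leq_trans; rewrite (leq_trans (size_polyMleq _ _))//.
  by move: sE; move: (size E) (size D) => u v; lia.
have Pz z : N z = 1 -> N (cpoly P).[z] <= M.
  move=> z1; have z0 : z != 0 by apply/eqP => e; move: z1; rewrite e Normc.normc0 => /eqP; rewrite eq_sym oner_eq0.
  have -> : N (cpoly P).[z] = N (cpoly Q).[z].
    rewrite DE /P !rmorphM !hornerM !Normc.normcM; congr (_ * _).
    rewrite /E; elim: (rs) => [|t l IH]; first by rewrite !big_nil.
    rewrite !big_cons !rmorphM !hornerM !Normc.normcM IH; congr (_ * _).
    rewrite !rmorphB /= !map_polyX !map_polyC /= map_polyZ /= map_polyX !hornerE.
    by rewrite normc_blaschke.
  rewrite horner_jpoly// Normc.normcM normcX z1 expr1n mul1r.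
  have [x /andP[x1 x2] ->] := normc_half z1.
  rewrite -rmorphM -rmorphB horner_map normc_real; apply: qM.
  have bc : 0 < b - c by rewrite subr_gt0.
  rewrite (_ : _ - _ = c + (b - c) / 2 * (1 - x)); last by field.
  by apply/andP; split; nra.
have J := jinv_itv c0; have /andP[v0 v1] := J.
have nv1 : `|jinv 0| <= 1 by rewrite gtr0_norm// ltW.
have := horner_le_circle (ltn0Sn _) sP nv1 Pz.
have q0 : q.[0] = (jinv 0)^-1 ^+ n * Q.[jinv 0].
  by rewrite hR ?gt_eqF// jmapK// mulrA -exprMn mulVf ?gt_eqF// expr1n mul1r.
have QP : `|Q.[jinv 0]| = `|P.[jinv 0]| * expR (- \sum_(0 <= j < d) gamker b c (lam j)).
  rewrite DE /P !hornerM !normrM -mulrA; congr (_ * _).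
  rewrite /E /rs /mkseq !big_map !horner_prod !normr_prod.
  have -> : iota 0 d = index_iota 0 d by rewrite /index_iota subn0.
  rewrite -sumrN expR_sum -big_split /=; apply: eq_big_nat => j /andP[_ jd].
  have [/andP[l0 lc] _] := ql j jd; have /andP[B0 B1] := BI j jd.
  have w0 : 0 < 1 - B j * jinv 0 by rewrite subr_gt0; nra.
  have -> : ('X - (B j)%:P).[jinv 0] = jinv 0 - B j by rewrite !hornerE.
  have -> : (1 - B j *: 'X).[jinv 0] = 1 - B j * jinv 0 by rewrite !hornerE.
  by rewrite -(jinv_ratio l0 lc) -/(B j) (gtr0_norm w0) mulrC divfK// gt_eqF.
move=> HP.
rewrite q0 normrM QP normrX normfV (gtr0_norm v0) jinv0_gam -expRM_natl mulrA.
rewrite expRD mulrA ler_wpM2r ?expR_ge0//.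
by rewrite mulrC ler_wpM2r ?expR_ge0.
Qed.

End BernsteinWalsh.

(** * Lower bound for the extremal constant *)

Section GreenKernel.
Variable R : realType.
Implicit Types b c x y : R.

Lemma lrat_le x y : x <= y -> y < 1 -> lrat x <= lrat y.
Proof.
move=> xy y1; have := ler_wsqrtr xy; have := sqrt_lt1 y1; have := sqrtr_ge0 x.
rewrite /lrat; move: (Num.sqrt x) (Num.sqrt y) => s t s0 t1 st.
have s1' : 0 < 1 - s by lra.
have t1' : 0 < 1 - t by lra.
rewrite ler_ln ?posrE ?divr_gt0//; try lra.
by rewrite ler_pdivrMr// mulrAC ler_pdivlMr//; lra.
Qed.

Lemma gamker_arg_lt1 b c y : 0 < y -> y < c -> c < b -> b * (c - y) / ((b - y) * c) < 1.
Proof.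
move=> y0 yc cb; have c0 := lt_trans y0 yc; have yb := lt_trans yc cb.
by rewrite ltr_pdivrMr ?mulr_gt0 ?subr_gt0// mul1r; nra.
Qed.

Lemma gamker_ge0 b c y : 0 < y -> y < c -> c < b -> 0 <= gamker b c y.
Proof.
move=> y0 yc cb; have h := sqrt_lt1 (gamker_arg_lt1 y0 yc cb).
rewrite /gamker /lrat ln_ge0//; move: h; have := sqrtr_ge0 (b * (c - y) / ((b - y) * c)).
by move: (Num.sqrt _) => s s0 s1; rewrite ler_pdivlMr; lra.
Qed.

Lemma gamker_anti b c x y : 0 < x -> x <= y -> y < c -> c < b -> gamker b c y <= gamker b c x.
Proof.
move=> x0 xy yc cb; apply: lrat_le; last by apply: gamker_arg_lt1 => //; exact: le_lt_trans yc.
have y0 := lt_le_trans x0 xy; have c0 := lt_trans y0 yc; have yb := lt_trans yc cb.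
have xb := le_lt_trans xy yb.
rewrite ler_pdivrMr ?mulr_gt0 ?subr_gt0// mulrAC ler_pdivlMr ?mulr_gt0 ?subr_gt0//.
rewrite -subr_ge0 (_ : _ - _ = b * c * ((b - c) * (y - x))); last by ring.
by rewrite !mulr_ge0 ?subr_ge0// ltW// (lt_trans y0).
Qed.

End GreenKernel.

Section LowerBound.
Variable R : realType.
Local Notation mu := (@lebesgue_measure R).
Local Notation measR := {finite_measure set (measurableTypeR R) -> \bar R}.
Variables (a0 b : R) (sigma : measR) (f : R -> R).
Hypothesis cd : constraint_data a0 b sigma f.
Local Notation tau := (tau a0 b sigma).
Local Notation a := (left_endpoint a0 b sigma).
Local Notation Hk := (inner_kernel b (gamdens b)).

Lemma mass_gt0_inv x : (0 < sigma [set` `]-oo, x]])%E -> a0 < x.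
Proof.
move=> s0; rewrite ltNge; apply/negP => la; move: s0; apply/negP; rewrite -leNgt.
have /andP[_ a0b] := cd_bounds cd.
apply: (@le_trans _ _ (sigma [set` `]-oo, a0]])%E).
  apply: le_measure; rewrite ?inE//= => y /=; rewrite !in_itv /= => h; exact: le_trans la.
by rewrite (sigma_halfline cd (ltW a0b)) set_itv_ge ?measure0// bnd_simp ltxx.
Qed.

Lemma tau_gamdens_le X : a0 < X -> X < b ->
  (\int[mu]_(e in `]a0, X[) (tau e * (gamdens b e)%:E) <= tau X * (gam b X)%:E)%E.
Proof.
move=> aX Xb; have /andP[a00 a0b] := cd_bounds cd.
apply: (@le_trans _ _ (\int[mu]_(e in `]a0, X[) (tau X * (gamdens b e)%:E))%E).
  apply: ge0_le_integral_nomeasurable => e; rewrite /= in_itv /= => /andP[e1 e2].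
    by rewrite mule_ge0 ?tau_ge0// lee_fin gamdens_ge0.
  by rewrite lee_wpmul2r ?lee_fin ?gamdens_ge0// (tau_le cd)// ltW.
rewrite ge0_integralZl ?tau_ge0//.
- rewrite gamdens_integral ?(ltW aX)// lee_wpmul2l ?tau_ge0//.
  by rewrite lee_fin gerBl gam_ge0.
- by apply/measurable_EFinP; apply: measurable_funTS; exact: measurable_gamdens.
- by move=> e _; rewrite lee_fin gamdens_ge0.
Qed.

(** Beyond [X] the kernel is at most [Num.sqrt (b / (X - l))]. This serves for [y] below the first
    eigenvalue, where the Green function with pole [y] is unbounded as [y] tends to 0. *)
Lemma inner_kernel_le_add (X c y l : R) : a0 <= y -> y <= l -> l < X -> X < b -> a0 < c -> c < b ->
  (Hk c y <= Hk X y + (Num.sqrt (b / (X - l)) * gam b c)%:E)%E.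
Proof.
move=> ay yl lX Xb ac cb; have /andP[a00 a0b] := cd_bounds cd.
have Xl0 : 0 < X - l by rewrite subr_gt0.
have mk y' : measurable_fun setT (fun e : R => Num.sqrt ((b - y') / (e - y')) * gamdens b e).
  apply: measurable_funM; last exact: measurable_gamdens.
  apply: measurable_fun_sqrtr; apply: measurable_funM => //.
  by apply: measurable_fun_invr; exact: measurable_funB.
have k0 e : 0 <= Num.sqrt ((b - y) / (e - y)) * gamdens b e by rewrite mulr_ge0// gamdens_ge0.
have g0 : 0 <= Num.sqrt (b / (X - l)) * gam b c by rewrite mulr_ge0// gam_ge0// (le_trans a00)// ltW.
have [cX|Xc] := leP c X.
  apply: (@le_trans _ _ (Hk X y)); last by rewrite leeDl// lee_fin.
  apply: ge0_subset_integral => //.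
  - by apply/measurable_EFinP; apply: measurable_funTS; exact: mk.
  - by move=> e _; rewrite lee_fin.
  - by move=> e; rewrite /= !in_itv /= => /andP[-> /lt_le_trans ->].
have yX := le_lt_trans yl lX.
rewrite /inner_kernel.
have -> : `]y, c[%classic = `]y, X[%classic `|` `[X, c[%classic :> set R.
  by rewrite -itv_bndbnd_setU// bnd_simp ltW.
rewrite ge0_integral_setU//; last 3 first.
- by apply/measurable_EFinP; apply: measurable_funTS; exact: mk.
- by move=> e _; rewrite lee_fin.
- apply/disj_setPLR => x /=; rewrite !in_itv /= => /andP[_ h1]; apply/negP; rewrite negb_and -ltNge h1 //.
rewrite leeD2l//.
rewrite -integral_itv_obnd_cbnd; last by apply/measurable_EFinP; apply: measurable_funTS; exact: mk.
apply: (@le_trans _ _ (\int[mu]_(e in `]X, c[) ((Num.sqrt (b / (X - l)))%:E * (gamdens b e)%:E))%E).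
  apply: ge0_le_integral_nomeasurable => e; rewrite /= in_itv /= => /andP[e1 e2]; first by rewrite lee_fin.
  rewrite -EFinM lee_fin ler_wpM2r ?gamdens_ge0// ler_wsqrtr//.
  have ey : 0 < e - y by rewrite subr_gt0 (lt_trans yX).
  rewrite ler_pdivrMr// mulrAC ler_pdivlMr//.
  have y0 := le_trans a00 ay.
  have : 0 < b - y by rewrite subr_gt0 (lt_trans yX).
  by move=> ?; nra.
rewrite ge0_integralZl//.
- rewrite gamdens_integral ?(ltW Xc)//; last by rewrite (le_trans a00)// (le_trans ay)// ltW.
  rewrite -EFinM lee_fin ler_wpM2l// gerBl gam_ge0// (le_trans a00)// (le_trans ay)// ltW //.
- by apply/measurable_EFinP; apply: measurable_funTS; exact: measurable_gamdens.
- by move=> e _; rewrite lee_fin gamdens_ge0.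
Qed.

Variables (N : nat) (lam : nat -> R).
Hypothesis s1 : sigma setT = 1%E.
Hypothesis inc : forall i j, (1 <= i < j)%N -> (j <= N)%N -> lam i < lam j.
Hypothesis cdf : forall j, (1 <= j <= N)%N -> sigma [set` `]-oo, lam j]] = (j%:R / N%:R)%:E.

Lemma lam_gt_a0 j : (1 <= j <= N)%N -> a0 < lam j.
Proof.
move=> h; apply: mass_gt0_inv; rewrite cdf// lte_fin; case/andP: h => j0 jN.
by rewrite divr_gt0 ?ltr0n// (leq_trans j0).
Qed.

Lemma lam_gt0 j : (1 <= j <= N)%N -> 0 < lam j.
Proof. by move=> /lam_gt_a0; apply: le_lt_trans; case/andP: (cd_bounds cd). Qed.

Lemma lam_lt (y : R) j : (1 <= j <= N)%N -> ((j%:R / N%:R)%:E < sigma [set` `]-oo, y]])%E -> lam j < y.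
Proof.
move=> h s; rewrite ltNge; apply/negP => yl; move: s; rewrite -cdf//; apply/negP; rewrite -leNgt.
by apply: le_measure; rewrite ?inE//= => x /=; rewrite !in_itv /= => /le_trans; exact.
Qed.

Lemma lam_lt_b j : (1 <= j < N)%N -> lam j < b.
Proof.
move=> /andP[j0 jN]; apply: lam_lt; first by rewrite j0 ltnW.
rewrite (sigma_halfline_b cd) s1 lte_fin ltr_pdivrMr ?ltr0n ?(leq_trans _ jN)//.
by rewrite mul1r ltr_nat.
Qed.

Lemma lam_le i j : (1 <= i)%N -> (i <= j)%N -> (j <= N)%N -> lam i <= lam j.
Proof. by move=> i0; rewrite leq_eqVlt => /predU1P[->//|ij] jN; rewrite ltW// inc// i0. Qed.

Lemma mass_cell j : (1 <= j < N)%N -> sigma [set` `]lam j, lam j.+1]] = (N%:R^-1)%:E.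
Proof.
move=> /andP[j0 jN].
have E : [set` `]-oo, lam j.+1]] = [set` `]-oo, lam j]] `|` [set` `]lam j, lam j.+1]] :> set (measurableTypeR R).
  by rewrite -itv_bndbnd_setU// bnd_simp ltW// inc// j0 /=.
have j1N : (1 <= j.+1 <= N)%N by [].
have := cdf j1N; rewrite E measureU//; last first.
  by rewrite -subset0 => x [] /=; rewrite !in_itv /= => h /andP[]; rewrite ltNge h.
have jN' : (1 <= j <= N)%N by rewrite j0 ltnW.
move=> h; have {h} := etrans (congr1 (fun z => z + _)%E (esym (cdf jN'))) h.
move=> /(congr1 (fun z => z - (j%:R / N%:R)%:E)%E); rewrite addeAC subee// add0e => ->.
by rewrite -EFinB -natr1; congr EFin; ring.
Qed.

Lemma cell_of (y : R) d : lam 1%N < y -> y <= lam d.+1 -> exists2 j, (1 <= j <= d)%N & lam j < y <= lam j.+1.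
Proof.
elim: d => [|d IH] h1 h2; first by move: (lt_le_trans h1 h2); rewrite ltxx.
have [h|h] := leP y (lam d.+1); last by exists d.+1; rewrite ?leqnn ?h.
by have [j /andP[j1 j2] ?] := IH h1 h; exists j => //; rewrite j1 ltnW.
Qed.

(* The term with [X] accounts for the mass to the left of the first eigenvalue. *)
Lemma tau_gamdens_le_sum d X : (d.+1 < N)%N -> lam 1%N < X -> X < b ->
  (\int[mu]_(e in `]a0, lam d.+1[) (tau e * (gamdens b e)%:E) <=
   tau X * (gam b X)%:E + (N%:R^-1 * (Num.sqrt (b / (X - lam 1%N)) * gam b (lam d.+1) + \sum_(1 <= j < d.+1) gamker b (lam d.+1) (lam j)))%:E)%E.
Proof.
move=> dN lX Xb; set c := lam d.+1.
have N0 : (0 < N)%N by exact: leq_trans dN.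
have I1 : (1 <= 1 <= N)%N by [].
have cN : (1 <= d.+1 <= N)%N by rewrite /= ltnW.
have ac : a0 < c by exact: lam_gt_a0.
have cb : c < b by apply: lam_lt_b.
have al := lam_gt_a0 I1.
have aX := lt_trans al lX.
have /andP[a00 a0b] := cd_bounds cd.
have g0 X' y : (0 <= Hk X' y)%E.
  by apply: integral_ge0 => e _; rewrite lee_fin mulr_ge0// gamdens_ge0.
have gc0 : 0 <= gam b c by rewrite gam_ge0// (le_trans a00)// ltW.
rewrite -(tau_kernel_integral a0 b sigma c (measurable_gamdens b) (gamdens_ge0 b)).
pose A : set (measurableTypeR R) := `[a0, c[%classic `&` [set` `]-oo, lam 1%N]].
pose B : set (measurableTypeR R) := `[a0, c[%classic `&` [set` `]lam 1%N, +oo[].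
have mA : measurable A by exact: measurableI.
have mB : measurable B by exact: measurableI.
have AB : `[a0, c[%classic = A `|` B.
  rewrite /A /B -setIUr -[LHS]setIT; congr (_ `&` _).
  by rewrite -itv_bndbnd_setU// set_itvNyy.
have mH := @measurable_inner_kernel R a0 b _ c (measurable_gamdens b) (gamdens_ge0 b).
rewrite AB ge0_integral_setU//; last 2 first.
- by rewrite -AB.
- apply/disj_set2P; rewrite -subset0 => x [[_ /=]]; rewrite in_itv /= => h [_ /=].
  by rewrite in_itv /= andbT ltNge h.
rewrite mulrDr EFinD [leRHS]addeA; apply: leeD.
  apply: (@le_trans _ _ (\int[sigma]_(y in A) (Hk X y + (Num.sqrt (b / (X - lam 1%N)) * gam b c)%:E))%E).
    apply: ge0_le_integral_nomeasurable => y; first by move=> _; exact: g0.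
    move=> [/=]; rewrite !in_itv /= => /andP[y1 y2] y3.
    exact: inner_kernel_le_add.
  have mHX := @measurable_inner_kernel R a0 b _ X (measurable_gamdens b) (gamdens_ge0 b).
  have AX : A `<=` `[a0, X[%classic.
    by move=> y [/=]; rewrite !in_itv /= => /andP[-> _] /le_lt_trans ->.
  rewrite ge0_integralD//; last 2 first.
  - by apply: measurable_funS mHX.
  - by move=> y _; rewrite lee_fin mulr_ge0.
  apply: leeD.
    apply: le_trans (tau_gamdens_le aX Xb).
    rewrite -(tau_kernel_integral a0 b sigma X (measurable_gamdens b) (gamdens_ge0 b)).
    apply: ge0_subset_integral => //; by move=> y _; exact: g0.
  rewrite integral_cst// [N%:R^-1 * _]mulrC [leRHS]EFinM lee_wpmul2l ?lee_fin ?mulr_ge0//.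
  have := cdf I1; rewrite mul1r => <-.
  by apply: le_measure; rewrite ?inE// => y [].
(* Each cell ]lam j, lam j.+1] has mass [1 / N], and on it the Green function with pole [y] is at
   most the one with pole at the left end. *)
pose st (y : R) := \sum_(1 <= j < d.+1) gamker b c (lam j) * \1_([set` `]lam j, lam j.+1]]) y.
have gk j : (1 <= j <= d)%N -> 0 <= gamker b c (lam j).
  move=> /andP[j1 jd]; apply: gamker_ge0 => //.
    by apply: lam_gt0; rewrite j1 (leq_trans jd)// ltnW// ltnW.
  by apply: inc; rewrite ?j1//= ltnW.
apply: (@le_trans _ _ (\int[sigma]_(y in B) (st y)%:E)%E).
  apply: ge0_le_integral_nomeasurable => y; first by move=> _; exact: g0.
  move=> [/=]; rewrite !in_itv /= => /andP[y1 y2]; rewrite andbT => y3.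
  have [j /andP[j1 jd] /andP[j2 j3]] := cell_of y3 (ltW y2).
  have l0 : 0 < lam j by apply: lam_gt0; rewrite j1 (leq_trans jd)// ltnW// ltnW.
  have y0 := lt_trans l0 j2.
  rewrite /inner_kernel gamdens_kernel_integral// lee_fin.
  apply: (@le_trans _ _ (gamker b c (lam j))); first by apply: gamker_anti => //; exact: ltW.
  rewrite /st (@big_cat_nat _ _ _ j)//=; last by rewrite ltnW// ltnS.
  rewrite (@big_ltn _ _ _ j) ?ltnS// indicE mem_set; last by rewrite /= in_itv /= j2.
  have p1 : 0 <= \sum_(1 <= i < j) gamker b c (lam i) * \1_([set` `]lam i, lam i.+1]]) y.
    rewrite big_nat sumr_ge0// => i /andP[i1 i2].
    by rewrite mulr_ge0// gk// i1 (leq_trans (ltnW i2)).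
  have p2 : 0 <= \sum_(j.+1 <= i < d.+1) gamker b c (lam i) * \1_([set` `]lam i, lam i.+1]]) y.
    rewrite big_nat sumr_ge0// => i /andP[i1 i2].
    by rewrite mulr_ge0// gk// (leq_trans _ i1).
  by rewrite mulr1; lra.
rewrite /st; under eq_integral => y _ do rewrite -sumEFin.
(* Unchanged for [1 <= j <= d]; termwise integration asks for nonnegative terms at every index. *)
pose g' j := Num.max 0 (gamker b c (lam j)).
have E : (\int[sigma]_(y in B) \sum_(1 <= j < d.+1) (gamker b c (lam j) * \1_([set` `]lam j, lam j.+1]]) y)%:E =
   \int[sigma]_(y in B) \sum_(1 <= j < d.+1) (g' j * \1_([set` `]lam j, lam j.+1]]) y)%:E)%E.
  apply: eq_integral => y _; apply: eq_big_nat => j /andP[j1 jd].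
  by rewrite /g' max_r// gk// j1.
rewrite E ge0_integral_sum//; last 2 first.
- move=> j; apply/measurable_EFinP; apply: measurable_funM => //.
- by move=> j y _; rewrite lee_fin mulr_ge0// le_max lexx.
rewrite mulr_sumr -sumEFin big_nat [leRHS]big_nat; apply: lee_sum => j /andP[j1 jd].
under eq_integral => y _ do rewrite EFinM.
rewrite ge0_integralZl//; last 2 first.
  by apply/measurable_EFinP; exact: measurable_indic.
  by rewrite lee_fin le_max lexx.
rewrite integral_indic// [N%:R^-1 * _]mulrC [leRHS]EFinM /g' max_r; last by rewrite gk// j1.
rewrite lee_wpmul2l ?lee_fin ?gk ?j1//.
rewrite -(@mass_cell j); last by rewrite j1 (leq_trans jd)// ltnW.
by apply: le_measure; rewrite ?inE//; exact: measurableI.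
Qed.

End LowerBound.

(** * Diagonal matrices and their admissible polynomials *)

Section DiagonalSpectrum.
Variable R : realType.

Lemma diag_enumerates N (lam : nat -> R) :
  (forall i j, (1 <= i < j)%N -> (j <= N)%N -> lam i < lam j) ->
  enumerates_spectrum (diag_of N lam) N lam.
Proof.
move=> inc; split=> // x; split.
  move=> /eigenvalueP[v vx v0].
  have /existsP[j vj] : [exists j, v 0 j != 0].
    apply: contraNT v0 => /existsPn h; apply/eqP/rowP => j; rewrite mxE.
    by apply/eqP; have := h j; rewrite negbK.
  exists j.+1; first by rewrite /= ltn_ord.
  have /rowP/(_ j) := vx; rewrite /diag_of mul_mx_diag !mxE mulrC => h.
  by apply/esym; exact: (mulIf vj h).
move=> [j /andP[j1 jN] ->]; case: j j1 jN => // j _ jN.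
apply/eigenvalueP; exists (delta_mx 0 (Ordinal jN)).
  rewrite /diag_of mul_mx_diag; apply/rowP => i; rewrite !mxE mulrC /=.
  by case: eqP => [->|_] /=; rewrite ?mulr0 ?mulr1.
by apply/eqP => /rowP/(_ (Ordinal jN)); rewrite !mxE !eqxx /= => /eqP; rewrite oner_eq0.
Qed.

End DiagonalSpectrum.

Section EnLower.
Variable R : realType.
Local Notation mu := (@lebesgue_measure R).
Local Notation measR := {finite_measure set (measurableTypeR R) -> \bar R}.
Variables (a0 b : R) (sigma : measR) (f : R -> R).
Hypothesis cd : constraint_data a0 b sigma f.
Hypothesis s1 : sigma setT = 1%E.
Variables (N : nat) (lam : nat -> R).
Hypothesis inc : forall i j, (1 <= i < j)%N -> (j <= N)%N -> lam i < lam j.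
Hypothesis cdf : forall j, (1 <= j <= N)%N -> sigma [set` `]-oo, lam j]] = (j%:R / N%:R)%:E.

(** All eigenvalues but the last lie below [b], so [lam N] is the only one that may fall to the
    right of the interval. *)
Lemma admissible_diag (n d : nat) (q : {poly R}) : (d < N)%N ->
  (size q <= n.+1)%N -> q.[0] != 0 -> (forall j, (1 <= j <= d)%N -> q.[lam j] = 0) -> q.[lam N] = 0 ->
  admissible_poly (diag_of N lam) `[lam d.+1, b]%classic n q.
Proof.
move=> dN q1 q2 q3 q4; split=> // x.
move=> /((diag_enumerates inc).2 x).1 [j /andP[j1 jN] ->] xI.
have [jd|jd] := leqP j d; first by rewrite q3// j1.
move: jN; rewrite leq_eqVlt => /predU1P[->//|jN]; exfalso; apply: xI.
rewrite /= in_itv /= (lam_le inc)// ?(ltnW jN)//= ltW//.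
by apply: (lam_lt_b cd s1 cdf); rewrite j1.
Qed.

(** Chains [gam_sum_le_integral] and [tau_gamdens_le_sum] at [t = n / N], multiplied by [N]. The
    left side is the exponent in [bernstein_walsh_zeros]. *)
Lemma weighted_count n d k X : (0 < n < N)%N -> (0 < k)%N -> (d.+1 < N)%N -> lam 1%N < X -> X < b ->
  n%:R * gam b (lam d.+1) - \sum_(1 <= j < d.+1) gamker b (lam d.+1) (lam j) <=
  n%:R / k%:R * gam_sum a0 b sigma (n%:R / N%:R) k + N%:R * (fine (tau a0 b sigma X) * gam b X)
    + Num.sqrt (b / (X - lam 1%N)) * gam b (lam d.+1).
Proof.
move=> /andP[n0 nN] k0 dN lX Xb.
have N0 : (0 < N)%N by exact: leq_trans nN.
have N0' : 0 < N%:R :> R by rewrite ltr0n.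
have t0 : 0 < n%:R / N%:R :> R by rewrite divr_gt0// ltr0n.
have tS : ((n%:R / N%:R)%:E < sigma setT)%E.
  by rewrite s1 lte_fin ltr_pdivrMr// mul1r ltr_nat.
have ac : a0 < lam d.+1 by apply: (lam_gt_a0 cd cdf); rewrite /= ltnW.
have cb : lam d.+1 < b by apply: (lam_lt_b cd s1 cdf).
have aX : a0 < X by apply: lt_trans lX; apply: (lam_gt_a0 cd cdf).
have := le_trans (gam_sum_le_integral cd t0 tS k0 ac cb) (tau_gamdens_le_sum cd s1 inc cdf dN lX Xb).
rewrite -(fineK (tau_fin cd aX Xb)) -EFinM -EFinD lee_fin fineK ?(tau_fin cd aX Xb)//.
set G := \sum_(_ <= _ < _) _; set T := fine _ * _; set K := Num.sqrt _ * _; set S := gam_sum _ _ _ _ _.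
rewrite -(ler_pM2l N0') => h.
have -> : n%:R * gam b (lam d.+1) - G = N%:R * (n%:R / N%:R * gam b (lam d.+1) - n%:R / N%:R / k%:R * S) + n%:R / k%:R * S - G.
  by field; rewrite !pnatr_eq0 !gtn_eqF.
have e : N%:R * (T + N%:R^-1 * (K + G)) = N%:R * T + K + G.
  by field; rewrite pnatr_eq0 gtn_eqF.
by rewrite e in h; lra.
Qed.

Lemma En_lower n d k X : (n < N)%N -> (d.+1 < n)%N -> (0 < k)%N -> lam 1%N < X -> X < b ->
  expR (- (ln (2 * n).+1%:R + n%:R / k%:R * gam_sum a0 b sigma (n%:R / N%:R) k
      + N%:R * (fine (tau a0 b sigma X) * gam b X) + Num.sqrt (b / (X - lam 1%N)) * gam b (lam d.+1)))
  <= En (diag_of N lam) n `[lam d.+1, b]%classic.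
Proof.
move=> nN dn k0 lX Xb.
have n0 : (0 < n)%N by exact: leq_trans dn.
have dN : (d.+1 < N)%N by exact: ltn_trans nN.
have N0 : (0 < N)%N by exact: leq_trans nN.
have l0 j : (1 <= j <= N)%N -> 0 < lam j by exact: (lam_gt0 cd cdf).
have cb : lam d.+1 < b by apply: (lam_lt_b cd s1 cdf).
have c0 : 0 < lam d.+1 by apply: l0; rewrite /= ltnW.
apply: En_ge.
  (* [En] is an infimum over a nonempty set: this polynomial has degree [d + 1 < n]. *)
  exists ((\prod_(1 <= j < d.+1) ('X - (lam j)%:P)) * ('X - (lam N)%:P)).
  apply: admissible_diag; first exact: ltnW.
  - apply: (leq_trans (size_polyMleq _ _)).
    by rewrite size_prod_XsubC size_XsubC size_iota subSS subn0 addn2 /= ltnW.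
  - rewrite hornerM mulf_neq0//; last by rewrite hornerXsubC sub0r oppr_eq0 gt_eqF// l0 ?N0 /=.
    rewrite horner_prod big_nat prodf_seq_neq0; apply/allP => j _; apply/implyP => /andP[j1 jd].
    by rewrite hornerXsubC sub0r oppr_eq0 gt_eqF// l0// j1 (leq_trans (ltnW jd))// ltnW.
  - move=> j jd; rewrite hornerM horner_prod (bigD1_seq j) ?iota_uniq//=; last by rewrite mem_index_iota ltnS.
    by rewrite hornerXsubC subrr !mul0r.
  - by rewrite hornerM hornerXsubC subrr mulr0.
move=> q [q1 q2 q3].
have ql j : (j < d)%N -> 0 < lam j.+1 < lam d.+1 /\ q.[lam j.+1] = 0.
  move=> jd.
  have jN : (1 <= j.+1 <= N)%N by rewrite /= (leq_trans jd)// ltnW// ltnW.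
  have h : lam j.+1 < lam d.+1 by apply: inc; rewrite /= ?ltnS// ltnW.
  split; first by rewrite l0.
  apply: q3; first by apply/((diag_enumerates inc).2 _); exists j.+1.
  by rewrite /= in_itv /= => /andP[]; rewrite leNgt h.
have qi i j : (i < d)%N -> (j < d)%N -> lam i.+1 = lam j.+1 -> i = j.
  move=> id jd e; apply/eqP; rewrite eqn_leq; apply/andP; split; rewrite leqNgt; apply/negP => h.
    by have := @inc j.+1 i.+1; rewrite e ltxx => /(_ h) H; have := H (leq_trans id (ltnW (ltnW dN))).
  by have := @inc i.+1 j.+1; rewrite e ltxx => /(_ h) H; have := H (leq_trans jd (ltnW (ltnW dN))).
have M x : lam d.+1 <= x <= b -> `|q.[x]| <= supnorm q `[lam d.+1, b]%classic by move/le_supnorm.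
have := bernstein_walsh_zeros c0 cb q1 M ql qi.
have M0 := supnorm_ge0 q `[lam d.+1, b]%classic.
set W := supnorm _ _ in M0 *; move=> h.
have h1 := @weighted_count n d k X _ k0 dN lX Xb; rewrite n0 nN in h1.
have {}h1 := h1 isT; rewrite big_add1 /= in h1.
set U := n%:R / k%:R * _ + _ + _ in h1.
have h2 : `|q.[0]| <= (2 * n).+1%:R * W * expR U.
  apply: le_trans h _; rewrite ler_wpM2l ?ler_expR// mulr_ge0//.
rewrite ler_pdivlMr ?normr_gt0//.
rewrite (_ : - _ = - ln (2 * n).+1%:R - U); last by rewrite /U; ring.
rewrite expRD !expRN lnK ?posrE ?ltr0n//.
have p1 : 0 < (2 * n).+1%:R :> R by rewrite ltr0n.
have p2 := expR_gt0 U.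
rewrite -invfM mulrC ler_pdivrMr ?mulr_gt0//.
by rewrite mulrA [W * _]mulrC.
Qed.

End EnLower.

(** * Upper bound for the eigenvalues of the diagonal matrices *)

Section EnUpper.
Variable R : realType.
Local Notation mu := (@lebesgue_measure R).
Local Notation measR := {finite_measure set (measurableTypeR R) -> \bar R}.

(** The mass [1 / N] up to [lam 1] is at most the square root in [mass_le_sqrt_tau], as [tau] is at
    most the total mass 1. Hence a factor [1 - x / lam j] grows at most polynomially in [N]. *)
Lemma first_eigenvalue_ge a0 b (sigma : measR) f N (lam : nat -> R) : constraint_data a0 b sigma f ->
  sigma setT = 1%E -> (1 < N)%N ->
  (forall j, (1 <= j <= N)%N -> sigma [set` `]-oo, lam j]] = (j%:R / N%:R)%:E) ->
  (b - a0) / N%:R ^+ 2 <= lam 1%N.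
Proof.
move=> cd s1 N1 cdf; have /andP[a00 a0b] := cd_bounds cd.
have I1 : (1 <= 1 <= N)%N by rewrite /= ltnW.
have al := lam_gt_a0 cd cdf I1.
have lb : lam 1%N < b by apply: (lam_lt_b cd s1 cdf).
have N0 : 0 < N%:R :> R by rewrite ltr0n ltnW.
have ba : 0 < b - a0 by rewrite subr_gt0.
have := mass_le_sqrt_tau cd al lb; rewrite cdf// mul1r => h.
have {}h : (N%:R^-1%:E <= (Num.sqrt ((lam 1%N - a0) / (b - a0)))%:E * 1)%E.
  by apply: le_trans h _; rewrite lee_wpmul2l ?lee_fin// -s1 (tau_le_mass cd al (ltW lb)).
move: h; rewrite mule1 lee_fin => h.
have h2 : N%:R ^- 2 <= (lam 1%N - a0) / (b - a0).
  rewrite -exprVn -[leRHS]sqr_sqrtr; last by rewrite divr_ge0 ?(ltW ba)// subr_ge0 ltW.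
  by rewrite ler_sqr ?nnegrE// invr_ge0 ltW.
move: h2; rewrite ler_pdivlMr// mulrC => h2.
by apply: le_trans h2 _; rewrite gerBl.
Qed.

(** If [lam d < a], then [d / N] is at most the mass up to [a], and [mass_le_sqrt_tau] applies with
    [tau a = n / N]. As long as [a] stays away from [b], [d] is at most a fixed fraction of [n],
    less than 1. *)
Lemma splitting_count a0 b (sigma : measR) f N (lam : nat -> R) n d : constraint_data a0 b sigma f ->
  sigma setT = 1%E -> (0 < n < N)%N ->
  (forall j, (1 <= j <= N)%N -> sigma [set` `]-oo, lam j]] = (j%:R / N%:R)%:E) ->
  splitting_index N lam (left_endpoint a0 b sigma (n%:R / N%:R)) d ->
  d%:R <= Num.sqrt ((left_endpoint a0 b sigma (n%:R / N%:R) - a0) / (b - a0)) * n%:R.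
Proof.
move=> cd s1 /andP[n0 nN] cdf [dN ld _].
case: (posnP d) => [->|d0]; first by rewrite mulr_ge0.
have N0 : 0 < N%:R :> R by rewrite ltr0n (ltn_trans n0).
have t0 : 0 < n%:R / N%:R :> R by rewrite divr_gt0// ltr0n.
have tS : ((n%:R / N%:R)%:E < sigma setT)%E by rewrite s1 lte_fin ltr_pdivrMr// mul1r ltr_nat.
have [_ ab ta] := left_endpointP cd (ltW t0) tS.
have := ld d0; set a := left_endpoint _ _ _ _ in ab ta * => la.
have jd : (1 <= d <= N)%N by rewrite d0 ltnW.
have aa : a0 < a by apply: lt_trans la; exact: (lam_gt_a0 cd cdf).
have := mass_le_sqrt_tau cd aa ab; rewrite ta => h.
have : ((d%:R / N%:R)%:E <= (Num.sqrt ((a - a0) / (b - a0)))%:E * (n%:R / N%:R)%:E)%E.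
  apply: le_trans h; rewrite -cdf//.
  by apply: le_measure; rewrite ?inE//= => x /=; rewrite !in_itv /= => /le_trans -> //; exact: ltW.
by rewrite -EFinM lee_fin mulrA ler_pM2r// invr_gt0.
Qed.

Lemma prod_normalized_roots k1 (mu0 : nat -> R) : (forall j, (j < k1)%N -> 0 < mu0 j) ->
  exists p : {poly R}, [/\ (size p <= k1.+1)%N, p.[0] = 1, forall j, (j < k1)%N -> p.[mu0 j] = 0 &
    forall x m b, 0 <= x <= b -> 0 < m -> (forall j, (j < k1)%N -> m <= mu0 j) -> `|p.[x]| <= (1 + b / m) ^+ k1].
Proof.
elim: k1 => [|k1 IH] mp.
  by exists 1; split; rewrite ?size_poly1 ?hornerC// => x m b _ _ _; rewrite hornerC expr0 normr1.
have [|p [p1 p2 p3 p4]] := IH; first by move=> j jk; apply: mp; exact: ltnW.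
have m0 := mp k1 (leqnn _).
have E x : (p * (1 - (mu0 k1)^-1 *: 'X)).[x] = p.[x] * (1 - x / mu0 k1).
  by rewrite hornerM hornerD hornerN hornerZ hornerX hornerC mulrC [_^-1 * _]mulrC mulrC.
exists (p * (1 - (mu0 k1)^-1 *: 'X)); split.
- apply: leq_trans (size_polyMleq _ _) _.
  have : (size (1 - (mu0 k1)^-1 *: 'X : {poly R})%R <= 2)%N.
    apply: leq_trans (size_polyD _ _) _; rewrite geq_max size_poly1 /= size_polyN.
    by apply: leq_trans (size_scale_leq _ _) _; rewrite size_polyX.
  by move=> h; rewrite -subn1 leq_subLR (leq_trans (leq_add p1 h))// addn2.
- by rewrite E p2 mul0r subr0 mulr1.
- move=> j; rewrite ltnS leq_eqVlt => /predU1P[->|jk]; rewrite E.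
    by rewrite divff ?gt_eqF// subrr mulr0.
  by rewrite p3// mul0r.
- move=> x m b /andP[x0 xb] mm mle; rewrite E normrM exprSr ler_pM//.
    by apply: p4; rewrite ?x0// => j jk; apply: mle; exact: ltnW.
  apply: le_trans (ler_normB _ _) _; rewrite normr1 lerD2l ger0_norm; last by rewrite divr_ge0// ltW.
  have mk := mle k1 (leqnn _).
  by apply: ler_pM => //; rewrite ?invr_ge0 ?(ltW m0)// lef_pV2.
Qed.

(* As [lam N] may exceed [b], its factor and those of the first [k1] eigenvalues are added to a polynomial of
   degree [n - k1.+1]; the latter give the room needed in the counting condition. *)
Lemma En_upper : exists C : R, forall a0 b (sigma : measR) f N (lam : nat -> R) n d k k1,
  constraint_data a0 b sigma f -> sigma setT = 1%E ->
  (forall i j, (1 <= i < j)%N -> (j <= N)%N -> lam i < lam j) ->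
  (forall j, (1 <= j <= N)%N -> sigma [set` `]-oo, lam j]] = (j%:R / N%:R)%:E) ->
  (0 < n < N)%N -> (1 < k)%N -> (k1.+1 < n)%N -> (d * k1.+1 <= n * k1)%N ->
  splitting_index N lam (left_endpoint a0 b sigma (n%:R / N%:R)) d ->
  En (diag_of N lam) n `[lam d.+1, b]%classic <=
  expR (C - (n - k1.+1)%:R / k%:R *
     (gam_sum a0 b sigma (n%:R / N%:R) k - 2 * gam b (left_endpoint a0 b sigma (n%:R / N%:R)))) *
  (1 + b * N%:R ^+ 2 / (b - a0)) ^+ k1.+1.
Proof.
have [C HC] := @constrained_poly_sigma R.
exists C => a0 b sigma f N lam n d k k1 cd s1 inc cdf /andP[n0 nN] kk k1n dk [dN ld la].
have /andP[a00 a0b] := cd_bounds cd.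
have b0 := le_lt_trans a00 a0b.
have N0 : 0 < N%:R :> R by rewrite ltr0n (ltn_trans n0).
have t0 : 0 < n%:R / N%:R :> R by rewrite divr_gt0// ltr0n.
have tS : ((n%:R / N%:R)%:E < sigma setT)%E by rewrite s1 lte_fin ltr_pdivrMr// mul1r ltr_nat.
have [ha0 ab _] := left_endpointP cd (ltW t0) tS.
set t := n%:R / N%:R in t0 tS ld la ha0 ab *.
set a := left_endpoint a0 b sigma t in ld la ha0 ab *.
have k1d : (d < n)%N by rewrite -(ltn_pmul2r (ltn0Sn k1)) (leq_ltn_trans dk)// ltn_pmul2l.
have l0 j : (1 <= j <= N)%N -> 0 < lam j by exact: (lam_gt0 cd cdf).
have n'0 : (0 < n - k1.+1)%N by rewrite subn_gt0.
have dn' : (d - k1 <= n - k1.+1)%N by rewrite -subSS leq_sub2r.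
have [j jd|q [q1 q2 q3 q4]] := HC a0 b sigma f cd (n - k1.+1)%N (d - k1)%N k (fun j => lam (k1 + j).+1) t n'0 kk dn' t0 tS.
- have jd' : (k1 + j < d)%N by rewrite -ltn_subRL.
  split.
    apply: le_lt_trans (ld (leq_ltn_trans (leq0n _) jd')).
    by apply: (lam_le inc) => //; exact: ltnW.
  rewrite cdf; last by rewrite /= (leq_trans jd')// ltnW.
  rewrite lee_fin /t -mulrA mulrAC ler_pM2r ?invr_gt0// mulrA.
  rewrite ler_pdivrMr ?ltr0n ?subn_gt0// -!natrM ler_nat.
  (* The claim is [n * (j + 1) <= (k1 + j + 1) * (n - k1 - 1)], equivalently
     [(k1 + 1) * (k1 + j + 1) <= n * k1], and [k1 + j + 1 <= d]. *)
  by move: dk jd' k1n; clear; nia.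
have lmin j : (1 <= j <= N)%N -> lam 1%N <= lam j by move=> /andP[j1 jN]; exact: (lam_le inc).
have l1 : 0 < lam 1%N by apply: l0; rewrite /= (ltn_trans n0).
pose mu0 j := if (j < k1)%N then lam j.+1 else lam N.
have mN j : exists2 i, (1 <= i <= N)%N & mu0 j = lam i.
  rewrite /mu0; case: ifP => jk; last by exists N => //; rewrite leqnn andbT (ltn_trans n0).
  by exists j.+1 => //=; rewrite (ltn_trans jk)// (ltn_trans _ nN)// ltnW.
have [|p [p1 p2 p3 p4]] := @prod_normalized_roots k1.+1 mu0.
  by move=> j _; have [i hi ->] := mN j; exact: l0.
have lb : lam d.+1 <= b by rewrite ltW//; apply: (lam_lt_b cd s1 cdf); rewrite /= (leq_ltn_trans k1d).
have aq : admissible_poly (diag_of N lam) `[lam d.+1, b]%classic n (q * p).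
  apply: (admissible_diag cd s1 inc cdf) => //.
  - apply: leq_trans (size_polyMleq _ _) _; rewrite -subn1 leq_subLR (leq_trans (leq_add q1 p1))//.
    by move: k1n; clear; lia.
  - by rewrite hornerM q2 p2 mulr1 oner_neq0.
  - move=> j /andP[j1 jd]; rewrite hornerM; have [jk|jk] := leqP j k1.
      by have := p3 j.-1; rewrite /mu0 prednK// jk => ->; rewrite ?mulr0// leqW.
    have [|_] := q3 (j - k1.+1)%N; first by move: jk jd; clear; lia.
    by rewrite -addSn subnKC// => ->; rewrite mul0r.
  - by rewrite hornerM; have := p3 k1 (leqnn _); rewrite /mu0 ltnn => ->; rewrite mulr0.
apply: le_trans (En_le aq) _; rewrite hornerM q2 p2 mulr1 normr1 divr1.
apply: supnorm_le; first by exists (lam d.+1); rewrite /= in_itv /= lexx.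
move=> x; rewrite /= in_itv /= => /andP[x1 x2].
have ax := le_trans la x1.
rewrite hornerM normrM ler_pM//; first by apply: q4; rewrite ax.
have x0 : 0 <= x by apply: le_trans ax; exact: le_trans ha0.
apply: le_trans (p4 x (lam 1%N) b _ l1 _) _; first by rewrite x0.
  by move=> j _; have [i hi ->] := mN j; exact: lmin.
have N1 : (1 < N)%N by exact: leq_ltn_trans nN.
have h := first_eigenvalue_ge cd s1 N1 cdf.
have ba : 0 < b - a0 by rewrite subr_gt0.
apply: lerXn2r; rewrite ?nnegrE ?addr_ge0 ?divr_ge0 ?mulr_ge0 ?(ltW b0) ?(ltW l1) ?(ltW ba)//.
rewrite lerD2l -mulrA ler_wpM2l ?(ltW b0)//.
rewrite -[leRHS]invrK invf_div lef_pV2// posrE.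
by rewrite divr_gt0// exprn_gt0.
Qed.

End EnUpper.

(** * Limits *)

Section Rates.
Variable R : realType.

Lemma ratio_box_nonempty (t : R) (e : nat * R) : 0 < t -> 0 < e.2 -> ratio_box t e !=set0.
Proof.
move=> t0 e0.
pose N := (maxn e.1 (Num.truncn (e.1.+1%:R / t)) + Num.truncn e.2^-1).+1.
have N0 : 0 < N%:R :> R by rewrite ltr0n.
have N1 : e.1.+1%:R / t < N%:R.
  apply: lt_le_trans (truncnS_gt _) _; rewrite ler_nat ltnS.
  by apply: leq_trans (leq_addr _ _); exact: leq_maxr.
have N2 : e.2^-1 < N%:R.
  by apply: lt_le_trans (truncnS_gt _) _; rewrite ler_nat ltnS leq_addl.
have /andP[h1 h2] := truncn_itv (mulr_ge0 (ltW t0) (ltW N0)).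
exists (Num.truncn (t * N%:R), N); split=> /=.
- have : e.1.+1%:R < (Num.truncn (t * N%:R)).+1%:R :> R.
    by apply: lt_trans h2; rewrite mulrC -ltr_pdivrMr.
  by rewrite ltr_nat ltnS => /ltnW.
- by rewrite /N ltnW// ltnS (leq_trans (leq_maxl _ (Num.truncn (e.1.+1%:R / t))))// leq_addr.
- rewrite ltr_distlC; apply/andP; split.
    rewrite ltrBlDr; apply: (@le_lt_trans _ _ t); [by rewrite ler_pdivrMr|by rewrite ltrDl].
  rewrite -ltrBlDl; apply: (@lt_trans _ _ (N%:R^-1)); last by rewrite invf_plt.
  by rewrite ltrBlDr -(ltr_pM2r N0) mulrDl divfK ?gt_eqF// mulVf ?gt_eqF// addrC natr1.
Qed.

(** The lower bound has to be uniform in [d], as the liminf ranges over all [d < n - 1]; the upper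
    one is needed only along [dd], together with [dd < n - 1], which makes [dd] a competitor in the
    liminf. Continuity of the exponential turns errors in the exponent into errors of the roots. *)
Lemma limits_of_rates (F : nat -> nat -> nat -> R) (dd : nat -> nat -> nat) (t L0 : R) : 0 < t ->
  (forall eps, 0 < eps -> exists2 e : nat * R, 0 < e.2 & forall p d, ratio_box t e p -> (d < p.1.-1)%N ->
     expR (- (p.1%:R * (L0 + eps))) <= F p.1 p.2 d) ->
  (forall eps, 0 < eps -> exists2 e : nat * R, 0 < e.2 & forall p, ratio_box t e p ->
     (dd p.1 p.2 < p.1.-1)%N /\ F p.1 p.2 (dd p.1 p.2) <= expR (- (p.1%:R * (L0 - eps)))) ->
  (F p.1 p.2 (dd p.1 p.2) `^ p.1%:R^-1) @[p --> ratio_filter t] --> expR (- L0) /\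
  limf_einf (fun p : nat * nat * nat => (F p.1.1 p.1.2 p.2 `^ p.1.1%:R^-1)%:E) (ratio_index_filter t)
    = (expR (- L0))%:E.
Proof.
move=> t0 lo up.
have near eta : 0 < eta -> exists2 eps : R, 0 < eps & forall x, `|x - - L0| <= eps -> `|expR (- L0) - expR x| < eta.
  move=> eta0; have /cvgrPdist_lt/(_ eta eta0) := @continuous_expR R (- L0).
  move=> /nbhs_ballP[r /= r0 Hr]; exists (r / 2); first by rewrite divr_gt0.
  move=> x xr; apply: Hr; rewrite /ball /= distrC; apply: le_lt_trans xr _.
  by rewrite ltr_pdivrMr// ltr_pMr// ltr1n.
have rootE n (x : R) : (0 < n)%N -> expR (- (n%:R * x)) `^ n%:R^-1 = expR (- x).
  move=> n0; rewrite -expRM mulNr mulrAC divff ?mul1r//.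
  by rewrite pnatr_eq0 gtn_eqF.
have LO eta : 0 < eta -> exists2 e : nat * R, 0 < e.2 & forall p d, ratio_box t e p -> (d < p.1.-1)%N ->
    expR (- L0) - eta <= F p.1 p.2 d `^ p.1%:R^-1.
  move=> /near[eps eps0 H]; have [e e0 He] := lo _ eps0; exists e => // p d pe dp.
  have p0 : (0 < p.1)%N by case: (p.1) dp.
  apply: (@le_trans _ _ (expR (- (L0 + eps)))).
    have := H (- (L0 + eps)); rewrite opprK opprD addrAC addNr add0r normrN gtr0_norm// lexx.
    by move=> /(_ isT); rewrite ltr_distlC => /andP[/ltW + _].
  rewrite -(rootE p.1)//; apply: ge0_ler_powR => //; rewrite ?nnegrE ?invr_ge0 ?expR_ge0//; last exact: He.
  exact: le_trans (expR_ge0 _) (He _ _ pe dp).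
have UP eta : 0 < eta -> exists2 e : nat * R, 0 < e.2 & forall p, ratio_box t e p -> (dd p.1 p.2 < p.1.-1)%N /\
    F p.1 p.2 (dd p.1 p.2) `^ p.1%:R^-1 <= expR (- L0) + eta.
  move=> /near[eps eps0 H]; have [e1 e10 He1] := up _ eps0.
  have [e2 e20 He2] := lo _ eps0.
  exists (maxn e1.1 e2.1, Num.min e1.2 e2.2); first by rewrite /= lt_min e10.
  move=> p /ratio_boxI[pe1 pe2]; have [dp hp] := He1 _ pe1; split=> //.
  have p0 : (0 < p.1)%N by case: (p.1) dp.
  apply: (@le_trans _ _ (expR (- (L0 - eps)))).
    rewrite -(rootE p.1)//; apply: ge0_ler_powR => //; rewrite ?nnegrE ?invr_ge0 ?expR_ge0//.
    exact: le_trans (expR_ge0 _) (He2 _ _ pe2 dp).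
  have := H (- (L0 - eps)); rewrite opprK opprB addrNK gtr0_norm// lexx.
  by move=> /(_ isT); rewrite ltr_distlC => /andP[_ /ltW].
split.
  apply/cvgrPdist_le => eta eta0.
  have [e1 e10 He1] := UP _ eta0; have [e2 e20 He2] := LO _ eta0.
  exists (maxn e1.1 e2.1, Num.min e1.2 e2.2); first by rewrite /= lt_min e10.
  move=> p /ratio_boxI[pe1 pe2] /=; have [dp hp] := He1 _ pe1.
  by rewrite ler_distlC (He2 _ _ pe2 dp).
rewrite limf_einfE; apply/eqP; rewrite eq_le; apply/andP; split.
  apply: ge_ereal_sup => _ [V [e /= e0 eV] <-].
  apply/lee_addgt0Pr => eta eta0.
  have [e1 e10 He1] := UP _ eta0.
  have [p /ratio_boxI[pe pe1]] := @ratio_box_nonempty t (maxn e.1 e1.1, Num.min e.2 e1.2) t0 ltac:(by rewrite /= lt_min e0).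
  have [dp hp] := He1 _ pe1.
  apply: ge_ereal_inf; exists (F p.1 p.2 (dd p.1 p.2) `^ p.1%:R^-1)%:E; last by rewrite -EFinD lee_fin.
  by exists (p, dd p.1 p.2) => //; apply: eV.
apply/lee_addgt0Pr => eta eta0; rewrite -leeBlDr//.
have [e e0 He] := LO _ eta0.
apply: le_ereal_sup_tmp; eexists.
  exists [set p | ratio_box t e p.1 /\ (p.2 < p.1.1.-1)%N]; last by reflexivity.
  by exists e.
by apply: le_ereal_inf_tmp => _ [p [p1 p2] <-]; rewrite -EFinB lee_fin He.
Qed.

(** With [s = Num.sqrt (2 * n + 1)] the logarithm is at most [2 * s], and [4 * (2 * n + 1) <= 12 * n
    <= (eps * n) ^+ 2] once [n >= 12 / eps ^+ 2]. *)
Lemma ln_eventually_small (eps : R) : 0 < eps ->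
  exists n0 : nat, forall n, (n0 <= n)%N -> ln (2 * n).+1%:R <= eps * n%:R.
Proof.
move=> e0; exists (Num.truncn (12 / eps ^+ 2)).+1 => n hn.
have n0 : (0 < n)%N by exact: leq_trans hn.
have n0' : 1 <= n%:R :> R by rewrite ler1n.
have h : 12 / eps ^+ 2 <= n%:R.
  by apply: le_trans (ltW (truncnS_gt _)) _; rewrite ler_nat.
pose s : R := Num.sqrt (2 * n).+1%:R.
have s2 : s ^+ 2 = (2 * n).+1%:R by rewrite sqr_sqrtr.
have s0 : 0 < s by rewrite sqrtr_gt0 ltr0n.
rewrite -s2 lnXn// -[leLHS]mulr_natl.
apply: (@le_trans _ _ (2 * s)); first by rewrite ler_pM2l// ltW// ln_sublinear.
rewrite -ler_sqr ?nnegrE ?mulr_ge0 ?(ltW e0) ?(ltW s0)//.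
rewrite !exprMn s2.
move: h; rewrite ler_pdivrMr ?exprn_gt0// => h.
apply: (@le_trans _ _ (12 * n%:R)); first by rewrite -[(2 * n).+1%:R]natr1 natrM; lra.
by rewrite [eps ^+ 2 * _]mulrC expr2 -mulrA [leRHS]mulrC ler_wpM2r// mulrC.
Qed.

Lemma const_eventually_small (eps K : R) : 0 < eps ->
  exists n0 : nat, forall n, (n0 <= n)%N -> K <= eps * n%:R.
Proof.
move=> e0; exists (Num.truncn (K / eps)).+1 => n hn.
rewrite mulrC -ler_pdivrMr//; apply: le_trans (ltW (truncnS_gt _)) _.
by rewrite ler_nat.
Qed.

End Rates.

Section MonotoneIntegral.
Variable R : realType.
Local Notation mu := (@lebesgue_measure R).
Variables (phi : R -> R) (M : R).
Hypothesis phi_nd : nondecreasing_fun phi.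
Hypothesis phi0 : forall s, 0 <= phi s.
Hypothesis phiM : forall s, phi s <= M.

Lemma Rintegral_monotone_lipschitz s s' : 0 <= s -> s <= s' ->
  0 <= \int[mu]_(x in `[0, s']) phi x - \int[mu]_(x in `[0, s]) phi x <= M * (s' - s).
Proof.
move=> s0 ss.
have F u v x y : (mu [set` Interval (BSide x u) (BSide y v)] < +oo)%E.
  by rewrite lebesgue_measure_itv /= ; case: ifP => _; rewrite ?ltry// -EFinB ltry.
have int u v x y : mu.-integrable [set` Interval (BSide x u) (BSide y v)] (EFin \o phi).
  apply: measurable_bounded_integrable; [exact: measurable_itv|exact: F| |].
    by apply: nondecreasing_measurable; [exact: measurable_itv|exact: phi_nd].
  exists M; split; first exact: num_real.
  by move=> r Mr z _ /=; rewrite ger0_norm// (le_trans (phiM z))// ltW.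
rewrite (Rintegral_itvB (int _ _ _ _)); rewrite ?bnd_simp//.
rewrite Rintegral_ge0//=.
apply: (@le_trans _ _ (\int[mu]_(x in `]s, s']) M)).
  apply: le_Rintegral => //.
  apply: measurable_bounded_integrable; [exact: measurable_itv|exact: F|exact: measurable_cst|].
  by exists `|M|; split; [exact: num_real|move=> r Mr z _; exact: ltW].
rewrite Rintegral_cst//= lebesgue_measure_itv /= lte_fin; case: ltP => [h|h]; first by rewrite -EFinB.
by rewrite mulr0 mulr_ge0 ?subr_ge0// (le_trans (phi0 s)).
Qed.

End MonotoneIntegral.

(** * Exponential rates of both bounds as n / N tends to t *)

Section AsymptoticRates.
Variable R : realType.
Local Notation mu := (@lebesgue_measure R).
Local Notation measR := {finite_measure set (measurableTypeR R) -> \bar R}.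
Variables (a0 b : R) (sigma : measR) (f : R -> R).
Hypothesis cd : constraint_data a0 b sigma f.
Hypothesis s1 : sigma setT = 1%E.
Local Notation a := (left_endpoint a0 b sigma).
Local Notation tau := (tau a0 b sigma).
Variable t : R.
Hypothesis t01 : 0 < t < 1.

(** A margin between [t] and 1: eventually [n / N <= tp], and up to [tp] the endpoints a(s) stay
    away from [b]. *)
Let tp := (1 + t) / 2.

Let t0 : 0 < t. Proof. by case/andP: t01. Qed.

Let t1 : t < 1. Proof. by case/andP: t01. Qed.

Let tp0 : 0 < tp. Proof. by rewrite /tp divr_gt0// addr_gt0// ltr01. Qed.

Let tp1 : tp < 1. Proof. by have := t1; rewrite /tp; lra. Qed.

(** Clamping to [0, tp] makes the function monotone and bounded on the whole line, as the results on
    monotone integrands require. *)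
Let phi (s : R) : R := gam b (a (Num.min (Num.max 0 s) tp)).

Let M := phi tp.

Let clamp_itv (s : R) : 0 <= Num.min (Num.max 0 s) tp <= tp.
Proof. by rewrite le_min le_max lexx (ltW tp0) ge_min lexx orbT. Qed.

Let clamp_id (s : R) : 0 <= s <= tp -> Num.min (Num.max 0 s) tp = s.
Proof. by move=> /andP[s0 stp]; rewrite max_r// min_l. Qed.

Let mass_lt (s : R) : s <= tp -> (s%:E < sigma setT)%E.
Proof. by move=> h; rewrite s1 lte_fin (le_lt_trans h). Qed.

Let phi_nd : nondecreasing_fun phi.
Proof.
move=> s s' ss; have /andP[h1 h2] := clamp_itv s; have /andP[h3 h4] := clamp_itv s'.
have [u1 u2 _] := left_endpointP cd h1 (mass_lt h2).
have [v1 v2 _] := left_endpointP cd h3 (mass_lt h4).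
have /andP[a00 _] := cd_bounds cd.
apply: gam_le => //; first exact: le_trans u1.
apply: (endpoint_le cd) => //; last exact: mass_lt.
rewrite le_min !ge_min lexx orbT andbT; apply/orP; left.
by rewrite ge_max !le_max lexx ss orbT.
Qed.

Let phi_ge0 s : 0 <= phi s.
Proof.
have /andP[h1 h2] := clamp_itv s; have [u1 u2 _] := left_endpointP cd h1 (mass_lt h2).
by have /andP[a00 _] := cd_bounds cd; apply: gam_ge0 => //; exact: le_trans u1.
Qed.

Let phi_le s : phi s <= M.
Proof.
have [h|h] := leP s tp; first exact: phi_nd.
have e : Num.min (Num.max 0 s) tp = tp by rewrite min_r// le_max (ltW h) orbT.
by rewrite /M /phi e clamp_id// lexx ltW.
Qed.

Let J (s : R) : R := \int[mu]_(x in `[0, s]) phi x.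

Let J_lip s s' : 0 <= s -> s <= s' -> 0 <= J s' - J s <= M * (s' - s).
Proof. by move=> h1 h2; exact: (Rintegral_monotone_lipschitz phi_nd phi_ge0 phi_le). Qed.

Let J_itv s : 0 <= s -> 0 <= J s <= M * s.
Proof.
move=> h; have := J_lip (lexx 0) h; rewrite subr0.
by rewrite {2 4}/J set_itv1 /Rintegral integral_set1 /= subr0.
Qed.

Let J_mean_close s : t / 2 <= s -> `|J s / s - J t / t| <= 4 * M / t * `|s - t|.
Proof.
move=> ts; have t_gt0 := t0; have s0 : 0 < s by apply: lt_le_trans ts; rewrite divr_gt0.
have M0 : 0 <= M by exact: phi_ge0.
have E : J s / s - J t / t = ((J s - J t) * t - J t * (s - t)) / (t * s).
  by field; rewrite !gt_eqF.
have h1 : `|J s - J t| <= M * `|s - t|.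
  have [st|/ltW st] := leP s t.
    have /andP[h1 h2] := J_lip (ltW s0) st.
    by rewrite distrC ger0_norm// distrC ger0_norm// subr_ge0.
  have /andP[h1 h2] := J_lip (ltW t0) st.
  by rewrite ger0_norm// ger0_norm// subr_ge0.
have /andP[h2 h3] := J_itv (ltW t0).
rewrite E normrM [`|(t * s)^-1|]gtr0_norm ?invr_gt0 ?mulr_gt0// ler_pdivrMr ?mulr_gt0//.
apply: (le_trans (ler_normB _ _)); rewrite !normrM (gtr0_norm t0) (ger0_norm h2).
have h4 : `|J s - J t| * t <= M * `|s - t| * t by rewrite ler_wpM2r// ltW.
have h5 : J t * `|s - t| <= M * t * `|s - t| by rewrite ler_wpM2r.
have h6 : 4 * M / t * `|s - t| * (t * s) = 4 * M * `|s - t| * s by field; rewrite gt_eqF.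
have h7 : M * `|s - t| * (t / 2) <= M * `|s - t| * s by rewrite ler_wpM2l ?mulr_ge0.
by rewrite h6; lra.
Qed.

(** A right-endpoint sum of a nondecreasing function exceeds the left-endpoint one by at most its
    last term, and the integral lies in between. *)
Let gam_sum_bounds s k : 0 < s -> s <= tp -> (0 < k)%N ->
  J s / s <= gam_sum a0 b sigma s k / k%:R <= J s / s + M / k%:R.
Proof.
move=> s0 stp k0.
have k0' : 0 < k%:R :> R by rewrite ltr0n.
have E : gam_sum a0 b sigma s k = \sum_(1 <= i < k.+1) phi (i%:R * (s / k%:R)).
  apply: eq_big_nat => i /andP[_ ik]; rewrite /phi clamp_id//.
  by have /andP[-> h] := grid_itv s0 k0 ik; rewrite (le_trans h).
have h1 : J s <= s / k%:R * gam_sum a0 b sigma s k.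
  by rewrite E; apply: Rintegral_le_step => // u v _ uv _; exact: phi_nd.
have h2 : s / k%:R * \sum_(0 <= i < k) phi (i%:R * (s / k%:R)) <= J s.
  by apply: step_le_Rintegral => // u v _ uv _; exact: phi_nd.
have h3 : gam_sum a0 b sigma s k <= \sum_(0 <= i < k) phi (i%:R * (s / k%:R)) + M.
  rewrite E; set g := fun i : nat => phi (i%:R * (s / k%:R)).
  have e1 : \sum_(0 <= i < k.+1) g i = g 0%N + \sum_(1 <= i < k.+1) g i by rewrite big_ltn.
  have e2 : \sum_(0 <= i < k.+1) g i = \sum_(0 <= i < k) g i + g k by rewrite big_nat_recr.
  have := phi_ge0 (0%N%:R * (s / k%:R)); have := phi_le (k%:R * (s / k%:R)).
  by rewrite -/(g k) -/(g 0%N); lra.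
apply/andP; split.
  rewrite ler_pdivrMr// (_ : _ / k%:R * s = s / k%:R * gam_sum a0 b sigma s k)//.
  by rewrite [RHS]mulrC mulrA mulrAC.
rewrite ler_pdivrMr// mulrDl divfK ?gt_eqF//; apply: (le_trans h3); rewrite lerD2r.
by rewrite [leRHS]mulrAC ler_pdivlMr// -ler_pdivrMr// -mulrA mulrC.
Qed.

Let J_mean_le s : 0 < s -> 0 <= J s / s <= M.
Proof.
move=> s0; have /andP[h1 h2] := J_itv (ltW s0).
by rewrite divr_ge0 ?(ltW s0)// ler_pdivrMr.
Qed.

Let ratio_facts (e : nat * R) p : ratio_box t e p -> (0 < e.1)%N -> e.2 <= t / 2 -> e.2 <= (1 - t) / 2 ->
  [/\ (0 < p.1 < p.2)%N, t / 2 <= p.1%:R / p.2%:R & p.1%:R / p.2%:R <= tp].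
Proof.
move=> [/= h1 h2 h3] e0 e1 e2.
have p10 : (0 < p.1)%N by exact: leq_trans h1.
have p20 : (0 < p.2)%N by exact: leq_trans h2.
move: h3; rewrite ltr_distlC => /andP[h3 h4].
have h5 : p.1%:R / p.2%:R <= tp by rewrite /tp; lra.
have tpl := tp1.
split=> //; last by lra.
rewrite p10 /= -(ltr_nat R) -[ltRHS]mul1r -ltr_pdivrMr ?ltr0n//.
exact: le_lt_trans tpl.
Qed.

Variables (lam : nat -> nat -> R) (dd : nat -> nat -> nat).
Hypothesis inc : forall N i j, (1 <= i < j)%N -> (j <= N)%N -> lam N i < lam N j.
Hypothesis cdf : forall N j, (1 <= j <= N)%N -> sigma [set` `]-oo, lam N j]] = (j%:R / N%:R)%:E.
Hypothesis split_dd : forall n N, (0 < n < N)%N -> splitting_index N (lam N) (a (n%:R / N%:R)) (dd n N).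

Let L0 := J t / t.

(** The entries [t / 2] and [(1 - t) / 2] keep [n / N] between [t / 2] and [tp]; the last one makes
    the error in [J_mean_close] at most [eps]. *)
Let box (eps : R) (n0 : nat) : nat * R :=
  (n0.+1, Num.min (Num.min (t / 2) ((1 - t) / 2)) (eps * t / (4 * M + 1))).

Let box_gt0 eps n0 : 0 < eps -> 0 < (box eps n0).2.
Proof.
move=> e0; have M0 : 0 <= M by exact: phi_ge0.
rewrite /box /= !lt_min !divr_gt0 ?mulr_gt0 ?subr_gt0//=.
by lra.
Qed.

Let boxP eps n0 p : 0 < eps -> ratio_box t (box eps n0) p ->
  [/\ (n0 <= p.1)%N, (n0 < p.2)%N, (0 < p.1 < p.2)%N, t / 2 <= p.1%:R / p.2%:R <= tp &
      `|J (p.1%:R / p.2%:R) / (p.1%:R / p.2%:R) - L0| <= eps].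
Proof.
move=> e0 pb; have [/= h1 h2 h3] := pb.
have [||h4 h5 h6] := ratio_facts pb isT; rewrite /= ?ge_min ?lexx ?orbT//.
split; rewrite ?h5 ?h6//; first exact: ltnW.
have M0 : 0 <= M by exact: phi_ge0.
have M1 : 0 < 4 * M + 1 by lra.
apply: (le_trans (J_mean_close h5)).
move: h3; rewrite !lt_min => /andP[_ h3].
have tg := t0.
apply: (@le_trans _ _ (4 * M / t * (eps * t / (4 * M + 1)))).
  by rewrite ler_wpM2l ?(ltW h3)// divr_ge0 ?(ltW tg)// mulr_ge0.
rewrite [leLHS](_ : _ = eps * (4 * M) / (4 * M + 1)); last by field; rewrite !gt_eqF.
by rewrite ler_pdivrMr// ler_pM2l//; lra.
Qed.

Lemma lower_rate eps : 0 < eps -> exists2 e : nat * R, 0 < e.2 & forall p d, ratio_box t e p ->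
  (d < p.1.-1)%N ->
  expR (- (p.1%:R * (L0 + eps))) <= En (diag_of p.2 (lam p.2)) p.1 `[lam p.2 d.+1, b]%classic.
Proof.
move=> eps0; have eta0 : 0 < eps / 5 by rewrite divr_gt0.
(* Five shares: the factor [2 * n + 1], the correction in [q2], the mass up to [X] in [q3], and in
   [q4] the Riemann sum and the passage from [n / N] to [t]. *)
have eE : eps = 5 * (eps / 5) by field.
move: (eps / 5) eta0 eE => eta eta0 eE.
have /andP[a00 a0b] := cd_bounds cd.
have tpl := tp1; have tph : tp < (1 + tp) / 2 by lra.
have tg := t0; have M0 : 0 <= M by exact: phi_ge0.
(* A bound for [lam N d.+1] that holds for all [d < n - 1], so that the Green function of
   [lam N d.+1, b] at 0 is bounded uniformly in [d]. *)
have [y [ay yb my]] : exists c, [/\ a0 < c, c < b & (((1 + tp) / 2)%:E <= sigma [set` `]-oo, c]])%E].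
  by apply: (mass_large cd); rewrite s1 lte_fin; lra.
pose m := (a0 + b) / 2.
have am : a0 < m by rewrite /m; lra.
have mb : m < b by rewrite /m; lra.
have gm0 : 0 <= gam b m by apply: gam_ge0 => //; lra.
have pg : 0 < pi * (gam b m + 1) :> R by rewrite mulr_gt0 ?pi_gt0//; lra.
have eX : 0 < eta * (t / 2) / (pi * (gam b m + 1)) by rewrite !divr_gt0// mulr_gt0// divr_gt0.
have [dl dl0 Hdl] := wt_small cd eX.
(* So close to [a0] that [tau X * gam b X <= eta * (t / 2)]; multiplied by [N] this is at most
   [eta * n]. *)
pose X := a0 + Num.min dl ((b - a0) / 2) / 2.
have mn0 : 0 < Num.min dl ((b - a0) / 2) by rewrite lt_min dl0 divr_gt0// subr_gt0.
have mn1 : Num.min dl ((b - a0) / 2) <= dl by rewrite ge_min lexx.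
have mn2 : Num.min dl ((b - a0) / 2) <= (b - a0) / 2 by rewrite ge_min lexx orbT.
have aX : a0 < X by rewrite /X; lra.
have Xm : X < m by rewrite /X /m; lra.
have Xb := lt_trans Xm mb.
have wX : wt a0 b f X < eta * (t / 2) / (pi * (gam b m + 1)) by apply: Hdl => //; rewrite /X; lra.
have gX : gam b X <= gam b m by apply: gam_le; rewrite ?(ltW Xm)//; exact: le_trans (ltW aX).
have gX0 : 0 <= gam b X by apply: gam_ge0 => //; exact: le_trans (ltW aX).
have TX : fine (tau X) * gam b X <= eta * (t / 2).
  have h : fine (tau X) <= pi * wt a0 b f X.
    by rewrite -lee_fin fineK ?(tau_fin cd aX Xb)// (tau_le_wt cd aX Xb).
  have w0 : 0 <= wt a0 b f X by exact: (wt_ge0 cd).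
  have fX : 0 <= fine (tau X) by rewrite fine_ge0// tau_ge0.
  apply: (@le_trans _ _ (pi * wt a0 b f X * (gam b m + 1))); first by apply: ler_pM => //; lra.
  move: wX; rewrite ltr_pdivlMr// => /ltW; apply: le_trans.
  by rewrite [leRHS]mulrCA mulrA.
(* The mass up to [z] is positive, so [lam N 1 < z] for large [N], and [X - lam N 1] stays bounded
   below. *)
pose z := (a0 + X) / 2.
have az : a0 < z by rewrite /z; lra.
have zX : z < X by rewrite /z; lra.
have mz := mass_gt0 cd az (lt_trans zX Xb).
have zf := fin_num_measure sigma [set` `]-oo, z]] (measurable_itv _).
have mz0 : 0 < fine (sigma [set` `]-oo, z]]) by rewrite -lte_fin fineK.
set sz := fine _ in mz0.
pose k := (Num.truncn (M / eta)).+1.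
have k0 : 0 < k%:R :> R by rewrite ltr0n.
have Mk : M / k%:R <= eta.
  by rewrite ler_pdivrMr// mulrC -ler_pdivrMr// ltW// truncnS_gt.
pose K := Num.sqrt (b / (X - z)) * gam b y.
have [n1 Hn1] := ln_eventually_small eta0.
have [n2 Hn2] := const_eventually_small K eta0.
exists (box eta (maxn (maxn n1 n2) (Num.truncn sz^-1).+1)); first exact: box_gt0.
move=> [n N] d /(boxP eta0)[/=]; rewrite !geq_max => /andP[/andP[hn1 hn2] hn3] hN /andP[n0 nN] /andP[tlow tup] close dn.
have N0 : 0 < N%:R :> R by rewrite ltr0n (ltn_trans n0).
have N3 : ((Num.truncn sz^-1).+1 <= N)%N by apply: leq_trans (ltnW hN); rewrite leq_max leqnn orbT.
have dn' : (d.+1 < n)%N by rewrite -ltn_predRL.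
have l1z : lam N 1%N < z.
  apply: (lam_lt (@cdf N)); first by rewrite /= (leq_trans n0)// ltnW.
  rewrite -[ltRHS]fineK// lte_fin mul1r invf_plt ?posrE//.
  by apply: lt_le_trans (truncnS_gt _) _; rewrite ler_nat.
have l1X := lt_trans l1z zX.
have dN : (d.+1 < N)%N by exact: ltn_trans nN.
have cy : lam N d.+1 < y.
  apply: (lam_lt (@cdf N)); first by rewrite /= ltnW.
  apply: lt_le_trans my; rewrite lte_fin.
  apply: (@le_lt_trans _ _ (n%:R / N%:R)); last exact: le_lt_trans tph.
  by rewrite ler_pM2r ?invr_gt0// ler_nat ltnW.
have c0 : 0 <= lam N d.+1.
  by rewrite ltW//; apply: (lam_gt0 cd (@cdf N)); rewrite /= ltnW.
apply: le_trans (En_lower cd s1 (@inc N) (@cdf N) nN dn' (_ : (0 < k)%N) l1X Xb) => //.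
rewrite ler_expR lerN2.
have s0 : 0 < n%:R / N%:R :> R by rewrite divr_gt0// ltr0n.
have /andP[_ gs] := gam_sum_bounds s0 tup (isT : (0 < k)%N).
set u := n%:R / N%:R in tlow tup close s0 gs *.
have q1 := Hn1 _ hn1.
have q2 : Num.sqrt (b / (X - lam N 1%N)) * gam b (lam N d.+1) <= eta * n%:R.
  apply: le_trans (Hn2 _ hn2); rewrite /K ler_pM// ?gam_ge0//.
  - exact: lt_trans yb.
  - rewrite ler_wsqrtr// ler_wpM2l ?(le_trans a00 (ltW a0b))// lef_pV2 ?posrE ?subr_gt0//.
    by rewrite lerD2l lerN2 ltW.
  - by apply: gam_le => //; exact: ltW.
have nu : n%:R = u * N%:R by rewrite /u divfK// gt_eqF.
have q3 : N%:R * (fine (tau X) * gam b X) <= eta * n%:R.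
  apply: (@le_trans _ _ (N%:R * (eta * (t / 2)))); first by rewrite ler_wpM2l// ltW.
  by rewrite nu mulrC -mulrA ler_wpM2l ?(ltW eta0)// ler_wpM2r// ltW.
have q4 : n%:R / k%:R * gam_sum a0 b sigma u k <= n%:R * (L0 + eta + eta).
  rewrite mulrAC -mulrA ler_wpM2l//; apply: (le_trans gs).
  by rewrite lerD//; move: close; rewrite ler_distlC lerBlDr => /andP[].
by rewrite eE; lra.
Qed.

Lemma upper_rate eps : 0 < eps -> exists2 e : nat * R, 0 < e.2 & forall p, ratio_box t e p ->
  (dd p.1 p.2 < p.1.-1)%N /\
  En (diag_of p.2 (lam p.2)) p.1 `[lam p.2 (dd p.1 p.2).+1, b]%classic <= expR (- (p.1%:R * (L0 - eps))).
Proof.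
move=> eps0; have eta0 : 0 < eps / 5 by rewrite divr_gt0.
have eE : eps = 5 * (eps / 5) by field.
move: (eps / 5) eta0 eE => eta eta0 eE.
have /andP[a00 a0b] := cd_bounds cd.
have ba : 0 < b - a0 by rewrite subr_gt0.
have b0 : 0 < b by exact: le_lt_trans a0b.
have tg := t0; have M0 : 0 <= M by exact: phi_ge0.
have [C HC] := @En_upper R.
pose th := Num.sqrt ((a tp - a0) / (b - a0)).
have [hp1 hp2 _] := left_endpointP cd (ltW tp0) (mass_lt (lexx tp)).
have th1 : th < 1.
  rewrite -[ltRHS]sqrtr1 ltr_sqrt// ltr_pdivrMr// mul1r; lra.
(* Then [(1 - th) * (k1 + 1) >= 1], which gives [d * (k1 + 1) <= n * k1] for all [d <= th * n]. *)
pose k1 := Num.truncn (1 - th)^-1.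
have hk1 : 1 <= (1 - th) * k1.+1%:R.
  by rewrite -ler_pdivrMl ?subr_gt0// mulr1 ltW// truncnS_gt.
pose k := (Num.truncn (2 * M / eta)).+2.
have k0 : 0 < k%:R :> R by rewrite ltr0n.
have Mk : 2 * M / k%:R <= eta.
  rewrite ler_pdivrMr// [leRHS]mulrC -ler_pdivrMr//; apply: le_trans (ltW (truncnS_gt _)) _.
  by rewrite ler_nat.
(* The bound for one added factor is at most [D * (2 * n + 1) ^+ 2]. It occurs with the fixed power
   [k1.+1], so its logarithm is small compared with [n]. *)
pose D := 1 + b / (b - a0) * (4 / t ^+ 2).
have D0 : 0 < D by rewrite addr_gt0// mulr_gt0// divr_gt0// exprn_gt0.
have k10 : 0 < k1.+1%:R :> R by rewrite ltr0n.
have [n1 Hn1] := @ln_eventually_small R (eta / (2 * k1.+1%:R)) (divr_gt0 eta0 (mulr_gt0 (ltr0n _ 2) k10)).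
have [n2 Hn2] := const_eventually_small (C + k1.+1%:R * M + k1.+1%:R * ln D) eta0.
exists (box eta (maxn (maxn n1 n2) k1.+2)); first exact: box_gt0.
move=> [n N] /(boxP eta0)[/=]; rewrite !geq_max => /andP[/andP[hn1 hn2] hn3] hN n0N /andP[tlow tup] close.
have /andP[n0 nN] := n0N.
have N0 : 0 < N%:R :> R by rewrite ltr0n (ltn_trans n0).
have n0' : 0 < n%:R :> R by rewrite ltr0n.
have s0 : 0 < n%:R / N%:R :> R by rewrite divr_gt0.
have spl := split_dd n0N.
have dth : (dd n N)%:R <= th * n%:R.
  apply: le_trans (splitting_count cd s1 n0N (@cdf N) spl) _; rewrite ler_wpM2r// ler_wsqrtr//.
  rewrite ler_wpM2r ?invr_ge0 ?(ltW ba)// lerD2r.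
  exact: (endpoint_le cd (ltW s0) tup (mass_lt (lexx tp))).
have dk : (dd n N * k1.+1 <= n * k1)%N.
  rewrite -(ler_nat R) !natrM; apply: (@le_trans _ _ (th * n%:R * k1.+1%:R)); first by rewrite ler_wpM2r.
  rewrite mulrAC mulrC ler_pM2l//.
  by move: hk1; rewrite -natr1; lra.
split.
  (* If [d >= n - 1], then [(n - 1) * (k1 + 1) <= n * k1], that is [n <= k1 + 1]. *)
  rewrite ltnNge; apply/negP => h.
  have : (n.-1 * k1.+1 <= n * k1)%N by apply: leq_trans dk; rewrite leq_mul2r h orbT.
  by move: hn3; case: (n) n0 => // n' _; clear; rewrite /= mulnS mulSn; lia.
apply: le_trans (HC a0 b sigma f N (lam N) n (dd n N) k k1 cd s1 (@inc N) (@cdf N) n0N isT hn3 dk spl) _.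
have := gam_sum_bounds s0 tup (isT : (0 < k)%N).
have := J_mean_le s0.
have gE : gam b (a (n%:R / N%:R)) <= M.
  by have := phi_le (n%:R / N%:R); rewrite /phi clamp_id// tup ltW.
set u := n%:R / N%:R in tlow tup close s0 gE *.
set j := J u / u in close *; set S := gam_sum _ _ _ _ _ => /andP[j0 jM] /andP[gs _].
have q1 := Hn1 _ hn1.
have q2 := Hn2 _ hn2.
have B1 : 1 + b * N%:R ^+ 2 / (b - a0) <= D * (2 * n).+1%:R ^+ 2.
  have nN2 : N%:R <= 2 / t * n%:R.
    rewrite mulrAC ler_pdivlMr//; move: tlow; rewrite /u ler_pdivlMr//; lra.
  have h1 : N%:R ^+ 2 <= (2 / t * n%:R) ^+ 2 by rewrite lerXn2r// nnegrE// ltW// mulr_gt0// divr_gt0.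
  have h2 : n%:R ^+ 2 <= (2 * n).+1%:R ^+ 2 :> R.
    by apply: lerXn2r; rewrite ?nnegrE// ler_nat; clear; lia.
  have h3 : 1 <= (2 * n).+1%:R ^+ 2 :> R by rewrite exprn_ege1// ler1n.
  rewrite /D mulrDl mul1r lerD//.
  rewrite [leLHS]mulrAC -[leRHS]mulrA ler_wpM2l ?divr_ge0 ?(ltW b0) ?(ltW ba)//.
  apply: (le_trans h1); rewrite exprMn (_ : (2 / t) ^+ 2 = 4 / t ^+ 2); last by field; rewrite gt_eqF.
  by rewrite ler_wpM2l// divr_ge0// exprn_ge0// ltW.
have B0 : 0 < 1 + b * N%:R ^+ 2 / (b - a0).
  by rewrite addr_gt0// divr_gt0// mulr_gt0// exprn_gt0.
have W0 : 0 < D * (2 * n).+1%:R ^+ 2 by apply: lt_le_trans B1.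
have q3 : ln (1 + b * N%:R ^+ 2 / (b - a0)) <= ln D + 2 * ln (2 * n).+1%:R.
  apply: le_trans (_ : ln (D * (2 * n).+1%:R ^+ 2) <= _); first by rewrite ler_ln.
  by rewrite lnM ?posrE ?exprn_gt0 ?ltr0n// lnXn ?ltr0n// -[X in _ + X]mulr_natl.
have q4 : k1.+1%:R * (2 * ln (2 * n).+1%:R) <= eta * n%:R.
  have := ler_wpM2l (ltW (mulr_gt0 (ltr0n R 2) k10)) q1.
  rewrite (_ : 2 * k1.+1%:R * (eta / (2 * k1.+1%:R) * n%:R) = eta * n%:R); last by field; rewrite gt_eqF.
  by rewrite mulrCA mulrA.
rewrite -[1 + _]lnK ?posrE// -expRM_natl -expRD ler_expR.
have q5 : k1.+1%:R * ln (1 + b * N%:R ^+ 2 / (b - a0)) <= k1.+1%:R * ln D + eta * n%:R.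
  by apply: le_trans (_ : _ <= k1.+1%:R * (ln D + 2 * ln (2 * n).+1%:R)) _; [rewrite ler_wpM2l|rewrite mulrDr lerD2l].
have nn : (n - k1.+1)%:R = n%:R - k1.+1%:R :> R by rewrite natrB// ltnW.
have nn0 : 0 <= n%:R - k1.+1%:R :> R by rewrite -nn.
have q6 : n%:R * j - k1.+1%:R * M - eta * n%:R <=
   (n - k1.+1)%:R / k%:R * (S - 2 * gam b (a u)).
  rewrite nn [leRHS]mulrAC -[leRHS]mulrA.
  apply: (@le_trans _ _ ((n%:R - k1.+1%:R) * (j - eta))).
    have : k1.+1%:R * j <= k1.+1%:R * M by rewrite ler_wpM2l.
    have : 0 <= k1.+1%:R * eta by rewrite mulr_ge0// ltW.
    by lra.
  rewrite ler_wpM2l// mulrDl lerD// mulNr lerN2; apply: le_trans Mk.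
  by rewrite ler_wpM2r ?invr_ge0 ?(ltW k0)// ler_wpM2l.
have q7 : n%:R * (L0 - eta) <= n%:R * j.
  by rewrite ler_wpM2l//; move: close; rewrite ler_distl => /andP[].
have q8 : 0 <= n%:R * eta by rewrite mulr_ge0// ltW.
by rewrite eE; lra.
Qed.

Lemma extremal_root_limits : exists L : R,
      (En (diag_of p.2 (lam p.2)) p.1 `[lam p.2 (dd p.1 p.2).+1, b]%classic
         `^ p.1%:R^-1) @[p --> ratio_filter t] --> L /\
      limf_einf (fun p : nat * nat * nat =>
          (En (diag_of p.1.2 (lam p.1.2)) p.1.1 `[lam p.1.2 p.2.+1, b]%classic
             `^ p.1.1%:R^-1)%:E)
        (ratio_index_filter t) = L%:E.
Proof.
exists (expR (- L0)).
exact: (@limits_of_rates R (fun n N d => En (diag_of N (lam N)) n `[lam N d.+1, b]%classic) dd t L0 t0 lower_rate upper_rate).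
Qed.

End AsymptoticRates.

Theorem theorem1p7 (R : realType) :
  (exists C_BW : R,
    forall (a0 b : R)
      (sigma : {finite_measure set (measurableTypeR R) -> \bar R})
      (f : R -> R),
    constraint_data a0 b sigma f ->
    forall (m : nat) (A : 'M[R]_m) (k : nat) (lam : nat -> R),
    posdef A ->
    enumerates_spectrum A k lam ->
    (forall x, spectrum A x -> x <= b) ->
    forall N n d : nat,
    (0 < N)%N ->
    (2 <= n)%N ->
    ((n%:R / N%:R)%:E < sigma setT)%E ->
    (d <= n - 2)%N ->
    (forall j, (1 <= j <= d)%N ->
      ((j%:R / N%:R)%:E <= sigma [set` `]-oo, lam j]])%E) ->
    splitting_index k lam (left_endpoint a0 b sigma (n%:R / N%:R)) d ->
    En A n (spectrum A) <= En A n `[lam d.+1, b]%classic /\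
    En A n `[lam d.+1, b]%classic <=
      expR (C_BW - N%:R *
        \int[lebesgue_measure]_(t in `[0, n%:R / N%:R])
          green_infty (St a0 b sigma t) (0, 0)))
  /\
  (forall (a0 b : R)
      (sigma : {finite_measure set (measurableTypeR R) -> \bar R})
      (f : R -> R),
    constraint_data a0 b sigma f ->
    sigma setT = 1%E ->
    forall (lam : nat -> nat -> R) (dd : nat -> nat -> nat),
    (forall N i j, (1 <= i < j)%N -> (j <= N)%N -> lam N i < lam N j) ->
    (forall N j, (1 <= j <= N)%N ->
      sigma [set` `]-oo, lam N j]] = (j%:R / N%:R)%:E) ->
    (forall n N, (0 < n < N)%N ->
      splitting_index N (lam N) (left_endpoint a0 b sigma (n%:R / N%:R))
        (dd n N)) ->
    forall t : R, 0 < t < 1 ->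
    exists L : R,
      (En (diag_of p.2 (lam p.2)) p.1 `[lam p.2 (dd p.1 p.2).+1, b]%classic
         `^ p.1%:R^-1) @[p --> ratio_filter t] --> L /\
      limf_einf (fun p : nat * nat * nat =>
          (En (diag_of p.1.2 (lam p.1.2)) p.1.1 `[lam p.1.2 p.2.+1, b]%classic
             `^ p.1.1%:R^-1)%:E)
        (ratio_index_filter t) = L%:E).
Proof.
split; first exact: extremal_constant_le.
move=> a0 b sigma f cd s1 lam dd inc cdf split_dd t t01.
exact: (extremal_root_limits cd s1 t01 inc cdf split_dd).
Qed.
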